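(* Let $X_1,\dots,X_N$ be i.i.d. real random variables with distribution function $F$, let $0<\alpha<\beta<1$, and let $T_N$, $\mu(\alpha,\beta)$, $\sigma_W$, $\lambda_1$, $\lambda_2$, $\beta_N$, $S_N$ be as defined in the context. Suppose that $f=F'$ exists in neighborhoods of $\xi_\alpha$ and $\xi_\beta$ and satisfies a Lipschitz condition there, and that $f(\xi_\alpha)>0$, $f(\xi_\beta)>0$. Let $$F_{N,S}(x)=P\left(\frac{N^{1/2}(T_N-\mu(\alpha,\beta))}{(\beta-\alpha)^{-1}S_N}\le x\right),\qquad H_N(x)=\Phi(x)+\frac{\phi(x)}{6\sqrt N}\left((2x^2+1)\lambda_1+3(x^2+1)\lambda_2-6N\frac{\beta_N}{\sigma_W}\right),$$ where $\Phi$ is the standard normal distribution function and $\phi=\Phi'$. Then $$\sup_{x\in\mathbb R}|F_{N,S}(x)-H_N(x)|=o(N^{-1/2})\quad\text{as }N\to\infty.$$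
   Context: $X_{1:N}\le\dots\le X_{N:N}$ are the order statistics. $T_N=\frac{1}{[\beta N]-[\alpha N]}\sum_{i=[\alpha N]+1}^{[\beta N]}X_{i:N}$ ($[\cdot]$ the integer part). $F^{-1}(u)=\inf\{x:F(x)\ge u\}$, $\xi_\nu=F^{-1}(\nu)$. $Q(u)=\xi_\alpha$ for $u\le\alpha$, $F^{-1}(u)$ for $\alpha<u\le\beta$, $\xi_\beta$ for $u>\beta$; $\mu_W=\int_0^1Q$, $\sigma_W^2=\int_0^1(Q-\mu_W)^2$, $\gamma_{3,W}=\int_0^1(Q-\mu_W)^3$, $\delta_{2,W}=-\alpha^2\frac{1}{f(\xi_\alpha)}[\mu_W-\xi_\alpha]^2+(1-\beta)^2\frac{1}{f(\xi_\beta)}[\mu_W-\xi_\beta]^2$, $\lambda_1=\gamma_{3,W}/\sigma_W^3$, $\lambda_2=\delta_{2,W}/\sigma_W^3$. $\mu(\alpha,\beta)=\frac{1}{\beta-\alpha}\int_\alpha^\beta F^{-1}(u)du$. $\beta_N=\frac1N\{-(\alpha N-[\alpha N])(\mu(\alpha,\beta)-\xi_\alpha)-\frac12\alpha(1-\alpha)/f(\xi_\alpha)+(\beta N-[\beta N])(\mu(\alpha,\beta)-\xi_\beta)+\frac12\beta(1-\beta)/f(\xi_\beta)\}$. With $k=[\alpha N]+1$, $m=[\beta N]$, define $\hat\mu_W=\frac kN X_{k:N}+\frac1N\sum_{i=k+1}^{m-1}X_{i:N}+\frac{N-m+1}{N}X_{m:N}$ and $S_N^2=\frac kN X_{k:N}^2+\frac1N\sum_{i=k+1}^{m-1}X_{i:N}^2+\frac{N-m+1}{N}X_{m:N}^2-\hat\mu_W^2$,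 $S_N=\sqrt{S_N^2}$. *)

(* Defs.v *)
From HB Require Import structures.
From mathcomp Require Import all_boot all_order all_algebra.
From mathcomp Require Import all_classical all_reals all_analysis.
Set Implicit Arguments. Unset Strict Implicit. Unset Printing Implicit Defensive.
Import Order.TTheory GRing.Theory Num.Theory.
Import numFieldNormedType.Exports.
Local Open Scope classical_set_scope.
Local Open Scope ring_scope.

Section Defs.
Context {R : realType}.

Definition quantile (F : R -> R) (u : R) : R := inf [set x | u <= F x].

Definition Qw (F : R -> R) (alpha beta : R) (u : R) : R :=
  if u <= alpha then quantile F alpha
  else if u <= beta then quantile F u
  else quantile F beta.

Definition Leb01 (g : R -> R) : R := Rintegral lebesgue_measure `[0, 1] g.

Definition muW F alpha beta : R := Leb01 (Qw F alpha beta).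
Definition sigma2W F alpha beta : R :=
  Leb01 (fun u => (Qw F alpha beta u - muW F alpha beta) ^+ 2).
Definition sigmaW F alpha beta : R := Num.sqrt (sigma2W F alpha beta).
Definition gamma3W F alpha beta : R :=
  Leb01 (fun u => (Qw F alpha beta u - muW F alpha beta) ^+ 3).
Definition delta2W F (f : R -> R) alpha beta : R :=
  - alpha ^+ 2 * (f (quantile F alpha))^-1
      * (muW F alpha beta - quantile F alpha) ^+ 2
  + (1 - beta) ^+ 2 * (f (quantile F beta))^-1
      * (muW F alpha beta - quantile F beta) ^+ 2.
Definition lambda1 F alpha beta : R :=
  gamma3W F alpha beta / sigmaW F alpha beta ^+ 3.
Definition lambda2 F f alpha beta : R :=
  delta2W F f alpha beta / sigmaW F alpha beta ^+ 3.

Definition mu_ab F alpha beta : R :=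
  (beta - alpha)^-1 * Rintegral lebesgue_measure `[alpha, beta] (quantile F).

Definition ip (nu : R) (N : nat) : nat := Num.truncn (nu * N%:R).

Definition betaN F f alpha beta (N : nat) : R :=
  N%:R^-1 * (
    - (alpha * N%:R - (ip alpha N)%:R) * (mu_ab F alpha beta - quantile F alpha)
    - 2^-1 * (alpha * (1 - alpha)) / f (quantile F alpha)
    + (beta * N%:R - (ip beta N)%:R) * (mu_ab F alpha beta - quantile F beta)
    + 2^-1 * (beta * (1 - beta)) / f (quantile F beta)).

(* order statistic X_{i:N} (1-indexed) of the sample xs *)
Definition ostat (xs : seq R) (i : nat) : R := nth 0 (sort <=%R xs) i.-1.

Definition trimmed_mean alpha beta (xs : seq R) : R :=
  let N := size xs in
  let a := ip alpha N in let m := ip beta N in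
  ((m - a)%:R)^-1 * \sum_(a.+1 <= i < m.+1) ostat xs i.

Definition hat_muW alpha beta (xs : seq R) : R :=
  let N := size xs in
  let k := (ip alpha N).+1 in let m := ip beta N in
  k%:R / N%:R * ostat xs k
  + N%:R^-1 * \sum_(k.+1 <= i < m) ostat xs i
  + ((N - m).+1)%:R / N%:R * ostat xs m.

Definition S2N alpha beta (xs : seq R) : R :=
  let N := size xs in
  let k := (ip alpha N).+1 in let m := ip beta N in
  k%:R / N%:R * ostat xs k ^+ 2
  + N%:R^-1 * \sum_(k.+1 <= i < m) ostat xs i ^+ 2
  + ((N - m).+1)%:R / N%:R * ostat xs m ^+ 2
  - hat_muW alpha beta xs ^+ 2.

Definition SN alpha beta (xs : seq R) : R := Num.sqrt (S2N alpha beta xs).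

Definition phi (x : R) : R := normal_pdf 0 1 x.
Definition Phi (x : R) : R := Rintegral lebesgue_measure `]-oo, x] phi.

Definition HN F f alpha beta (N : nat) (x : R) : R :=
  Phi x + phi x / (6 * Num.sqrt N%:R) *
    ((2 * x ^+ 2 + 1) * lambda1 F alpha beta
     + 3 * (x ^+ 2 + 1) * lambda2 F f alpha beta
     - 6 * N%:R * betaN F f alpha beta N / sigmaW F alpha beta).

Definition mutually_independent d (T : measurableType d)
    (P : probability T R) (X : nat -> T -> R) : Prop :=
  forall (I : seq nat) (B : nat -> set R), uniq I ->
    (forall i, measurable (B i)) ->
    fine (P (\bigcap_(i in [set` I]) (X i @^-1` B i)))
    = \prod_(i <- I) fine (P (X i @^-1` B i)).

(* the sample (X_1, ..., X_N) at outcome w (X_j is X (j-1)) *)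
Definition sample d (T : measurableType d) (X : nat -> T -> R) (N : nat) (w : T)
  : seq R := [seq X j w | j <- iota 0 N].

Definition FNS d (T : measurableType d) (P : probability T R)
    (X : nat -> T -> R) (F : R -> R) alpha beta (N : nat) (x : R) : R :=
  fine (P [set w | Num.sqrt N%:R * (trimmed_mean alpha beta (sample X N w)
                                    - mu_ab F alpha beta)
                   / ((beta - alpha)^-1 * SN alpha beta (sample X N w)) <= x]).

End Defs.

(* Main.v *)
(* Let W be an observation clipped to [xi_alpha, xi_beta] and centred, and write
   q = sqrt N.  The excesses over the clipping levels are quadratic in the numbers A, B of
   observations below xi_alpha, xi_beta (centred), and S_N^2 is, to first order, an
   average of i.i.d. terms v.  Hence, off an event of small probability, the event
   {statistic <= x} is {Z + Q <= x sigma} up to a negligible change of the threshold, with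
   Z = (1/q) sum_j (W(X_j) - x v(X_j) / (2 sigma q)) and
   Q = (1/q) (c_0 - A^2 / (2 N f(xi_alpha)) + B^2 / (2 N f(xi_beta))).

   No characteristic functions are used.  The indicator of {z <= y} is replaced by
   Phi ((y - z) / sqrt s) with s a high negative power of N.  Its z-derivatives are huge,
   but they become bounded once averaged over a fixed fraction of the summands: to the
   right of xi_alpha the law of W has a density bounded below, so one summand dominates a
   fixed multiple of the average of a uniform law and its translate, and binomial averages
   of translates gain a factor j^(-1/2) per derivative.  Lindeberg's replacement, with the
   heat equation for Phi ((y - z) / sqrt s), then gives the expansion of Z; Q is treated by
   a first-order Taylor expansion, conditioning on the one or two indices which occur in a
   term of A^2 or B^2.

   With N = t^16 all of this is uniform for |x| <= t with error O(t^(-9)) = o(N^(-1/2));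
   for |x| > t both functions are close to 0 or 1 by monotonicity. *)

Require Import Defs.
From HB Require Import structures.
From mathcomp Require Import all_boot all_order all_algebra.
From mathcomp Require Import all_classical all_reals all_analysis measurable_realfun.
From mathcomp Require Import ring lra zify.
Import Order.TTheory GRing.Theory Num.Theory.
Import numFieldNormedType.Exports.
Set Implicit Arguments. Unset Strict Implicit. Unset Printing Implicit Defensive.
Local Open Scope classical_set_scope.
Local Open Scope ring_scope.

(** * Bounded measurable functions *)

(** The obstacle is that [F] is smooth only near the two quantiles: the law of [W] has atoms at both
    clipping levels and is arbitrary in most of the interval between them, so all smoothing must
    come from observations just to the right of [xi_alpha]. There both counters change in a fixed
    way, so the gain in the real variable is available for each value of the counts. This is why a
    sum is encoded by operators on functions of a state [(s, z)], with [s] the pair of counts and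
    [z] the running sum; [Q] is then a function of [s]. The kernel has variance [t ^ -24], hence
    width [t ^ -12], far below the tolerated [t ^ -9]. Its derivatives up to order 8 are of size at
    most [t ^ 96], which is beaten by [(1 - p) ^ m1], the weight of never meeting the smooth
    component in a block of [m1] summands, with [m1] about [N / 20]. Order 8 is what the replacement
    asks for: a step costs four derivatives and is carried out for derivatives up to the fourth.
    Centred bounded sums exceed [t ^ 9 = t * sqrt N] with probability of order [expR (- t)], so
    truncation at that level costs nothing. *)

Section BoundedMeasurable.
Context d (T : measurableType d) (R : realType) (mu : {measure set T -> \bar R}).
Variable D : set T.

(** The domain is a parameter because the same closure rules serve probability measures on the whole
    space and Lebesgue measure on [[0, 1]]. *)
Definition bmeas (g : T -> R) : Prop :=
  measurable_fun D g /\ exists M, forall x, D x -> `|g x| <= M.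

Lemma bmeas_cst c : bmeas (fun=> c).
Proof. by split; [exact: measurable_cst | exists `|c|]. Qed.

Lemma bmeasD f g : bmeas f -> bmeas g -> bmeas (fun x => f x + g x).
Proof.
move=> [mf [Mf hf]] [mg [Mg hg]]; split; first exact: measurable_funD.
by exists (Mf + Mg) => x Dx; rewrite (le_trans (ler_normD _ _))// lerD ?hf ?hg.
Qed.

Lemma bmeasM f g : bmeas f -> bmeas g -> bmeas (fun x => f x * g x).
Proof.
move=> [mf [Mf hf]] [mg [Mg hg]]; split; first exact: measurable_funM.
by exists (Mf * Mg) => x Dx; rewrite normrM ler_pM ?hf ?hg.
Qed.

Lemma bmeasZ c f : bmeas f -> bmeas (fun x => c * f x).
Proof. by move=> bf; apply: bmeasM => //; exact: bmeas_cst. Qed.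

Lemma bmeasN f : bmeas f -> bmeas (fun x => - f x).
Proof. by move=> /(bmeasZ (-1)) bf; under eq_fun do rewrite -mulN1r. Qed.

Lemma bmeasB f g : bmeas f -> bmeas g -> bmeas (fun x => f x - g x).
Proof. by move=> bf /bmeasN; apply: bmeasD. Qed.

Lemma bmeasX n f : bmeas f -> bmeas (fun x => f x ^+ n).
Proof.
move=> bf; elim: n => [|n ih].
  by under eq_fun do rewrite expr0; exact: bmeas_cst.
by under eq_fun do rewrite exprS; exact: bmeasM.
Qed.

Lemma bmeas_sum (I : Type) (r : seq I) (F : I -> T -> R) :
  (forall i, bmeas (F i)) -> bmeas (fun x => \sum_(i <- r) F i x).
Proof.
move=> bF; elim: r => [|i r ih].
  by under eq_fun do rewrite big_nil; exact: bmeas_cst.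
by under eq_fun do rewrite big_cons; exact: bmeasD.
Qed.

Lemma bmeas_norm f : bmeas f -> bmeas (fun x => `|f x|).
Proof.
move=> [mf [Mf hf]]; split; first exact: measurableT_comp.
by exists Mf => x Dx; rewrite normr_id hf.
Qed.

Lemma bmeas_indic (A : set T) : measurable A -> bmeas (\1_A).
Proof.
move=> mA; split; first exact: measurable_indic.
by exists 1 => x _; rewrite indicE; case: (_ \in _); rewrite ?normr0 ?normr1.
Qed.

Hypothesis mD : measurable D.
Hypothesis fD : (mu D < +oo)%E.

Lemma bmeas_integrable f : bmeas f -> mu.-integrable D (EFin \o f).
Proof.
move=> [mf [M hM]]; apply: measurable_bounded_integrable => //.
exists M; split; first exact: num_real.
by move=> N MN x Dx /=; rewrite (le_trans (hM x Dx)) ?ltW.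
Qed.

Lemma RintD f g : bmeas f -> bmeas g ->
  \int[mu]_(x in D) (f x + g x) = \int[mu]_(x in D) f x + \int[mu]_(x in D) g x.
Proof. by move=> bf bg; apply: RintegralD => //; exact: bmeas_integrable. Qed.

Lemma RintB f g : bmeas f -> bmeas g ->
  \int[mu]_(x in D) (f x - g x) = \int[mu]_(x in D) f x - \int[mu]_(x in D) g x.
Proof. by move=> bf bg; apply: RintegralB => //; exact: bmeas_integrable. Qed.

Lemma RintZ c f : bmeas f ->
  \int[mu]_(x in D) (c * f x) = c * \int[mu]_(x in D) f x.
Proof. by move=> bf; apply: RintegralZl => //; exact: bmeas_integrable. Qed.

Lemma Rint_le f g : bmeas f -> bmeas g -> (forall x, D x -> f x <= g x) ->
  \int[mu]_(x in D) f x <= \int[mu]_(x in D) g x.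
Proof. by move=> bf bg; apply: le_Rintegral => //; exact: bmeas_integrable. Qed.

Lemma Rint_sum (I : Type) (r : seq I) (F : I -> T -> R) :
  (forall i, bmeas (F i)) ->
  \int[mu]_(x in D) (\sum_(i <- r) F i x) = \sum_(i <- r) \int[mu]_(x in D) F i x.
Proof.
move=> bF; elim: r => [|i r ih].
  under eq_Rintegral do rewrite big_nil.
  by rewrite Rintegral_cst// mul0r big_nil.
under eq_Rintegral do rewrite big_cons.
by rewrite RintD ?ih ?big_cons//; exact: bmeas_sum.
Qed.

Lemma Rint_norm f : bmeas f ->
  `|\int[mu]_(x in D) f x| <= \int[mu]_(x in D) `|f x|.
Proof. by move=> bf; apply: le_normr_Rintegral => //; exact: bmeas_integrable. Qed.

End BoundedMeasurable.

Lemma Rint_indic d (T : measurableType d) (R : realType)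
    (P : probability T R) (A : set T) : measurable A ->
  \int[P]_x (\1_A x) = fine (P A).
Proof. by move=> mA; rewrite /Rintegral integral_indic// setIT. Qed.

Lemma Rint_prob_cst d (T : measurableType d) (R : realType)
    (P : probability T R) (c : R) : \int[P]_x c = c.
Proof.
rewrite Rintegral_cst//; transitivity (c * 1); last by rewrite mulr1.
congr (c * _); have /(congr1 fine) := @probability_setT _ _ _ P; exact.
Qed.

Lemma probT_lty d (T : measurableType d) (R : realType) (P : probability T R) :
  (P setT < +oo)%E.
Proof. by rewrite probability_setT ltry. Qed.

Section ProbIntegral.
Context d (T : measurableType d) (R : realType) (P : probability T R).
Let mT := @measurableT _ T.
Let fT := probT_lty P.

Lemma Rint_bound (f : T -> R) (M : R) : measurable_fun setT f -> (forall x, `|f x| <= M) ->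
  `|\int[P]_x f x| <= M.
Proof.
move=> mf hM; have bf : bmeas setT f by split=> //; exists M.
apply: (le_trans (Rint_norm mT fT bf)).
rewrite -[leRHS](Rint_prob_cst P M); apply: (Rint_le mT fT) => //.
  exact: bmeas_norm.
exact: bmeas_cst.
Qed.

Lemma prob_le (A B : set T) : measurable A -> measurable B -> A `<=` B ->
  fine (P A) <= fine (P B).
Proof.
by move=> mA mB AB; rewrite fine_le ?fin_num_measure// le_measure ?inE.
Qed.

Lemma prob_setU_le (A B : set T) : measurable A -> measurable B ->
  fine (P (A `|` B)) <= fine (P A) + fine (P B).
Proof.
move=> mA mB; rewrite -fineD ?fin_num_measure// fine_le ?fin_num_measure//.
- exact: measurableU.
- by rewrite fin_numD !fin_num_measure.
- exact: measureU2.
Qed.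

Lemma prob_bigcup_le (n : nat) (A : nat -> set T) (c : R) :
  (forall i, measurable (A i)) -> (forall i, (i < n)%N -> fine (P (A i)) <= c) ->
  fine (P (\bigcup_(i in [set k | (k < n)%N]) A i)) <= n%:R * c.
Proof.
move=> mA hA; rewrite bigcup_mkord.
elim: n hA => [|n ih] hA; first by rewrite big_ord0 measure0 mul0r.
rewrite big_ord_recr/= (le_trans (prob_setU_le _ _))//.
  exact: bigsetU_measurable.
by rewrite mulrSr mulrDl mul1r lerD ?hA// ih// => i /ltnW; exact: hA.
Qed.

End ProbIntegral.

(** * Independent samples *)

(** The half-lines []x, +oo[] are a pi-system generating the Borel sets, and their masses are
    complements of values of the distribution functions. *)
Lemma prob_cdf_unique (R : realType) (m1 m2 : probability R R) :
  (forall x, m1 `]-oo, x]%classic = m2 `]-oo, x]%classic) ->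
  forall A, measurable A -> m1 A = m2 A.
Proof.
move=> h A mA.
have mE : @measurable _ R = <<s @RGenOInfty.G R >>.
  exact: RGenOInfty.measurableE.
apply: (@measure_unique _ _ _ (@RGenOInfty.G R) (fun n => `]- n%:R, +oo[%classic)) => //.
- move=> _ _ [x ->] [y ->]; exists (Num.max x y).
  by apply/seteqP; split=> z /=; rewrite !in_itv/= !andbT gt_max => /andP.
- by move=> n; exists (- n%:R).
- apply/seteqP; split=> // x _ /=; exists (Num.truncn `|x|).+1 => //=.
  rewrite in_itv/= andbT ltrNl (le_lt_trans (ler_norm _))// normrN.
  by rewrite truncnS_gt.
- move=> _ [x ->].
  have -> : `]x, +oo[%classic = ~` `]-oo, x]%classic by rewrite setCitvl.
  transitivity (1 - m1 `]-oo, x]%classic)%E; first exact: probability_setC.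
  by rewrite h; apply/esym; exact: probability_setC.
- by move=> n; rewrite ltey_eq fin_num_measure//; exact: measurable_itv.
Qed.

Section IndependentSample.
Context d (T : measurableType d) (R : realType) (P : probability T R).
Variable X : nat -> {RV P >-> R}.
Hypothesis hind : mutually_independent P (fun i => (X i : T -> R)).
Hypothesis hid : forall i x,
  fine (P [set w | X i w <= x]) = fine (P [set w | X 0%N w <= x]).

Definition law : probability R R := distribution P (X 0%N).

Lemma mX i : measurable_fun setT (X i : T -> R).
Proof. exact: measurable_funPT. Qed.

Lemma mXpre i (B : set R) : measurable B -> measurable (X i @^-1` B).
Proof. by move=> mB; rewrite -[_ @^-1` _]setTI; exact: mX. Qed.

Lemma lawE i (B : set R) : measurable B -> P (X i @^-1` B) = law B.
Proof.
move=> mB; rewrite -/(distribution P (X i) B).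
apply: (@prob_cdf_unique R (distribution P (X i)) law) => // x.
have e : `]-oo, x]%classic = [set y : R | y <= x].
  by apply/seteqP; split=> y /=; rewrite in_itv.
rewrite e /law /distribution /pushforward/=.
rewrite -[LHS]fineK ?fin_num_measure//; last first.
  by rewrite -e; exact: measurable_itv.
rewrite -[RHS]fineK ?fin_num_measure//; last first.
  by rewrite -e; exact: measurable_itv.
by congr (_%:E); exact: hid.
Qed.

Lemma Rint_law i (f : R -> R) : bmeas setT f ->
  \int[P]_w f (X i w) = \int[law]_x f x.
Proof.
move=> [mf [M hM]].
have fin := @probT_lty _ _ _ P.
have -> : \int[law]_x f x = \int[distribution P (X i)]_x f x.
  rewrite /Rintegral; congr fine; apply: eq_measure_integral => A mA _.
  by apply/esym/lawE.
rewrite /Rintegral integral_distribution//; first exact/measurable_EFinP.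
apply: (bmeas_integrable measurableT fin (f := fun w => f (X i w))).
by split; [exact: measurableT_comp | exists M => x _; exact: hM].
Qed.

(** The pi-system on which mutual independence speaks directly; it generates the events determined
    by the observations with index in [l]. *)
Definition cylinders (l : seq nat) : set (set T) :=
  [set A | exists B : nat -> set R, (forall j, measurable (B j)) /\
     A = \bigcap_(j in [set` l]) (X j @^-1` B j)].

(** The points of [T] with the coarser sigma-algebra generated by the observations in [l]:
    measurability of a function on this type means that it depends on these observations only. *)
Definition past (l : seq nat) := g_sigma_algebraType (cylinders l).

Lemma cyl_measurable l : cylinders l `<=` measurable.
Proof.
move=> _ [B [mB ->]]; apply: fin_bigcap_measurable => // j _.
exact: mXpre.
Qed.

Lemma past_measurable l (A : set T) :
  (cylinders l).-sigma.-measurable A -> measurable A.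
Proof.
by apply: smallest_sub; [exact: sigma_algebra_measurable | exact: cyl_measurable].
Qed.

Lemma past_X l j : j \in l -> measurable_fun setT (X j : past l -> R).
Proof.
move=> jl _ B mB; rewrite setTI; apply: sub_sigma_algebra.
exists (fun i => if i == j then B else setT); split=> [i|].
  by case: ifP.
apply/seteqP; split=> w /=; first by move=> Bw i _; case: eqP => // ->.
by move=> /(_ j jl); rewrite eqxx.
Qed.

Lemma cyl_indep l i (B : set R) (A : set T) : uniq l -> i \notin l ->
  measurable B -> cylinders l A ->
  P (A `&` X i @^-1` B) = (law B * P A)%E.
Proof.
move=> ul il mB Al; have mA := cyl_measurable Al.
have mC := mXpre i mB; case: Al => C [mC' AE].
rewrite -[LHS]fineK ?fin_num_measure//; last exact: measurableI.
rewrite -(lawE i mB) -[P (_ @^-1` _)]fineK ?fin_num_measure//.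
rewrite -[X in (_ * X)%E]fineK ?fin_num_measure// -EFinM; congr (_%:E).
(* Since [i] is not in [l], overwriting the set at [i] leaves the cylinder [A] unchanged;
   independence is then used for [i :: l] and for [l]. *)
pose C' j := if j == i then B else C j.
have mC'' j : measurable (C' j) by rewrite /C'; case: ifP.
have e : \bigcap_(j in [set` l]) (X j @^-1` C' j) = A.
  rewrite AE; apply: eq_bigcapr => j /= jl; rewrite /C'.
  by case: eqP => // ji; rewrite -ji jl in il.
have := hind (I := i :: l) (B := C').
rewrite /= il ul => /(_ isT mC''); rewrite big_cons /C' eqxx -/C' => h.
have := hind (I := l) ul mC''; rewrite e => ->.
rewrite -h; congr (fine (P _)).
rewrite -[in LHS]e setIC; apply/seteqP; split=> w /=.
  move=> [Bw hw] j /=; rewrite inE => /orP[/eqP ->|jl]; last exact: hw.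
  by rewrite eqxx.
move=> hw; split; first by have := hw i; rewrite /= eqxx inE eqxx; exact.
by move=> j jl; apply: hw; rewrite /= inE jl orbT.
Qed.

(** For fixed [B] both sides are finite measures in [A] which agree on cylinders, so uniqueness on a
    generating pi-system extends the product rule. *)
Lemma past_indep l i (B : set R) (A : set T) : uniq l -> i \notin l ->
  measurable B -> (cylinders l).-sigma.-measurable A ->
  P (A `&` X i @^-1` B) = (law B * P A)%E.
Proof.
move=> ul il mB mA; have mC := mXpre i mB.
pose c : {nonneg R} := NngNum (fine_ge0 (measure_ge0 law B)).
have -> : (law B * P A)%E = mscale c P A.
  by rewrite /mscale/= fineK// fin_num_measure.
rewrite -/(mrestr P mC A).
apply: (@g_sigma_algebra_measure_unique _ R T (cylinders l) (@cyl_measurable l)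
   (fun=> setT)) => //.
- move=> _; exists (fun=> setT); split=> //.
  by apply/seteqP; split=> // w _ j _.
- by apply/seteqP; split=> // w _; exists 0%N.
- move=> _ _ [B1 [mB1 ->]] [B2 [mB2 ->]].
  exists (fun j => B1 j `&` B2 j); split=> [j|]; first exact: measurableI.
  by rewrite -bigcapI.
- move=> A' cA'; rewrite /= /mscale/= /mrestr fineK ?fin_num_measure//.
  exact: (cyl_indep ul il mB cA').
- move=> _; rewrite /= /mrestr setTI.
  by rewrite (le_lt_trans (probability_le1 _ _))// ltry.
Qed.

(** The joint law of the past and of [X i] is the product of the marginals, so a new observation can
    be integrated out with the past frozen. Everything about independent sums below rests on this
    form of conditioning. *)
Lemma indep_fubini l i (Phi : past l * R -> R) (M : R) :
  uniq l -> i \notin l ->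
  measurable_fun setT Phi -> (forall z, `|Phi z| <= M) ->
  \int[P]_w Phi (w, X i w) = \int[P]_w \int[law]_x Phi (w, x).
Proof.
move=> ul il mPhi hM.
have mid : measurable_fun setT (idfun : T -> past l).
  by move=> _ A mA; rewrite setTI; exact: (past_measurable mA).
pose i0 : {mfun T >-> past l} := mfun_Sub (mem_set mid).
pose P' : probability (past l) R := distribution P i0.
have mp : measurable_fun setT (fun w : T => ((w, X i w) : past l * R)).
  by apply: measurable_fun_pair => //; exact: mX.
pose pr : {mfun T >-> (past l * R)%type} := mfun_Sub (mem_set mp).
pose Q : probability (past l * R)%type R := distribution P pr.
have QE A : measurable A -> (P' \x law)%E A = Q A.
  move=> mA; apply: product_measure_unique => // {mA A} A B mA mB.
  rewrite [RHS]muleC -(past_indep ul il mB mA) /Q /distribution /pushforward/=.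
  by congr (P _).
have ip : (P' \x law)%E.-integrable setT (EFin \o Phi).
  apply: bmeas_integrable => //; last by split=> //; exists M => z _; exact: hM.
  apply: (le_lt_trans _ (probT_lty Q)).
  by move/eqP: (QE setT measurableT); rewrite eq_le => /andP[h _]; exact: h.
have intQ : Q.-integrable setT (EFin \o Phi).
  apply: bmeas_integrable => //; last by split=> //; exists M => z _; exact: hM.
  exact: probT_lty.
have intP : P.-integrable setT (EFin \o (fun w => Phi (w, X i w))).
  apply: bmeas_integrable => //; first exact: probT_lty.
  split; last by exists M => z _; exact: hM.
  exact: (measurableT_comp mPhi mp).
have -> : \int[P]_w Phi (w, X i w) = fine (\int[Q]_z (Phi z)%:E)%E.
  by rewrite /Rintegral (integral_distribution (X := pr))//; exact/measurable_EFinP.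
have -> : (\int[Q]_z (Phi z)%:E = \int[P' \x law]_z (Phi z)%:E)%E.
  by apply: eq_measure_integral => A mA _; exact: esym (QE A mA).
rewrite -(integral12_prod_meas1 ip) /fubini_F.
have mF := measurable_fubini_F ip.
have fE w : (\int[law]_y (Phi (w, y))%:E)%E = (\int[law]_y Phi (w, y))%:E.
  rewrite /Rintegral fineK//; apply: integrable_fin_num => //.
  apply: bmeas_integrable => //; first exact: probT_lty.
  split; last by exists M => z _; exact: hM.
  exact: (measurableT_comp mPhi).
rewrite /Rintegral; congr fine.
rewrite (integral_distribution (X := i0)) => [| |].
- by apply: eq_integral => w _ /=; rewrite fE.
- exact: mF.
- have -> : (fubini_F law (EFin \o Phi)) \o i0 =
    EFin \o (fun w : T => \int[law]_y Phi (w, y)).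
    by apply/funext => w /=; rewrite -fE.
  apply: bmeas_integrable => //; first exact: probT_lty.
  split.
    apply/measurable_EFinP.
    have -> : EFin \o (fun w : T => \int[law]_y Phi (w, y)) =
      (fubini_F law (EFin \o Phi)) \o i0 by apply/funext => w /=; rewrite -fE.
    by apply: measurableT_comp.
  exists M => w _; apply: (Rint_bound law) => //.
  exact: (measurableT_comp mPhi).
Qed.

Lemma past_fun l j (f : R -> R) : j \in l -> measurable_fun setT f ->
  measurable_fun setT (fun w : past l => f (X j w)).
Proof. by move=> jl mf; apply: measurableT_comp => //; exact: past_X. Qed.

Lemma past_prod l (l' : seq nat) (h : R -> R) : measurable_fun setT h ->
  {subset l' <= l} ->
  measurable_fun setT (fun w : past l => \prod_(j <- l') h (X j w)).
Proof.
move=> mh; elim: l' => [|j l' ih] sub.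
  by under eq_fun do rewrite big_nil; exact: measurable_cst.
under eq_fun do rewrite big_cons; apply: measurable_funM.
  by apply: past_fun => //; apply: sub; rewrite inE eqxx.
by apply: ih => k kl; apply: sub; rewrite inE kl orbT.
Qed.

Lemma past_sum l (l' : seq nat) (h : R -> R) : measurable_fun setT h ->
  {subset l' <= l} ->
  measurable_fun setT (fun w : past l => \sum_(j <- l') h (X j w)).
Proof.
move=> mh; elim: l' => [|j l' ih] sub.
  by under eq_fun do rewrite big_nil; exact: measurable_cst.
under eq_fun do rewrite big_cons; apply: measurable_funD.
  by apply: past_fun => //; apply: sub; rewrite inE eqxx.
by apply: ih => k kl; apply: sub; rewrite inE kl orbT.
Qed.

Lemma past_count l (l' : seq nat) (c : R) : {subset l' <= l} ->
  measurable_fun setT (fun w : past l => (\sum_(j <- l') (X j w <= c)%R)%N).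
Proof.
elim: l' => [|j l' ih] sub.
  by under eq_fun do rewrite big_nil; exact: measurable_cst.
under eq_fun do rewrite big_cons; apply: measurable_fun_addn; last first.
  by apply: ih => k kl; apply: sub; rewrite inE kl orbT.
have -> : (fun w : past l => nat_of_bool (X j w <= c)) =
    (fun w : past l => if (X j w <= c) then 1%N else 0%N).
  by apply/funext => w; case: ifP.
apply: measurable_fun_ifT => //; apply: measurable_fun_ler => //.
by apply: past_X; apply: sub; rewrite inE eqxx.
Qed.

Lemma Rint_prod l (h : R -> R) : uniq l -> bmeas setT h ->
  \int[P]_w (\prod_(j <- l) h (X j w)) = (\int[law]_x h x) ^+ size l.
Proof.
move=> + [mh [M hM]]; elim: l => [_|i l ih /andP[il ul]] /=.
  rewrite expr0; under eq_Rintegral do rewrite big_nil.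
  exact: Rint_prob_cst.
under eq_Rintegral do rewrite big_cons.
pose H (w : past l) := \prod_(j <- l) h (X j w).
have HM w : `|H w| <= M ^+ size l.
  rewrite /H normr_prod; move: (w : T) => t; clear -hM.
  elim: l => [|k l ih].
    by rewrite big_nil expr0.
  rewrite big_cons exprS ler_pM ?hM//.
  by apply: prodr_ge0 => j _.
rewrite (indep_fubini (l := l) (i := i) (Phi := fun z => h z.2 * H z.1)
   (M := M * M ^+ size l))//; last 2 first.
- apply: measurable_funM; first exact: measurableT_comp.
  apply: measurableT_comp => //; exact: past_prod.
- by move=> z; rewrite normrM ler_pM// hM.
under eq_Rintegral => w _.
  under eq_Rintegral => x _ do rewrite /= mulrC.
  rewrite (RintZ measurableT (probT_lty law)); last by split=> //; exists M.
  over.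
have bH : bmeas setT (H : T -> R).
  split; last by exists (M ^+ size l) => w _; exact: HM.
  move=> _ B mB; apply: (past_measurable (l := l)).
  exact: (past_prod mh (fun j jl => jl)).
under eq_Rintegral do rewrite mulrC.
by rewrite (RintZ measurableT (probT_lty P) _ bH) ih// exprS.
Qed.

End IndependentSample.

(** * Bounded functions, Lipschitz in the real variable *)

Section BoundedLipschitz.
Context (R : realType) (S : Type).
Implicit Types (f g : S -> R -> R).

(** The class on which all operators act: the bounds are uniform in the state, the class is stable
    under one-step expectations, and continuity in [z] supplies measurability. *)
Definition blip g : Prop :=
  (exists M, forall s z, `|g s z| <= M) /\
  (exists L, forall s z z', `|g s z - g s z'| <= L * `|z - z'|).

Lemma blip_cont g s : blip g -> continuous (g s).
Proof.
move=> [_ [L hL]] z; apply/cvgrPdist_le => e e0.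
have L0 : 0 <= L by have := hL s 1 0; rewrite subr0 normr1 mulr1; exact: le_trans.
near=> y; rewrite (le_trans (hL s z y))//.
have : `|z - y| <= e / (L + 1).
  near: y; apply: (@cvgr_dist_le _ _ _ _ _ id); first exact: cvg_id.
  by rewrite divr_gt0// ltr_wpDl.
rewrite ler_pdivlMr ?ltr_wpDl// => h; apply: le_trans h.
by rewrite mulrC ler_wpM2l// lerDl.
Unshelve. all: by end_near. Qed.

End BoundedLipschitz.

(** The two counters take countably many values, so the preimage is a countable union of pieces on
    which they are fixed and only continuity in the real variable matters. *)
Lemma blip_meas (R : realType) d (T : measurableType d)
    (g : nat * nat -> R -> R) (N1 N2 : T -> nat) (Z : T -> R) :
  blip g -> measurable_fun setT N1 -> measurable_fun setT N2 ->
  measurable_fun setT Z ->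
  measurable_fun setT (fun t => g (N1 t, N2 t) (Z t)).
Proof.
move=> bg m1 m2 mZ _ B mB; rewrite setTI.
have -> : (fun t => g (N1 t, N2 t) (Z t)) @^-1` B =
  \bigcup_a \bigcup_b ((N1 @^-1` [set a] `&` N2 @^-1` [set b]) `&`
     (g (a, b) \o Z) @^-1` B).
  apply/seteqP; split=> t /=.
    by move=> Bt; exists (N1 t) => //; exists (N2 t).
  by move=> [a _ [b _ [[/= <- <-]]]].
apply: bigcup_measurable => a _; apply: bigcup_measurable => b _.
apply: measurableI.
  by apply: measurableI; rewrite -[_ @^-1` _]setTI; [exact: m1|exact: m2].
rewrite -[_ @^-1` _]setTI; apply: measurableT_comp => //.
by apply: continuous_measurable_fun; exact: blip_cont.
Qed.

(** * Sums with two counters as iterated one-step operators *)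

Section Chain.
Context d (T : measurableType d) (R : realType) (P : probability T R).
Variable X : nat -> {RV P >-> R}.
Hypothesis hind : mutually_independent P (fun i => (X i : T -> R)).
Hypothesis hid : forall i x,
  fine (P [set w | X i w <= x]) = fine (P [set w | X 0%N w <= x]).
Variables (c1 c2 : R) (w : R -> R).
Hypothesis mw : measurable_fun setT w.

Definition upd (x : R) (s : nat * nat) : nat * nat :=
  ((x <= c1)%R + s.1, (x <= c2)%R + s.2)%N.

Definition stepK (g : nat * nat -> R -> R) (s : nat * nat) (z : R) : R :=
  \int[law X]_x g (upd x s) (z + w x).

Definition stS (l : seq nat) (t : T) : nat * nat :=
  ((\sum_(j <- l) (X j t <= c1)%R)%N, (\sum_(j <- l) (X j t <= c2)%R)%N).

Definition stZ (l : seq nat) (t : T) : R := \sum_(j <- l) w (X j t).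

Lemma meas_le (c : R) : measurable_fun setT (fun x : R => nat_of_bool (x <= c)).
Proof.
have -> : (fun x : R => nat_of_bool (x <= c)) =
    (fun x => if (x <= c) then 1%N else 0%N) by apply/funext => x; case: ifP.
by apply: measurable_fun_ifT => //; apply: measurable_fun_ler.
Qed.

Lemma stepK_bmeas g s z : blip g -> bmeas setT (fun x => g (upd x s) (z + w x)).
Proof.
move=> bg; split; last by case: bg => -[M hM] _; exists M.
apply: blip_meas => //.
- by apply: measurable_fun_addn => //; exact: meas_le.
- by apply: measurable_fun_addn => //; exact: meas_le.
- exact: measurable_funD.
Qed.

Lemma stepK_blip g : blip g -> blip (stepK g).
Proof.
move=> bg; have [[M hM] [L hL]] := bg; split.
  exists M => s z; apply: Rint_bound => //.
  exact: (stepK_bmeas s z bg).1.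
exists L => s z z'; rewrite /stepK -(RintB measurableT (probT_lty _));
  [|exact: stepK_bmeas..].
apply: Rint_bound => [|x].
  by have [] := bmeasB (stepK_bmeas s z bg) (stepK_bmeas s z' bg).
by rewrite (le_trans (hL _ _ _))// opprD addrACA subrr addr0.
Qed.

(** The head of the list is integrated out by [indep_fubini] with the tail as past; this replaces
    [g] by [stepK g], and the induction hypothesis applies to the new function. *)
Lemma chain l g : uniq l -> blip g ->
  \int[P]_t g (stS l t) (stZ l t) = iter (size l) stepK g (0%N, 0%N) 0.
Proof.
elim: l g => [|i l ih] g /=.
  move=> _ bg; rewrite /stS /stZ.
  under eq_Rintegral do rewrite !big_nil.
  exact: Rint_prob_cst.
move=> /andP[il ul] bg; have [[M hM] _] := bg.
have e t : g (stS (i :: l) t) (stZ (i :: l) t) =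
   g (upd (X i t) (stS l t)) (stZ l t + w (X i t)).
  by rewrite /stS /stZ /upd/= !big_cons [w _ + _]addrC.
under eq_Rintegral do rewrite e.
rewrite (indep_fubini hind hid (l := l) (i := i)
  (Phi := fun z => g (upd z.2 (stS l z.1)) (stZ l z.1 + w z.2)) (M := M))//.
  rewrite -iterS iterSr -ih//; exact: stepK_blip.
apply: blip_meas => //.
- apply: measurable_fun_addn.
    by apply: (measurableT_comp (meas_le c1)).
  apply: (measurableT_comp (f := fun t : past X l =>
    (\sum_(j <- l) (X j t <= c1)%R)%N)) => //; exact: past_count.
- apply: measurable_fun_addn.
    by apply: (measurableT_comp (meas_le c2)).
  apply: (measurableT_comp (f := fun t : past X l =>
    (\sum_(j <- l) (X j t <= c2)%R)%N)) => //; exact: past_count.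
- apply: measurable_funD; apply: measurableT_comp => //.
  exact: past_sum.
Qed.

End Chain.

(** * Smoothing by Markov operators *)

Section MarkovOperators.
Context (R : realType) (S : Type).
Local Notation state := (S -> R -> R).
Implicit Types (f g : state) (K : state -> state) (M h : R).

Definition bnd M f := forall s z, `|f s z| <= M.

Lemma bnd_ge0 M f (s : S) : bnd M f -> 0 <= M.
Proof. by move=> /(_ s 0); exact: le_trans. Qed.

Lemma blip_cst (c : R) : blip (fun (_ : S) (_ : R) => c).
Proof.
split; first by exists `|c|.
by exists 0 => s z z'; rewrite subrr normr0 mul0r.
Qed.

Lemma blipD f g : blip f -> blip g -> blip (fun s z => f s z + g s z).
Proof.
move=> [[Mf hf] [Lf lf]] [[Mg hg] [Lg lg]]; split.
  by exists (Mf + Mg) => s z; rewrite (le_trans (ler_normD _ _))// lerD.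
exists (Lf + Lg) => s z z'.
by rewrite opprD addrACA (le_trans (ler_normD _ _))// mulrDl lerD.
Qed.

Lemma blipZ (c : R) f : blip f -> blip (fun s z => c * f s z).
Proof.
move=> [[Mf hf] [Lf lf]]; split.
  by exists (`|c| * Mf) => s z; rewrite normrM ler_wpM2l.
exists (`|c| * Lf) => s z z'.
by rewrite -mulrBr normrM -mulrA ler_wpM2l.
Qed.

Lemma blipN f : blip f -> blip (fun s z => - f s z).
Proof.
move=> /(blipZ (-1)) bf.
by under eq_fun => s do under eq_fun => z do rewrite -mulN1r.
Qed.

Lemma blipB f g : blip f -> blip g -> blip (fun s z => f s z - g s z).
Proof. by move=> bf /blipN; exact: blipD. Qed.

Lemma blip_tr h f : blip f -> blip (fun s z => f s (z + h)).
Proof.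
move=> [[Mf hf] [Lf lf]]; split; first by exists Mf.
exists Lf => s z z'; rewrite (le_trans (lf _ _ _))//.
by rewrite opprD addrACA subrr addr0.
Qed.

(** Markov operators commuting with translations of [z]. The abstraction allows the part of a
    one-step expectation left after removing its smooth component to be treated like the expectation
    itself, although it is not given as an integral. *)
Record mop K : Prop := Mop {
  mopD : forall f g, blip f -> blip g -> forall s z,
    K (fun s z => f s z + g s z) s z = K f s z + K g s z;
  mopZ : forall c f, blip f -> forall s z,
    K (fun s z => c * f s z) s z = c * K f s z;
  mop_ge0 : forall f, blip f -> (forall s z, 0 <= f s z) ->
    forall s z, 0 <= K f s z;
  mop1 : forall s z, K (fun _ _ => 1) s z = 1;
  mop_tr : forall h f, blip f -> forall s z,
    K (fun s z => f s (z + h)) s z = K f s (z + h) }.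

Section OneOperator.
Variable K : state -> state.
Hypothesis mK : mop K.

Lemma mopB f g : blip f -> blip g -> forall s z,
  K (fun s z => f s z - g s z) s z = K f s z - K g s z.
Proof.
move=> bf bg s z.
have -> : (fun s z => f s z - g s z) = (fun s z => f s z + (-1) * g s z).
  by apply/funext => t; apply/funext => y; rewrite mulN1r.
by rewrite (mopD mK)// ?(mopZ mK)// ?mulN1r//; exact: blipZ.
Qed.

Lemma mop_cst (c : R) s z : K (fun _ _ => c) s z = c.
Proof.
have -> : (fun (_ : S) (_ : R) => c) = (fun _ _ => c * 1).
  by apply/funext => t; apply/funext => y; rewrite mulr1.
rewrite (@mopZ K mK c (fun _ _ => 1))//; last exact: blip_cst.
by rewrite (mop1 mK) mulr1.
Qed.

Lemma mop_le f g : blip f -> blip g -> (forall s z, f s z <= g s z) ->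
  forall s z, K f s z <= K g s z.
Proof.
move=> bf bg fg s z; rewrite -subr_ge0 -mopB//.
by apply: (mop_ge0 mK) => [|t y]; [exact: blipB | rewrite subr_ge0].
Qed.

Lemma mop_bnd M f : blip f -> bnd M f -> bnd M (K f).
Proof.
move=> bf hM s z; rewrite ler_norml -{1}(mop_cst (- M) s z) -{2}(mop_cst M s z).
apply/andP; split; (apply: mop_le => //; first exact: blip_cst) => t y.
  by have := hM t y; rewrite ler_norml => /andP[].
by have := hM t y; rewrite ler_norml => /andP[].
Qed.

(** Commutation with translations turns a difference of two values of [K f] into [K] applied to a
    translated difference of [f], which is bounded by the Lipschitz constant. *)
Lemma mop_blip f : blip f -> blip (K f).
Proof.
move=> bf; have [[M hM] [L hL]] := bf; split; first by exists M; exact: mop_bnd.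
exists L => s z z'.
have -> : K f s z = K f s (z' + (z - z')) by rewrite addrC subrK.
rewrite -(mop_tr mK)// -mopB//; last exact: blip_tr.
apply: (mop_bnd (f := fun s y => f s (y + (z - z')) - f s y)).
  by apply: blipB => //; exact: blip_tr.
by move=> t y; rewrite (le_trans (hL _ _ _))// [y + _]addrC addrK.
Qed.

End OneOperator.

Lemma mop_comp K K' : mop K -> mop K' -> mop (K \o K').
Proof.
move=> mK mK'; split => /=.
- move=> f g bf bg s z.
  have -> : K' (fun s z => f s z + g s z) = (fun s z => K' f s z + K' g s z).
    by apply/funext => t; apply/funext => y; exact: mopD.
  by apply: (mopD mK); exact: mop_blip.
- move=> c f bf s z.
  have -> : K' (fun s z => c * f s z) = (fun s z => c * K' f s z).
    by apply/funext => t; apply/funext => y; exact: mopZ.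
  by apply: (mopZ mK); exact: mop_blip.
- move=> f bf f0 s z; apply: (mop_ge0 mK); first exact: mop_blip.
  by move=> t y; exact: (mop_ge0 mK').
- move=> s z; have -> : K' (fun _ _ => 1) = (fun _ _ => 1).
    by apply/funext => t; apply/funext => y; exact: mop1.
  exact: mop1.
- move=> h f bf s z; have -> : K' (fun s z => f s (z + h)) = (fun s z => K' f s (z + h)).
    by apply/funext => t; apply/funext => y; exact: mop_tr.
  by apply: (mop_tr mK); exact: mop_blip.
Qed.

Lemma mop_id : mop id. Proof. by []. Qed.

Lemma mop_iter n K : mop K -> mop (iter n K).
Proof.
move=> mK; elim: n => [|n ih]; first exact: mop_id.
exact: (mop_comp mK ih).
Qed.

(** Says that [g] is the [z]-derivative of [f], as a uniform quadratic bound. A positive operator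
    preserves such an inequality directly, so that derivation and operator commute without any
    interchange of limits. *)
Definition dpair M f g := forall s z h,
  `|f s (z + h) - f s z - h * g s z| <= M * h ^+ 2.

Lemma mop_dpair K M f g : mop K -> blip f -> blip g ->
  dpair M f g -> dpair M (K f) (K g).
Proof.
move=> mK bf bg fg s z h.
rewrite -(mop_tr mK)// -(mopZ mK)// -(mopB mK)//; last exact: blip_tr.
rewrite -(mopB mK)//; [|by apply: blipB => //; exact: blip_tr|exact: blipZ].
apply: (mop_bnd mK) => [|t y]; last exact: fg.
by apply: blipB; [apply: blipB => //; exact: blip_tr | exact: blipZ].
Qed.

End MarkovOperators.
Arguments bnd {R S}. Arguments mop {R S}. Arguments dpair {R S}.
Arguments mop_cst {R S K}.

(** * Total variation of binomial weights *)

Section BinomialSmoothing.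
Context (R : realType).
Implicit Types (n j : nat).

Lemma binS_sum n (F : nat -> R) :
  \sum_(i < n.+2) 'C(n.+1, i)%:R * F i =
  \sum_(i < n.+1) 'C(n, i)%:R * (F i + F i.+1).
Proof.
rewrite big_ord_recl/= bin0 mul1r.
under eq_bigr => i _ do rewrite /bump/= add1n binS natrD mulrDl.
rewrite big_split/= addrA.
under [RHS]eq_bigr => i _ do rewrite mulrDr.
rewrite big_split/=; congr (_ + _).
rewrite [RHS]big_ord_recl/= bin0 mul1r; congr (_ + _).
rewrite big_ord_recr/= bin_small// mul0r addr0.
by apply: eq_bigr.
Qed.

Lemma bin_sum1 n : \sum_(i < n.+1) 'C(n, i)%:R = (2 : R) ^+ n.
Proof.
elim: n => [|n ih]; first by rewrite big_ord1 bin0.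
under eq_bigr => i _ do rewrite -[_%:R]mulr1.
rewrite (binS_sum n (fun=> 1)) -mulr_suml ih exprS mulrC.
by congr (_ * _); rewrite -natr1.
Qed.

(** The second moment of a sum of [n] fair signs, by Pascal's rule. *)
Lemma bin_sum2 n :
  \sum_(i < n.+1) 'C(n, i)%:R * (2 * i%:R - n%:R) ^+ 2 = n%:R * (2 : R) ^+ n.
Proof.
elim: n => [|n ih]; first by rewrite big_ord1 mulr0 subr0 expr0n/= mulr0 mul0r.
rewrite (binS_sum n (fun i => (2 * i%:R - n.+1%:R) ^+ 2)).
under eq_bigr => i _.
  have -> : (2 * i%:R - n.+1%:R) ^+ 2 + (2 * i.+1%:R - n.+1%:R) ^+ 2 =
    2 * (2 * i%:R - n%:R) ^+ 2 + 2 :> R by rewrite -!natr1; ring.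
  rewrite mulrDr mulrCA [_ * 2]mulrC; over.
rewrite big_split/= -!mulr_sumr ih bin_sum1 exprS -natr1; ring.
Qed.

(** Cauchy-Schwarz for the binomial weights, in the pointwise form [2 q |u| <= u ^ 2 + q ^ 2] with
    [q = sqrt n]. *)
Lemma bin_dev n : (0 < n)%N ->
  \sum_(i < n.+1) 'C(n, i)%:R * `|2 * i%:R - n%:R| <=
    Num.sqrt n%:R * (2 : R) ^+ n.
Proof.
move=> n0; set q := Num.sqrt n%:R.
have q0 : 0 < q by rewrite sqrtr_gt0 ltr0n.
have q2 : q ^+ 2 = n%:R by rewrite sqr_sqrtr.
apply: (@le_trans _ _ (\sum_(i < n.+1)
   ((2 * q)^-1 * ('C(n, i)%:R * (2 * i%:R - n%:R) ^+ 2) + q / 2 * 'C(n, i)%:R))).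
  apply: ler_sum => i _.
  rewrite -subr_ge0; set c := 'C(n, i)%:R; set t := 2 * i%:R - n%:R.
  have -> : (2 * q)^-1 * (c * t ^+ 2) + q / 2 * c - c * `|t| =
     c / (2 * q) * (`|t| - q) ^+ 2.
    by rewrite -[t ^+ 2]real_normK ?num_real//; field; rewrite gt_eqF.
  by rewrite mulr_ge0 ?sqr_ge0// divr_ge0// ?ler0n// mulr_ge0// ltW.
rewrite big_split/= -!mulr_sumr bin_sum2 bin_sum1 -q2.
rewrite le_eqVlt; apply/orP; left; apply/eqP; field.
by rewrite gt_eqF.
Qed.

(* the coefficients of [(tau - 1) (1 + tau) ^ j], where [tau] is the translation by [delta] *)
Definition dbin j i : R :=
  (if i is i'.+1 then 'C(j, i')%:R else 0) - 'C(j, i)%:R.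

Lemma dbinE j i : (j.+1)%:R * dbin j i = 'C(j.+1, i)%:R * (2 * i%:R - j.+1%:R).
Proof.
rewrite /dbin; case: i => [|i].
  by rewrite !bin0; ring.
have e1 : (j.+1%:R * 'C(j, i)%:R = i.+1%:R * 'C(j.+1, i.+1)%:R :> R).
  by rewrite -!natrM mul_bin_diag.
have e2 : 'C(j.+1, i.+1)%:R = 'C(j, i.+1)%:R + 'C(j, i)%:R :> R.
  by rewrite binS natrD.
have -> : 'C(j, i.+1)%:R = 'C(j.+1, i.+1)%:R - 'C(j, i)%:R :> R.
  by rewrite e2 addrK.
rewrite !mulrBr e1.
ring.
Qed.

(** By [dbinE] the differences of neighbouring binomial coefficients are proportional to the
    distance from the centre, so their total variation is the mean absolute deviation of [j + 1]
    signs divided by [j + 1]. This is where the factor [j ^ (-1/2)] arises. *)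
Lemma dbin_sum j : \sum_(i < j.+2) `|dbin j i| <= 2 ^+ j.+1 / Num.sqrt j.+1%:R.
Proof.
set q := Num.sqrt _; have q0 : 0 < q by rewrite sqrtr_gt0 ltr0n.
have q2 : q ^+ 2 = j.+1%:R by rewrite sqr_sqrtr.
rewrite ler_pdivlMr// -(ler_pM2l q0) [leLHS]mulrC -mulrA -expr2 q2 mulrC mulr_sumr.
apply: le_trans (bin_dev (ltn0Sn j)); apply: ler_sum => i _.
have -> : j.+1%:R * `|dbin j i| = `|j.+1%:R * dbin j i|.
  by rewrite normrM ger0_norm ?ler0n.
by rewrite dbinE normrM ger0_norm ?ler0n.
Qed.

Lemma dbinS j (F : nat -> R) :
  \sum_(i < j.+3) dbin j.+1 i * F i =
  \sum_(i < j.+2) dbin j i * (F i + F i.+1).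
Proof.
rewrite /dbin; under eq_bigr do rewrite mulrBl.
under [RHS]eq_bigr do rewrite mulrBl.
rewrite !sumrB; congr (_ - _).
  rewrite big_ord_recl/= mul0r add0r [RHS]big_ord_recl/= mul0r add0r.
  exact: (binS_sum j (fun i => F i.+1)).
rewrite big_ord_recr/= bin_small// mul0r addr0.
rewrite [RHS]big_ord_recr/= bin_small// mul0r addr0.
exact: (binS_sum j F).
Qed.

End BinomialSmoothing.

(** * Gain of derivatives from a uniform component of the step *)

Section Smoothing.
Context (R : realType) (S : Type).
Local Notation state := (S -> R -> R).
Implicit Types (f g : state) (M : R).
Variables (K B C : state -> state) (p delta : R).
Hypotheses (mK : mop K) (mB : mop B) (mC : mop C).
Hypotheses (p0 : 0 < p) (p1 : p < 1) (delta0 : 0 < delta).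
(** In the application [B] averages over a uniform law of width [delta] and [C] is the translation
    to its left end; [primitive] is then the fundamental theorem of calculus. *)
Hypothesis minor : forall g, blip g -> (forall s z, 0 <= g s z) ->
  forall s z, p * (2^-1 * (B g s z + B g s (z + delta))) <= K g s z.
Hypothesis primitive : forall f g M, blip f -> blip g -> dpair M f g ->
  forall s z, B g s z = delta^-1 * (C f s (z + delta) - C f s z).

Definition half g : state := fun s z => 2^-1 * (g s z + g s (z + delta)).

Lemma blip_half g : blip g -> blip (half g).
Proof. by move=> bg; apply/blipZ/blipD => //; exact: blip_tr. Qed.

Lemma half_mop K' g : mop K' -> blip g -> K' (half g) = half (K' g).
Proof.
move=> mK' bg; apply/funext => s; apply/funext => z.
by rewrite /half (mopZ mK') ?(mopD mK') ?(mop_tr mK')//;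
  [exact: blip_tr|apply: blipD => //; exact: blip_tr].
Qed.

(** The increment over [delta] after [j] lazy averages, where [j] counts how often the smooth
    component has been used. *)
Fixpoint theta (j : nat) g : state :=
  if j is j'.+1 then theta j' (half g) else fun s z => g s (z + delta) - g s z.

Lemma thetaE j g s z :
  theta j g s z = 2 ^- j * \sum_(i < j.+2) dbin R j i * g s (z + i%:R * delta).
Proof.
elim: j g => [|j ih] g.
  rewrite /= big_ord_recl big_ord1/= /dbin/= /bump/= expr0 invr1.
  by rewrite !addn0 bin0 bin_small// mul0r addr0 mul1r sub0r subr0 mulN1r mul1r addrC mul1r.
rewrite /= ih (dbinS j (fun i => g s (z + i%:R * delta))) exprS invfM -mulrA mulrCA.
congr (_ * _); rewrite mulr_sumr; apply: eq_bigr => i _.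
have -> : z + i.+1%:R * delta = z + i%:R * delta + delta.
  by rewrite -natr1 mulrDl mul1r addrA.
by rewrite /half mulrCA.
Qed.

Lemma theta_bnd j g M : bnd M g -> bnd (2 * M / Num.sqrt j.+1%:R) (theta j g).
Proof.
move=> gM s z; have M0 := bnd_ge0 s gM.
rewrite thetaE normrM ger0_norm ?invr_ge0 ?exprn_ge0//.
rewrite ler_pdivrMl ?exprn_gt0//.
apply: (le_trans (ler_norm_sum _ _ _)).
apply: (@le_trans _ _ (\sum_(i < j.+2) `|dbin R j i| * M)).
  by apply: ler_sum => i _; rewrite normrM ler_wpM2l.
rewrite -mulr_suml.
apply: (@le_trans _ _ (2 ^+ j.+1 / Num.sqrt j.+1%:R * M)).
  by rewrite ler_wpM2r// dbin_sum.
by rewrite le_eqVlt; apply/orP; left; apply/eqP; rewrite exprS; ring.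
Qed.

Lemma blip_theta j g : blip g -> blip (theta j g).
Proof.
elim: j g => [|j ih] g bg /=; last by apply: ih; exact: blip_half.
by apply: blipB => //; exact: blip_tr.
Qed.

Lemma theta_mop K' j g : mop K' -> blip g -> K' (theta j g) = theta j (K' g).
Proof.
move=> mK'; elim: j g => [|j ih] g bg /=.
  apply/funext => s; apply/funext => z.
  by rewrite (mopB mK') ?(mop_tr mK')//; exact: blip_tr.
by rewrite (ih _ (blip_half bg)) half_mop.
Qed.

Lemma theta_lin j (a b : R) f g :
  theta j (fun s z => a * f s z + b * g s z) =
  fun s z => a * theta j f s z + b * theta j g s z.
Proof.
elim: j f g => [|j ih] f g /=.
  by apply/funext => s; apply/funext => z; ring.
rewrite -ih; congr (theta j _).
by apply/funext => s; apply/funext => z; rewrite /half; ring.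
Qed.

(** What remains of [K] once the fraction [p] of the lazy uniform average is removed; [minor] is
    exactly its positivity, so it is again a Markov operator. *)
Definition rest g : state :=
  fun s z => (1 - p)^-1 * (K g s z - p * half (B g) s z).

Let q0 : 0 < 1 - p. Proof. by rewrite subr_gt0. Qed.

Lemma K_split g : K g = fun s z => p * half (B g) s z + (1 - p) * rest g s z.
Proof.
apply/funext => s; apply/funext => z; rewrite /rest mulVKf ?gt_eqF//.
by rewrite addrC subrK.
Qed.

Lemma mop_rest : mop rest.
Proof.
have mh : mop (fun g => half (B g)).
  split.
  - by move=> f g bf bg s z; rewrite /half !(mopD mB)//; ring.
  - by move=> c f bf s z; rewrite /half !(mopZ mB)//; ring.
  - move=> f bf f0 s z; rewrite mulr_ge0 ?invr_ge0// addr_ge0//; exact: (mop_ge0 mB).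
  - by move=> s z; rewrite /half !(mop1 mB); field.
  - by move=> h f bf s z; rewrite /half !(mop_tr mB)// addrAC.
split.
- by move=> f g bf bg s z; rewrite /rest (mopD mK)// (mopD mh)//; ring.
- by move=> c f bf s z; rewrite /rest (mopZ mK)// (mopZ mh)//; ring.
- move=> f bf f0 s z; rewrite /rest mulr_ge0 ?invr_ge0 ?(ltW q0)//.
  by rewrite subr_ge0; exact: minor.
- move=> s z; rewrite /rest (mop1 mK) (mop1 mh) mulr1 mulVf// gt_eqF//.
- by move=> h f bf s z; rewrite /rest (mop_tr mK)// (mop_tr mh).
Qed.

(** With weight [p] the counter grows by 1; by convexity of the inverse root only a growth of
    [p / 4] is kept in the bound. With [a = sqrt y], the gain from the larger counter is at least
    [p / (4 a ^ 3)], using [sqrt (y + 1) <= 3 a / 2], while the target lies at most [p / (8 a ^ 3)]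
    below [1 / a]. *)
Lemma sqrt_step (y : R) : 1 <= y ->
  p / Num.sqrt (y + 1) + (1 - p) / Num.sqrt y <= (Num.sqrt (y + p / 4))^-1.
Proof.
move=> y1; have y0 : 0 < y by lra.
have := p0; have := p1; move=> p1' p0'.
set a := Num.sqrt y; set b := Num.sqrt (y + 1); set c := Num.sqrt (y + _).
have a0 : 0 < a by rewrite sqrtr_gt0.
have b0 : 0 < b by rewrite sqrtr_gt0; lra.
have c0 : 0 < c by rewrite sqrtr_gt0; lra.
have a2 : a ^+ 2 = y by rewrite sqr_sqrtr// ltW.
have b2 : b ^+ 2 = y + 1 by rewrite sqr_sqrtr//; lra.
have c2 : c ^+ 2 = y + p / 4 by rewrite sqr_sqrtr//; lra.
have ac : a <= c by rewrite -(ler_pXn2r (n := 2)) ?nnegrE// ?ltW// a2 c2; lra.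
have ba : b <= 3 / 2 * a.
  rewrite -(ler_pXn2r (n := 2))// ?nnegrE ?ltW//; last by lra.
  by rewrite exprMn b2 a2; lra.
have e1 : a^-1 - c^-1 = (p / 4) / (a * c * (a + c)).
  have : (c - a) * (c + a) = p / 4 by rewrite -subr_sqr c2 a2; lra.
  move=> <-; field; rewrite !gt_eqF//; lra.
have e2 : a^-1 - b^-1 = (a * b * (a + b))^-1.
  have h : (b - a) * (b + a) = 1 by rewrite -subr_sqr b2 a2; lra.
  rewrite -[RHS]mul1r -h; field; rewrite !gt_eqF//; lra.
have k1 : a^-1 - c^-1 <= (p / 4) / (2 * a ^+ 3).
  rewrite e1 ler_wpM2l//; first by lra.
  rewrite lef_pV2 ?posrE ?mulr_gt0 ?exprn_gt0 ?addr_gt0//.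
  have -> : 2 * a ^+ 3 = a * a * (a + a) by ring.
  by apply: ler_pM; [rewrite mulr_ge0 ?ltW//|rewrite addr_ge0 ?ltW//|rewrite ler_pM2l|rewrite lerD2l].
have k2 : (4 * a ^+ 3)^-1 <= a^-1 - b^-1.
  rewrite e2 lef_pV2 ?posrE ?mulr_gt0 ?exprn_gt0 ?addr_gt0//.
  apply: (@le_trans _ _ (a * (3 / 2 * a) * (a + 3 / 2 * a))).
    by apply: ler_pM; [rewrite mulr_ge0 ?ltW//|rewrite addr_ge0 ?ltW//|rewrite ler_pM2l|rewrite lerD2l].
  have -> : a * (3 / 2 * a) * (a + 3 / 2 * a) = 15 / 4 * a ^+ 3 by field.
  by rewrite ler_wpM2r ?exprn_ge0 ?ltW//; lra.
have k3 : p * (4 * a ^+ 3)^-1 <= p * (a^-1 - b^-1) by rewrite ler_pM2l.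
have k4 : p / 4 / (2 * a ^+ 3) = p * (4 * a ^+ 3)^-1 / 2.
  by field; rewrite gt_eqF.
have k5 : 0 < p * (4 * a ^+ 3)^-1 by rewrite mulr_gt0// invr_gt0 mulr_gt0// exprn_gt0.
by move: k1 k3; rewrite k4 mulrBr; move: k5; set u := p * _; lra.
Qed.

(** Induction on [m] with [j] general: a step either uses the smooth component, raising [j] by one,
    or the rest, leaving [j] unchanged. [sqrt_step] averages the two resulting bounds. *)
Lemma theta_iter m j g M : blip g -> bnd M g ->
  bnd (2 * M / Num.sqrt (j.+1%:R + m%:R * p / 4)) (iter m K (theta j g)).
Proof.
elim: m j g => [|m ih] j g bg gM; first by rewrite !mul0r addr0; exact: theta_bnd.
rewrite iterSr theta_mop// K_split => s z; have M0 := bnd_ge0 s gM.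
have bB := mop_blip mB bg; have bV := mop_blip mop_rest bg.
rewrite theta_lin (mopD (mop_iter m mK)); last 2 first.
- by apply/blipZ/blip_theta/blip_half.
- by apply/blipZ/blip_theta.
rewrite (@mopZ _ _ _ (mop_iter m mK) p (theta j (half (B g)))); last exact/blip_theta/blip_half.
rewrite (@mopZ _ _ _ (mop_iter m mK) (1 - p) (theta j (rest g))); last exact/blip_theta.
set y := j.+1%:R + m%:R * p / 4.
have y1 : 1 <= y.
  by rewrite /y -natr1 -addrA addrCA lerDl addr_ge0 ?ler0n// divr_ge0// mulr_ge0 ?ler0n ?ltW.
have h1 := ih j.+1 _ bB (mop_bnd mB bg gM) s z.
have h2 := ih j _ bV (mop_bnd mop_rest bg gM) s z.
have -> : j.+1%:R + m.+1%:R * p / 4 = y + p / 4 by rewrite /y -[m.+1%:R]natr1; field.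
move: h1; have -> : j.+2%:R + m%:R * p / 4 = y + 1 by rewrite /y -natr1; ring.
move=> h1; apply: (le_trans (ler_normD _ _)); rewrite !normrM (gtr0_norm p0) (gtr0_norm q0).
apply: (@le_trans _ _ (2 * M * (p / Num.sqrt (y + 1) + (1 - p) / Num.sqrt y))).
  have -> : 2 * M * (p / Num.sqrt (y + 1) + (1 - p) / Num.sqrt y) =
    p * (2 * M / Num.sqrt (y + 1)) + (1 - p) * (2 * M / Num.sqrt y) by ring.
  by apply: lerD; rewrite ler_pM2l.
by rewrite ler_wpM2l ?mulr_ge0// sqrt_step.
Qed.

(** At the first use of the smooth component the derivative [g] becomes a difference quotient of
    [C f], which the remaining steps smooth by [theta_iter]. The bound [M'] of [g] itself is paid
    only with the weight of never using that component. The constant 3 in place of 2 closes the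
    recursion, since [(3 - p) (1 + p / 8) <= 3]. *)
Lemma smooth1 m f g M M' D : blip f -> blip g -> dpair D f g ->
  bnd M f -> bnd M' g ->
  bnd (3 * M / delta / Num.sqrt (1 + m%:R * p / 4) + (1 - p) ^+ m * M')
    (iter m K g).
Proof.
elim: m f g => [|m ih] f g bf bg fg fM gM.
  move=> s z; rewrite /= expr0 mul1r (le_trans (gM s z))// lerDr.
  by rewrite !divr_ge0 ?sqrtr_ge0 ?mulr_ge0 ?(bnd_ge0 s fM)// ltW.
rewrite iterSr K_split => s z; have M0 := bnd_ge0 s fM.
have M'0 := bnd_ge0 s gM.
have bB := mop_blip mB bg; have bV := mop_blip mop_rest bg.
have bC := mop_blip mC bf.
rewrite (mopD (mop_iter m mK)); [|by apply/blipZ/blip_half|exact: blipZ].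
rewrite (@mopZ _ _ _ (mop_iter m mK) p (half (B g))); last exact: blip_half.
rewrite (@mopZ _ _ _ (mop_iter m mK) (1 - p) (rest g))//.
have p0' := p0; have p1' := p1.
have eB : B g = fun s z => delta^-1 * theta 0 (C f) s z.
  by apply/funext => t; apply/funext => y; rewrite (primitive bf bg fg).
have bt := blip_theta 0 bC.
rewrite (half_mop (mop_iter m mK))//.
have hB t y : `|iter m K (B g) t y| <= delta^-1 * (2 * M / Num.sqrt (1 + m%:R * p / 4)).
  rewrite eB (mopZ (mop_iter m mK))// normrM gtr0_norm ?invr_gt0//.
  by rewrite ler_pM2l ?invr_gt0// theta_iter//; exact: mop_bnd.
have h2 := ih _ _ (mop_blip mop_rest bf) bV (mop_dpair mop_rest bf bg fg)
  (mop_bnd mop_rest bf fM) (mop_bnd mop_rest bg gM) s z.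
set y := 1 + m%:R * p / 4 in hB h2.
have y1 : 1 <= y by rewrite /y lerDl divr_ge0// mulr_ge0 ?ler0n ?ltW.
have -> : 1 + m.+1%:R * p / 4 = y + p / 4 by rewrite /y -[m.+1%:R]natr1; field.
have h1 : `|half (iter m K (B g)) s z| <= 2 * M / delta / Num.sqrt y.
  have -> : 2 * M / delta / Num.sqrt y = delta^-1 * (2 * M / Num.sqrt y) by ring.
  rewrite /half normrM ger0_norm ?invr_ge0// ler_pdivrMl//.
  apply: (le_trans (ler_normD _ _)).
  have := lerD (hB s z) (hB s (z + delta)); move=> h; apply: (le_trans h).
  by rewrite le_eqVlt; apply/orP; left; apply/eqP; ring.
apply: (le_trans (ler_normD _ _)); rewrite (normrM p) (normrM (1 - p)) (gtr0_norm p0) (gtr0_norm q0).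
apply: (@le_trans _ _ (p * (2 * M / delta / Num.sqrt y) +
   (1 - p) * (3 * M / delta / Num.sqrt y + (1 - p) ^+ m * M'))).
  by apply: lerD; rewrite ler_pM2l.
rewrite exprS -(mulrA (1 - p) ((1 - p) ^+ m) M') (mulrDr (1 - p)) addrA lerD2r.
set a := Num.sqrt y; set c := Num.sqrt (y + _).
have a0 : 0 < a by rewrite sqrtr_gt0; lra.
have c0 : 0 < c by rewrite sqrtr_gt0; lra.
have a2 : a ^+ 2 = y by rewrite sqr_sqrtr//; lra.
have c2 : c ^+ 2 = y + p / 4 by rewrite sqr_sqrtr//; lra.
have ca : c <= (1 + p / 8) * a.
  rewrite -(ler_pXn2r (n := 2))// ?nnegrE ?mulr_ge0 ?(ltW a0) ?(ltW c0)//; last by lra.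
  rewrite exprMn c2 a2.
  have -> : (1 + p / 8) ^+ 2 * y = y + p / 4 * y + (p / 8) ^+ 2 * y by field.
  have h3 : p / 4 * 1 <= p / 4 * y by rewrite ler_pM2l//; lra.
  have h4 : 0 <= (p / 8) ^+ 2 * y by rewrite mulr_ge0 ?sqr_ge0//; lra.
  by lra.
have -> : p * (2 * M / delta / a) + (1 - p) * (3 * M / delta / a) =
   M / delta * ((3 - p) / a) by ring.
have -> : 3 * M / delta / c = M / delta * (3 / c) by ring.
rewrite ler_wpM2l ?divr_ge0 ?(ltW delta0)// ler_pdivrMr// mulrAC ler_pdivlMr//.
apply: (@le_trans _ _ ((3 - p) * ((1 + p / 8) * a))).
  by rewrite ler_wpM2l//; lra.
rewrite mulrA ler_wpM2r ?(ltW a0)//.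
have -> : (3 - p) * (1 + p / 8) = 3 - 5 / 8 * p - p ^+ 2 / 8 by field.
have := sqr_ge0 p; lra.
Qed.

(** One block of [m] steps per derivative: each block trades a derivative for a factor [A]. The
    crude bound [Q] may be enormous because it always comes with [(1 - p) ^ m]. *)
Lemma smooth_chain m k (g : nat -> state) (M A Q : R) :
  (forall i, (i <= k)%N -> blip (g i)) ->
  (forall i, (i < k)%N -> exists D, dpair D (g i) (g i.+1)) ->
  (forall i, (i <= k)%N -> bnd Q (g i)) -> bnd M (g 0%N) ->
  1 <= A -> 3 / delta / Num.sqrt (1 + m%:R * p / 4) <= A ->
  bnd (A ^+ k * (M + k%:R * ((1 - p) ^+ m * Q))) (iter (k * m) K (g k)).
Proof.
move=> bg dg gQ gM A1 hA; have A0 : 0 <= A by lra.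
elim: k bg dg gQ => [|k ih] bg dg gQ.
  by rewrite mul0n/= expr0 mul0r addr0 mul1r.
move=> s z; have Q0 := bnd_ge0 s (gQ _ (leq0n _)).
have M0 := bnd_ge0 s gM.
have [D hD] := dg k (ltnSn k).
have bk := bg k (leqnSn k); have bk1 := bg k.+1 (leqnn _).
rewrite mulSn iterD.
have mKk := mop_iter (k * m) mK.
have ihk := ih (fun i ik => bg i (leqW ik)) (fun i ik => dg i (leqW ik))
  (fun i ik => gQ i (leqW ik)).
have := smooth1 m (mop_blip mKk bk) (mop_blip mKk bk1) (mop_dpair mKk bk bk1 hD)
  ihk (mop_bnd mKk bk1 (gQ k.+1 (leqnn _))) s z.
move=> h; apply: (le_trans h).
set rQ := (1 - p) ^+ m * Q.
have rQ0 : 0 <= rQ by rewrite mulr_ge0// exprn_ge0// ltW.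
set N := A ^+ k * (M + k%:R * rQ).
have N0 : 0 <= N by rewrite mulr_ge0 ?exprn_ge0// addr_ge0// mulr_ge0.
have -> : 3 * N / delta / Num.sqrt (1 + m%:R * p / 4) =
  3 / delta / Num.sqrt (1 + m%:R * p / 4) * N by ring.
apply: (@le_trans _ _ (A * N + A ^+ k.+1 * rQ)).
  apply: lerD; first by rewrite ler_wpM2r.
  by rewrite ler_peMl// exprn_ege1.
by rewrite le_eqVlt; apply/orP; left; apply/eqP; rewrite /N exprS -natr1; ring.
Qed.

Lemma smooth_le m m' k (g : nat -> state) (M A Q : R) :
  (forall i, (i <= k)%N -> blip (g i)) ->
  (forall i, (i < k)%N -> exists D, dpair D (g i) (g i.+1)) ->
  (forall i, (i <= k)%N -> bnd Q (g i)) -> bnd M (g 0%N) ->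
  1 <= A -> 3 / delta / Num.sqrt (1 + m%:R * p / 4) <= A -> (k * m <= m')%N ->
  bnd (A ^+ k * (M + k%:R * ((1 - p) ^+ m * Q))) (iter m' K (g k)).
Proof.
move=> bg dg gQ gM A1 hA km; rewrite -(subnK km) iterD.
apply: (mop_bnd (mop_iter _ mK)); last exact: smooth_chain.
by apply: (mop_blip (mop_iter _ mK)); exact: bg.
Qed.

End Smoothing.

(** * Taylor bounds and the Gaussian distribution *)

Section CalculusTools.
Context (R : realType).

Local Notation dvt f x df := (is_derive x (1 : R) f df).

Lemma dvt_eq (f : R -> R) (x a b : R) : dvt f x a -> a = b -> dvt f x b.
Proof. by move=> ? <-. Qed.

Lemma dvt_cst (c x : R) : dvt (fun=> c) x 0.
Proof. exact: is_derive_cst. Qed.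

Lemma dvt_id (x : R) : dvt (fun y => y) x 1.
Proof. exact: is_derive_id. Qed.

Lemma dvtD (f g : R -> R) (x a b : R) : dvt f x a -> dvt g x b ->
  dvt (fun y => f y + g y) x (a + b).
Proof. exact: is_deriveD. Qed.

Lemma dvtB (f g : R -> R) (x a b : R) : dvt f x a -> dvt g x b ->
  dvt (fun y => f y - g y) x (a - b).
Proof. exact: is_deriveB. Qed.

Lemma dvtN (f : R -> R) (x a : R) : dvt f x a -> dvt (fun y => - f y) x (- a).
Proof. exact: is_deriveN. Qed.

Lemma dvtM (f g : R -> R) (x a b : R) : dvt f x a -> dvt g x b ->
  dvt (fun y => f y * g y) x (f x * b + g x * a).
Proof. exact: is_deriveM. Qed.

Lemma dvtZ (c : R) (f : R -> R) (x a : R) : dvt f x a ->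
  dvt (fun y => c * f y) x (c * a).
Proof. exact: is_deriveZ. Qed.

Lemma dvtX n (f : R -> R) (x a : R) : dvt f x a ->
  dvt (fun y => f y ^+ n) x (n%:R * f x ^+ n.-1 * a).
Proof.
move=> df; elim: n => [|n ih].
  by rewrite !mul0r (_ : (fun y => _) = fun=> 1)//; exact: dvt_cst.
rewrite (_ : (fun y => _) = fun y => f y * f y ^+ n); last first.
  by apply/funext => y; rewrite exprS.
apply: dvt_eq (dvtM df ih) _ => /=.
by case: n {ih} => [|n] /=; rewrite ?expr0 -?natr1 ?exprS; ring.
Qed.

Lemma dvtV (f : R -> R) (x a : R) : f x != 0 -> dvt f x a ->
  dvt (fun y => (f y)^-1) x (- (f x ^+ 2)^-1 * a).
Proof. by move=> fx df; exact: is_deriveV. Qed.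

Lemma dvt_comp (f g : R -> R) (x a b : R) : dvt f (g x) a -> dvt g x b ->
  dvt (fun y => f (g y)) x (a * b).
Proof. exact: is_derive1_comp. Qed.

Lemma is_derive_cont (f : R -> R) (x df : R) :
  is_derive x (1 : R) f df -> {for x, continuous f}.
Proof. by move=> [d _]; apply: differentiable_continuous; exact/derivable1_diffP. Qed.

Lemma mvt_bound (f df : R -> R) (a h M : R) :
  (forall t, 0 <= t <= 1 -> dvt f (a + t * h) (df (a + t * h))) ->
  (forall t, 0 <= t <= 1 -> `|df (a + t * h)| <= M) ->
  `|f (a + h) - f a| <= M * `|h|.
Proof.
have main b c : b <= c -> `|c - b| = `|h| ->
   (forall x, b <= x <= c -> dvt f x (df x)) ->
   (forall x, b <= x <= c -> `|df x| <= M) -> `|f c - f b| <= M * `|h|.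
  move=> bc <- fd fM.
  have [||y yab ->] := @MVT_segment _ f df b c bc.
  - move=> x; rewrite in_itv/= => /andP[/ltW bx /ltW xc].
    by apply/fd; rewrite bx xc.
  - have cf : {in `[b, c]%classic, continuous f}.
      move=> z; rewrite inE/= in_itv/= => zab.
      exact: is_derive_cont (fd z zab).
    exact: continuous_in_subspaceT cf.
  - by rewrite normrM ler_wpM2r// fM//; move: yab; rewrite in_itv.
move=> fd fM; have [->|h0] := eqVneq h 0.
  by rewrite addr0 subrr normr0 mulr0.
have rep x : 0 <= (x - a) / h <= 1 -> exists2 t, 0 <= t <= 1 & x = a + t * h.
  by exists ((x - a) / h) => //; rewrite mulfVK// addrC subrK.
case: (ltrP 0 h) => hp.
  have R1 x : a <= x <= a + h -> 0 <= (x - a) / h <= 1.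
    by move=> /andP[ax xc]; rewrite divr_ge0 ?subr_ge0 ?(ltW hp)//= ler_pdivrMr// mul1r lerBlDl.
  apply: main => //; [by rewrite lerDl ltW|by rewrite addrC addKr| |].
    by move=> x /R1/rep[t t01 ->]; exact: fd.
  by move=> x /R1/rep[t t01 ->]; exact: fM.
have hn : h < 0 by rewrite lt_neqAle h0.
have R1 x : a + h <= x <= a -> 0 <= (x - a) / h <= 1.
  move=> /andP[ax xc]; rewrite ler_ndivlMr// ler_ndivrMr// mul1r mul0r.
  by rewrite subr_le0 xc/= lerBrDl.
rewrite distrC; apply: main => //; [by rewrite gerDl| | |].
  by rewrite opprD addNKr normrN.
  by move=> x /R1/rep[t t01 ->]; exact: fd.
by move=> x /R1/rep[t t01 ->]; exact: fM.
Qed.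

(** The way back from quadratic bounds, which operators preserve, to genuine derivatives. *)
Lemma is_derive_of_quad (f : R -> R) (x df M e : R) : 0 < e ->
  (forall h, `|h| <= e -> `|f (x + h) - f x - h * df| <= M * h ^+ 2) ->
  is_derive x (1 : R) f df.
Proof.
move=> e0 H.
have cv : (fun h : R => h^-1 *: ((f \o shift x) (h *: (1 : R)) - f x)) @ 0^' --> df.
  apply/cvgrPdist_le => t t0; near=> h.
  have h0 : h != 0 by near: h; exact: nbhs_dnbhs_neq.
  have he : `|h| <= e.
    by near: h; exact: dnbhs0_le.
  have ht : `|h| <= t / (`|M| + 1).
    by near: h; apply: dnbhs0_le; rewrite divr_gt0// ltr_wpDl.
  have := H h he; rewrite /= /GRing.scale/= mulr1 [h + x]addrC => {}H.
  have -> : df - h^-1 * (f (x + h) - f x) = - (h^-1 * (f (x + h) - f x - h * df)).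
    by field.
  rewrite normrN normrM normfV ler_pdivrMl ?normr_gt0//.
  apply: (le_trans H); rewrite -[h ^+ 2]real_normK ?num_real// expr2 mulrCA.
  rewrite ler_wpM2l//.
  apply: (@le_trans _ _ ((`|M| + 1) * `|h|)).
    by rewrite ler_wpM2r// (le_trans (ler_norm M))// lerDl.
  by rewrite mulrC -ler_pdivlMr// ltr_wpDl.
apply: DeriveDef; last by rewrite /derive; apply/cvg_lim.
by apply/cvg_ex; exists df.
Unshelve. all: by end_near. Qed.

Lemma is_derive_addl (f : R -> R) (a x df : R) :
  is_derive (a + x) (1 : R) f df -> is_derive x (1 : R) (fun y => f (a + y)) df.
Proof.
move=> D1; apply: dvt_eq (dvt_comp (g := fun y => a + y) D1 (dvtD (dvt_cst a x) (dvt_id x))) _.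
by rewrite add0r mulr1.
Qed.

(** The induction applies the statement to the shifted family of derivatives and passes to the
    remainder by the mean value inequality, which gives the remainder without the factor
    [1 / n!]. *)
Lemma taylor_chain (n : nat) (f : nat -> R -> R) (a h M : R) :
  (forall i t, (i < n)%N -> 0 <= t <= 1 ->
     dvt (f i) (a + t * h) (f i.+1 (a + t * h))) ->
  (forall t, 0 <= t <= 1 -> `|f n (a + t * h)| <= M) ->
  `|f 0%N (a + h) - \sum_(j < n) h ^+ j / (j`!)%:R * f j a| <= M * `|h| ^+ n.
Proof.
elim: n f h => [|n ih] f h fd fM.
  rewrite big_ord0 subr0 expr0 mulr1 -[h]mul1r; apply: fM.
  by rewrite ler01 lexx.
pose phi y := f 0%N (a + y) - \sum_(j < n.+1) y ^+ j / (j`!)%:R * f j a.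
have -> : f 0%N (a + h) - \sum_(j < n.+1) h ^+ j / (j`!)%:R * f j a =
    phi (0 + h) - phi 0.
  rewrite add0r /phi addr0; set A := f 0%N (a + h) - _.
  rewrite big_ord_recl/= expr0 fact0 divr1 mul1r big1 ?addr0 ?subrr ?subr0//.
  by move=> i _; rewrite exprS mul0r !mul0r.
pose dphi y := f 1%N (a + y) - \sum_(j < n) y ^+ j / (j`!)%:R * f j.+1 a.
rewrite exprSr mulrA; apply: (mvt_bound (df := dphi)) => t t01; rewrite add0r;
  set y := t * h.
  have D1 : dvt (fun y => f 0%N (a + y)) y (f 1%N (a + y)).
    by apply: is_derive_addl; exact: fd.
  have D2 : is_derive y (1 : R) (fun y => \sum_(j < n.+1) y ^+ j / (j`!)%:R * f j a)
     (\sum_(j < n) y ^+ j / (j`!)%:R * f j.+1 a).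
    have -> : (fun y => \sum_(j < n.+1) y ^+ j / (j`!)%:R * f j a) =
      \sum_(j < n.+1) (fun y => y ^+ j / (j`!)%:R * f j a).
      by apply/funext => z; rewrite fct_sumE.
    have -> : \sum_(j < n) y ^+ j / (j`!)%:R * f j.+1 a =
      \sum_(j < n.+1) (if (j : nat) is j'.+1 then y ^+ j' / (j'`!)%:R * f j a else 0).
      by rewrite big_ord_recl/= add0r.
    apply: is_derive_sum => -[[|j] jn] /=.
      rewrite (_ : (fun _ => _) = cst (f 0%N a)); last first.
        by apply/funext => z; rewrite expr0 fact0 divr1 mul1r.
      exact: is_derive_cst.
    have -> : (fun y => y ^+ j.+1 / (j.+1`!)%:R * f j.+1 a) =
      (fun y => f j.+1 a / (j.+1`!)%:R * y ^+ j.+1).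
      by apply/funext => z; ring.
    apply: dvt_eq (dvtZ _ (dvtX j.+1 (dvt_id y))) _.
    rewrite factS natrM mulr1 /=; field.
    by rewrite -(natrD _ 1 j) !pnatr_eq0 -lt0n fact_gt0.
  exact: is_deriveB.
have M0 : 0 <= M by apply: le_trans (fM 0 _); rewrite // lexx ler01.
have yh : `|y| <= `|h|.
  case/andP: t01 => t0 t1.
  by rewrite /y normrM (ger0_norm t0) ler_piMl.
apply: (@le_trans _ _ (M * `|y| ^+ n)); last first.
  by rewrite ler_wpM2l// lerXn2r// nnegrE.
have t'01 t' : 0 <= t' <= 1 -> 0 <= t' * t <= 1.
  case/andP: t01 => t0 t1 /andP[t'0 t'1].
  by rewrite mulr_ge0//= mulr_ile1.
apply: (ih (fun i => f i.+1)) => [i t' ilt /t'01 tt|t' /t'01 tt].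
  by rewrite /y mulrA; exact: fd.
by rewrite /y mulrA; exact: fM.
Qed.

Lemma taylor2 (f f1 f2 : R -> R) (a h M : R) :
  (forall t, 0 <= t <= 1 -> dvt f (a + t * h) (f1 (a + t * h))) ->
  (forall t, 0 <= t <= 1 -> dvt f1 (a + t * h) (f2 (a + t * h))) ->
  (forall t, 0 <= t <= 1 -> `|f2 (a + t * h)| <= M) ->
  `|f (a + h) - f a - h * f1 a| <= M * h ^+ 2.
Proof.
move=> d0 d1 fM.
pose F (i : nat) := if i is i'.+1 then (if i' is 0%N then f1 else f2) else f.
have := @taylor_chain 2 F a h M.
have -> : \sum_(j < 2) h ^+ j / (j`!)%:R * F j a = f a + h * f1 a.
  have -> : \sum_(j < 2) h ^+ j / (j`!)%:R * F j a = h ^+ 0 / 1 * f a + h ^+ 1 / 1 * f1 a.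
    by rewrite big_ord_recl big_ord1.
  by rewrite expr0 expr1 !divr1 mul1r.
rewrite real_normK ?num_real// opprD addrA; apply=> //.
by case=> [|[|//]] t _; [exact: d0|exact: d1].
Qed.

End CalculusTools.

(** * The normal distribution function, its derivatives and tails *)

Section Gauss.
Context (R : realType).
Local Notation dvt f x df := (is_derive x (1 : R) f df).
Notation mu := (@lebesgue_measure R).
Local Notation phi := (@phi R).
Local Notation Phi := (@Phi R).

Lemma phi_def x : phi x = normal_peak 1 * expR (- x ^+ 2 / 2).
Proof.
rewrite /Defs.phi normal_pdfE ?oner_neq0// /normal_fun subr0 expr1n.
by rewrite -[1 *+ 2]/2%:R.
Qed.

Lemma derive_phi x : is_derive x (1 : R) phi (- x * phi x).
Proof.
have -> : phi = fun x => normal_peak (1 : R) * expR (- 2^-1 * x ^+ 2).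
  by apply/funext => y; rewrite phi_def; congr (_ * expR _); ring.
apply: dvt_eq (dvtZ _ (dvt_comp (is_derive_expR _) (dvtZ _ (dvtX 2 (dvt_id x))))) _.
by rewrite mulr1 expr1; field.
Qed.

Lemma phi_integrable A : measurable A -> mu.-integrable A (EFin \o phi).
Proof.
move=> mA; apply: (integrableS _ mA (subsetT _)) => //.
exact: integrable_normal_pdf.
Qed.

Lemma derive_Phi x : is_derive x (1 : R) Phi (phi x).
Proof.
have xu : x < x + 1 by rewrite ltrDl.
have mI := @phi_integrable [set` Interval -oo%O (BRight (x + 1))] (measurable_itv _).
have cphi : {for x, continuous phi} by apply: continuous_normal_pdf; exact: oner_neq0.
have H := @continuous_FTC1 R phi -oo%O x (x + 1) xu mI.
have [|d1 d2] := H _ cphi; first by rewrite ltNyr.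
apply: DeriveDef; first exact: d1.
by rewrite -derive1E; exact: d2.
Qed.

Lemma PhiE x : (Phi x)%:E = normal_prob (0 : R) 1 `]-oo, x]%classic.
Proof.
rewrite /Defs.Phi /Rintegral /normal_prob fineK//.
exact: integrable_fin_num (phi_integrable _).
Qed.

Lemma Phi_ge0 x : 0 <= Phi x.
Proof. by rewrite -lee_fin PhiE. Qed.

Lemma Phi_le1 x : Phi x <= 1.
Proof. by rewrite -lee_fin PhiE; exact: probability_le1. Qed.

Let mid : @measurable_fun _ _ (measurableTypeR R) R setT (fun x : R => x).
Proof. exact: measurable_id. Qed.
Let idX : {RV (normal_prob (0 : R) 1) >-> R} :=
  @mfun_Sub _ _ (measurableTypeR R) R _ (mem_set mid).

Lemma Phi_cvg1 : Phi x @[x --> +oo] --> (1 : R).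
Proof.
have /fine_cvg := @cvg_cdfy1 _ _ R _ idX.
apply: cvg_trans; apply: near_eq_cvg; near=> x => /=.
by rewrite /cdf /distribution /pushforward preimage_id -PhiE.
Unshelve. all: by end_near. Qed.

Lemma Phi_cvg0 : Phi x @[x --> -oo] --> (0 : R).
Proof.
have /fine_cvg := @cvg_cdfNy0 _ _ R _ idX.
apply: cvg_trans; apply: near_eq_cvg; near=> x => /=.
by rewrite /cdf /distribution /pushforward preimage_id -PhiE.
Unshelve. all: by end_near. Qed.

(** The successive derivatives of [Phi]; the recursion is that of the Hermite polynomials, started
    from [phi' = - x phi]. *)
Fixpoint Phi_der (k : nat) (x : R) : R :=
  match k with
  | 0%N => Phi x
  | k'.+1 => if k' is k''.+1 then - (x * Phi_der k' x + k''%:R * Phi_der k'' x) else phi x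
  end.

Arguments Phi_der : simpl never.

Lemma Phi_derSS k x : Phi_der k.+2 x = - (x * Phi_der k.+1 x + k%:R * Phi_der k x).
Proof. by []. Qed.

Lemma derive_Phi_der k x : is_derive x (1 : R) (Phi_der k) (Phi_der k.+1 x).
Proof.
suff : is_derive x (1 : R) (Phi_der k) (Phi_der k.+1 x) /\
       is_derive x (1 : R) (Phi_der k.+1) (Phi_der k.+2 x) by case.
elim: k => [|k [ih0 ih1]]; last first.
  split=> //.
  apply: dvt_eq (dvtN (dvtD (dvtM (dvt_id x) ih1) (dvtZ k%:R ih0))) _.
  have -> : Phi_der k.+3 x = - (x * Phi_der k.+2 x + k.+1%:R * Phi_der k.+1 x) by exact: Phi_derSS.
  by rewrite -natr1 mulr1 mulrDl mul1r -addrA [Phi_der k.+1 x + _]addrC.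
split; first exact: derive_Phi.
by apply: (dvt_eq (derive_phi x)); rewrite Phi_derSS mul0r addr0 mulNr.
Qed.

(** The exponential [expR (x ^ 2 / 2)] dominates the single term [(x ^ 2 / 2) ^ j / j!] of its
    series. *)
Lemma phi_decay j : exists C, forall x, `|x| ^+ j * phi x <= C.
Proof.
exists (normal_peak 1 * (2 ^+ j * (j`!)%:R)) => x.
have p0 : 0 <= normal_peak (1 : R) by exact: normal_peak_ge0.
rewrite phi_def mulrCA ler_wpM2l// mulNr expRN ler_pdivrMr ?expR_gt0//.
have e1 : 1 <= expR (x ^+ 2 / 2).
  by rewrite -expR0 ler_expR divr_ge0// sqr_ge0.
have h1 : 1 <= 2 ^+ j :> R by rewrite exprn_ege1// ler1n.
have h2 : 1 <= (j`!)%:R :> R by rewrite ler1n fact_gt0.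
have h3 : 1 <= 2 ^+ j * (j`!)%:R :> R by rewrite mulr_ege1.
case: (leP `|x| 1) => x1.
  apply: (@le_trans _ _ 1); first by rewrite exprn_ile1.
  by rewrite mulr_ege1.
case: j h1 h2 h3 => [|j] h1 h2 h3.
  by rewrite expr0 mulr_ege1.
have h := @expR_ge1Dxn R (x ^+ 2 / 2) j (divr_ge0 (sqr_ge0 _) (ler0n _ 2)).
apply: (@le_trans _ _ (2 ^+ j.+1 * (j.+1`!)%:R * ((x ^+ 2 / 2) ^+ j.+1 / j.+1`!%:R))).
  have -> : 2 ^+ j.+1 * (j.+1`!)%:R * ((x ^+ 2 / 2) ^+ j.+1 / j.+1`!%:R) =
     `|x| ^+ j.+1 * `|x| ^+ j.+1.
    rewrite -[x ^+ 2]real_normK ?num_real// expr_div_n exprAC expr2; field.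
    by rewrite pnatr_eq0 -lt0n fact_gt0 /= expf_neq0.
  by rewrite ler_peMr ?exprn_ge0// exprn_ege1// ltW.
rewrite ler_wpM2l ?mulr_ge0 ?exprn_ge0//; lra.
Qed.

Lemma phi_ge0 x : 0 <= phi x. Proof. exact: normal_pdf_ge0. Qed.

Lemma Phi_der_decay k j : exists C, forall x, `|x| ^+ j * `|Phi_der k.+1 x| <= C.
Proof.
suff : (forall j, exists C, forall x, `|x| ^+ j * `|Phi_der k.+1 x| <= C) /\
  (forall j, exists C, forall x, `|x| ^+ j * `|Phi_der k.+2 x| <= C) by case=> h _.
elim: k {j} => [|k [h0 h1]].
  split=> j.
    have [C hC] := phi_decay j; exists C => x.
    by rewrite [Phi_der 1 x]/(phi x) (ger0_norm (phi_ge0 x)).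
  have [C hC] := phi_decay j.+1; exists C => x.
  rewrite Phi_derSS mul0r addr0 normrN normrM mulrA -exprSr [Phi_der 1 x]/(phi x).
  by rewrite (ger0_norm (phi_ge0 x)).
split=> // j; have [C1 H1] := h1 j.+1; have [C0 H0] := h0 j.
exists (C1 + k.+1%:R * C0) => x.
rewrite Phi_derSS normrN.
apply: (@le_trans _ _ (`|x| ^+ j * (`|x| * `|Phi_der k.+2 x| + k.+1%:R * `|Phi_der k.+1 x|))).
  rewrite ler_wpM2l ?exprn_ge0// (le_trans (ler_normD _ _))// !normrM.
  by rewrite (ger0_norm (ler0n _ _)).
rewrite mulrDr mulrA -exprSr mulrCA lerD// ler_wpM2l//.
Qed.

Lemma Phi_der_bnd (n : nat) : exists C, 1 <= C /\ forall k x, (k <= n)%N -> `|Phi_der k x| <= C.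
Proof.
elim: n => [|n [C [C1 hC]]].
  exists 1; split=> // k x; rewrite leqn0 => /eqP ->.
  by rewrite ger0_norm ?Phi_le1 ?Phi_ge0.
have [D hD] := Phi_der_decay n 0; exists (Num.max C D); split.
  by rewrite le_max C1.
move=> k x; rewrite leq_eqVlt => /orP[/eqP ->|kn].
  by have := hD x; rewrite expr0 mul1r le_max => ->; rewrite orbT.
by rewrite le_max hC.
Qed.

(** Because [|x| ^ 11 phi x <= C], the function [psi 1] is nonincreasing on the right tail and
    [psi (-1)] on the left tail; comparison with the limits 1 and 0 of [Phi] gives the bounds. *)
Lemma Phi_tail : exists C, 0 <= C /\ forall t, 0 < t ->
  1 - Phi t <= C / t ^+ 10 /\ Phi (- t) <= C / t ^+ 10.
Proof.
have [C hC] := phi_decay 11.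
have C0 : 0 <= C by apply: le_trans (hC 0); rewrite mulr_ge0// ?phi_ge0.
exists C; split=> // t t0.
pose psi (s x : R) := Phi x + s * C * (x ^+ 10)^-1.
have dpsi (s x : R) : x != 0 ->
    is_derive x (1 : R) (psi s) (phi x - s * C * 10 * x ^+ 9 / x ^+ 20).
  move=> x0; have x10 : x ^+ 10 != 0 by rewrite expf_neq0.
  apply: dvt_eq (dvtD (derive_Phi x) (dvtZ (s * C) (dvtV (f := fun y => y ^+ 10) x10 (dvtX 10 (dvt_id x))))) _.
  by rewrite /=; field; rewrite x0.
have neg (x : R) : x != 0 -> phi x <= C * 10 * `|x| ^+ 9 / x ^+ 20.
  move=> x0; have x0' : 0 < `|x| by rewrite normr_gt0.
  have -> : x ^+ 20 = `|x| ^+ 20.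
    by rewrite -[20%N]/(2 * 10)%N !exprM real_normK// num_real.
  rewrite ler_pdivlMr ?exprn_gt0//.
  have := hC x.
  have -> : phi x * `|x| ^+ 20 = `|x| ^+ 9 * (`|x| ^+ 11 * phi x) by ring.
  move=> h; apply: (@le_trans _ _ (`|x| ^+ 9 * C)).
    by rewrite ler_wpM2l ?exprn_ge0.
  have : 0 <= `|x| ^+ 9 * C by rewrite mulr_ge0 ?exprn_ge0.
  lra.
split.
  have H x : t <= x -> psi 1 x <= psi 1 t.
    move=> tx; apply: (@ler0_derive1_nincry R (psi 1) t) => //.
    - by move=> y; rewrite in_itv/= andbT => ty; have [] := dpsi 1 y (lt0r_neq0 (lt_trans t0 ty)).
    - move=> y; rewrite in_itv/= andbT => ty; have y0 := lt_trans t0 ty.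
      rewrite derive1E; have [_ ->] := dpsi 1 y (lt0r_neq0 y0).
      by rewrite mul1r subr_le0 -{2}(gtr0_norm y0) neg// gt_eqF.
    - have cf : {in `[t, +oo[%classic, continuous (psi 1)}.
        move=> y; rewrite inE/= in_itv/= andbT => ty.
        exact: is_derive_cont (dpsi 1 y (lt0r_neq0 (lt_le_trans t0 ty))).
      exact: continuous_in_subspaceT cf.
  have h : 1 <= psi 1 t.
    apply: (cvgr_to_le Phi_cvg1); near=> x.
    apply: (@le_trans _ _ (psi 1 x)); last by apply: H; near: x; apply: nbhs_pinfty_ge; exact: num_real.
    by rewrite /psi lerDl mul1r divr_ge0// -[10%N]/(2 * 5)%N exprM exprn_ge0// sqr_ge0.
  by move: h; rewrite /psi mul1r; lra.
have H x : x <= - t -> psi (-1) (- t) <= psi (-1) x.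
  move=> tx; apply: (@ler0_derive1_nincrNy R (psi (-1)) (- t)) => //.
  - move=> y; rewrite in_itv/= => ty; have y0 : y < 0 by lra.
    by have [] := dpsi (-1) y (ltr0_neq0 y0).
  - move=> y; rewrite in_itv/= => ty; have y0 : y < 0 by lra.
    rewrite derive1E; have [_ ->] := dpsi (-1) y (ltr0_neq0 y0).
    rewrite subr_le0; have := neg y (ltr0_neq0 y0); rewrite (ltr0_norm y0).
    by congr (_ <= _); rewrite exprNn; ring.
  - have cf : {in `]-oo, - t]%classic, continuous (psi (-1))}.
      move=> y; rewrite inE/= in_itv/= => ty; have y0 : y < 0 by lra.
      exact: is_derive_cont (dpsi (-1) y (ltr0_neq0 y0)).
    exact: continuous_in_subspaceT cf.
have h : psi (-1) (- t) <= 0.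
  apply: (cvgr_to_ge Phi_cvg0); near=> x.
  apply: (@le_trans _ _ (psi (-1) x)); first by apply: H; near: x; apply: nbhs_ninfty_le; exact: num_real.
  rewrite /psi gerDl mulN1r mulNr oppr_le0 divr_ge0//.
  by rewrite -[10%N]/(2 * 5)%N exprM exprn_ge0// sqr_ge0.
move: h; rewrite /psi mulN1r mulNr -[10%N]/(2 * 5)%N !exprM sqrrN; lra.
Unshelve. all: by end_near. Qed.

End Gauss.

(** * One-step expectations and their uniform component *)

Section StepOperator.
Context (R : realType) (nu : probability R R) (S : Type).
Variables (upd : R -> S -> S) (w : R -> R).
Notation mu := (@lebesgue_measure R).
Hypothesis hm : forall (g : S -> R -> R) s z, blip g ->
  measurable_fun setT (fun x => g (upd x s) (z + w x)).

Definition stepop (g : S -> R -> R) (s : S) (z : R) : R :=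
  \int[nu]_x g (upd x s) (z + w x).

Let mT := @measurableT _ R.
Let fT := probT_lty nu.

Lemma step_bmeas g s z : blip g -> bmeas setT (fun x => g (upd x s) (z + w x)).
Proof. by move=> bg; split; [exact: hm | case: bg => -[M hM] _; exists M]. Qed.

Lemma mop_stepop : mop stepop.
Proof.
split.
- by move=> f g bf bg s z; rewrite /stepop (RintD mT fT)//; exact: step_bmeas.
- by move=> c f bf s z; rewrite /stepop (RintZ mT fT)//; exact: step_bmeas.
- by move=> f bf f0 s z; apply: Rintegral_ge0.
- by move=> s z; rewrite /stepop Rint_prob_cst.
- by move=> h f bf s z; rewrite /stepop; under eq_Rintegral do rewrite addrAC.
Qed.

Variables (J : set R) (uJ : S -> S) (y0 delta kappa : R).
Hypotheses (mJ : measurable J) (delta0 : 0 < delta) (kappa0 : 0 <= kappa).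
Hypothesis mw : measurable_fun setT w.
Hypothesis updJ : forall x s, J x -> upd x s = uJ s.
Hypothesis dens : forall a b, y0 <= a -> a <= b -> b <= y0 + 2 * delta ->
  kappa * (b - a) <= fine (nu (J `&` w @^-1` `]a, b])).

Definition unifop (g : S -> R -> R) (s : S) (z : R) : R :=
  \int[mu]_(v in `[0, 1]) g (uJ s) (z + y0 + delta * v).

Definition shiftop (g : S -> R -> R) (s : S) (z : R) : R := g (uJ s) (z + y0).

Lemma mop_shiftop : mop shiftop.
Proof.
by split=> [//|//|f bf f0 s z|//|h f bf s z]; rewrite /shiftop// addrAC.
Qed.

Let mI : measurable (`[0, 1]%classic : set (measurableTypeR R)). Proof. exact: measurable_itv. Qed.
Let fI : (mu `[0%R, 1%R]%classic < +oo)%E.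
Proof. by rewrite lebesgue_measure_itv/= lte_fin ltr01 oppr0 adde0 ltry. Qed.

Lemma unif_bmeas g s z : blip g ->
  bmeas (`[0, 1]%classic : set (measurableTypeR R)) (fun v => g (uJ s) (z + y0 + delta * v)).
Proof.
move=> bg; split; last by case: bg => -[M hM] _; exists M.
apply: measurable_funTS; apply: measurableT_comp.
  by apply: continuous_measurable_fun; exact: blip_cont.
by apply: measurable_funD => //; exact: measurable_funM.
Qed.

Lemma mop_unifop : mop unifop.
Proof.
split.
- by move=> f g bf bg s z; rewrite /unifop (RintD mI fI)//; exact: unif_bmeas.
- by move=> c f bf s z; rewrite /unifop (RintZ mI fI)//; exact: unif_bmeas.
- by move=> f bf f0 s z; apply: Rintegral_ge0.
- move=> s z; rewrite /unifop Rintegral_cst//.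
  have -> : fine (mu `[0%R, 1%R]%classic) = 1.
    by rewrite lebesgue_measure_itv/= lte_fin ltr01 oppr0 adde0.
  by rewrite mulr1.
- by move=> h f bf s z; apply: eq_Rintegral => v _; congr (f _ _); ring.
Qed.

(** The fundamental theorem of calculus for [f] along the segment swept by the uniform law. *)
Lemma unifop_primitive f g M : blip f -> blip g -> dpair M f g ->
  forall s z, unifop g s z = delta^-1 * (shiftop f s (z + delta) - shiftop f s z).
Proof.
move=> bf bg fg s z.
have df x : is_derive x (1 : R) (f (uJ s)) (g (uJ s) x).
  by apply: (@is_derive_of_quad R _ x _ M 1) => // h _; exact: fg.
pose F v := delta^-1 * f (uJ s) (z + y0 + delta * v).
have dF v : is_derive v (1 : R) F (g (uJ s) (z + y0 + delta * v)).
  have D1 : is_derive v (1 : R) (fun v => z + y0 + delta * v) delta.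
    by apply: dvt_eq (dvtD (dvt_cst _ _) (dvtZ _ (dvt_id _))) _; rewrite add0r mulr1.
  apply: dvt_eq (dvtZ _ (dvt_comp (df _) D1)) _.
  by rewrite mulrCA mulVf ?mulr1// gt_eqF.
have cg : continuous (fun v => g (uJ s) (z + y0 + delta * v)).
  move=> v; apply: (@continuous_comp _ _ _ (fun v => z + y0 + delta * v) (g (uJ s))).
    apply: is_derive_cont; apply: (dvtD (dvt_cst _ _) (dvtZ _ (dvt_id _))).
  exact: blip_cont.
rewrite /unifop /Rintegral (@continuous_FTC2 _ _ F 0 1)//=.
- by rewrite /F mulr1 mulr0 addr0 -mulrBr /shiftop addrAC.
- exact: continuous_subspaceT.
- split.
  + by move=> x _; have [] := dF x.
  + by apply: cvg_at_right_filter; exact: is_derive_cont (dF 0).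
  + by apply: cvg_at_left_filter; exact: is_derive_cont (dF 1).
- by move=> x _; rewrite derive1E; have [_ ->] := dF x.
Qed.

(** What is known of the law of [w] is a lower bound for the mass of intervals, not a density. The
    Lipschitz property of [g] makes the comparison exact up to an error of order [1 / r], and [r] is
    arbitrary. The uniform law and its translate by [delta] together fill the interval of length
    [2 delta]. *)
Lemma stepop_minor g : blip g -> (forall s z, 0 <= g s z) -> forall s z,
  (2 * delta * kappa) * (2^-1 * (unifop g s z + unifop g s (z + delta))) <= stepop g s z.
Proof.
move=> bg g0 s z; have [[M hM] [L hL]] := bg.
have L0 : 0 <= L by have := hL s 1 0; rewrite subr0 normr1 mulr1; exact: le_trans.
pose G y := g (uJ s) (z + y0 + y).
have GL y y' : `|G y - G y'| <= L * `|y - y'|.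
  by rewrite (le_trans (hL _ _ _))// opprD addrACA subrr add0r.
suff H (r : nat) : (0 < r)%N ->
    kappa * delta * (unifop g s z + unifop g s (z + delta)) <=
    stepop g s z + (2 * kappa * delta + 1) * (L * delta) / r%:R.
  have -> : 2 * delta * kappa * (2^-1 * (unifop g s z + unifop g s (z + delta))) =
    kappa * delta * (unifop g s z + unifop g s (z + delta)) by field.
  apply/ler_addgt0Pr => e e0.
  set c := (2 * kappa * delta + 1) * (L * delta) in H *.
  have c0 : 0 <= c.
    have d0 := ltW delta0.
    by rewrite /c mulr_ge0 ?mulr_ge0// addr_ge0// !mulr_ge0.
  have := H (Num.truncn (c / e)).+1 isT.
  move=> h; apply: (le_trans h); rewrite lerD2l ler_pdivrMr ?ltr0n//.
  rewrite mulrC -ler_pdivrMr//; apply: ltW; exact: truncnS_gt.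
move=> r0; have rR : 0 < r%:R :> R by rewrite ltr0n.
pose a (i : nat) : R := delta * i%:R / r%:R.
have aS i : a i.+1 = a i + delta / r%:R by rewrite /a -natr1; ring.
pose eps := L * delta / r%:R.
have eps0 : 0 <= eps by rewrite divr_ge0// mulr_ge0// ltW.
(* Riemann sums: the averages are compared with the mass of [w] on cells of mesh [delta / r] *)
have U (j : nat) : unifop g s (z + delta * j%:R) <=
   \sum_(i < r) (r%:R^-1 * (G (a (j * r + i)%N) + eps)).
  rewrite /unifop.
  pose cell (i : nat) : set (measurableTypeR R) :=
    `[i%:R / r%:R, i.+1%:R / r%:R]%classic.
  have cellE i : \int[mu]_(v in `[0%R, 1%R]) \1_(cell i) v <= r%:R^-1.
    rewrite /Rintegral integral_indic//; last exact: measurable_itv.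
    have -> : r%:R^-1 = fine (mu (cell i)).
      rewrite lebesgue_measure_itv/= lte_fin ltr_pM2r ?invr_gt0// ltr_nat ltnSn.
      by rewrite -natr1 /=; ring.
    have mc : measurable (cell i) by exact: measurable_itv.
    have le1 : (mu (cell i `&` `[0%R, 1%R]) <= mu (cell i))%E.
      by apply: le_measure; rewrite ?inE//; exact: measurableI.
    have fc : (mu (cell i) < +oo)%E.
      by rewrite lebesgue_measure_itv/=; case: ifP => _; rewrite ltry.
    rewrite fine_le// ge0_fin_numE//.
    exact: le_lt_trans le1 fc.
  have bcell i : bmeas (`[0, 1]%classic : set (measurableTypeR R)) (\1_(cell i) : measurableTypeR R -> R).
    split; first by apply: measurable_funTS; apply: measurable_indic; exact: measurable_itv.
    by exists 1 => x _; rewrite indicE; case: (_ \in _); rewrite ?normr0 ?normr1.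
  apply: (@le_trans _ _ (\int[mu]_(v in `[0%R, 1%R])
     (\sum_(i < r) (G (a (j * r + i)%N) + eps) * \1_(cell i) v))).
    apply: (Rint_le mI fI); first exact: unif_bmeas.
      by apply: bmeas_sum => i; exact: bmeasZ.
    move=> v /=; rewrite in_itv/= => /andP[v0 v1].
    have [i [ir iv]] : exists i, (i < r)%N /\ i%:R / r%:R <= v <= i.+1%:R / r%:R.
      (* The minimum puts the endpoint [v = 1] into the last cell. *)
      exists (minn (Num.truncn (v * r%:R)) r.-1); split.
        by rewrite (leq_ltn_trans (geq_minr _ _))// prednK.
      have vr0 : 0 <= v * r%:R by rewrite mulr_ge0// ltW.
      rewrite ler_pdivrMr// ler_pdivlMr//; apply/andP; split.
        apply: (@le_trans _ _ (Num.truncn (v * r%:R))%:R).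
          by rewrite ler_nat geq_minl.
        by rewrite truncn_le.
      rewrite /minn; case: ltnP => _; first exact/ltW/truncnS_gt.
      by rewrite prednK// ler_piMl// ltW.
    rewrite (bigD1 (Ordinal ir))//= ler_wpDr//.
      apply: sumr_ge0 => k _; rewrite mulr_ge0 ?indicE ?ler0n// addr_ge0//.
      by rewrite /G.
    have -> : \1_(cell i) v = 1 :> R by rewrite indicE mem_set//= in_itv.
    rewrite mulr1.
    have -> : g (uJ s) (z + delta * j%:R + y0 + delta * v) = G (delta * (j%:R + v)).
      by rewrite /G; congr (g _ _); ring.
    rewrite -lerBlDl; apply: (le_trans (ler_norm _)).
    apply: (le_trans (GL _ _)); rewrite /eps -mulrA ler_wpM2l//.
    have -> : delta * (j%:R + v) - a (j * r + i)%N = delta * (v - i%:R / r%:R).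
      by rewrite /a natrD natrM; field; rewrite gt_eqF.
    rewrite normrM gtr0_norm// ler_wpM2l ?(ltW delta0)//.
    move: iv => /andP[iv1 iv2]; rewrite ger0_norm ?subr_ge0//.
    by rewrite lerBlDr (le_trans iv2)// -natr1 mulrDl mul1r addrC.
  rewrite (Rint_sum mI fI); last by move=> i; exact: bmeasZ.
  apply: ler_sum => i _; rewrite (RintZ mI fI)// mulrC ler_wpM2r//.
  by rewrite addr_ge0// /G.
pose A (i : nat) : set R := J `&` w @^-1` `]y0 + a i, y0 + a i.+1]%classic.
have mA i : measurable (A i).
  by apply: measurableI => //; rewrite -[_ @^-1` _]setTI; apply: mw => //; exact: measurable_itv.
have a2 : a (r + r)%N = 2 * delta by rewrite /a natrD; field; rewrite gt_eqF.
have a_ge0 i : 0 <= a i by rewrite divr_ge0// mulr_ge0 ?ler0n// ltW.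
have a_mono i k : (i <= k)%N -> a i <= a k.
  by move=> ik; rewrite ler_pM2r ?invr_gt0// ler_pM2l// ler_nat.
have nuA i : (i < r + r)%N -> kappa * (delta / r%:R) <= fine (nu (A i)).
  move=> ir; have := dens (a := y0 + a i) (b := y0 + a i.+1).
  have -> : y0 + a i.+1 - (y0 + a i) = delta / r%:R by rewrite aS; ring.
  apply; first by rewrite lerDl.
    by rewrite lerD2l a_mono.
  by rewrite lerD2l -a2 a_mono.
have disj i k x : A i x -> A k x -> i = k.
  move=> [_ /=]; rewrite in_itv/= => /andP[i1 i2] [_ /=]; rewrite in_itv/= => /andP[k1 k2].
  case: (ltngtP i k) => // ik; exfalso; have := a_mono _ _ ik; clear ik; lra.
have L1 : \sum_(i < r + r) (G (a i) - eps) * fine (nu (A i)) <= stepop g s z.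
  have -> : \sum_(i < r + r) (G (a i) - eps) * fine (nu (A i)) =
     \int[nu]_x (\sum_(i < r + r) (G (a i) - eps) * \1_(A i) x).
    rewrite (Rint_sum mT fT); last by move=> i; apply: bmeasZ; exact: bmeas_indic.
    apply: eq_bigr => i _; rewrite (RintZ mT fT) ?Rint_indic//.
    exact: bmeas_indic.
  apply: (Rint_le mT fT); last 2 first.
  - exact: step_bmeas.
  - move=> x _.
    have [[i Aix]|none] := pselect (exists i : 'I_(r + r), A i x).
      rewrite (bigD1 i)//= big1 ?addr0; last first.
        move=> k ki; rewrite indicE memNset ?mulr0// => Akx.
        by move: ki; rewrite (_ : k = i) ?eqxx//; apply: val_inj; exact: disj Akx Aix.
      rewrite indicE mem_set// mulr1 lerBlDr -lerBlDl.
      case: (Aix) => Jx /=; rewrite in_itv/= => /andP[w1 w2].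
      rewrite updJ//.
      have -> : z + w x = z + y0 + (w x - y0) by ring.
      apply: (le_trans (ler_norm _)); apply: (le_trans (GL _ _)).
      have wa : a i - (w x - y0) <= 0 by move: w1; set A' := a i; set W := w x; lra.
      rewrite /eps -mulrA ler_wpM2l// ler0_norm//.
      by move: w2; rewrite aS; set A' := a i; set W := w x; set D := _ / _; lra.
    rewrite big1// => i _; rewrite indicE memNset ?mulr0// => Aix.
    by apply: none; exists i.
  - by apply: bmeas_sum => i; apply: bmeasZ; exact: bmeas_indic.
have S1 : \sum_(i < r + r) fine (nu (A i)) <= 1.
  have -> : \sum_(i < r + r) fine (nu (A i)) = \int[nu]_x (\sum_(i < r + r) \1_(A i) x).
    rewrite (Rint_sum mT fT); last by move=> i; exact: bmeas_indic.
    by apply: eq_bigr => i _; rewrite Rint_indic.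
  rewrite -[leRHS](Rint_prob_cst nu 1); apply: (Rint_le mT fT).
  - by apply: bmeas_sum => i; exact: bmeas_indic.
  - exact: bmeas_cst.
  move=> x _; have [[i Aix]|none] := pselect (exists i : 'I_(r + r), A i x).
    rewrite (bigD1 i)//= big1 ?addr0; last first.
      move=> k ki; rewrite indicE memNset// => Akx.
      by move: ki; rewrite (_ : k = i) ?eqxx//; apply: val_inj; exact: disj Akx Aix.
    by rewrite indicE; case: (_ \in _).
  rewrite big1// => i _; rewrite indicE memNset// => Aix.
  by apply: none; exists i.
have L2 : kappa * (delta / r%:R) * \sum_(i < r + r) G (a i) <= stepop g s z + eps.
  apply: (@le_trans _ _ (\sum_(i < r + r) G (a i) * fine (nu (A i)))).
    rewrite mulr_sumr; apply: ler_sum => i _; rewrite mulrC ler_wpM2l ?nuA//.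
    by rewrite /G.
  rewrite -lerBlDr; apply: le_trans L1.
  under [leRHS]eq_bigr do rewrite mulrBl.
  rewrite sumrB lerD2l lerN2 -mulr_sumr -[leRHS]mulr1 ler_wpM2l//.
have := U 0%N; have := U 1%N; rewrite mulr1 mulr0 addr0 -!mulr_sumr => U1 U0.
have kd0 : 0 <= kappa * delta by rewrite mulr_ge0// ltW.
apply: (@le_trans _ _ (kappa * delta * (r%:R^-1 * \sum_(i < r + r) (G (a i) + eps)))).
  rewrite ler_wpM2l// big_split_ord/= mulrDr lerD//.
  apply: (le_trans U1); rewrite ler_wpM2l ?invr_ge0 ?ler0n//.
  by apply: ler_sum => i _; rewrite mul1n.
rewrite big_split/= sumr_const card_ord.
have -> : kappa * delta * (r%:R^-1 * (\sum_(i < r + r) G (a i) + eps *+ (r + r))) =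
  kappa * (delta / r%:R) * \sum_(i < r + r) G (a i) + 2 * kappa * delta * eps.
  by rewrite -(mulr_natr eps) natrD; field; rewrite gt_eqF.
apply: (@le_trans _ _ (stepop g s z + eps + 2 * kappa * delta * eps)).
  by rewrite lerD2r.
by rewrite le_eqVlt; apply/orP; left; apply/eqP; rewrite /eps; ring.
Qed.

End StepOperator.

(** * Edgeworth expansion by replacement *)

Section HeatKernel.
Context (R : realType).
Local Notation dvt f x df := (is_derive x (1 : R) f df).

(* the k-th derivative in [z] of [Phi ((y - z) / sqrt s)] *)
Definition heat_der (k : nat) (y s z : R) : R :=
  (-1) ^+ k * (Num.sqrt s)^-1 ^+ k * Phi_der k ((y - z) * (Num.sqrt s)^-1).

Lemma heat_der_dz k y s z : dvt (fun z => heat_der k y s z) z (heat_der k.+1 y s z).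
Proof.
have D1 : dvt (fun z => (y - z) * (Num.sqrt s)^-1) z (- (Num.sqrt s)^-1).
  apply: dvt_eq (dvtM (dvtB (dvt_cst y z) (dvt_id z)) (dvt_cst _ z)) _.
  by rewrite mulr0 add0r sub0r mulrN1.
apply: dvt_eq (dvtZ _ (dvt_comp (derive_Phi_der k _) D1)) _.
by rewrite /heat_der !exprS; ring.
Qed.

Lemma sqrtV_ds (s : R) : 0 < s ->
  dvt (fun s => (Num.sqrt s)^-1) s (- 2^-1 * (Num.sqrt s)^-1 ^+ 3).
Proof.
move=> s0; have q0 : Num.sqrt s != 0 by rewrite gt_eqF// sqrtr_gt0.
by apply: dvt_eq (dvtV q0 (is_derive1_sqrt s0)) _; field.
Qed.

(** The heat equation; the recursion of [Phi_der] makes it hold at every order [k]. *)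
Lemma heat_der_ds k y (s : R) z : 0 < s -> dvt (fun s => heat_der k y s z) s (2^-1 * heat_der k.+2 y s z).
Proof.
move=> s0; have D1 := sqrtV_ds s0.
apply: dvt_eq (dvtM (dvtZ ((-1) ^+ k) (dvtX k D1))
  (dvt_comp (derive_Phi_der k _) (dvtZ (y - z) D1))) _.
rewrite /heat_der Phi_derSS !exprS; set q := (Num.sqrt s)^-1; set x := (y - z) * q.
case: k => [|k] /=; first by rewrite !expr0 /x; ring.
by rewrite !exprS /x; ring.
Qed.

Lemma heat_der_bnd (n : nat) : exists C, 1 <= C /\ forall k y s0 s z, (k <= n)%N ->
  0 < s0 -> s0 <= s -> `|heat_der k y s z| <= C * (Num.sqrt s0)^-1 ^+ k.
Proof.
have [C [C1 hC]] := Phi_der_bnd R n; exists C; split=> // k y s0 s z kn s00 ss.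
rewrite /heat_der normrM normrM normrX normrN1 expr1n mul1r mulrC.
have q0 : 0 < Num.sqrt s0 by rewrite sqrtr_gt0.
have qs : Num.sqrt s0 <= Num.sqrt s by rewrite ler_wsqrtr.
apply: ler_pM => //; first exact: hC.
rewrite normrX lerXn2r ?nnegrE ?invr_ge0 ?sqrtr_ge0//.
by rewrite ger0_norm ?invr_ge0 ?sqrtr_ge0// lef_pV2// posrE (lt_le_trans q0).
Qed.

Lemma heat_der_quad k y s : 0 < s -> exists D, forall z h,
  `|heat_der k y s (z + h) - heat_der k y s z - h * heat_der k.+1 y s z| <= D * h ^+ 2.
Proof.
move=> s0; have [C [C1 hC]] := heat_der_bnd k.+2.
exists (C * (Num.sqrt s)^-1 ^+ k.+2) => z h.
apply: (@taylor2 R (fun z => heat_der k y s z) (fun z => heat_der k.+1 y s z)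
  (fun z => heat_der k.+2 y s z) z h (C * (Num.sqrt s)^-1 ^+ k.+2)) => t _.
- exact: heat_der_dz.
- exact: heat_der_dz.
- exact: hC.
Qed.

Lemma heat_der_blip (S : Type) k y s : 0 < s -> blip (fun (_ : S) z => heat_der k y s z).
Proof.
move=> s0; have [C [C1 hC]] := heat_der_bnd k.+1; split.
  by exists (C * (Num.sqrt s)^-1 ^+ k) => _ z; apply: hC.
exists (C * (Num.sqrt s)^-1 ^+ k.+1) => _ z z'.
have := @mvt_bound R (fun z => heat_der k y s z) (fun z => heat_der k.+1 y s z) z' (z - z')
  (C * (Num.sqrt s)^-1 ^+ k.+1).
rewrite [z' + _]addrC subrK; apply => t _; first exact: heat_der_dz.
exact: hC.
Qed.

End HeatKernel.

(** * Lindeberg replacement for an abstract one-step operator *)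

Section Edgeworth.
Context (R : realType).
Local Notation dvt f x df := (is_derive x (1 : R) f df).
Variable K : (unit -> R -> R) -> (unit -> R -> R).
Hypothesis mK : mop K.
Variables (N m0 : nat) (h a3 b4 y s0 sbar Cs : R).
Hypotheses (s0_gt0 : 0 < s0) (h_ge0 : 0 <= h) (Cs_ge0 : 0 <= Cs) (m0_gt0 : (0 < m0)%N).
Hypothesis b4_ge0 : 0 <= b4.
Hypothesis KT : forall (v : nat -> R -> R) M, (forall i, blip (fun (_ : unit) => v i)) ->
  (forall i z, dvt (v i) z (v i.+1 z)) -> (forall z, `|v 4%N z| <= M) ->
  forall z, `|K (fun _ => v 0%N) tt z - (v 0%N z + h / 2 * v 2%N z + a3 / 6 * v 3%N z)|
    <= b4 * M.

(** A stage of the replacement: [m] original summands are left, the others have been absorbed into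
    the Gaussian variance [s]. *)
Definition heat_iter (m k : nat) (s z : R) : R := iter m K (fun _ z => heat_der k y s z) tt z.

(** A derivative is bounded either because [m0] summands are left to smooth it, or because the
    Gaussian variance has reached [sbar]; [timing] guarantees that one of the two holds at every
    stage. *)
Hypothesis smooth : forall k m s z, (k <= 8)%N -> s0 <= s ->
  (m0 <= m)%N \/ sbar <= s -> `|heat_iter m k s z| <= Cs.
Hypothesis timing : forall m j, (N <= m + j + 3)%N -> (m < m0)%N -> sbar <= s0 + j%:R * h.

Lemma heat_iter_blip m k s : 0 < s -> blip (fun (_ : unit) z => heat_iter m k s z).
Proof.
move=> s1.
have -> : (fun (_ : unit) z => heat_iter m k s z) = iter m K (fun _ z => heat_der k y s z).
  by apply/funext => -[].
by apply: (mop_blip (mop_iter m mK)); exact: heat_der_blip.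
Qed.

Lemma heat_iter_dz m k s z : 0 < s -> dvt (heat_iter m k s) z (heat_iter m k.+1 s z).
Proof.
move=> s1; have [D hD] := heat_der_quad k y s1.
apply: (@is_derive_of_quad R _ _ _ D 1) => // t _.
have /(_ tt z t) := @mop_dpair R unit (iter m K) D _ _ (mop_iter m mK)
  (heat_der_blip unit k y s1) (heat_der_blip unit k.+1 y s1) (fun _ => hD).
exact.
Qed.

(** For increments up to [s / 2] the variance stays above [s / 2], where the second derivative in
    [s], a multiple of a [z]-derivative of order [k + 4], is uniformly bounded; the quadratic bound
    then passes through the operator. *)
Lemma heat_iter_ds m k (s : R) z : 0 < s -> dvt (fun s => heat_iter m k s z) s (2^-1 * heat_iter m k.+2 s z).
Proof.
move=> s1; have [C [C1 hC]] := heat_der_bnd R k.+4.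
pose D := C * (Num.sqrt (s / 2))^-1 ^+ k.+4.
have s2 : 0 < s / 2 by rewrite divr_gt0.
apply: (@is_derive_of_quad R _ _ _ D (s / 2)) => // t st.
have mKm := mop_iter m mK.
have s3 r : 0 <= r <= 1 -> s / 2 <= s + r * t.
  move=> /andP[r0 r1].
  have : `|r * t| <= s / 2.
    rewrite normrM (ger0_norm r0); apply: le_trans st.
    by rewrite ler_piMl.
  by rewrite ler_norml => /andP[]; set rt := r * t; lra.
have st0 : 0 < s + t by have := s3 1; rewrite mul1r lexx ler01 => /(_ isT); apply: lt_le_trans.
have b1 := heat_der_blip unit k y s1; have b2 := heat_der_blip unit k.+2 y s1.
have b3 := heat_der_blip unit k y st0.
have -> : heat_iter m k (s + t) z - heat_iter m k s z - t * (2^-1 * heat_iter m k.+2 s z) =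
  iter m K (fun _ z => heat_der k y (s + t) z - heat_der k y s z - t * 2^-1 * heat_der k.+2 y s z) tt z.
  rewrite (mopB mKm); [|exact: blipB|exact: blipZ].
  by rewrite (mopB mKm)// (mopZ mKm)// mulrA.
apply: (mop_bnd mKm); first by apply: blipB; [exact: blipB|exact: blipZ].
move=> _ x.
rewrite -mulrA; apply: (@taylor2 R (fun s => heat_der k y s x) (fun s => 2^-1 * heat_der k.+2 y s x)
  (fun s => 2^-1 * (2^-1 * heat_der k.+4 y s x)) s t D) => r r01.
- by apply: heat_der_ds; exact: lt_le_trans s2 (s3 _ r01).
- by apply: dvtZ; apply: heat_der_ds; exact: lt_le_trans s2 (s3 _ r01).
rewrite mulrA normrM; apply: (@le_trans _ _ (1 * `|heat_der k.+4 y (s + r * t) x|)).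
  by rewrite ler_wpM2r// ger0_norm//; lra.
by rewrite mul1r; apply: hC => //; exact: s3.
Qed.

(** The second-order term of the summand and the first-order term of the heat equation are both
    [h / 2] times the second derivative and cancel; the third moment is what is left. *)
Lemma one_step m k s z Mx : (k <= 4)%N -> s0 <= s ->
  (forall s' z, s <= s' -> s' <= s + h -> `|heat_iter m (k + 4) s' z| <= Mx) ->
  `|heat_iter m.+1 k s z - heat_iter m k (s + h) z - a3 / 6 * heat_iter m (k + 3) s z| <= (b4 + h ^+ 2) * Mx.
Proof.
move=> k4 ss hM; have s1 : 0 < s by exact: lt_le_trans ss.
have M0 : 0 <= Mx by apply: le_trans (hM s 0 _ _) => //; rewrite lerDl.
have e1 : heat_iter m.+1 k s z = K (fun _ => heat_iter m k s) tt z.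
  by rewrite /heat_iter iterS; congr (K _ tt z); apply/funext => -[].
have h1 := @KT (fun i => heat_iter m (k + i) s) Mx
  (fun i => heat_iter_blip m (k + i) s1)
  (fun i z => eq_ind_r (fun j => dvt (heat_iter m (k + i) s) z (heat_iter m j s z)) (heat_iter_dz m (k + i) z s1) (addnS k i))
  (fun z => hM s z (lexx _) (ler_wpDr h_ge0 (lexx _))) z.
have h2 : `|heat_iter m k (s + h) z - heat_iter m k s z - h * (2^-1 * heat_iter m k.+2 s z)| <= h ^+ 2 * Mx.
  rewrite [leRHS]mulrC; apply: (@taylor2 R (fun s => heat_iter m k s z) (fun s => 2^-1 * heat_iter m k.+2 s z)
    (fun s => 2^-1 * (2^-1 * heat_iter m k.+4 s z)) s h Mx) => r /andP[r0 r1].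
  - by apply: heat_iter_ds; rewrite ltr_wpDr// mulr_ge0.
  - by apply: dvtZ; apply: heat_iter_ds; rewrite ltr_wpDr// mulr_ge0.
  rewrite mulrA normrM; apply: (@le_trans _ _ (1 * `|heat_iter m (k + 4) (s + r * h) z|)).
    by rewrite addn4 ler_wpM2r// ger0_norm//; lra.
  rewrite mul1r; apply: hM; first by rewrite lerDl mulr_ge0.
  by rewrite lerD2l ler_piMl.
move: h1; rewrite addn0 addn2 -e1 => h1.
have -> : heat_iter m.+1 k s z - heat_iter m k (s + h) z - a3 / 6 * heat_iter m (k + 3) s z =
  (heat_iter m.+1 k s z - (heat_iter m k s z + h / 2 * heat_iter m k.+2 s z + a3 / 6 * heat_iter m (k + 3) s z))
  - (heat_iter m k (s + h) z - heat_iter m k s z - h * (2^-1 * heat_iter m k.+2 s z)) by ring.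
rewrite mulrDl; apply: (le_trans (ler_normB _ _)); exact: lerD.
Qed.

Local Notation sj j := (s0 + j%:R * h).

Let sj_ge j : s0 <= sj j. Proof. by rewrite lerDl mulr_ge0. Qed.
Let sjS j : sj j + h = sj j.+1. Proof. by rewrite -natr1; ring. Qed.

Let early m j : (N <= m + j + 3)%N -> forall k s' z, (k <= 8)%N -> sj j <= s' ->
  `|heat_iter m k s' z| <= Cs.
Proof.
move=> mj k s' z k8 ss'; apply: smooth => //; first exact: le_trans ss'.
case: (leqP m0 m) => [|lt]; [by left|right].
exact: le_trans (timing mj lt) ss'.
Qed.

Let rate := `|a3| + b4 + h ^+ 2.

(** The crude version, in which the third-moment term is bounded instead of kept. The slack 2 in the
    number of summands serves the sums with one or two terms removed. *)
Lemma telescope m j k z : (k <= 4)%N -> (N <= m + j + 2)%N ->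
  `|heat_iter m k (sj j) z - heat_der k y (sj (j + m)%N) z| <= m%:R * (rate * Cs).
Proof.
move=> k4; elim: m j => [|m ih] j mj.
  by rewrite addn0 /heat_iter/= subrr normr0 mul0r.
have mj3 : (N <= m + j + 3)%N by lia.
have k8 : (k + 4 <= 8)%N by lia.
have h1 := @one_step m k (sj j) z Cs k4 (sj_ge j)
  (fun s' z' a _ => early mj3 z' k8 a).
have mj2 : (N <= m + j.+1 + 2)%N by lia.
have h2 := ih j.+1 mj2.
have h3 : `|a3 / 6 * heat_iter m (k + 3) (sj j) z| <= `|a3| * Cs.
  rewrite normrM; apply: ler_pM => //.
    by rewrite normrM ler_piMr// ger0_norm//; lra.
  by apply: (early mj3) => //; lia.
rewrite sjS in h1; rewrite addSnnS in h2.
have -> : heat_iter m.+1 k (sj j) z - heat_der k y (sj (j + m.+1)%N) z =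
  (heat_iter m.+1 k (sj j) z - heat_iter m k (sj j.+1) z - a3 / 6 * heat_iter m (k + 3) (sj j) z)
  + a3 / 6 * heat_iter m (k + 3) (sj j) z
  + (heat_iter m k (sj j.+1) z - heat_der k y (sj (j + m.+1)%N) z) by ring.
have -> : m.+1%:R * (rate * Cs) = (b4 + h ^+ 2) * Cs + `|a3| * Cs + m%:R * (rate * Cs).
  by rewrite -natr1 /rate; ring.
apply: (le_trans (ler_normD _ _)); apply: lerD => //.
by apply: (le_trans (ler_normD _ _)); apply: lerD.
Qed.

Definition edge_err := N%:R * ((b4 + h ^+ 2) * Cs + `|a3| * (N%:R * (rate * Cs) + h * Cs)).

(** Each step contributes a third derivative at its own stage. By [telescope] all of them may be
    evaluated at the final Gaussian, where the [N] contributions coincide; [h4] supplies the one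
    increment of variance that is missing. *)
Lemma edgeworth z :
  `|heat_iter N 0 s0 z - heat_der 0 y (sj N) z - N%:R * (a3 / 6) * heat_der 3 y (sj N) z| <= edge_err.
Proof.
pose E := (b4 + h ^+ 2) * Cs + `|a3| * (N%:R * (rate * Cs) + h * Cs).
have rate0 : 0 <= rate by rewrite !addr_ge0 ?sqr_ge0.
suff H m j : (m + j)%N = N ->
    `|heat_iter m 0 (sj j) z - heat_der 0 y (sj N) z - m%:R * (a3 / 6) * heat_der 3 y (sj N) z| <= m%:R * E.
  by have := H N 0%N (addn0 N); rewrite mul0r addr0.
elim: m j => [|m ih] j mj.
  by move: mj; rewrite add0n => ->; rewrite /heat_iter/= subrr !mul0r subr0 normr0.
have mj3 : (N <= m + j + 3)%N by lia.
have h1 := @one_step m 0 (sj j) z Cs isT (sj_ge j) (fun s' z' a _ => @early m j mj3 4 s' z' isT a).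
have mjS : (m + j.+1)%N = N by lia.
have h2 := ih j.+1 mjS.
have mj2 : (N <= m + j + 2)%N by lia.
have h3 := @telescope m j 3 z isT mj2.
have h4 : `|heat_der 3 y (sj N) z - heat_der 3 y (sj (j + m)%N) z| <= h * Cs.
  have -> : sj N = sj (j + m)%N + h by rewrite sjS; congr (s0 + _%:R * h); lia.
  have := @mvt_bound R (fun s => heat_der 3 y s z) (fun s => 2^-1 * heat_der 5 y s z) (sj (j + m)%N) h Cs.
  rewrite (ger0_norm h_ge0) [Cs * _]mulrC; apply => t /andP[t0 t1].
    by apply: heat_der_ds; rewrite ltr_wpDr ?mulr_ge0//; exact: lt_le_trans (sj_ge _).
  rewrite normrM ger0_norm//.
  apply: (@le_trans _ _ `|heat_der 5 y (sj (j + m)%N + t * h) z|).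
    by rewrite ler_piMl//; lra.
  have e3 : (N <= 0 + (j + m) + 3)%N by lia.
  by apply: (early e3 (k := 5)) => //; rewrite lerDl mulr_ge0.
rewrite sjS add0n in h1.
set V1 := heat_iter m.+1 0 _ z in h1 *; set V0 := heat_iter m 0 (sj j.+1) z in h1 h2 *.
set V3 := heat_iter m 3 _ z in h1 h3; set U0 := heat_der 0 y _ z in h2 *.
set U3 := heat_der 3 y (sj N) z in h2 h4 *; set U3' := heat_der 3 y _ z in h3 h4.
have -> : V1 - U0 - m.+1%:R * (a3 / 6) * U3 =
  (V1 - V0 - a3 / 6 * V3) + (V0 - U0 - m%:R * (a3 / 6) * U3)
  + a3 / 6 * ((V3 - U3') - (U3 - U3')) by rewrite -natr1; ring.
have h5 : `|a3 / 6 * ((V3 - U3') - (U3 - U3'))| <= `|a3| * (N%:R * (rate * Cs) + h * Cs).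
  rewrite normrM; apply: ler_pM => //.
    by rewrite normrM ler_piMr// ger0_norm//; lra.
  apply: (le_trans (ler_normB _ _)); apply: lerD => //.
  apply: (le_trans h3); rewrite ler_wpM2r ?mulr_ge0// ler_nat; lia.
have -> : m.+1%:R * E = (b4 + h ^+ 2) * Cs + m%:R * E + `|a3| * (N%:R * (rate * Cs) + h * Cs).
  by rewrite -natr1 /E; ring.
apply: (le_trans (ler_normD _ _)); apply: lerD => //.
by apply: (le_trans (ler_normD _ _)); apply: lerD.
Qed.

End Edgeworth.

(** Fewer than [8 m1 <= 2 N / 5] summands left means at least [3 N / 5 - 3] replaced, which is at
    least [N / 2] from [N = 30] on. *)
Lemma timing_nat (N m j m1 : nat) : (N <= m + j + 3)%N -> (m < 8 * m1)%N -> (30 <= N)%N ->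
  (m1 * 20 <= N)%N -> (N <= j * 2)%N.
Proof. lia. Qed.

(** * The operators of a normalized sum of i.i.d. terms *)

Section TriangularArray.
Context (R : realType) (nu : probability R R).
Local Notation dvt f x df := (is_derive x (1 : R) f df).
Variables (w : R -> R) (b : R) (N : nat).
Hypotheses (mw : measurable_fun setT w) (wb : forall x, `|w x| <= b).
Hypothesis N0 : (0 < N)%N.
Let q := Num.sqrt (N%:R : R).
Let w' x := w x / q.
Let mT := @measurableT _ R.
Let fT := probT_lty nu.

Let q0 : 0 < q. Proof. by rewrite sqrtr_gt0 ltr0n. Qed.
Let q2 : q ^+ 2 = N%:R. Proof. by rewrite sqr_sqrtr ?ler0n. Qed.
Let NR : 0 < N%:R :> R. Proof. by rewrite ltr0n. Qed.
Let b0 : 0 <= b. Proof. exact: le_trans (wb 0). Qed.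

Let mw' : measurable_fun setT w'.
Proof. by apply: measurable_funM => //. Qed.

Let w'b x : `|w' x| <= b / q.
Proof. by rewrite /w' normrM normfV (gtr0_norm q0) ler_wpM2r ?wb// invr_ge0 ltW. Qed.

Variables (c1 c2 : R).

(** [K1] forgets the counters and carries the expansion; [K2] keeps them for the treatment of [Q].
    On functions of [z] alone the two agree. *)
Definition K1 : (unit -> R -> R) -> unit -> R -> R := stepop nu (fun _ u => u) w'.
Definition K2 : (nat * nat -> R -> R) -> nat * nat -> R -> R := stepop nu (upd c1 c2) w'.

Let hm1 (g : unit -> R -> R) s z : blip g -> measurable_fun setT (fun x => g s (z + w' x)).
Proof.
move=> bg; apply: (measurableT_comp (f := g s)).
  by apply: continuous_measurable_fun; exact: blip_cont.
exact: measurable_funD.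
Qed.

Let hm2 (g : nat * nat -> R -> R) s z : blip g ->
  measurable_fun setT (fun x => g (upd c1 c2 x s) (z + w' x)).
Proof.
move=> bg; apply: blip_meas => //.
- by apply: measurable_fun_addn => //; exact: meas_le.
- by apply: measurable_fun_addn => //; exact: meas_le.
- exact: measurable_funD.
Qed.

Lemma mop_K1 : mop K1. Proof. exact: mop_stepop. Qed.
Lemma mop_K2 : mop K2. Proof. exact: mop_stepop. Qed.

Lemma iter_K2_K1 n (f : R -> R) s z :
  iter n K2 (fun _ => f) s z = iter n K1 (fun _ => f) tt z.
Proof.
have -> : iter n K2 (fun _ => f) = fun _ => iter n K1 (fun _ => f) tt.
  elim: n => [//|n ih]; apply/funext => t; rewrite !iterS ih.
  by apply/funext => y; apply: eq_Rintegral.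
by [].
Qed.

Hypothesis w_mean : \int[nu]_x w x = 0.
Let sig2 := \int[nu]_x (w x) ^+ 2.
Let gam := \int[nu]_x (w x) ^+ 3.

Lemma w_bmeas : bmeas setT w. Proof. by split=> //; exists b. Qed.

(** Third-order Taylor expansion under the integral; the linear term disappears because [w] is
    centred. *)
Lemma K1_taylor (v : nat -> R -> R) M : (forall i, blip (fun (_ : unit) => v i)) ->
  (forall i z, dvt (v i) z (v i.+1 z)) -> (forall z, `|v 4%N z| <= M) ->
  forall z, `|K1 (fun _ => v 0%N) tt z -
     (v 0%N z + sig2 / N%:R / 2 * v 2%N z + gam / q ^+ 3 / 6 * v 3%N z)|
    <= b ^+ 4 / N%:R ^+ 2 * M.
Proof.
move=> bv dv vM z; have M0 : 0 <= M by exact: le_trans (vM 0).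
have bw := w_bmeas.
have bW k : bmeas setT (fun x => w x ^+ k) by exact: bmeasX.
pose T4 x := v 0%N z + (w x / q * v 1%N z + (w x ^+ 2 / N%:R / 2 * v 2%N z +
   w x ^+ 3 / q ^+ 3 / 6 * v 3%N z)).
have bT1 c : bmeas setT (fun x => w x * c).
  by apply: bmeasM => //; exact: bmeas_cst.
have bTk k c d e : bmeas setT (fun x => w x ^+ k / c / d * e).
  by do 3! [apply: bmeasM; last exact: bmeas_cst].
have bT1' : bmeas setT (fun x => w x / q * v 1%N z).
  by do 2! [apply: bmeasM; last exact: bmeas_cst].
have bT4 : bmeas setT T4.
  by apply: bmeasD; [exact: bmeas_cst | apply: bmeasD => //; exact: bmeasD].
have -> : v 0%N z + sig2 / N%:R / 2 * v 2%N z + gam / q ^+ 3 / 6 * v 3%N z = \int[nu]_x T4 x.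
  rewrite /T4 (RintD mT fT) ?Rint_prob_cst; [|exact: bmeas_cst|by apply: bmeasD => //; exact: bmeasD].
  rewrite (RintD mT fT)//; last exact: bmeasD.
  rewrite (RintD mT fT)//.
  have E k (c d e : R) : \int[nu]_x (w x ^+ k / c / d * e) =
     (\int[nu]_x (w x ^+ k)) / c / d * e.
    have -> : (\int[nu]_x (w x ^+ k)) / c / d * e = (e / d / c) * \int[nu]_x (w x ^+ k).
      by ring.
    by rewrite -(RintZ mT fT)//; apply: eq_Rintegral => x _; ring.
  rewrite !E.
  have -> : \int[nu]_x (w x / q * v 1%N z) = 0.
    rewrite -[RHS](mulr0 (v 1%N z / q)) -w_mean -(RintZ mT fT)//.
    by apply: eq_Rintegral => x _; ring.
  by rewrite add0r addrA.
have bv0 : bmeas setT (fun x => v 0%N (z + w' x)).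
  split; first exact: (hm1 tt z (bv 0%N)).
  by have [[M' hM'] _] := bv 0%N; exists M' => x _; exact: (hM' tt).
rewrite /K1 /stepop -(RintB mT fT)//.
apply: Rint_bound => [|x]; first by have [] := bmeasB bv0 bT4.
have := @taylor_chain R 4 v z (w' x) M (fun i t _ _ => dv i _) (fun t _ => vM _).
have -> : \sum_(j < 4) w' x ^+ j / (j`!)%:R * v j z = T4 x.
  have q4 : q != 0 by rewrite gt_eqF.
  have -> : \sum_(j < 4) w' x ^+ j / (j`!)%:R * v j z =
      w' x ^+ 0 / 1 * v 0%N z + (w' x ^+ 1 / 1 * v 1%N z +
      (w' x ^+ 2 / 2 * v 2%N z + (w' x ^+ 3 / 6 * v 3%N z + 0))).
    by rewrite 4!big_ord_recl big_ord0.
  by rewrite /T4 /w' -q2; field.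
move=> h; apply: (le_trans h); rewrite mulrC ler_wpM2r//.
apply: (@le_trans _ _ ((b / q) ^+ 4)).
  by rewrite lerXn2r// nnegrE divr_ge0// ltW.
by rewrite expr_div_n -[4%N]/(2 * 2)%N !exprM q2.
Qed.

Variables (J : set R) (uJ : nat * nat -> nat * nat) (y0 delta kappa : R).
Hypotheses (mJ : measurable J) (delta0 : 0 < delta) (kappa0 : 0 < kappa).
Let p := 2 * delta * kappa.
Hypothesis p1 : p < 1.
Hypothesis updJ : forall x s, J x -> upd c1 c2 x s = uJ s.
Hypothesis dens : forall a b, y0 <= a -> a <= b -> b <= y0 + 2 * delta ->
  kappa * (b - a) <= fine (nu (J `&` w @^-1` `]a, b])).

Let p0 : 0 < p. Proof. by rewrite !mulr_gt0. Qed.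

Let dens' a b' : y0 / q <= a -> a <= b' -> b' <= y0 / q + 2 * (delta / q) ->
  kappa * q * (b' - a) <= fine (nu (J `&` w' @^-1` `]a, b'])).
Proof.
move=> h1 h2 h3.
have -> : w' @^-1` `]a, b'] = w @^-1` `]a * q, b' * q].
  apply/seteqP; split=> x /=; rewrite !in_itv/= /w' ltr_pdivlMr// ler_pdivrMr//.
have -> : kappa * q * (b' - a) = kappa * (b' * q - a * q) by ring.
apply: dens; first by rewrite -ler_pdivrMr.
  by rewrite ler_pM2r.
rewrite -ler_pdivlMr//; apply: (le_trans h3).
by rewrite le_eqVlt; apply/orP; left; apply/eqP; ring.
Qed.

Section Smooth.
Variables (m1 : nat) (A : R).
Hypothesis A1 : 1 <= A.
Hypothesis hA : 3 / (delta / q) / Num.sqrt (1 + m1%:R * p / 4) <= A.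

(** Division by [q] shrinks the interval to [delta / q] and multiplies the density by [q], so the
    weight [p] of the smooth component does not depend on [N]. The state space is left general in
    order to cover both operators. *)
Lemma smooth_step (S : Type) (up : R -> S -> S) (u : S -> S) m k
    (g : nat -> S -> R -> R) (M Q : R) :
  (forall (g : S -> R -> R) s z, blip g ->
     measurable_fun setT (fun x => g (up x s) (z + w' x))) ->
  (forall x s, J x -> up x s = u s) ->
  (forall i, (i <= k)%N -> blip (g i)) ->
  (forall i, (i < k)%N -> exists D, dpair D (g i) (g i.+1)) ->
  (forall i, (i <= k)%N -> bnd Q (g i)) -> bnd M (g 0%N) ->
  (1 - p) ^+ m1 * Q <= 1 -> (k * m1 <= m)%N ->
  bnd (A ^+ k * (M + k%:R)) (iter m (stepop nu up w') (g k)).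
Proof.
move=> hm hu bg dg gQ gM Q1 km s z.
have dq : 0 < delta / q by rewrite divr_gt0.
have pE : 2 * (delta / q) * (kappa * q) = p by rewrite /p; field; rewrite gt_eqF.
have minor := stepop_minor hm mJ dq (ltW (mulr_gt0 kappa0 q0)) mw' hu dens'.
rewrite pE in minor.
have := @smooth_le R S (stepop nu up w') (unifop u (y0 / q) (delta / q))
  (shiftop u (y0 / q)) p (delta / q) (mop_stepop nu hm) (mop_unifop _ _ _)
  (mop_shiftop _ _) p0 p1 dq minor
  (fun f g M bf bg fg => unifop_primitive u (y0 / q) dq bf bg fg)
  m1 m k g M A Q bg dg gQ gM A1 hA km s z.
move=> h; apply: (le_trans h); rewrite ler_wpM2l ?exprn_ge0 ?(le_trans ler01)//.
by rewrite lerD2l -[leRHS]mulr1 ler_wpM2l.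
Qed.

Variables (y s0 C : R).
Hypotheses (s00 : 0 < s0) (s01 : s0 <= 1).
Hypothesis hC : 1 <= C /\ forall k y s0 s z, (k <= 12)%N ->
  0 < s0 -> s0 <= s -> `|heat_der k y s z| <= C * (Num.sqrt s0)^-1 ^+ k.
Hypothesis tiny : (1 - p) ^+ m1 * (C * (Num.sqrt s0)^-1 ^+ 8) <= 1.

Definition smooth_cst := A ^+ 8 * (C + 8).

Let C0 : 0 <= C. Proof. by case: hC => h _; apply: le_trans h. Qed.

Let Csm_le k M : (k <= 8)%N -> 0 <= M -> M <= C -> A ^+ k * (M + k%:R) <= smooth_cst.
Proof.
move=> k8 M0 MC; have A0 : 0 <= A by exact: le_trans A1.
apply: ler_pM; rewrite ?exprn_ge0 ?addr_ge0 ?ler0n//.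
  by rewrite ler_weXn2l.
by rewrite lerD// ler_nat.
Qed.

Let sq1 : 1 <= (Num.sqrt s0)^-1.
Proof.
have q1 : Num.sqrt s0 <= 1 by rewrite -sqrtr1 ler_wsqrtr.
by rewrite invf_ge1// sqrtr_gt0.
Qed.

Let uQ k s z : (k <= 8)%N -> s0 <= s ->
  `|heat_der k y s z| <= C * (Num.sqrt s0)^-1 ^+ 8.
Proof.
move=> k8 ss; have [_ H] := hC.
have h := H k y s0 s z (leq_trans k8 (isT : (8 <= 12)%N)) s00 ss.
apply: (le_trans h).
by rewrite ler_wpM2l// ler_weXn2l.
Qed.

Lemma smooth_heat_der k m s z : (k <= 8)%N -> s0 <= s -> (8 * m1 <= m)%N ->
  `|iter m K1 (fun _ z => heat_der k y s z) tt z| <= smooth_cst.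
Proof.
move=> k8 ss km; have s1 : 0 < s by exact: lt_le_trans ss.
have km1 : (k * m1 <= m)%N by rewrite (leq_trans _ km)// leq_mul2r k8 orbT.
have h := @smooth_step unit (fun _ u => u) id m k (fun i _ z => heat_der i y s z) C
  (C * (Num.sqrt s0)^-1 ^+ 8) hm1 (fun _ _ _ => erefl) (fun i _ => heat_der_blip unit i y s1)
  _ (fun i ik _ z => uQ z (leq_trans ik k8) ss) _ tiny km1 tt z.
apply: le_trans (Csm_le k8 C0 (lexx C)); apply: h.
  move=> i _; have [D hD] := heat_der_quad i y s1; exists D => _ z' h; exact: hD.
by move=> _ z'; have [_ H] := hC; have := H 0%N y s s z' isT s1 (lexx _); rewrite expr0 mulr1.
Qed.

Variables (Q : nat * nat -> R) (qm : R).
Hypothesis Qb : forall s, `|Q s| <= qm.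

Lemma dpair_weight (c : nat * nat -> R) (cm th : R) k : (forall s, `|c s| <= cm) ->
  exists D, dpair D (fun s z => c s * heat_der k y s0 (z + th * Q s))
                    (fun s z => c s * heat_der k.+1 y s0 (z + th * Q s)).
Proof.
move=> cb; have [D hD] := heat_der_quad k y s00.
exists (cm * `|D|) => s z h.
have -> : c s * heat_der k y s0 (z + h + th * Q s) - c s * heat_der k y s0 (z + th * Q s) -
    h * (c s * heat_der k.+1 y s0 (z + th * Q s)) =
  c s * (heat_der k y s0 (z + th * Q s + h) - heat_der k y s0 (z + th * Q s) - h * heat_der k.+1 y s0 (z + th * Q s)).
  by rewrite [z + h + _]addrAC; ring.
rewrite normrM -mulrA; apply: ler_pM => //.
apply: (le_trans (hD _ _)); rewrite ler_wpM2r ?sqr_ge0// ler_norm//.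
Qed.

Lemma blip_weight (c : nat * nat -> R) (cm th : R) k : (forall s, `|c s| <= cm) ->
  blip (fun s z => c s * heat_der k y s0 (z + th * Q s)).
Proof.
move=> cb; have [[M hM] [L hL]] := heat_der_blip unit k y s00.
have L0 : 0 <= L by have := hL tt 1 0; rewrite subr0 normr1 mulr1; exact: le_trans.
split; first by exists (cm * M) => s z; rewrite normrM ler_pM// (hM tt).
exists (cm * L) => s z z'; rewrite -mulrBr normrM -mulrA ler_pM//.
by apply: (le_trans (hL tt _ _)); rewrite opprD addrACA subrr addr0.
Qed.

(** The whole expectation is expanded as a function of a strength [th] in front of [Q]. Its second
    derivative is an expectation of [Q ^ 2] times a second [z]-derivative at a shifted point, and
    two smoothing blocks bound it; an absolute bound of that derivative before taking the
    expectation would be far too large. *)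
Lemma perturb : (2 * m1 <= N)%N -> 0 < qm ->
  `|iter N K2 (fun s z => heat_der 0 y s0 (z + Q s)) (0%N, 0%N) 0
   - iter N K2 (fun s z => heat_der 0 y s0 z) (0%N, 0%N) 0
   - iter N K2 (fun s z => Q s * heat_der 1 y s0 z) (0%N, 0%N) 0| <= qm ^+ 2 * smooth_cst.
Proof.
move=> mN qm1; have qm0 := ltW qm1.
have mK := mop_iter N mop_K2.
have Q2b s : `|(Q s / qm) ^+ 2| <= 1.
  by rewrite normrX expr_le1// normrM normfV (gtr0_norm qm1) ler_pdivrMr// mul1r.
have one s : `|(fun _ : nat * nat => 1 : R) s| <= 1 by rewrite normr1.
pose E (c : nat * nat -> R) k (th : R) :=
  iter N K2 (fun s z => c s * heat_der k y s0 (z + th * Q s)) (0%N, 0%N) 0.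
have dE (c : nat * nat -> R) cm k th : (forall s, `|c s| <= cm) ->
    dvt (E c k) th (E (fun s => c s * Q s) k.+1 th).
  move=> cb.
  have quad_corr s : `|c s * Q s| <= cm * qm by rewrite normrM ler_pM.
  have [D hD] := heat_der_quad k y s00.
  apply: (@is_derive_of_quad R _ _ _ (cm * (`|D| * qm ^+ 2)) 1) => // h _.
  have B1 := blip_weight (th + h) k cb; have B2 := blip_weight th k cb.
  have B3 := blip_weight th k.+1 quad_corr.
  rewrite /E -(mopZ mK)// -(mopB mK)// -(mopB mK)//; last 2 first.
  - exact: blipB.
  - exact: blipZ.
  apply: (mop_bnd mK); first by apply: blipB; [exact: blipB | exact: blipZ].
  move=> s z.
  have -> : c s * heat_der k y s0 (z + (th + h) * Q s) - c s * heat_der k y s0 (z + th * Q s) -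
     h * (c s * Q s * heat_der k.+1 y s0 (z + th * Q s)) =
    c s * (heat_der k y s0 (z + th * Q s + h * Q s) - heat_der k y s0 (z + th * Q s) -
     h * Q s * heat_der k.+1 y s0 (z + th * Q s)).
    by rewrite mulrDl addrA; ring.
  rewrite normrM; have -> : cm * (`|D| * qm ^+ 2) * h ^+ 2 = cm * (`|D| * (qm ^+ 2 * h ^+ 2)) by ring.
  apply: ler_pM => //.
  apply: (le_trans (hD _ _)).
  apply: (@le_trans _ _ (`|D| * (h * Q s) ^+ 2)).
    by rewrite ler_wpM2r ?sqr_ge0// ler_norm.
  rewrite exprMn ler_wpM2l// mulrC ler_wpM2r ?sqr_ge0//.
  by rewrite -[Q s ^+ 2]real_normK ?num_real// lerXn2r// nnegrE.
have t2 : `|E (fun=> 1) 0%N (0 + 1) - E (fun=> 1) 0%N 0 - 1 * E (fun s => 1 * Q s) 1%N 0|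
    <= qm ^+ 2 * smooth_cst * 1 ^+ 2.
  apply: (@taylor2 R (E (fun=> 1) 0%N) (E (fun s => 1 * Q s) 1%N)
     (E (fun s => 1 * Q s * Q s) 2%N)) => t _.
  - exact: dE one.
  - by apply: (dE _ qm) => s; rewrite mul1r.
  rewrite add0r mulr1.
  (* Normalized by [qm], the weight is at most 1 and the smoothing constants are those of the
     unweighted kernel. *)
  pose g i s z := (Q s / qm) ^+ 2 * heat_der i y s0 (z + t * Q s).
  have gb : bnd C (g 0%N).
    move=> s z; rewrite /g normrM -[leRHS]mul1r ler_pM//.
    by have [_ H] := hC; have := H 0%N y s0 s0 (z + t * Q s) isT s00 (lexx _); rewrite expr0 mulr1.
  have h := @smooth_step (nat * nat) (upd c1 c2) uJ N 2 g C
    (C * (Num.sqrt s0)^-1 ^+ 8) hm2 updJ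
    (fun i _ => blip_weight t i Q2b) (fun i _ => dpair_weight t i Q2b) _ gb tiny mN (0%N, 0%N) 0.
  have -> : E (fun s => 1 * Q s * Q s) 2%N t = qm ^+ 2 * iter N K2 (g 2%N) (0%N, 0%N) 0.
    rewrite -(mopZ mK); last exact: blip_weight.
    congr (iter N K2 _ _ _); apply/funext => s; apply/funext => z.
    by rewrite /g mul1r; field; rewrite lt0r_neq0.
  rewrite normrM normrX (ger0_norm qm0); apply: ler_wpM2l; first by rewrite exprn_ge0.
  apply: (le_trans (h _)).
    move=> i i2 s z; rewrite /g normrM -[leRHS]mul1r ler_pM//; apply: uQ => //.
    by rewrite (leq_trans i2).
  have h2 : A ^+ 2 * (C + 2%:R) <= smooth_cst by apply: Csm_le.
  exact: h2.
move: t2; rewrite add0r expr1n mulr1 mul1r.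
congr (`|_ - _ - _| <= _); congr (iter N K2 _ _ _); apply/funext => s; apply/funext => z.
- by rewrite mul1r mul1r.
- by rewrite mul1r mul0r addr0.
- by rewrite mul1r mul0r addr0.
Qed.

Variable sbar : R.
Hypotheses (sbar0 : 0 < sbar) (hsb : 2 * sbar <= sig2) (N30 : (30 <= N)%N)
  (m1N : (m1 * 20 <= N)%N) (m1_gt0 : (0 < m1)%N).

Definition edge_cst := Num.max smooth_cst (C * (Num.max 1 (Num.sqrt sbar)^-1) ^+ 8).

Let Ced0 : 0 <= edge_cst.
Proof. by rewrite le_max; apply/orP; right; rewrite mulr_ge0 ?exprn_ge0// le_max ler01. Qed.

Let sig2_ge0 : 0 <= sig2.
Proof. by apply: Rintegral_ge0 => x _; rewrite sqr_ge0. Qed.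

Let smooth_all k m s z : (k <= 8)%N -> s0 <= s -> (8 * m1 <= m)%N \/ sbar <= s ->
  `|heat_iter K1 y m k s z| <= edge_cst.
Proof.
move=> k8 ss [hm|hs]; first by rewrite le_max smooth_heat_der.
have s1 : 0 < s by exact: lt_le_trans ss.
apply: (mop_bnd (mop_iter m mop_K1)); first exact: heat_der_blip.
move=> _ {}z; have [_ H] := hC; rewrite le_max.
apply/orP; right; have h := H k y sbar s z (leq_trans k8 (isT : (8 <= 12)%N)) sbar0 hs; apply: (le_trans h).
rewrite ler_wpM2l//; apply: (@le_trans _ _ ((Num.max 1 (Num.sqrt sbar)^-1) ^+ k)).
  by rewrite lerXn2r ?nnegrE ?invr_ge0 ?sqrtr_ge0 ?le_max ?ler01// lexx orbT.
by rewrite ler_weXn2l// le_max lexx.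
Qed.

Let timing_all m j : (N <= m + j + 3)%N -> (m < 8 * m1)%N ->
  sbar <= s0 + j%:R * (sig2 / N%:R).
Proof.
move=> mj m8; apply: (@le_trans _ _ (j%:R * (sig2 / N%:R))); last first.
  by rewrite lerDr ltW.
have j2 : (N <= j * 2)%N := timing_nat mj m8 N30 m1N.
rewrite mulrA ler_pdivlMr//; apply: (@le_trans _ _ (sbar * (j * 2)%:R)).
  by rewrite ler_wpM2l ?ler_nat// ltW.
have -> : sbar * (j * 2)%:R = j%:R * (2 * sbar) by rewrite natrM; ring.
by rewrite ler_wpM2l.
Qed.

Lemma array_edgeworth k z : (k <= 4)%N ->
  (forall m, (N <= m + 2)%N -> (m <= N)%N ->
   `|heat_iter K1 y m k s0 z - heat_der k y (s0 + m%:R * (sig2 / N%:R)) z| <=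
    N%:R * ((`|gam / q ^+ 3| + b ^+ 4 / N%:R ^+ 2 + (sig2 / N%:R) ^+ 2) * edge_cst)).
Proof.
move=> k4 m mN mN'.
have hs : 0 <= sig2 / N%:R by rewrite divr_ge0// ltW.
have b4 : 0 <= b ^+ 4 / N%:R ^+ 2 by rewrite divr_ge0 ?exprn_ge0// ltW.
have m8 : (0 < 8 * m1)%N by rewrite muln_gt0.
have mN2 : (N <= m + 0 + 2)%N by rewrite addn0.
have := @telescope R K1 mop_K1 N (8 * m1) (sig2 / N%:R) (gam / q ^+ 3)
  (b ^+ 4 / N%:R ^+ 2) y s0 sbar edge_cst s00 hs Ced0 m8 b4
  K1_taylor smooth_all timing_all m 0 k z k4 mN2.
rewrite mul0r addr0 add0n => h; apply: (le_trans h).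
rewrite ler_wpM2r ?ler_nat//.
by rewrite mulr_ge0// !addr_ge0// sqr_ge0.
Qed.

Lemma array_edgeworth0 z :
   `|heat_iter K1 y N 0 s0 z - heat_der 0 y (s0 + sig2) z - gam / (6 * q) * heat_der 3 y (s0 + sig2) z| <=
    edge_err N (sig2 / N%:R) (gam / q ^+ 3) (b ^+ 4 / N%:R ^+ 2) edge_cst.
Proof.
have hs : 0 <= sig2 / N%:R by rewrite divr_ge0// ltW.
have b4 : 0 <= b ^+ 4 / N%:R ^+ 2 by rewrite divr_ge0 ?exprn_ge0// ltW.
have m8 : (0 < 8 * m1)%N by rewrite muln_gt0.
have := @edgeworth R K1 mop_K1 N (8 * m1) (sig2 / N%:R) (gam / q ^+ 3)
  (b ^+ 4 / N%:R ^+ 2) y s0 sbar edge_cst s00 hs Ced0 m8 b4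
  K1_taylor smooth_all timing_all z.
have -> : N%:R * (sig2 / N%:R) = sig2 by field; rewrite gt_eqF.
have -> : N%:R * (gam / q ^+ 3 / 6) = gam / (6 * q).
  by rewrite -q2; field; rewrite gt_eqF.
exact.
Qed.

End Smooth.

End TriangularArray.

(** * Squares of centred sums against a smoothed derivative *)

Section QuadraticForm.
Context d (T : measurableType d) (R : realType) (P : probability T R).
Variable X : nat -> {RV P >-> R}.
Hypothesis hind : mutually_independent P (fun i => (X i : T -> R)).
Hypothesis hid : forall i x,
  fine (P [set w | X i w <= x]) = fine (P [set w | X 0%N w <= x]).
Local Notation nu := (law X).
Let mT := @measurableT _ T.
Let fT := probT_lty P.
Let mTR := @measurableT _ R.
Let fTR := probT_lty nu.

Lemma Rint_pair i j (g h : R -> R) : i != j -> bmeas setT g -> bmeas setT h ->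
  \int[P]_t (g (X i t) * h (X j t)) = (\int[nu]_x g x) * \int[nu]_x h x.
Proof.
move=> ij [mg [Mg hg]] [mh [Mh hh]].
rewrite (indep_fubini hind hid (l := [:: i]) (i := j)
  (Phi := fun z => g (X i z.1) * h z.2) (M := Mg * Mh))//; last 3 first.
- by rewrite inE eq_sym.
- apply: measurable_funM; last exact: measurableT_comp.
  apply: measurableT_comp => //.
  apply: (measurableT_comp (f := (X i : past X [:: i] -> R))) => //.
  by apply: past_X; rewrite inE.
- by move=> z; rewrite normrM ler_pM ?hg ?hh.
have bh : bmeas setT h by split=> //; exists Mh.
under eq_Rintegral do rewrite /= (RintZ mTR fTR)//.
under eq_Rintegral do rewrite mulrC.
have bg : bmeas setT (fun t => g (X i t)).
  split; last by exists Mg => t _; exact: hg.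
  by apply: measurableT_comp => //; exact: mX.
have bg' : bmeas setT g by split=> //; exists Mg.
by rewrite (RintZ mT fT _ bg) mulrC (Rint_law hid i bg').
Qed.

Variables (w : R -> R) (b : R).
Hypotheses (mw : measurable_fun setT w) (wb : forall x, `|w x| <= b).
Let K := stepop nu (fun _ (u : unit) => u) w.
Let sumw (l : seq nat) (t : T) : R := \sum_(j <- l) w (X j t).

Let hm1 (g : unit -> R -> R) s z : blip g -> measurable_fun setT (fun x => g s (z + w x)).
Proof.
move=> bg; apply: (measurableT_comp (f := g s)).
  by apply: continuous_measurable_fun; exact: blip_cont.
exact: measurable_funD.
Qed.

Let mK : mop K. Proof. exact: mop_stepop. Qed.

(** Integrates out only the summands in [l]; those in [l0] stay frozen in the weight [c] and in the
    offset [z]. *)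
Lemma weighted_chain l0 l (c z : T -> R) Mc (g : unit -> R -> R) : uniq (l ++ l0) ->
  (forall l1, {subset l0 <= l1} -> measurable_fun setT (c : past X l1 -> R)) ->
  (forall l1, {subset l0 <= l1} -> measurable_fun setT (z : past X l1 -> R)) ->
  (forall t, `|c t| <= Mc) -> blip g ->
  \int[P]_t (c t * g tt (z t + sumw l t)) = \int[P]_t (c t * iter (size l) K g tt (z t)).
Proof.
move=> + mc mz cM; elim: l g => [|i l ih] g /=.
  by move=> _ _; apply: eq_Rintegral => t _; rewrite /sumw big_nil addr0.
move=> /andP[il ul] bg; have [[M hM] _] := bg.
have e t : c t * g tt (z t + sumw (i :: l) t) = c t * g tt (z t + sumw l t + w (X i t)).
  by rewrite /sumw big_cons; congr (_ * g tt _); ring.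
under eq_Rintegral do rewrite e.
have sub0 : {subset l0 <= l ++ l0} by move=> j jl; rewrite mem_cat jl orbT.
have subl : {subset l <= l ++ l0} by move=> j jl; rewrite mem_cat jl.
rewrite (indep_fubini hind hid (l := l ++ l0) (i := i)
  (Phi := fun t => c t.1 * g tt (z t.1 + sumw l t.1 + w t.2)) (M := Mc * M))//.
- rewrite -iterS iterSr -ih//; last exact: mop_blip.
  apply: eq_Rintegral => t _ /=; rewrite (RintZ mTR fTR)//.
  by split; [exact: hm1 | exists M => x _; exact: hM].
- apply: measurable_funM.
    by apply: (measurableT_comp (f := (c : past X (l ++ l0) -> R))) => //; exact: mc.
  apply: (measurableT_comp (f := g tt)).
    by apply: continuous_measurable_fun; exact: blip_cont.
  apply: measurable_funD; last exact: measurableT_comp.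
  apply: measurable_funD.
    by apply: (measurableT_comp (f := (z : past X (l ++ l0) -> R))) => //; exact: mz.
  apply: (measurableT_comp (f := (sumw l : past X (l ++ l0) -> R))) => //.
  exact: past_sum.
- by move=> t; rewrite normrM ler_pM.
Qed.

Variables (a : R -> R) (y s : R).
Hypotheses (ma : measurable_fun setT a) (ab : forall x, `|a x| <= 1)
  (a_mean : \int[nu]_x a x = 0) (s0 : 0 < s).
Variable F : nat -> nat -> R -> R.
Hypothesis FE : forall m k z, heat_iter K y m k s z = F m k z.
Let F_dz m k z : is_derive z (1 : R) (F m k) (F m k.+1 z).
Proof.
rewrite -FE (_ : F m k = heat_iter K y m k s); first exact: heat_iter_dz.
by apply/funext => t; rewrite FE.
Qed.
Let F0 k z : F 0%N k z = heat_der k y s z. Proof. by rewrite -FE. Qed.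
Let ba : bmeas setT a. Proof. by split=> //; exists 1. Qed.
Let bw : bmeas setT w. Proof. by split=> //; exists b. Qed.
Let b0 : 0 <= b. Proof. exact: le_trans (wb 0). Qed.
Let bX i (f : R -> R) : bmeas setT f -> bmeas setT (fun t => f (X i t)).
Proof.
move=> [mf [M hM]]; split; last by exists M => t _; exact: hM.
by apply: measurableT_comp => //; exact: mX.
Qed.
Let F_bmeas m k (z : T -> R) : measurable_fun setT z -> bmeas setT (fun t => F m k (z t)).
Proof.
move=> mz; have bV : blip (fun _ : unit => F m k).
  rewrite (_ : F m k = heat_iter K y m k s); first exact: heat_iter_blip.
  by apply/funext => t; rewrite FE.
split.
  apply: (measurableT_comp (f := F m k)) => //.
  by have c := @blip_cont R unit _ tt bV; exact: continuous_measurable_fun c.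
by have [[M hM] _] := bV; exists M => t _; exact: (hM tt).
Qed.

Lemma quad_diag i l M : uniq (i :: l) -> (forall z, `|F (size l) 2 z| <= M) ->
  `|\int[P]_t (a (X i t) ^+ 2 * heat_der 1 y s (sumw (i :: l) t))
    - (\int[nu]_x a x ^+ 2) * F (size l) 1 0| <= M * b.
Proof.
move=> uil FM; have M0 : 0 <= M by exact: le_trans (FM 0).
have ui : uniq (l ++ [:: i]) by rewrite cats1 rcons_uniq.
have a2 x : `|a x ^+ 2| <= 1 by rewrite normrX expr_le1.
have ba2 : bmeas setT (fun x => a x ^+ 2) by exact: bmeasX.
have -> : \int[P]_t (a (X i t) ^+ 2 * heat_der 1 y s (sumw (i :: l) t)) =
    \int[P]_t (a (X i t) ^+ 2 * F (size l) 1 (w (X i t))).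
  transitivity (\int[P]_t (a (X i t) ^+ 2 * heat_der 1 y s (w (X i t) + sumw l t))).
    by apply: eq_Rintegral => t _; rewrite /sumw big_cons.
  transitivity (\int[P]_t (a (X i t) ^+ 2 * heat_iter K y (size l) 1 s (w (X i t)))); last first.
    by apply: eq_Rintegral => t _; rewrite -FE.
  apply: (@weighted_chain [:: i] l (fun t => a (X i t) ^+ 2) (fun t => w (X i t)) 1
    (fun _ z => heat_der 1 y s z) ui _ _ (fun t => a2 _)).
  - move=> l1 sub; apply: (past_fun (X := X) (f := fun x => a x ^+ 2)); last exact: ba2.1.
    by apply: sub; rewrite inE.
  - by move=> l1 sub; apply: past_fun => //; apply: sub; rewrite inE.
  - exact: heat_der_blip.
have bF : bmeas setT (fun t => F (size l) 1 (w (X i t))) := F_bmeas _ _ (bX i bw).1.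
have -> : (\int[nu]_x a x ^+ 2) * F (size l) 1 0 =
    \int[P]_t (F (size l) 1 0 * a (X i t) ^+ 2).
  by rewrite (RintZ mT fT _ (bX i ba2)) (Rint_law hid i ba2) mulrC.
rewrite -(RintB mT fT); last 2 first.
- by apply: bmeasM => //; exact: (bX i ba2).
- by apply: bmeasZ; exact: (bX i ba2).
apply: Rint_bound => [|t].
  apply: measurable_funB; first by apply: measurable_funM; [exact: (bX i ba2).1 | exact: bF.1].
  by apply: measurable_funM => //; exact: (bX i ba2).1.
rewrite [F _ _ _ * _]mulrC -mulrBr normrM; apply: (@le_trans _ _ (1 * (M * `|w (X i t)|))).
  apply: ler_pM => //.
  have := @mvt_bound R (F (size l) 1) (F (size l) 2) 0 (w (X i t)) M.
  rewrite add0r; apply => t' _; first exact: F_dz.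
  exact: FM.
by rewrite mul1r ler_wpM2l.
Qed.

(** In the second-order expansion in [w (X i) + w (X j)], centring of [a] kills every term in which
    one of the two indices carries only the factor [a]. The mixed product survives and gives the
    squared covariance with the third derivative. *)
Lemma quad_offdiag i j l M : uniq [:: i, j & l] -> (forall z, `|F (size l) 4 z| <= M) ->
  `|\int[P]_t (a (X i t) * a (X j t) * heat_der 1 y s (sumw [:: i, j & l] t))
    - (\int[nu]_x (a x * w x)) ^+ 2 * F (size l) 3 0| <= M * (2 * b) ^+ 3.
Proof.
move=> uil FM; have M0 : 0 <= M by exact: le_trans (FM 0).
have ij : i != j by move: uil; rewrite /= inE negb_or -andbA => /and3P[].
have ji : j != i by rewrite eq_sym.
have ui : uniq (l ++ [:: i; j]) by rewrite uniq_catC.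
have a2 t : `|a (X i t) * a (X j t)| <= 1 by rewrite normrM mulr_ile1.
pose yy t := w (X i t) + w (X j t).
have -> : \int[P]_t (a (X i t) * a (X j t) * heat_der 1 y s (sumw [:: i, j & l] t)) =
    \int[P]_t (a (X i t) * a (X j t) * F (size l) 1 (yy t)).
  transitivity (\int[P]_t (a (X i t) * a (X j t) * heat_der 1 y s (yy t + sumw l t))).
    by apply: eq_Rintegral => t _; rewrite /sumw !big_cons addrA.
  transitivity (\int[P]_t (a (X i t) * a (X j t) * heat_iter K y (size l) 1 s (yy t))); last first.
    by apply: eq_Rintegral => t _; rewrite -FE.
  apply: (@weighted_chain [:: i; j] l (fun t => a (X i t) * a (X j t)) yy 1
    (fun _ z => heat_der 1 y s z) ui _ _ a2).
  - move=> l1 sub; apply: measurable_funM; apply: past_fun => //;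
      by apply: sub; rewrite !inE eqxx ?orbT.
  - move=> l1 sub; apply: measurable_funD; apply: past_fun => //;
      by apply: sub; rewrite !inE eqxx ?orbT.
  - exact: heat_der_blip.
have baX k := bX k ba; have bwX k := bX k bw.
have byy : bmeas setT yy by exact: bmeasD.
pose Ft t := F (size l) 1 0 + (yy t * F (size l) 2 0 + yy t ^+ 2 / 2 * F (size l) 3 0).
have baw : bmeas setT (fun x => a x * w x) by exact: bmeasM.
have baww : bmeas setT (fun x => a x * w x ^+ 2) by apply: bmeasM => //; exact: bmeasX.
have -> : (\int[nu]_x (a x * w x)) ^+ 2 * F (size l) 3 0 =
    \int[P]_t (a (X i t) * a (X j t) * Ft t).
  have e t : a (X i t) * a (X j t) * Ft t =
    F (size l) 1 0 * (a (X i t) * a (X j t))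
    + (F (size l) 2 0 * (a (X i t) * w (X i t) * a (X j t))
    + (F (size l) 2 0 * (a (X j t) * w (X j t) * a (X i t))
    + (F (size l) 3 0 / 2 * (a (X i t) * w (X i t) ^+ 2 * a (X j t))
    + (F (size l) 3 0 / 2 * (a (X j t) * w (X j t) ^+ 2 * a (X i t))
    + F (size l) 3 0 * (a (X i t) * w (X i t) * (a (X j t) * w (X j t))))))).
    by rewrite /Ft /yy; field.
  rewrite (@eq_Rintegral _ _ _ P setT _ _ (fun t _ => e t)).
  have bP k k' (f g : R -> R) c : bmeas setT f -> bmeas setT g ->
    bmeas setT (fun t => c * (f (X k t) * g (X k' t))).
    by move=> bf bg; apply: bmeasZ; apply: bmeasM; exact: bX.
  have E k k' (f g : R -> R) c : k != k' -> bmeas setT f -> bmeas setT g ->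
    \int[P]_t (c * (f (X k t) * g (X k' t))) = c * ((\int[nu]_x f x) * \int[nu]_x g x).
    by move=> kk bf bg; rewrite (RintZ mT fT) ?Rint_pair//; apply: bmeasM; exact: bX.
  have b1 := bP i j a a (F (size l) 1 0) ba ba.
  have b2 := bP i j _ a (F (size l) 2 0) baw ba.
  have b3 := bP j i _ a (F (size l) 2 0) baw ba.
  have b4 := bP i j _ a (F (size l) 3 0 / 2) baww ba.
  have b5 := bP j i _ a (F (size l) 3 0 / 2) baww ba.
  have b6 := bP i j _ _ (F (size l) 3 0) baw baw.
  rewrite (RintD mT fT)//; last by do 4! [apply: bmeasD => //].
  rewrite (RintD mT fT)//; last by do 3! [apply: bmeasD => //].
  rewrite (RintD mT fT)//; last by do 2! [apply: bmeasD => //].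
  rewrite (RintD mT fT)//; last by apply: bmeasD => //.
  rewrite (RintD mT fT)//.
  rewrite E// (E i j (fun x => a x * w x) a)// (E j i (fun x => a x * w x) a)//.
  rewrite (E i j (fun x => a x * w x ^+ 2) a)// (E j i (fun x => a x * w x ^+ 2) a)//.
  rewrite (E i j (fun x => a x * w x) (fun x => a x * w x))// a_mean.
  by ring.
have bFt : bmeas setT Ft.
  apply: bmeasD; first exact: bmeas_cst.
  apply: bmeasD; apply: bmeasM; try exact: bmeas_cst => //.
    exact: byy.
  by apply: bmeasM; [exact: bmeasX | exact: bmeas_cst].
have bF : bmeas setT (fun t => F (size l) 1 (yy t)) := F_bmeas _ _ byy.1.
have baa : bmeas setT (fun t => a (X i t) * a (X j t)) by exact: bmeasM.
rewrite -(RintB mT fT); [|exact: bmeasM..].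
apply: Rint_bound => [|t].
  by apply: measurable_funB; apply: measurable_funM; [exact: baa.1|exact: bF.1|exact: baa.1|exact: bFt.1].
have yyb : `|yy t| <= 2 * b.
  by rewrite mulrDl mul1r (le_trans (ler_normD _ _))// lerD.
rewrite -mulrBr normrM; apply: (@le_trans _ _ (1 * (M * `|yy t| ^+ 3))).
  apply: ler_pM => //.
  have := @taylor_chain R 3 (fun k => F (size l) k.+1) 0 (yy t) M.
  rewrite add0r.
  have -> : \sum_(j0 < 3) yy t ^+ j0 / j0`!%:R * F (size l) j0.+1 0 = Ft t.
    have -> : \sum_(j0 < 3) yy t ^+ j0 / j0`!%:R * F (size l) j0.+1 0 =
      yy t ^+ 0 / 1 * F (size l) 1 0 + (yy t ^+ 1 / 1 * F (size l) 2 0 +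
      (yy t ^+ 2 / 2 * F (size l) 3 0 + 0)) by rewrite 3!big_ord_recl big_ord0.
    by rewrite /Ft; field.
  apply => [k t' _ _|t' _]; first exact: F_dz.
  exact: FM.
by rewrite mul1r ler_wpM2l// lerXn2r// nnegrE mulr_ge0.
Qed.

Lemma quad_form N M : (2 <= N)%N ->
  (forall z, `|F N.-1 2 z| <= M) -> (forall z, `|F N.-2 4 z| <= M) ->
  `|\int[P]_t ((\sum_(j <- iota 0 N) a (X j t)) ^+ 2 * heat_der 1 y s (sumw (iota 0 N) t))
    - N%:R * ((\int[nu]_x a x ^+ 2) * F N.-1 1 0)
    - N%:R * (N.-1%:R * ((\int[nu]_x (a x * w x)) ^+ 2 * F N.-2 3 0))|
  <= N%:R * (M * b + N.-1%:R * (M * (2 * b) ^+ 3)).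
Proof.
move=> N2 FM1 FM2.
pose u t := heat_der 1 y s (sumw (iota 0 N) t).
have bu : bmeas setT u.
  rewrite (_ : u = fun t => F 0 1 (sumw (iota 0 N) t)); last by apply/funext => t; rewrite F0.
  apply: F_bmeas.
  by have [] := bmeas_sum (iota 0 N) (fun j => bX j bw).
have bau i j : bmeas setT (fun t => a (X i t) * a (X j t) * u t).
  by apply: bmeasM => //; apply: bmeasM; exact: bX.
have e t : (\sum_(j <- iota 0 N) a (X j t)) ^+ 2 * u t =
    \sum_(i <- iota 0 N) \sum_(j <- iota 0 N) a (X i t) * a (X j t) * u t.
  rewrite expr2 -mulrA !mulr_suml; apply: eq_bigr => i _.
  rewrite mulr_sumr; apply: eq_bigr => j _; ring.
under eq_Rintegral do rewrite e.
rewrite (Rint_sum mT fT); last by move=> i; exact: bmeas_sum.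
set c1 := (\int[nu]_x a x ^+ 2) * _; set c2 := _ ^+ 2 * F N.-2 3 0.
have one (i : nat) : i \in iota 0 N ->
   `|\int[P]_t (\sum_(j <- iota 0 N) a (X i t) * a (X j t) * u t) - c1 - N.-1%:R * c2|
   <= M * b + N.-1%:R * (M * (2 * b) ^+ 3).
  move=> iN; have pi := perm_to_rem iN.
  have ui : uniq (i :: rem i (iota 0 N)) by rewrite -(perm_uniq pi) iota_uniq.
  have si : size (rem i (iota 0 N)) = N.-1 by rewrite size_rem// size_iota.
  rewrite (Rint_sum mT fT)// (perm_big _ pi)/= big_cons.
  set l := rem i _ in pi ui si *; clearbody l.
  have h1 := quad_diag ui (M := M); rewrite si in h1; have {}h1 := h1 FM1.
  have e1 : \int[P]_t (a (X i t) * a (X i t) * u t) =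
     \int[P]_t (a (X i t) ^+ 2 * heat_der 1 y s (sumw (i :: l) t)).
    by apply: eq_Rintegral => t _; rewrite /u expr2 /sumw (perm_big _ pi).
  rewrite -e1 in h1.
  have h2 j : j \in l -> `|\int[P]_t (a (X i t) * a (X j t) * u t) - c2| <= M * (2 * b) ^+ 3.
    move=> jl; have pj := perm_to_rem jl.
    have pij : perm_eq (i :: l) [:: i, j & rem j l] by rewrite perm_cons.
    have uij : uniq [:: i, j & rem j l] by rewrite -(perm_uniq pij).
    have sj : size (rem j l) = N.-2 by rewrite (size_rem jl) si.
    have h := quad_offdiag uij (M := M); rewrite sj in h.
    have e2 t : u t = heat_der 1 y s (sumw [:: i, j & rem j l] t).
      by rewrite /u /sumw (perm_big _ pi) (perm_big _ pij).
    have e3 : \int[P]_t (a (X i t) * a (X j t) * u t) =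
       \int[P]_t (a (X i t) * a (X j t) * heat_der 1 y s (sumw [:: i, j & rem j l] t)).
      by apply: eq_Rintegral => t _; rewrite e2.
    by rewrite e3; exact: h FM2.
  set A := \int[P]_t _ in h1 *.
  have -> : A + \sum_(j <- l) \int[P]_x (a (X i x) * a (X j x) * u x) - c1 - N.-1%:R * c2 =
     (A - c1) + \sum_(j <- l) (\int[P]_x (a (X i x) * a (X j x) * u x) - c2).
    by rewrite sumrB big_const_seq count_predT iter_addr_0 si mulr_natl; ring.
  apply: (le_trans (ler_normD _ _)); apply: lerD; first exact: h1.
  apply: (le_trans (ler_norm_sum _ _ _)).
  rewrite -si mulr_natl -iter_addr_0 -[X in iter X](count_predT l) -big_const_seq.
  by rewrite big_seq [leRHS]big_seq; apply: ler_sum => j jl; exact: h2.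
have -> : forall A : R, A - N%:R * c1 - N%:R * (N.-1%:R * c2) = A - N%:R * (c1 + N.-1%:R * c2).
  by move=> A; ring.
have sN (c : R) : N%:R * c = \sum_(i <- iota 0 N) c.
  by rewrite big_const_seq count_predT iter_addr_0 size_iota mulr_natl.
rewrite 2!sN -sumrB; apply: (le_trans (ler_norm_sum _ _ _)).
rewrite big_seq [leRHS]big_seq; apply: ler_sum => i iN.
by have := one i iN; rewrite -addrA -opprD.
Qed.

End QuadraticForm.

(** * Exponential tail bounds *)

(** Inverting [expR (- x) >= 1 - x] reduces the claim to [(1 + x + 2 x ^ 2) (1 - x) >= 1]. *)
Lemma expR_le_quad (R : realType) (x : R) : `|x| <= 1 / 2 -> expR x <= 1 + x + 2 * x ^+ 2.
Proof.
rewrite ler_norml => /andP[x1 x2].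
have h := expR_ge1Dx (- x); have h0 : 0 < 1 - x by lra.
have -> : expR x = (expR (- x))^-1 by rewrite expRN invrK.
apply: (@le_trans _ _ (1 - x)^-1); first by rewrite lef_pV2// posrE expR_gt0.
rewrite -[leLHS]mul1r ler_pdivrMr//.
have -> : (1 + x + 2 * x ^+ 2) * (1 - x) = 1 + x ^+ 2 * (1 - 2 * x) by ring.
by rewrite lerDl mulr_ge0 ?sqr_ge0//; lra.
Qed.

Section Bernstein.
Context d (T : measurableType d) (R : realType) (P : probability T R).
Variable X : nat -> {RV P >-> R}.
Hypothesis hind : mutually_independent P (fun i => (X i : T -> R)).
Hypothesis hid : forall i x,
  fine (P [set w | X i w <= x]) = fine (P [set w | X 0%N w <= x]).
Let mT := @measurableT _ T.
Let fT := probT_lty P.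
Let mTR := @measurableT _ R.
Let fTR := probT_lty (law X).

Lemma meas_sumX (l : seq nat) (f : R -> R) : measurable_fun setT f ->
  measurable_fun setT (fun t => \sum_(j <- l) f (X j t)).
Proof.
move=> mf; elim: l => [|i l ih].
  by under eq_fun do rewrite big_nil; exact: measurable_cst.
under eq_fun do rewrite big_cons; apply: measurable_funD => //.
by apply: measurableT_comp => //; exact: mX.
Qed.

Lemma meas_ge (f : T -> R) r : measurable_fun setT f -> measurable [set t | r <= f t].
Proof.
move=> mf; have -> : [set t | r <= f t] = f @^-1` `[r, +oo[.
  by apply/seteqP; split=> t /=; rewrite in_itv/= andbT.
by rewrite -[_ @^-1` _]setTI; exact: mf.
Qed.

(** The exponential Markov inequality, with the moment generating function factorized by
    independence. The parameter [lam] stays free because two scales occur: [t ^ -8] for full sums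
    and [t ^ -5] for increments over short intervals. *)
Lemma bernstein_ge (n : nat) (eta : R -> R) (lam v r : R) : measurable_fun setT eta ->
  0 < lam -> (forall x, `|lam * eta x| <= 1 / 2) -> \int[law X]_x eta x = 0 ->
  \int[law X]_x eta x ^+ 2 <= v ->
  fine (P [set t | r <= \sum_(j <- iota 0 n) eta (X j t)]) <=
    expR (- lam * r + 2 * n%:R * lam ^+ 2 * v).
Proof.
move=> meta lam0 eb e0 ev.
have lamb x : `|eta x| <= (1 / 2) / lam.
  by have := eb x; rewrite normrM (gtr0_norm lam0) => h; rewrite (ler_pdivlMr _ _ lam0) mulrC.
have beta : bmeas setT eta by split=> //; exists (1 / 2 / lam).
pose h x := expR (lam * eta x).
have bh : bmeas setT h.
  split; first by apply: measurableT_comp => //; exact: measurable_funM.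
  exists (expR (1 / 2)) => x _; rewrite ger0_norm ?expR_ge0// ler_expR.
  exact: le_trans (ler_norm _) (eb x).
have mS := meas_sumX (iota 0 n) meta.
have mA := meas_ge r mS.
have bprod : bmeas setT (fun t => \prod_(j <- iota 0 n) h (X j t)).
  elim: (iota 0 n) => [|i l ih].
    by under eq_fun do rewrite big_nil; exact: bmeas_cst.
  under eq_fun do rewrite big_cons; apply: bmeasM => //.
  case: bh => mh [M hM]; split; last by exists M => t _; exact: hM.
  by apply: measurableT_comp => //; exact: mX.
rewrite -(Rint_indic P mA).
apply: (@le_trans _ _ (\int[P]_t (expR (- lam * r) * \prod_(j <- iota 0 n) h (X j t)))).
  apply: (Rint_le mT fT); [exact: bmeas_indic | exact: bmeasZ |] => t _.
  rewrite /h -expR_sum -expRD indicE.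
  case: (boolP (t \in _)) => [|_]; last by rewrite expR_ge0.
  rewrite inE /= => hr; rewrite -expR0 ler_expR -mulr_sumr mulNr addrC subr_ge0.
  by rewrite ler_wpM2l// ltW.
rewrite (RintZ mT fT)// (Rint_prod hind hid (iota_uniq 0 n) bh) size_iota expRD.
rewrite ler_wpM2l ?expR_ge0//.
have -> : 2 * n%:R * lam ^+ 2 * v = n%:R * (2 * lam ^+ 2 * v) by ring.
rewrite expRM_natl lerXn2r ?nnegrE ?expR_ge0//.
  by apply: Rintegral_ge0 => x _; exact: expR_ge0.
apply: le_trans (expR_ge1Dx _).
have be2 : bmeas setT (fun x => eta x ^+ 2) by exact: bmeasX.
apply: (@le_trans _ _ (\int[law X]_x (1 + (lam * eta x + 2 * lam ^+ 2 * eta x ^+ 2)))).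
  apply: (Rint_le mTR fTR) => // [|x _].
    apply: bmeasD; first exact: bmeas_cst.
    by apply: bmeasD; exact: bmeasZ.
  apply: (le_trans (expR_le_quad (eb x))).
  by rewrite le_eqVlt; apply/orP; left; apply/eqP; ring.
rewrite (RintD mTR fTR); last 2 first.
- exact: bmeas_cst.
- by apply: bmeasD; exact: bmeasZ.
rewrite Rint_prob_cst (RintD mTR fTR); [|exact: bmeasZ..].
rewrite !(RintZ mTR fTR)// e0 mulr0 add0r lerD2l ler_wpM2l//.
by rewrite mulr_ge0 ?sqr_ge0.
Qed.

Lemma bernstein (n : nat) (eta : R -> R) (lam v r : R) : measurable_fun setT eta ->
  0 < lam -> (forall x, `|lam * eta x| <= 1 / 2) -> \int[law X]_x eta x = 0 ->
  \int[law X]_x eta x ^+ 2 <= v ->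
  fine (P [set t | r <= `|\sum_(j <- iota 0 n) eta (X j t)|]) <=
    2 * expR (- lam * r + 2 * n%:R * lam ^+ 2 * v).
Proof.
move=> meta lam0 eb e0 ev.
have mneta : measurable_fun setT (fun x => - eta x) by exact: measurableT_comp.
have h1 := bernstein_ge n r meta lam0 eb e0 ev.
have h2 : fine (P [set t | r <= \sum_(j <- iota 0 n) - eta (X j t)]) <=
    expR (- lam * r + 2 * n%:R * lam ^+ 2 * v).
  apply: (@bernstein_ge n (fun x => - eta x)) => //.
  - by move=> x; rewrite mulrN normrN.
  - rewrite -[RHS](mulr0 (-1)) -e0 -(RintZ mTR fTR).
      by apply: eq_Rintegral => x _; rewrite mulN1r.
    split=> //; exists (1 / 2 / lam) => x _.
    by have := eb x; rewrite normrM (gtr0_norm lam0) => h; rewrite (ler_pdivlMr _ _ lam0) mulrC.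
  - by apply: le_trans ev; under eq_Rintegral do rewrite sqrrN.
have m1 := meas_ge r (meas_sumX (iota 0 n) meta).
have m2 := meas_ge r (meas_sumX (iota 0 n) mneta).
apply: (@le_trans _ _ (fine (P ([set t | r <= \sum_(j <- iota 0 n) eta (X j t)] `|`
    [set t | r <= \sum_(j <- iota 0 n) - eta (X j t)])))).
  apply: prob_le; [|exact: measurableU|].
    by apply: meas_ge; apply: measurableT_comp => //; exact: meas_sumX.
  move=> t /=; rewrite sumrN; set S := \sum_(j <- _) _.
  by case: (ger0P S) => _ h; [left | right].
apply: (le_trans (prob_setU_le _ _ _)) => //.
by rewrite mulrDl mul1r lerD.
Qed.

End Bernstein.

(** * Order statistics and the quantile transform *)

Section Measurability.
Context d (T : measurableType d) (R : realType).

Lemma meas_of_le (f : T -> R) : (forall c, measurable [set t | f t <= c]) ->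
  measurable_fun setT f.
Proof.
move=> h; apply: (measurability _ (RGenOInfty.measurableE R)) => _ [_ [x ->] <-].
rewrite setTI (_ : f @^-1` _ = ~` [set t | f t <= x]); first exact: measurableC.
by apply/seteqP; split=> t /=; rewrite in_itv/= andbT ltNge => /negP.
Qed.

Lemma meas_bool (b : T -> bool) : measurable_fun setT b -> measurable [set t | b t].
Proof.
move=> mb; rewrite (_ : [set t | b t] = setT `&` b @^-1` [set true]); first exact: mb.
by rewrite setTI; apply/seteqP; split.
Qed.

(** By convention [0^-1 = 0], so the sublevel sets of the inverse have a separate piece where [f]
    vanishes. *)
Lemma meas_invr (f : T -> R) : measurable_fun setT f -> (forall t, 0 <= f t) ->
  measurable_fun setT (fun t => (f t)^-1).
Proof.
move=> mf f0; apply: meas_of_le => c.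
have -> : [set t | (f t)^-1 <= c] =
    [set t | ((f t <= 0) && (0 <= c)) || (((0 : R) < f t) && (1 <= c * f t))].
  apply/seteqP; split=> t /=; have := f0 t; rewrite le_eqVlt => /predU1P[<-|h].
  - by rewrite invr0 lexx/= => ->.
  - by rewrite (leNgt (f t) 0) h/= -[_^-1]mul1r ler_pdivrMr.
  - by rewrite invr0 lexx ltxx/= orbF.
  - by rewrite (leNgt (f t) 0) h/= -[_^-1]mul1r ler_pdivrMr.
apply: meas_bool; apply: measurable_or; apply: measurable_and.
- exact: measurable_fun_ler.
- exact: measurable_fun_ler.
- exact: measurable_fun_ltr.
- by apply: measurable_fun_ler => //; exact: measurable_funM.
Qed.

End Measurability.

Section OrderStatistics.
Context (R : realType).
Implicit Types (xs : seq R).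

(** The Galois connection by which statements on order statistics become statements on counts. *)
Lemma ostat_le xs i c : (0 < i <= size xs)%N ->
  (ostat xs i <= c) = (i <= count (<= c) xs)%N.
Proof.
move=> /andP[i0 iN].
have ss : sorted <=%O (sort <=%R xs) by exact: (sort_sorted le_total).
rewrite /ostat -(count_sort <=%R).
case: (leqP i (count _ _)) => h.
  by apply: nth_count_le => //; rewrite prednK.
apply/negbTE; rewrite -ltNge; apply: nth_count_gt => //.
by rewrite size_sort; move: i0 iN h; case: i => // i _ /=; rewrite ltnS => -> ->.
Qed.

Lemma ostat_mono xs i j : (0 < i)%N -> (i <= j)%N -> (j <= size xs)%N ->
  ostat xs i <= ostat xs j.
Proof.
move=> i0 ij jN.
have hj : (0 < j <= size xs)%N by rewrite jN (leq_trans i0).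
have hi : (0 < i <= size xs)%N by rewrite i0 (leq_trans ij).
rewrite ostat_le// (leq_trans ij)// -ostat_le//.
Qed.

Lemma sum_ostat (V : zmodType) xs (g : R -> V) :
  \sum_(1 <= i < (size xs).+1) g (ostat xs i) = \sum_(x <- xs) g x.
Proof.
rewrite big_add1 /= [RHS](perm_big (sort <=%R xs)); last by rewrite perm_sym perm_sort.
by rewrite [RHS](big_nth 0) size_sort.
Qed.

Lemma count_sum xs c : count (<= c) xs = (\sum_(x <- xs) (x <= c)%R)%N.
Proof. by elim: xs => [|x xs ih] /=; rewrite ?big_nil// big_cons ih. Qed.

End OrderStatistics.

Section SampleMeasurability.
Context d (T : measurableType d) (R : realType) (P : probability T R).
Variable X : nat -> {RV P >-> R}.
Local Notation Xf := (fun i => (X i : T -> R)).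

Lemma size_sample N t : size (sample Xf N t) = N.
Proof. by rewrite size_map size_iota. Qed.

Lemma count_sample N t c :
  count (<= c) (sample Xf N t) = (\sum_(j <- iota 0 N) (X j t <= c)%R)%N.
Proof. by rewrite count_sum big_map. Qed.

Let meas_count_ge N i c : measurable [set t | (i <= \sum_(j <- iota 0 N) (X j t <= c)%R)%N].
Proof.
suff h : measurable_fun setT (fun t => (\sum_(j <- iota 0 N) (X j t <= c)%R)%N).
  by rewrite -[X in measurable X]setTI; exact: (h measurableT [set n | (i <= n)%N] I).
elim: (iota 0 N) => [|j l ih].
  by under eq_fun do rewrite big_nil; exact: measurable_cst.
under eq_fun do rewrite big_cons; apply: measurable_fun_addn => //.
by apply: (measurableT_comp (meas_le c)); exact: mX.
Qed.

Lemma meas_ostat N i : measurable_fun setT (fun t => ostat (sample Xf N t) i).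
Proof.
have main k : (0 < k <= N)%N -> measurable_fun setT (fun t => ostat (sample Xf N t) k).
  move=> hk; apply: meas_of_le => c.
  rewrite (_ : [set t | _] = [set t | (k <= \sum_(j <- iota 0 N) (X j t <= c)%R)%N])//.
  by apply/seteqP; split=> t /=; rewrite ostat_le ?size_sample// count_sample.
(* Index 0 reads the same entry as index 1, because only [i.-1] is used; beyond [N] the default
   value 0 is constant. *)
have [hi|hi] := boolP (0 < i.-1.+1 <= N)%N; first exact: (main _ hi).
rewrite (_ : (fun t => _) = cst 0); first exact: measurable_cst.
apply/funext => t; rewrite /ostat nth_default// size_sort size_sample.
by move: hi; rewrite /= -leqNgt.
Qed.

Let meas_sum_nat (a b : nat) (g : nat -> T -> R) : (forall i, measurable_fun setT (g i)) ->
  measurable_fun setT (fun t => \sum_(a <= i < b) g i t).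
Proof.
move=> mg; rewrite /index_iota; elim: (iota _ _) => [|j l ih].
  by under eq_fun do rewrite big_nil; exact: measurable_cst.
by under eq_fun do rewrite big_cons; exact: measurable_funD.
Qed.

Lemma meas_FNS_event (alpha beta m : R) N x : 0 <= beta - alpha ->
  measurable [set t | Num.sqrt N%:R * (trimmed_mean alpha beta (sample Xf N t) - m)
    / ((beta - alpha)^-1 * SN alpha beta (sample Xf N t)) <= x].
Proof.
move=> ab; have mo := meas_ostat N.
have mtm : measurable_fun setT (fun t => trimmed_mean alpha beta (sample Xf N t)).
  rewrite (_ : (fun t => _) = fun t => ((ip beta N - ip alpha N)%:R)^-1 *
    \sum_((ip alpha N).+1 <= i < (ip beta N).+1) ostat (sample Xf N t) i); last first.
    by apply/funext => t; rewrite /trimmed_mean size_sample.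
  by apply: measurable_funM => //; exact: meas_sum_nat.
have mSN : measurable_fun setT (fun t => SN alpha beta (sample Xf N t)).
  apply: measurableT_comp.
    by apply: continuous_measurable_fun; exact: sqrt_continuous.
  rewrite (_ : (fun t => _) = fun t =>
    (ip alpha N).+1%:R / N%:R * ostat (sample Xf N t) (ip alpha N).+1 ^+ 2
    + N%:R^-1 * \sum_((ip alpha N).+2 <= i < ip beta N) ostat (sample Xf N t) i ^+ 2
    + ((N - ip beta N).+1)%:R / N%:R * ostat (sample Xf N t) (ip beta N) ^+ 2
    - ((ip alpha N).+1%:R / N%:R * ostat (sample Xf N t) (ip alpha N).+1
    + N%:R^-1 * \sum_((ip alpha N).+2 <= i < ip beta N) ostat (sample Xf N t) i
    + ((N - ip beta N).+1)%:R / N%:R * ostat (sample Xf N t) (ip beta N)) ^+ 2); last first.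
    by apply/funext => t; rewrite /S2N /hat_muW size_sample.
  apply: measurable_funB.
    apply: measurable_funD; first apply: measurable_funD.
    - by apply: measurable_funM => //; exact: measurable_funX.
    - by apply: measurable_funM => //; apply: meas_sum_nat => i; exact: measurable_funX.
    - by apply: measurable_funM => //; exact: measurable_funX.
  apply: measurable_funX; apply: measurable_funD; first apply: measurable_funD.
  - exact: measurable_funM.
  - by apply: measurable_funM => //; exact: meas_sum_nat.
  - exact: measurable_funM.
apply: meas_bool; apply: measurable_fun_ler => //; apply: measurable_funM.
  by apply: measurable_funM => //; exact: measurable_funB.
apply: meas_invr; first exact: measurable_funM.
by move=> t; rewrite mulr_ge0 ?invr_ge0// sqrtr_ge0.
Qed.

End SampleMeasurability.

(** * Moments of the clipped observation through the quantile transform *)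

Section QuantileTransform.
Context d (T : measurableType d) (R : realType) (P : probability T R).
Variable X : nat -> {RV P >-> R}.
Variable F : R -> R.
Hypothesis hF : forall x, fine (P [set w | X 0%N w <= x]) = F x.

Lemma lawF x : law X `]-oo, x]%classic = (F x)%:E.
Proof.
rewrite -hF fineK; last by rewrite fin_num_measure//; apply: meas_bool; apply: measurable_fun_ler => //; exact: mX.
rewrite /law /distribution /pushforward/=; congr (P _).
Qed.

Lemma F_cdf x : (F x)%:E = cdf (X 0%N) x. Proof. by rewrite -lawF. Qed.

Lemma F_mono x y : x <= y -> F x <= F y.
Proof. by move=> xy; rewrite -lee_fin !F_cdf; exact: cdf_nondecreasing. Qed.

Lemma F_ge0 x : 0 <= F x. Proof. by rewrite -lee_fin F_cdf cdf_ge0. Qed.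
Lemma F_le1 x : F x <= 1. Proof. by rewrite -lee_fin F_cdf cdf_le1. Qed.

Lemma F_right x u : (forall y, x < y -> u <= F y) -> u <= F x.
Proof.
move=> h; have c := @cdf_right_continuous _ T R P (X 0%N) x.
rewrite -lee_fin F_cdf; apply: (cvge_ge _ c); near=> y.
rewrite -F_cdf lee_fin; apply: h; near: y; exact: nbhs_right_gt.
Unshelve. all: by end_near. Qed.

Lemma F_low u : 0 < u -> exists x, F x < u.
Proof.
move=> u0; have c := fine_cvg (@cvg_cdfNy0 _ T R P (X 0%N)).
have /= [M [_ hM]] := cvgr_lt _ (c _) _ u0.
by exists (M - 1); rewrite -[F _]/(fine (F _)%:E) F_cdf; apply: hM; rewrite ltrBlDr ltrDl.
Qed.

Lemma F_high u : u < 1 -> exists x, u <= F x.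
Proof.
move=> u1; have c := fine_cvg (@cvg_cdfy1 _ T R P (X 0%N)).
have /= [M [_ hM]] := cvgr_gt _ (c _) _ u1.
by exists (M + 1); rewrite -[F _]/(fine (F _)%:E) F_cdf ltW//; apply: hM; rewrite ltrDl.
Qed.

(** Right continuity of [F] puts the infimum into the set over which it is taken. *)
Lemma quantile_le u x : 0 < u -> u < 1 -> (quantile F u <= x) = (u <= F x).
Proof.
move=> u0 u1.
have [xl hl] := F_low u0; have [xh hh] := F_high u1.
have lb : has_lbound [set x | u <= F x].
  exists xl => y /= hy; rewrite leNgt; apply/negP => yl.
  by have := le_lt_trans (le_trans hy (F_mono (ltW yl))) hl; rewrite ltxx.
apply/idP/idP => h; last exact: ge_inf.
apply: F_right => y xy.
have q0 : 0 < y - quantile F u by rewrite subr_gt0; exact: le_lt_trans h xy.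
have hi : has_inf [set x | u <= F x] by split=> //; exists xh.
have [z /= hz] := inf_adherent q0 hi.
rewrite -/(quantile F u) addrCA subrr addr0 => zy.
by rewrite (le_trans hz)// F_mono// ltW.
Qed.

Variables (alpha beta : R).
Hypotheses (a0 : 0 < alpha) (ab : alpha < beta) (b1 : beta < 1).
Local Notation xa := (quantile F alpha).
Local Notation xb := (quantile F beta).
Hypotheses (Fa : F xa = alpha) (Fb : F xb = beta).

Let b0 : 0 < beta. Proof. exact: lt_trans ab. Qed.
Let a1 : alpha < 1. Proof. exact: lt_trans b1. Qed.

Lemma xa_lt_xb : xa < xb.
Proof. by rewrite ltNge; apply/negP => /F_mono; rewrite Fa Fb leNgt ab. Qed.

Definition clip x := if x <= xa then xa else if x <= xb then x else xb.

Lemma meas_clip : measurable_fun setT clip.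
Proof.
apply: measurable_fun_ifT => //; first exact: measurable_fun_ler.
by apply: measurable_fun_ifT => //; exact: measurable_fun_ler.
Qed.

Lemma clip_ge x : xa <= clip x.
Proof.
rewrite /clip; case: (leP x xa) => // /ltW h; case: ifP => // _; exact: ltW xa_lt_xb.
Qed.

Lemma clip_le x : clip x <= xb.
Proof. by rewrite /clip; case: (leP x xa) => [_|_]; [exact: ltW xa_lt_xb | case: (leP x xb)]. Qed.

(** The quantile function, with values prescribed outside []0, 1[] in such a way that [Qw] equals
    [clip] of it at every real [u]. *)
Let V (u : measurableTypeR R) : R := if u <= 0 then xa else if 1 <= u then xb else quantile F u.

Let Vle u c : (V u <= c) = if u <= 0 then xa <= c else if 1 <= u then xb <= c else u <= F c.
Proof.
rewrite /V; case: (leP u 0) => // u0; case: (leP 1 u) => // u1.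
exact: quantile_le.
Qed.

Let mV : measurable_fun (setT : set (measurableTypeR R)) V.
Proof.
apply: meas_of_le => c; apply: meas_bool.
under eq_fun do rewrite Vle.
apply: measurable_fun_ifT => //; first exact: measurable_fun_ler.
by apply: measurable_fun_ifT; exact: measurable_fun_ler.
Qed.

Lemma Qw_clip u : Qw F alpha beta u = clip (V u).
Proof.
rewrite /Qw /clip /V.
case: (leP u 0) => u0; first by rewrite lexx (le_trans u0 (ltW a0)).
case: (leP 1 u) => u1.
  rewrite !leNgt (lt_le_trans b1 u1) (lt_le_trans a1 u1) xa_lt_xb ltxx/=.
  by [].
case: (leP u alpha) => ua; first by rewrite quantile_le// Fa ua.
by rewrite !quantile_le// Fa Fb (leNgt u alpha) ua.
Qed.

Let Un := uniform_prob (@ltr01 R).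
Let Vr : {mfun (measurableTypeR R) >-> R} :=
  @mfun_Sub _ _ (measurableTypeR R) R V (mem_set mV).

Let Un_int (g : R -> R) : bmeas (setT : set (measurableTypeR R)) g ->
  \int[Un]_u g u = Leb01 g.
Proof.
move=> bg; have [mg [M hM]] := bg.
have pos (h : R -> R) : measurable_fun (setT : set (measurableTypeR R)) h ->
    (forall u, 0 <= h u) -> \int[Un]_u h u = Leb01 h.
  move=> mh h0; rewrite /Leb01 /Rintegral (integral_uniform ltr01)//.
  - by rewrite subr0 invr1 mul1e.
  - exact/measurable_EFinP.
have bl : bmeas (setT : set (measurableTypeR R)) (fun u => g u + M).
  by apply: bmeasD => //; exact: bmeas_cst.
have bl01 (h : R -> R) : bmeas (setT : set (measurableTypeR R)) h ->
    bmeas (`[0, 1]%classic : set (measurableTypeR R)) h.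
  move=> [mh [M' hM']]; split; last by exists M' => x _; exact: hM'.
  exact: measurable_funTS.
(* The case of nonnegative integrands applies after adding the bound [M], which cancels at the
   end. *)
have := pos (fun u => g u + M) bl.1.
rewrite (RintD measurableT (probT_lty Un) bg (bmeas_cst _ M)) Rint_prob_cst.
have m01 : measurable (`[0, 1]%classic : set (measurableTypeR R)) by exact: measurable_itv.
have l01 : lebesgue_measure (`[0, 1]%classic : set (measurableTypeR R)) = 1%E.
  by rewrite lebesgue_measure_itv/= lte_fin ltr01 oppr0 adde0.
have f01 : (lebesgue_measure (`[0%R, 1%R]%classic : set (measurableTypeR R)) < +oo)%E.
  by rewrite l01 ltry.
rewrite /Leb01 (RintD m01 f01 (bl01 _ bg) (bmeas_cst _ M)).
have -> : \int[lebesgue_measure]_(u in (`[0, 1]%classic : set (measurableTypeR R))) M = M.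
  rewrite Rintegral_cst//; transitivity (M * 1); last by rewrite mulr1.
  by congr (M * _); exact: (congr1 fine l01).
move=> h; apply: (addIr M); apply: h => u.
by have := hM u I; rewrite ler_norml => /andP[h _]; rewrite -lerBlDr sub0r.
Qed.

(** Inside []0, 1[] the event is [u <= F c], so up to the two endpoints it is the interval
    [[0, F c]]. *)
Let Un_le c : (distribution Un Vr : set R -> \bar R) `]-oo, c]%classic = (F c)%:E.
Proof.
have mA : measurable (V @^-1` `]-oo, c]%classic : set (measurableTypeR R)).
  by rewrite -[_ @^-1` _]setTI; exact: mV.
have e : Un (V @^-1` `]-oo, c]%classic) =
    lebesgue_measure ((V @^-1` `]-oo, c]%classic) `&` `[0, 1]%classic).
  transitivity (\int[Un]_u (\1_(V @^-1` `]-oo, c]%classic) u)%:E)%E.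
    by rewrite integral_indic// setIT.
  rewrite (integral_uniform ltr01)//; last by exact/measurable_EFinP/measurable_indic.
  by rewrite subr0 invr1 mul1e integral_indic.
transitivity (Un (V @^-1` `]-oo, c]%classic)); first by [].
rewrite e; have m01 : measurable (`[0, 1]%classic : set (measurableTypeR R)) by exact: measurable_itv.
have F0 := F_ge0 c; have F1 := F_le1 c.
apply/eqP; rewrite eq_le; apply/andP; split.
  apply: (@le_trans _ _ (lebesgue_measure (`[0, F c]%classic `|` [set 1] : set (measurableTypeR R)))).
    apply: le_measure; rewrite ?inE; [exact: measurableI|exact: measurableU|].
    move=> u []/=; rewrite !in_itv/= Vle => + /andP[u0 u1].
    case: leP => [u0' _|u0']; first by left; rewrite u0 (le_trans u0').
    by case: leP => [h _|h hu]; [right; apply/eqP; rewrite eq_le u1 | left; rewrite u0].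
  apply: (le_trans (measureU2 _ _ _)) => //.
  have l1 : lebesgue_measure (`[0, F c]%classic : set (measurableTypeR R)) = (F c)%:E.
    rewrite lebesgue_measure_itv/= lte_fin lt_def F0 andbT.
    by case: eqP => [->|_]; rewrite ?sube0.
  have l2 := lebesgue_measure_set1 (1 : R).
  rewrite -[leRHS]adde0; apply: leeD; first by rewrite le_eqVlt; apply/orP; left; exact/eqP.
  by rewrite le_eqVlt; apply/orP; left; exact/eqP.
have l3 : lebesgue_measure (`]0, F c[%classic : set (measurableTypeR R)) = (F c)%:E.
  rewrite lebesgue_measure_itv/= lte_fin lt_def F0 andbT.
  by case: eqP => [->|_]; rewrite ?sube0.
apply: (@le_trans _ _ (lebesgue_measure (`]0, F c[%classic : set (measurableTypeR R)))).
  by rewrite le_eqVlt; apply/orP; left; apply/eqP; exact: esym l3.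
apply: le_measure; rewrite ?inE; [exact: measurable_itv|exact: measurableI|].
move=> u /=; rewrite !in_itv/= => /andP[u0 uF]; rewrite Vle.
rewrite leNgt u0/= leNgt (lt_le_trans uF F1)/=.
by split; [exact: ltW | rewrite !ltW// (lt_le_trans uF F1)].
Qed.

Lemma law_quantile (g : R -> R) : bmeas setT g ->
  \int[law X]_x g x = Leb01 (fun u => g (V u)).
Proof.
move=> [mg [M hM]].
have bgV : bmeas (setT : set (measurableTypeR R)) (fun u => g (V u)).
  split; last by exists M => u _; exact: hM.
  exact: (measurableT_comp mg mV).
rewrite -Un_int//.
transitivity (\int[distribution Un Vr]_x g x).
  rewrite /Rintegral; congr fine; apply: eq_measure_integral => A mA _.
  by apply: (@prob_cdf_unique R (law X) (distribution Un Vr)) => // x; exact: etrans (lawF x) (esym (Un_le x)).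
rewrite /Rintegral integral_distribution//; first exact/measurable_EFinP.
exact: (bmeas_integrable measurableT (probT_lty Un) bgV).
Qed.

Lemma Leb01_Qw (g : R -> R) : measurable_fun setT g ->
  (exists M, forall x, `|g (clip x)| <= M) ->
  Leb01 (fun u => g (Qw F alpha beta u)) = \int[law X]_x g (clip x).
Proof.
move=> mg [M hM]; rewrite law_quantile; last first.
  by split; [exact: (measurableT_comp mg meas_clip) | exists M].
by congr Leb01; apply/funext => u; rewrite Qw_clip.
Qed.

Lemma bmeas_clip : bmeas (setT : set R) clip.
Proof.
split; first exact: meas_clip.
exists (`|xa| + `|xb|) => x _; rewrite ler_norml; apply/andP; split.
  apply: (le_trans _ (clip_ge x)); rewrite lerNl (le_trans (ler_norm _))// normrN lerDl//.
by apply: (le_trans (clip_le x)); rewrite (le_trans (ler_norm _))// lerDr.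
Qed.

Let mu := muW F alpha beta.
Lemma muWE : mu = \int[law X]_x clip x.
Proof.
apply: (@Leb01_Qw id); first exact: measurable_id.
by have [_ [M hM]] := bmeas_clip; exists M => x; exact: hM.
Qed.

Let momE k : Leb01 (fun u => (Qw F alpha beta u - mu) ^+ k) =
  \int[law X]_x (clip x - mu) ^+ k.
Proof.
apply: (@Leb01_Qw (fun x => (x - mu) ^+ k)).
  by apply: measurable_funX; exact: measurable_funB.
have [_ [M hM]] := bmeasX k (bmeasB bmeas_clip (bmeas_cst _ mu)).
by exists M => x; exact: hM.
Qed.

Lemma sigma2WE : sigma2W F alpha beta = \int[law X]_x (clip x - mu) ^+ 2.
Proof. exact: (momE 2). Qed.

Lemma gamma3WE : gamma3W F alpha beta = \int[law X]_x (clip x - mu) ^+ 3.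
Proof. exact: (momE 3). Qed.

Let mQw : bmeas (setT : set (measurableTypeR R)) (Qw F alpha beta).
Proof.
rewrite (_ : Qw F alpha beta = fun u => clip (V u)); last first.
  by apply/funext => u; exact: Qw_clip.
have [mc [M hM]] := bmeas_clip; split; last by exists M => u _; exact: hM.
exact: (measurableT_comp mc mV).
Qed.

Let Qw_integrable (D : set (measurableTypeR R)) : measurable D ->
  (lebesgue_measure D < +oo)%E -> lebesgue_measure.-integrable D (EFin \o Qw F alpha beta).
Proof.
move=> mD fD; apply: bmeas_integrable => //; have [m [M hM]] := mQw.
split; last by exists M => u _; exact: hM.
exact: measurable_funTS.
Qed.

Let itv_fin (a b : R) c1 c2 :
  (lebesgue_measure ([set` Interval (BSide c1 a) (BSide c2 b)] : set (measurableTypeR R)) < +oo)%E.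
Proof. by rewrite lebesgue_measure_itv/=; case: ifP => _; rewrite ?ltry// -EFinB ltry. Qed.

(** Links the winsorized mean, at which the clipped observations are centred, with the trimmed mean
    that is being estimated: the outer pieces of [Qw] are constant. *)
Lemma muW_split : mu = alpha * xa + (beta - alpha) * mu_ab F alpha beta + (1 - beta) * xb.
Proof.
pose Q := Qw F alpha beta.
have ig (a b : R) c1 c2 : lebesgue_measure.-integrable
    ([set` Interval (BSide c1 a) (BSide c2 b)] : set (measurableTypeR R)) (EFin \o Q).
  by apply: Qw_integrable => //; exact: itv_fin.
have s1 : \int[lebesgue_measure]_(u in `[0, 1]) Q u -
    \int[lebesgue_measure]_(u in `[0, alpha]) Q u = \int[lebesgue_measure]_(u in `]alpha, 1]) Q u.
  by apply: Rintegral_itvB; [exact: ig | rewrite bnd_simp ltW | rewrite bnd_simp ltW].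
have s2 : \int[lebesgue_measure]_(u in `]alpha, 1]) Q u -
    \int[lebesgue_measure]_(u in `]alpha, beta]) Q u = \int[lebesgue_measure]_(u in `]beta, 1]) Q u.
  by apply: Rintegral_itvB; [exact: ig | rewrite bnd_simp ltW | rewrite bnd_simp ltW].
have e1 : \int[lebesgue_measure]_(u in `[0, alpha]) Q u = alpha * xa.
  transitivity (\int[lebesgue_measure]_(u in `[0, alpha]) xa).
    apply: eq_Rintegral => u; rewrite inE/= in_itv/= => /andP[_ h].
    by rewrite /Q /Qw h.
  rewrite Rintegral_cst// mulrC; congr (_ * _).
  have := lebesgue_measure_itv `[0, alpha]; rewrite /= lte_fin a0 => h.
  by rewrite (congr1 fine h)/= oppr0 addr0.
have e3 : \int[lebesgue_measure]_(u in `]beta, 1]) Q u = (1 - beta) * xb.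
  transitivity (\int[lebesgue_measure]_(u in `]beta, 1]) xb).
    apply: eq_Rintegral => u; rewrite inE/= in_itv/= => /andP[h _].
    by rewrite /Q /Qw leNgt (lt_trans ab h)/= leNgt h.
  rewrite Rintegral_cst// mulrC; congr (_ * _).
  have := lebesgue_measure_itv `]beta, 1]; rewrite /= lte_fin b1 => h.
  by rewrite (congr1 fine h).
have e2 : \int[lebesgue_measure]_(u in `]alpha, beta]) Q u = (beta - alpha) * mu_ab F alpha beta.
  rewrite /mu_ab mulrA divff ?mul1r; last by rewrite lt0r_neq0// subr_gt0.
  transitivity (\int[lebesgue_measure]_(u in `[alpha, beta]) Q u).
    exact: (Rintegral_itv_obnd_cbnd (ig alpha beta false false)).
  apply: eq_Rintegral => u; rewrite inE/= in_itv/= => /andP[h1 h2].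
  by rewrite /Q /Qw h2; case: leP => // h3; congr quantile; apply/eqP; rewrite eq_le h1 h3.
have -> : mu = \int[lebesgue_measure]_(u in `[0, 1]) Q u by [].
by rewrite -e1 -e2 -e3 -s2 -s1; ring.
Qed.

Local Notation nu := (law X).
Let mTR := @measurableT _ R.
Let fTR := probT_lty nu.
Let bW : bmeas setT (fun x => clip x - mu).
Proof. by apply: bmeasB; [exact: bmeas_clip | exact: bmeas_cst]. Qed.

Definition ind (c x : R) : R := ((x <= c)%R : nat)%:R.

Lemma indE c : ind c = \1_(`]-oo, c]%classic).
Proof.
apply/funext => x; rewrite /ind indicE; congr (nat_of_bool _)%:R.
by apply/idP/idP; rewrite inE/= in_itv.
Qed.

Lemma bmeas_ind c : bmeas (setT : set R) (ind c).
Proof. by rewrite indE; apply: bmeas_indic; exact: measurable_itv. Qed.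

Lemma Rint_ind c : \int[nu]_x ind c x = F c.
Proof.
rewrite (_ : ind c = \1_(`]-oo, c]%classic)); last exact: indE.
by rewrite Rint_indic// (congr1 fine (lawF c)).
Qed.

Lemma ind_centered c u : F c = u -> \int[nu]_x (ind c x - u) = 0.
Proof.
move=> Fc; rewrite (RintB mTR fTR (bmeas_ind c) (bmeas_cst _ u)).
by rewrite Rint_ind Rint_prob_cst Fc subrr.
Qed.

Lemma ind_var c u : F c = u -> \int[nu]_x (ind c x - u) ^+ 2 = u * (1 - u).
Proof.
move=> Fc; have bi := bmeas_ind c.
have e x : (ind c x - u) ^+ 2 = (1 - 2 * u) * ind c x + u ^+ 2.
  by rewrite /ind; case: (_ <= _)%R => /=; ring.
under eq_Rintegral do rewrite e.
rewrite (RintD mTR fTR (bmeasZ _ bi) (bmeas_cst _ _)) (RintZ mTR fTR _ bi) Rint_ind.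
by rewrite Rint_prob_cst Fc; ring.
Qed.

Lemma W_centered : \int[nu]_x (clip x - mu) = 0.
Proof.
rewrite (RintB mTR fTR bmeas_clip (bmeas_cst _ mu)) -muWE Rint_prob_cst.
by rewrite subrr.
Qed.

(** Where the indicator is 1 the clipped observation is the constant [xa], so the product is linear
    in the two factors. *)
Lemma ind_W_a : \int[nu]_x ((ind xa x - alpha) * (clip x - mu)) = alpha * (xa - mu).
Proof.
have bi := bmeas_ind xa.
have e x : (ind xa x - alpha) * (clip x - mu) = (xa - mu) * ind xa x - alpha * (clip x - mu).
  by rewrite /ind /clip; case: (x <= xa) => /=; ring.
under eq_Rintegral do rewrite e.
rewrite (RintB mTR fTR (bmeasZ _ bi) (bmeasZ _ bW)) !(RintZ mTR fTR)// Rint_ind W_centered Fa.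
by ring.
Qed.

Lemma ind_W_b : \int[nu]_x ((ind xb x - beta) * (clip x - mu)) = - (1 - beta) * (xb - mu).
Proof.
have bi := bmeas_ind xb.
have e x : (ind xb x - beta) * (clip x - mu) =
    (xb - mu) * ind xb x + (1 - beta) * (clip x - mu) - (xb - mu).
  rewrite /ind /clip; case: (leP x xb) => h; first by case: ifP => _ /=; ring.
  by rewrite leNgt (lt_trans xa_lt_xb h) /=; ring.
under eq_Rintegral do rewrite e.
rewrite (RintB mTR fTR (bmeasD (bmeasZ _ bi) (bmeasZ _ bW)) (bmeas_cst _ _)).
rewrite (RintD mTR fTR (bmeasZ _ bi) (bmeasZ _ bW)) !(RintZ mTR fTR)// Rint_ind W_centered Fb.
by rewrite Rint_prob_cst; ring.
Qed.

(** The clipped observation equals [xa] with probability at least [alpha] and [xb] with probability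
    at least [1 - beta], and [mu] cannot coincide with both. *)
Lemma sigma2W_gt0 : 0 < sigma2W F alpha beta.
Proof.
rewrite sigma2WE; have ba := bmeas_ind xa; have bb := bmeas_ind xb.
apply: (@lt_le_trans _ _ (alpha * (xa - mu) ^+ 2 + (1 - beta) * (xb - mu) ^+ 2)).
  have [e|ne] := eqVneq xa mu.
    rewrite e subrr expr0n/= mulr0 add0r mulr_gt0 ?subr_gt0//.
    by rewrite exprn_gt0// subr_gt0 -e xa_lt_xb.
  apply: ltr_wpDr; first by rewrite mulr_ge0 ?sqr_ge0// subr_ge0 ltW.
  by rewrite mulr_gt0// exprn_even_gt0//= subr_eq0.
have -> : alpha * (xa - mu) ^+ 2 + (1 - beta) * (xb - mu) ^+ 2 =
    \int[nu]_x ((xa - mu) ^+ 2 * ind xa x + (xb - mu) ^+ 2 * (1 - ind xb x)).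
  have b1' : bmeas setT (fun x => 1 - ind xb x) by exact: bmeasB (bmeas_cst _ 1) bb.
  rewrite (RintD mTR fTR (bmeasZ _ ba) (bmeasZ _ b1')) !(RintZ mTR fTR)//.
  by rewrite (RintB mTR fTR (bmeas_cst _ 1) bb) !Rint_ind Rint_prob_cst Fa Fb; ring.
apply: (Rint_le mTR fTR).
- apply: bmeasD; apply: bmeasZ => //; exact: bmeasB (bmeas_cst _ 1) bb.
- exact: bmeasX.
- move=> x _; rewrite /ind /clip; case: (leP x xa) => ha.
    by rewrite (le_trans ha (ltW xa_lt_xb)) subrr mulr0 mulr1 addr0.
  case: (leP x xb) => hb; last by rewrite mulr0 add0r subr0 mulr1.
  by rewrite mulr0 subrr mulr0 addr0 sqr_ge0.
Qed.

End QuantileTransform.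

(** * Bahadur representation of the studentized trimmed mean *)

Section Bahadur.
Context (R : realType) (xs : seq R).
Local Notation N := (size xs).
Local Notation Y := (ostat xs).
Local Notation cnt c := (count (<= c) xs).

Definition pp (y : R) : R := Num.max y 0.

Lemma ppE y : pp y - pp (- y) = y.
Proof.
rewrite /pp; case: (lerP 0 y) => h.
  by rewrite max_r ?subr0// oppr_le0.
by rewrite max_l ?sub0r ?opprK// oppr_ge0 ltW.
Qed.

Lemma pp0 y : y <= 0 -> pp y = 0. Proof. by move=> h; rewrite /pp max_r. Qed.
Lemma pp_id y : 0 <= y -> pp y = y. Proof. by move=> h; rewrite /pp max_l. Qed.

Definition clipf (a b x : R) : R := if x <= a then a else if x <= b then x else b.

Lemma clipf_pp a b x : a <= b -> clipf a b x = x + pp (a - x) - pp (x - b).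
Proof.
move=> ab; rewrite /clipf; case: (leP x a) => xa.
  by rewrite pp_id ?subr_ge0// pp0 ?subr_le0 ?(le_trans xa)//; ring.
have -> : pp (a - x) = 0 by apply: pp0; rewrite subr_le0 ltW.
case: (leP x b) => xb; first by rewrite pp0 ?subr_le0//; ring.
have -> : pp (x - b) = x - b by apply: pp_id; rewrite subr_ge0 ltW.
by ring.
Qed.

(** The total overshoot of observations ranked on the wrong side of [c]. One of the two sums
    vanishes, depending on whether [kap] exceeds the number of observations up to [c]. *)
Definition excess (kap : nat) (c : R) : R :=
  \sum_(1 <= i < kap.+1) pp (Y i - c) + \sum_(kap.+1 <= i < N.+1) pp (c - Y i).

(* Replacing each observation by its clipped value changes the trimmed sum only by the
   one-sided excesses at the two clipping levels. *)
Lemma trimmed_sum (k m : nat) (a b : R) : (k <= m)%N -> (m <= N)%N -> a <= b ->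
  \sum_(k.+1 <= i < m.+1) Y i =
  \sum_(x <- xs) clipf a b x - k%:R * a - (N - m)%:R * b - excess k a + excess m b.
Proof.
move=> km mN ab; rewrite -(sum_ostat xs (clipf a b)).
have kN : (k <= N)%N by exact: leq_trans mN.
have -> : \sum_(1 <= i < N.+1) clipf a b (Y i) =
  \sum_(1 <= i < N.+1) Y i + \sum_(1 <= i < N.+1) pp (a - Y i)
  - \sum_(1 <= i < N.+1) pp (Y i - b).
  by rewrite -big_split -sumrB; apply: eq_bigr => i _; rewrite clipf_pp.
rewrite /excess.
have sp (g : nat -> R) j : (j <= N)%N -> \sum_(1 <= i < N.+1) g i =
    \sum_(1 <= i < j.+1) g i + \sum_(j.+1 <= i < N.+1) g i.
  by move=> jN; rewrite (@big_cat_nat _ _ _ j.+1).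
rewrite (sp (fun i => pp (a - Y i)) k kN) (sp (fun i => pp (Y i - b)) m mN).
rewrite (sp _ m mN) (@big_cat_nat _ _ _ k.+1 1 m.+1)//=.
have e1 : k%:R * a = \sum_(1 <= i < k.+1) Y i + \sum_(1 <= i < k.+1) pp (a - Y i)
    - \sum_(1 <= i < k.+1) pp (Y i - a).
  have -> : k%:R * a = \sum_(1 <= i < k.+1) a by rewrite sumr_const_nat subn1 mulr_natl.
  rewrite -big_split -sumrB; apply: eq_bigr => i _ /=.
  by have := ppE (a - Y i); rewrite opprB => h; lra.
have e2 : (N - m)%:R * b = \sum_(m.+1 <= i < N.+1) Y i - \sum_(m.+1 <= i < N.+1) pp (Y i - b)
    + \sum_(m.+1 <= i < N.+1) pp (b - Y i).
  have -> : (N - m)%:R * b = \sum_(m.+1 <= i < N.+1) b by rewrite sumr_const_nat subSS mulr_natl.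
  rewrite -sumrB -big_split; apply: eq_bigr => i _ /=.
  by have := ppE (b - Y i); rewrite opprB => h; lra.
by rewrite e1 e2; ring.
Qed.

Lemma sum_lin (n D : nat) : \sum_(n <= i < n + D) (i%:R - n%:R : R) = D%:R * (D%:R - 1) / 2.
Proof.
elim: D => [|D ih]; first by rewrite addn0 big_geq// !mul0r.
rewrite addnS big_nat_recr ?leq_addr//= ih natrD -natr1; by field.
Qed.

Lemma sum_close (a b : nat) (g h : nat -> R) e : (a <= b)%N ->
  (forall i, (a <= i < b)%N -> `|g i - h i| <= e) ->
  `|\sum_(a <= i < b) g i - \sum_(a <= i < b) h i| <= (b - a)%:R * e.
Proof.
move=> ab H; rewrite -sumrB (le_trans (ler_norm_sum _ _ _))//.
rewrite mulr_natl -sumr_const_nat; apply: ler_sum_nat => i hi; exact: H.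
Qed.

Lemma Y_le i c : (0 < i <= N)%N -> (i <= cnt c)%N -> Y i <= c.
Proof. by move=> hi h; rewrite ostat_le. Qed.

Lemma Y_gt i c : (0 < i <= N)%N -> (cnt c < i)%N -> c < Y i.
Proof. by move=> hi h; rewrite ltNge ostat_le// -ltnNge. Qed.

(** Between the rank [kap] and the count the order statistics are almost linear in the rank, with
    slope [1 / M]. The excess is then close to an arithmetic sum, [D (D - 1) / (2 M)] or
    [D (D + 1) / (2 M)] according to the side, and [D / (2 M)] goes into the error. *)
Lemma excess_quad (kap : nat) (c M e : R) : (kap <= N)%N -> 0 < M ->
  (forall i, (0 < i <= N)%N -> (minn kap (cnt c) <= i <= maxn kap (cnt c))%N ->
     `|Y i - c - (i%:R - (cnt c)%:R) / M| <= e) ->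
  `|excess kap c - ((cnt c)%:R - kap%:R) ^+ 2 / (2 * M)| <=
    `|(cnt c)%:R - kap%:R| * (e + 1 / M).
Proof.
move=> kN M0 H; have cN : (cnt c <= N)%N by exact: count_size.
have split0 (a b d : nat) (g : nat -> R) : (a <= d)%N -> (d <= b)%N ->
   \sum_(a <= i < b) g i = \sum_(a <= i < d) g i + \sum_(d <= i < b) g i.
  by move=> *; rewrite (@big_cat_nat _ _ _ d).
have z0 (a b : nat) (g : nat -> R) : (forall i, (a <= i < b)%N -> g i = 0) ->
    \sum_(a <= i < b) g i = 0.
  by move=> h; rewrite big_nat_cond big1// => i; rewrite andbT; exact: h.
have DM (D : nat) : `|D%:R / (2 * M)| <= D%:R * (1 / M).
  have M2 : 0 < 2 * M by rewrite mulr_gt0.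
  rewrite ger0_norm; last by rewrite divr_ge0// ltW.
  by rewrite ler_wpM2l// mul1r lef_pV2// ?posrE//; lra.
case: (leqP kap (cnt c)) => h.
  have [D cD] : exists D, cnt c = (kap + D)%N by exists (cnt c - kap)%N; rewrite subnKC.
  have -> : excess kap c = \sum_(kap.+1 <= i < kap.+1 + D) (c - Y i).
    rewrite /excess z0 ?add0r => [|i /andP[i1 i2]]; last first.
      apply: pp0; rewrite subr_le0; apply: Y_le; last by rewrite (leq_trans _ h)// -ltnS.
      by rewrite i1 (leq_trans _ kN)// -ltnS.
    rewrite (split0 _ _ (kap.+1 + D)%N) ?leq_addr//; last by rewrite addSn -cD ltnS.
    rewrite [X in _ + X]z0 ?addr0 => [|i /andP[i1 i2]]; last first.
      apply: pp0; rewrite subr_le0 ltW//; apply: Y_gt.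
        by rewrite (leq_trans _ i1).
      by rewrite cD.
    apply: eq_big_nat => i /andP[i1 i2]; rewrite pp_id// subr_ge0; apply: Y_le.
      by rewrite (leq_trans _ i1)//= (leq_trans _ cN)// cD -ltnS.
    by rewrite cD -ltnS.
  have hc : `|\sum_(kap.+1 <= i < kap.+1 + D) (c - Y i) -
     \sum_(kap.+1 <= i < kap.+1 + D) (((cnt c)%:R - i%:R) / M)| <= D%:R * e.
    have := @sum_close kap.+1 (kap.+1 + D) (fun i => c - Y i) (fun i => ((cnt c)%:R - i%:R) / M) e.
    rewrite addKn; apply; first exact: leq_addr.
    move=> i /andP[i1 i2]; have hi : (0 < i <= N)%N.
      by rewrite (leq_trans _ i1)//= (leq_trans _ cN)// cD -ltnS.
    have := H i hi; rewrite (minn_idPl h) (maxn_idPr h) (ltnW i1) cD.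
    rewrite addSn ltnS in i2; rewrite i2 => /(_ isT).
    rewrite -normrN; congr (`|_| <= _); by ring.
  have e2 : \sum_(kap.+1 <= i < kap.+1 + D) (((cnt c)%:R - i%:R) / M) =
     D%:R * (D%:R - 1) / 2 / M.
    rewrite -mulr_suml; congr (_ / M).
    have -> : \sum_(kap.+1 <= i < kap.+1 + D) ((cnt c)%:R - i%:R : R) =
      \sum_(kap.+1 <= i < kap.+1 + D) (D%:R - 1 : R) -
      \sum_(kap.+1 <= i < kap.+1 + D) (i%:R - kap.+1%:R : R).
      rewrite -sumrB; apply: eq_bigr => i _; rewrite cD natrD -natr1; ring.
    by rewrite sum_lin sumr_const_nat addKn mulr_natl; field.
  rewrite e2 in hc; have -> : (cnt c)%:R - kap%:R = D%:R :> R by rewrite cD natrD; ring.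
  rewrite [`|D%:R|]ger0_norm// mulrDr.
  have -> : \sum_(kap.+1 <= i < kap.+1 + D) (c - Y i) - D%:R ^+ 2 / (2 * M) =
    (\sum_(kap.+1 <= i < kap.+1 + D) (c - Y i) - D%:R * (D%:R - 1) / 2 / M) - D%:R / (2 * M).
    by field; rewrite lt0r_neq0.
  apply: (le_trans (ler_normB _ _)); apply: lerD => //; exact: DM.
have h' := ltnW h.
have [D cD] : exists D, kap = (cnt c + D)%N by exists (kap - cnt c)%N; rewrite subnKC.
have -> : excess kap c = \sum_((cnt c).+1 <= i < (cnt c).+1 + D) (Y i - c).
  rewrite /excess [X in _ + X]z0 ?addr0 => [|i /andP[i1 i2]]; last first.
    apply: pp0; rewrite subr_le0 ltW//; apply: Y_gt.
      by rewrite (leq_trans _ i1).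
    exact: leq_trans i1.
  rewrite (split0 _ _ (cnt c).+1)// z0 ?add0r => [|i /andP[i1 i2]]; last first.
    apply: pp0; rewrite subr_le0; apply: Y_le => //.
    by rewrite i1 (leq_trans _ cN).
  rewrite addSn -cD; apply: eq_big_nat => i /andP[i1 i2].
  rewrite pp_id// subr_ge0 ltW//; apply: Y_gt => //.
  by rewrite (leq_trans _ i1)//= (leq_trans _ kN).
have hc : `|\sum_((cnt c).+1 <= i < (cnt c).+1 + D) (Y i - c) -
   \sum_((cnt c).+1 <= i < (cnt c).+1 + D) ((i%:R - (cnt c)%:R) / M)| <= D%:R * e.
  have := @sum_close (cnt c).+1 ((cnt c).+1 + D) (fun i => Y i - c) (fun i => (i%:R - (cnt c)%:R) / M) e.
  rewrite addKn; apply; first exact: leq_addr.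
  rewrite addSn -cD => i /andP[i1 i2]; apply: H.
    by rewrite (leq_trans _ i1)//= (leq_trans _ kN).
  by rewrite (minn_idPr h') (maxn_idPl h') (ltnW i1).
have e2 : \sum_((cnt c).+1 <= i < (cnt c).+1 + D) ((i%:R - (cnt c)%:R) / M) =
   D%:R * (D%:R + 1) / 2 / M.
  rewrite -mulr_suml; congr (_ / M).
  have -> : \sum_((cnt c).+1 <= i < (cnt c).+1 + D) (i%:R - (cnt c)%:R : R) =
    \sum_((cnt c).+1 <= i < (cnt c).+1 + D) (1 : R) +
    \sum_((cnt c).+1 <= i < (cnt c).+1 + D) (i%:R - (cnt c).+1%:R : R).
    rewrite -big_split; apply: eq_bigr => i _ /=; rewrite -natr1; ring.
  by rewrite sum_lin sumr_const_nat addKn; field.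
rewrite e2 in hc.
have -> : (cnt c)%:R - kap%:R = - D%:R :> R by rewrite [in kap%:R]cD natrD; ring.
rewrite normrN sqrrN [`|D%:R|]ger0_norm// mulrDr.
set S := \sum_(_ <= i < _) _ in hc *.
have -> : S - D%:R ^+ 2 / (2 * M) = (S - D%:R * (D%:R + 1) / 2 / M) + D%:R / (2 * M).
  by field; rewrite lt0r_neq0.
by apply: (le_trans (ler_normD _ _)); apply: lerD => //; exact: DM.
Qed.

End Bahadur.

(** * Winsorizing at ranks compared with clipping at levels *)

Section SampleVariance.
Context (R : realType) (xs : seq R).
Local Notation N := (size xs).
Local Notation Y := (ostat xs).
Local Notation cnt c := (count (<= c) xs).

Let z0 (a b : nat) (g : nat -> R) : (forall i, (a <= i < b)%N -> g i = 0) ->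
  \sum_(a <= i < b) g i = 0.
Proof. by move=> h; rewrite big_nat_cond big1// => i; rewrite andbT; exact: h. Qed.

Lemma sum_leq p : (p <= N)%N -> \sum_(1 <= i < N.+1) ((i <= p)%N : nat)%:R = p%:R :> R.
Proof.
move=> pN; rewrite (@big_cat_nat _ _ _ p.+1)//= [X in _ + X]z0 ?addr0 => [|i /andP[i1 _]].
  transitivity (\sum_(1 <= i < p.+1) (1 : R)); last by rewrite sumr_const_nat subn1.
  by apply: eq_big_nat => i /andP[_ i2]; rewrite -ltnS i2.
by rewrite leqNgt i1.
Qed.

Lemma sum_leq_diff p q : (p <= N)%N -> (q <= N)%N ->
  \sum_(1 <= i < N.+1) `|((i <= p)%N : nat)%:R - ((i <= q)%N : nat)%:R| = `|p%:R - q%:R| :> R.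
Proof.
wlog pq : p q / (p <= q)%N.
  move=> H pN qN; have [h|h] := leqP p q; first exact: H.
  rewrite distrC -(H q p (ltnW h) qN pN); apply: eq_bigr => i _; exact: distrC.
move=> pN qN; rewrite distrC ger0_norm ?subr_ge0 ?ler_nat// -(sum_leq pN) -(sum_leq qN) -sumrB.
apply: eq_bigr => i _; rewrite distrC ger0_norm// subr_ge0 ler_nat.
by case: (leqP i p) => h //; rewrite (leq_trans h pq).
Qed.

Variables (k m : nat).
Hypotheses (k0 : (0 < k)%N) (km : (k < m)%N) (mN : (m <= N)%N).

Definition wins (i : nat) : R := if (i <= k)%N then Y k else if (i < m)%N then Y i else Y m.

Lemma sum_wins (g : R -> R) :
  k%:R * g (Y k) + \sum_(k.+1 <= i < m) g (Y i) + (N - m).+1%:R * g (Y m) =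
  \sum_(1 <= i < N.+1) g (wins i).
Proof.
rewrite (@big_cat_nat _ _ _ k.+1 1 N.+1)//=; last by rewrite ltnS (leq_trans (ltnW km)).
rewrite (@big_cat_nat _ _ _ m k.+1 N.+1)//=; last by rewrite (leq_trans mN).
rewrite addrA; congr (_ + _ + _).
- transitivity (\sum_(1 <= i < k.+1) g (Y k)); first by rewrite sumr_const_nat subn1 mulr_natl.
  by apply: eq_big_nat => i /andP[_ i2]; rewrite /wins -ltnS i2.
- apply: eq_big_nat => i /andP[i1 i2].
  by rewrite /wins leqNgt i1/= i2.
- transitivity (\sum_(m <= i < N.+1) g (Y m)); first by rewrite sumr_const_nat subSn// mulr_natl.
  apply: eq_big_nat => i /andP[i1 i2].
  by rewrite /wins leqNgt (leq_trans km i1)/= ltnNge i1.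
Qed.

Variables (a b mu eps D : R).
Hypotheses (ab : a <= b) (amu : a <= mu) (mub : mu <= b).
Local Notation W := (clipf a b).
Let da := Y k - a.
Let db := Y m - b.
Hypotheses (dae : `|da| <= eps) (dbe : `|db| <= eps).
Hypotheses (Dk : `|(cnt a)%:R - k%:R| <= D) (Dm : `|(cnt b)%:R - m%:R| <= D).

Let la i : R := ((i <= cnt a)%N : nat)%:R.
Let hi i : R := 1 - ((i <= cnt b)%N : nat)%:R.
(** Apart from shifting the two clipping levels by [da] and [db], winsorizing at ranks differs from
    clipping only for ranks between [k] and the count up to [a], or between [m.-1] and the count up
    to [b]; the predecessor occurs because rank [m] already belongs to the upper block. *)
Let E i := wins i - W (Y i) - da * la i - db * hi i.
Let eps0 : 0 <= eps. Proof. exact: le_trans dae. Qed.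
Let cab : (cnt a <= cnt b)%N.
Proof. by apply: sub_count => x /= h; exact: le_trans ab. Qed.

Let Ya i : (0 < i <= N)%N -> (Y i <= a) = (i <= cnt a)%N. Proof. exact: ostat_le. Qed.
Let Yb i : (0 < i <= N)%N -> (Y i <= b) = (i <= cnt b)%N. Proof. exact: ostat_le. Qed.

Let diff_le i : (0 < i <= N)%N -> `|wins i - W (Y i)| <= eps.
Proof.
move=> hi0; have /andP[i0 iN] := hi0.
have := dae; have := dbe; rewrite !ler_norml /da /db => /andP[b1 b2] /andP[a1 a2].
have e0 := eps0; have ab' := ab.
have kN : (k <= N)%N by exact: leq_trans (ltnW km) mN.
rewrite /wins /clipf; case: (leqP i k) => ik.
  have h : Y i <= Y k by apply: ostat_mono.
  by case: (leP (Y i) a) => h1; [|case: (leP (Y i) b) => h2]; apply/andP; split; lra.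
have h : Y k <= Y i by apply: ostat_mono => //; exact: ltnW.
case: (ltnP i m) => im.
  have h' : Y i <= Y m by apply: ostat_mono => //; exact: ltnW.
  by case: (leP (Y i) a) => h1; [|case: (leP (Y i) b) => h2]; apply/andP; split; lra.
have h' : Y m <= Y i by apply: ostat_mono => //; exact: (leq_trans k0 (ltnW km)).
by case: (leP (Y i) a) => h1; [|case: (leP (Y i) b) => h2]; apply/andP; split; lra.
Qed.

Let E_le i : (0 < i <= N)%N -> `|E i| <= 2 * eps *
  (`|((i <= cnt a)%N : nat)%:R - ((i <= k)%N : nat)%:R| +
   `|((i <= cnt b)%N : nat)%:R - ((i <= m.-1)%N : nat)%:R|).
Proof.
move=> hi0; have h := diff_le hi0; have ya := Ya hi0; have yb := Yb hi0; have e0 := eps0.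
have gen : `|E i| <= 2 * eps.
  rewrite /E -addrA -opprD (le_trans (ler_normB _ _))//.
  have -> : 2 * eps = eps + eps by ring.
  rewrite lerD//.
  rewrite /la /hi; case: (leqP i (cnt a)) => h1.
    by rewrite (leq_trans h1 cab) /= subrr mulr0 addr0 mulr1.
  by case: (leqP i (cnt b)) => h2 /=; rewrite ?subrr ?subr0 ?mulr0 ?mulr1 add0r ?normr0.
have m1 : (i <= m.-1)%N = (i < m)%N by rewrite -ltnS prednK// (leq_trans _ km).
rewrite m1; have [e1|e1] := eqVneq (i <= cnt a)%N (i <= k)%N; last first.
  apply: (le_trans gen); rewrite ler_peMr ?mulr_ge0//.
  apply: (@le_trans _ _ (1 + 0)); first by rewrite addr0.
  apply: lerD => //; move: e1; case: (_ <= _)%N; case: (_ <= _)%N => //= _.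
    by rewrite subr0 normr1.
  by rewrite sub0r normrN normr1.
have [e2|e2] := eqVneq (i <= cnt b)%N (i < m)%N; last first.
  apply: (le_trans gen); rewrite ler_peMr ?mulr_ge0//.
  apply: (@le_trans _ _ (0 + 1)); first by rewrite add0r.
  apply: lerD => //; move: e2; case: (_ <= _)%N; case: (_ < _)%N => //= _.
    by rewrite subr0 normr1.
  by rewrite sub0r normrN normr1.
rewrite e1 e2 !subrr normr0 addr0 mulr0.
rewrite /E /la /hi e1 e2 /wins /clipf ya yb e1 e2 /da /db.
case: (leqP i k) => ik /=.
  rewrite (leq_ltn_trans ik km) /=.
  by rewrite normr_le0; apply/eqP; ring.
by case: (ltnP i m) => im /=; rewrite normr_le0; apply/eqP; ring.
Qed.

Let sumE : \sum_(1 <= i < N.+1) `|E i| <= 2 * eps * (2 * D + 1).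
Proof.
have kN : (k <= N)%N by exact: leq_trans (ltnW km) mN.
have m1N : (m.-1 <= N)%N by exact: leq_trans (leq_pred _) mN.
apply: (@le_trans _ _ (\sum_(1 <= i < N.+1) (2 * eps *
  (`|((i <= cnt a)%N : nat)%:R - ((i <= k)%N : nat)%:R| +
   `|((i <= cnt b)%N : nat)%:R - ((i <= m.-1)%N : nat)%:R|)))).
  by apply: ler_sum_nat => i; rewrite ltnS; exact: E_le.
rewrite -mulr_sumr ler_wpM2l ?mulr_ge0// big_split/=.
rewrite !sum_leq_diff ?count_size//.
have -> : 2 * D + 1 = D + (D + 1) by ring.
rewrite lerD//.
have -> : (cnt b)%:R - m.-1%:R = ((cnt b)%:R - m%:R) + 1 :> R.
  by rewrite -[in m%:R](prednK (leq_trans (ltn0Sn k) km)) -natr1; ring.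
by rewrite (le_trans (ler_normD _ _))// lerD// normr1.
Qed.

Let SW := \sum_(x <- xs) (W x - mu).

Lemma wins_sum1 : `|\sum_(1 <= i < N.+1) (wins i - mu)| <= `|SW| + N%:R * eps.
Proof.
have -> : \sum_(1 <= i < N.+1) (wins i - mu) = SW + \sum_(1 <= i < N.+1) (wins i - W (Y i)).
  by rewrite /SW -(sum_ostat xs (fun x => W x - mu)) -big_split; apply: eq_bigr => i _ /=; ring.
rewrite (le_trans (ler_normD _ _))// lerD// (le_trans (ler_norm_sum _ _ _))//.
have -> : N%:R * eps = \sum_(1 <= i < N.+1) eps by rewrite sumr_const_nat subn1 mulr_natl.
by apply: ler_sum_nat => i; rewrite ltnS; exact: diff_le.
Qed.

(** Where a shift is active, [W] equals the corresponding level, so the cross terms with [da] and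
    [db] are exact; [E] and the squared differences make up the error. *)
Lemma wins_sum2 : `|\sum_(1 <= i < N.+1) (wins i - mu) ^+ 2 -
   (\sum_(x <- xs) (W x - mu) ^+ 2 + 2 * (a - mu) * da * (cnt a)%:R
     + 2 * (b - mu) * db * (N%:R - (cnt b)%:R))| <=
  4 * (b - a) * eps * (2 * D + 1) + N%:R * eps ^+ 2.
Proof.
rewrite -(sum_ostat xs (fun x => (W x - mu) ^+ 2)).
have e1 : (cnt a)%:R = \sum_(1 <= i < N.+1) la i :> R by rewrite sum_leq// count_size.
have e2 : N%:R - (cnt b)%:R = \sum_(1 <= i < N.+1) hi i :> R.
  by rewrite sumrB sum_leq ?count_size// sumr_const_nat subn1.
rewrite e1 e2 !mulr_sumr -!big_split -sumrB/=.
have key i : (0 < i <= N)%N ->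
  `|(wins i - mu) ^+ 2 - ((W (Y i) - mu) ^+ 2 + 2 * (a - mu) * da * la i + 2 * (b - mu) * db * hi i)|
   <= 2 * (b - a) * `|E i| + eps ^+ 2.
  move=> hi0; have ya := Ya hi0; have yb := Yb hi0.
  have Wa : (W (Y i) - a) * la i = 0.
    by rewrite /la /clipf ya; case: (_ <= _)%N; rewrite ?subrr ?mul0r ?mulr0.
  have Wb : (W (Y i) - b) * hi i = 0.
    rewrite /hi /clipf ya yb; case: (leqP i (cnt b)) => h; first by rewrite subrr mulr0.
    by rewrite leqNgt (leq_ltn_trans cab h)/= subrr mul0r.
  have -> : (wins i - mu) ^+ 2 - ((W (Y i) - mu) ^+ 2 + 2 * (a - mu) * da * la i + 2 * (b - mu) * db * hi i)
    = 2 * (W (Y i) - mu) * E i + (wins i - W (Y i)) ^+ 2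
      + 2 * da * ((W (Y i) - a) * la i) + 2 * db * ((W (Y i) - b) * hi i).
    by rewrite /E; ring.
  rewrite Wa Wb !mulr0 !addr0 (le_trans (ler_normD _ _))// lerD//.
    rewrite normrM ler_wpM2r// normrM normr_nat ler_wpM2l//.
    have h1 : a <= W (Y i) by rewrite /clipf; case: (leP (Y i) a) => // /ltW; case: ifP.
    have h2 : W (Y i) <= b by rewrite /clipf; case: (leP (Y i) a) => // _; case: (leP (Y i) b).
    have amu' := amu; have mub' := mub.
    by rewrite ler_norml; apply/andP; split; lra.
  by rewrite normrX lerXn2r ?nnegrE// diff_le.
apply: (le_trans (ler_norm_sum _ _ _)).
apply: (@le_trans _ _ (\sum_(1 <= i < N.+1) (2 * (b - a) * `|E i| + eps ^+ 2))).
  by apply: ler_sum_nat => i; rewrite ltnS => /key.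
have ee : \sum_(1 <= i < N.+1) eps ^+ 2 = N%:R * eps ^+ 2.
  by rewrite sumr_const_nat subn1 mulr_natl.
rewrite big_split/= -mulr_sumr ee lerD2r.
have -> : 4 * (b - a) * eps * (2 * D + 1) = 2 * (b - a) * (2 * eps * (2 * D + 1)) by ring.
by rewrite ler_wpM2l// mulr_ge0// subr_ge0.
Qed.

End SampleVariance.

(** A variance may be computed around any centre; the population value [mu] is chosen so that both
    sums become small fluctuations. *)
Lemma S2N_wins (R : realType) (alpha beta : R) (xs : seq R) (mu : R) :
  let N := size xs in let k := (ip alpha N).+1 in let m := ip beta N in
  (k < m)%N -> (m <= N)%N ->
  S2N alpha beta xs =
    (\sum_(1 <= i < N.+1) (wins xs k m i - mu) ^+ 2) / N%:R
    - ((\sum_(1 <= i < N.+1) (wins xs k m i - mu)) / N%:R) ^+ 2.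
Proof.
move=> N k m km mN; have N0 : (0 < N)%N by apply: leq_trans mN; exact: leq_trans km.
have NR : N%:R != 0 :> R by rewrite pnatr_eq0 -lt0n.
have S2 := sum_wins (xs := xs) km mN (fun y => y ^+ 2).
have S1 := sum_wins (xs := xs) km mN id.
have hm : hat_muW alpha beta xs = (\sum_(1 <= i < N.+1) wins xs k m i) / N%:R.
  by rewrite -S1 /hat_muW -/N -/k -/m; field.
have -> : S2N alpha beta xs = (\sum_(1 <= i < N.+1) wins xs k m i ^+ 2) / N%:R
    - hat_muW alpha beta xs ^+ 2.
  by rewrite -S2 /S2N -/N -/k -/m; field.
rewrite hm.
have -> : \sum_(1 <= i < N.+1) (wins xs k m i - mu) =
    \sum_(1 <= i < N.+1) wins xs k m i - N%:R * mu.
  by rewrite sumrB sumr_const_nat subn1 mulr_natl.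
have -> : \sum_(1 <= i < N.+1) (wins xs k m i - mu) ^+ 2 =
    \sum_(1 <= i < N.+1) wins xs k m i ^+ 2 - 2 * mu * \sum_(1 <= i < N.+1) wins xs k m i
    + N%:R * mu ^+ 2.
  have -> : N%:R * mu ^+ 2 = \sum_(1 <= i < N.+1) mu ^+ 2.
    by rewrite sumr_const_nat subn1 mulr_natl.
  by rewrite mulr_sumr -sumrB -big_split; apply: eq_bigr => i _ /=; ring.
by field.
Qed.

(** * Uniform orders of magnitude *)

Section OrderCalculus.
Context (R : realType) (C : Type) (D : C -> Prop) (t : C -> R).
Implicit Types (f g : C -> R) (k : int).

(** The relation [f = O(t ^ k)], uniform over the configurations in [D]; exponents are integers so
    that negative orders are covered, and [t >= 1] lets orders be raised. *)
Definition OO k f := exists M : R, forall c, D c -> `|f c| <= M * t c ^ k.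

Hypothesis t1 : forall c, D c -> 1 <= t c.

Lemma OO_tgt0 c k : D c -> 0 < t c ^ k.
Proof. by move=> Dc; rewrite exprz_gt0// (lt_le_trans ltr01)// t1. Qed.

Lemma OO_pos k f : OO k f -> exists M : R, 0 <= M /\ forall c, D c -> `|f c| <= M * t c ^ k.
Proof.
move=> [M hM]; exists `|M|; split=> // c Dc; apply: (le_trans (hM c Dc)).
by rewrite ler_wpM2r ?ler_norm// ltW// OO_tgt0.
Qed.

Lemma OO_le k k' f : k <= k' -> OO k f -> OO k' f.
Proof.
move=> kk /OO_pos[M [M0 hM]]; exists M => c Dc; apply: (le_trans (hM c Dc)).
by rewrite ler_wpM2l// ler_weXz2l// t1.
Qed.

Lemma OO_dom k f g : (forall c, D c -> `|f c| <= `|g c|) -> OO k g -> OO k f.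
Proof. by move=> h [M hM]; exists M => c Dc; apply: le_trans (h c Dc) (hM c Dc). Qed.

Lemma OO_eq k f g : (forall c, D c -> f c = g c) -> OO k g -> OO k f.
Proof. by move=> h; apply: OO_dom => c Dc; rewrite h. Qed.

Lemma OO_cst a : OO 0 (fun=> a).
Proof. by exists `|a| => c _; rewrite expr0z mulr1. Qed.

Lemma OO_bnd f a : (forall c, D c -> `|f c| <= a) -> OO 0 f.
Proof. by move=> h; exists a => c Dc; rewrite expr0z mulr1 h. Qed.

Lemma OO_t k : OO k (fun c => t c ^ k).
Proof. by exists 1 => c Dc; rewrite mul1r ger0_norm// ltW// OO_tgt0. Qed.

Lemma OO_D k1 k2 k f g : k1 <= k -> k2 <= k -> OO k1 f -> OO k2 g -> OO k (fun c => f c + g c).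
Proof.
move=> h1 h2 /(OO_le h1)[M hM] /(OO_le h2)[M' hM']; exists (M + M') => c Dc.
by rewrite mulrDl (le_trans (ler_normD _ _))// lerD ?hM ?hM'.
Qed.

Lemma OO_N k f : OO k f -> OO k (fun c => - f c).
Proof. by move=> [M hM]; exists M => c Dc; rewrite normrN hM. Qed.

Lemma OO_B k1 k2 k f g : k1 <= k -> k2 <= k -> OO k1 f -> OO k2 g -> OO k (fun c => f c - g c).
Proof. by move=> h1 h2 Hf Hg; apply: (OO_D h1 h2 Hf); exact: OO_N. Qed.

Lemma OO_M k1 k2 k f g : k1 + k2 <= k -> OO k1 f -> OO k2 g -> OO k (fun c => f c * g c).
Proof.
move=> h /OO_pos[M [M0 hM]] /OO_pos[M' [M'0 hM']]; apply: (OO_le h); exists (M * M') => c Dc.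
rewrite expfzDr; last by rewrite lt0r_neq0// (lt_le_trans ltr01)// t1.
by rewrite normrM mulrACA ler_pM ?hM ?hM'.
Qed.

Lemma OO_Z a k f : OO k f -> OO k (fun c => a * f c).
Proof. by apply: OO_M (OO_cst a); rewrite add0r. Qed.

Lemma OO_X2 k k' f : k + k <= k' -> OO k f -> OO k' (fun c => f c ^+ 2).
Proof. by move=> h Hf; under eq_fun do rewrite expr2; exact (OO_M h Hf Hf). Qed.

Lemma OO_norm k f : OO k f -> OO k (fun c => `|f c|).
Proof. by apply: OO_dom => c _; rewrite normr_id. Qed.

End OrderCalculus.

Lemma OO_sub (R : realType) (C : Type) (D D' : C -> Prop) (t : C -> R) k f :
  (forall c, D' c -> D c) -> OO D t k f -> OO D' t k f.
Proof. by move=> h [M hM]; exists M => c /h; exact: hM. Qed.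

Lemma half_le_of_close (R : realType) (u v s : R) : - u <= v - s -> u <= s / 2 -> s / 2 <= v.
Proof. lra. Qed.

Lemma sandwich_of_close (R : realType) (p q r u v e1 e2 : R) :
  `|p - q| <= e1 -> `|u - (v + r)| <= e2 ->
  (p <= u -> q - r <= v + (e1 + e2)) /\ (q - r <= v - (e1 + e2) -> p <= u).
Proof.
by rewrite !ler_norml => /andP[? ?] /andP[? ?]; split => ?; lra.
Qed.

(** * Deterministic expansion on regular samples *)

Section BahadurExpansion.
Context (R : realType).
Variables (alpha beta a b mab fa fb sigma : R).
Hypotheses (a0 : 0 < alpha) (ab : alpha < beta) (b1 : beta < 1) (xab : a < b)
  (fa0 : 0 < fa) (fb0 : 0 < fb) (sig0 : 0 < sigma).
Let mu := alpha * a + (beta - alpha) * mab + (1 - beta) * b.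
Hypotheses (amu : a <= mu) (mub : mu <= b).

Local Notation cfg := (seq R * R * R)%type.
Implicit Types (c : cfg).
Let xs c := c.1.1.
Let t c := c.1.2.
Let x c := c.2.
Let N c : R := (size (xs c))%:R.
Let Na c : R := (count (<= a) (xs c))%:R.
Let Nb c : R := (count (<= b) (xs c))%:R.
Let A c := Na c - alpha * N c.
Let B c := Nb c - beta * N c.
Let k0 c := ip alpha (size (xs c)).
Let m0 c := ip beta (size (xs c)).
Let Y c i := ostat (xs c) i.
Local Notation W := (clipf a b).
Let SW c := \sum_(y <- xs c) (W y - mu).

(* the influence function of the winsorized variance *)
Definition vfun (y : R) : R := (W y - mu) ^+ 2 - sigma ^+ 2
  - 2 * alpha * (a - mu) / fa * (((y <= a)%R : nat)%:R - alpha)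
  - 2 * (1 - beta) * (b - mu) / fb * (((y <= b)%R : nat)%:R - beta).
Let SV c := \sum_(y <- xs c) vfun y.

(* The sample size is [t ^ 16], so that the square root of the sample size is [t ^ 8]; powers
   of [t] thus replace fractional powers of the sample size. *)
Definition regular c : Prop :=
  [/\ 1 <= t c, N c = t c ^ 16%Z, 4 <= (beta - alpha) * N c & `|x c| <= t c] /\
  [/\ `|A c| <= t c ^ 9%Z, `|B c| <= t c ^ 9%Z, `|SW c| <= t c ^ 9%Z & `|SV c| <= t c ^ 9%Z] /\
  (forall i, (0 < i <= size (xs c))%N -> `|i%:R - Na c| <= 3 * t c ^ 9%Z ->
    `|Y c i - a - (i%:R - Na c) / (N c * fa)| <= t c ^ (-10)%Z) /\
  (forall i, (0 < i <= size (xs c))%N -> `|i%:R - Nb c| <= 3 * t c ^ 9%Z ->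
    `|Y c i - b - (i%:R - Nb c) / (N c * fb)| <= t c ^ (-10)%Z).

Local Notation O := (OO regular t).
Let t1 c : regular c -> 1 <= t c. Proof. by case=> -[]. Qed.
Let t0 c : regular c -> 0 < t c. Proof. by move=> /t1; exact: lt_le_trans. Qed.
Let N0 c : regular c -> 0 < N c.
Proof. by move=> rc; have [[_ -> _ _] _] := rc; rewrite exprz_gt0// t0. Qed.
Let ON : O 16%Z N.
Proof. by apply: (OO_eq (g := fun c => t c ^ 16%Z)) (OO_t t1 _) => c [[_ -> _ _] _]. Qed.
Let ONV : O (-16)%Z (fun c => (N c)^-1).
Proof.
apply: (OO_eq (g := fun c => t c ^ (-16)%Z)) (OO_t t1 _) => c [[_ -> _ _] _].
by rewrite invr_expz.
Qed.
Let Ox : O 1%Z x.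
Proof. by exists 1 => c [[_ _ _ h] _]; rewrite mul1r expr1z. Qed.
Let OA : O 9%Z A. Proof. by exists 1 => c [_ [[h _ _ _] _]]; rewrite mul1r. Qed.
Let OB : O 9%Z B. Proof. by exists 1 => c [_ [[_ h _ _] _]]; rewrite mul1r. Qed.
Let OSW : O 9%Z SW. Proof. by exists 1 => c [_ [[_ _ h _] _]]; rewrite mul1r. Qed.
Let OSV : O 9%Z SV. Proof. by exists 1 => c [_ [[_ _ _ h] _]]; rewrite mul1r. Qed.

Let b0 : 0 < beta. Proof. exact: lt_trans ab. Qed.
Let ipP (nu : R) n : 0 < nu -> (ip nu n)%:R <= nu * n%:R /\ nu * n%:R < (ip nu n)%:R + 1.
Proof.
move=> nu0; have /truncn_itv/andP[h1 h2] : 0 <= nu * n%:R by rewrite mulr_ge0// ltW.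
by rewrite h1 -natr1 in h2 *.
Qed.

Let ra c := alpha * N c - (k0 c)%:R.
Let rb c := beta * N c - (m0 c)%:R.
Let ra1 c : 0 <= ra c <= 1.
Proof. by have [h1 h2] := ipP (size (xs c)) a0; rewrite /ra/N/k0; apply/andP; split; lra. Qed.
Let rb1 c : 0 <= rb c <= 1.
Proof. by have [h1 h2] := ipP (size (xs c)) b0; rewrite /rb/N/m0; apply/andP; split; lra. Qed.
Let Ora : O 0 ra.
Proof. by apply: (@OO_bnd _ _ _ _ _ 1) => c _; have /andP[h1 h2] := ra1 c; rewrite ger0_norm. Qed.
Let Orb : O 0 rb.
Proof. by apply: (@OO_bnd _ _ _ _ _ 1) => c _; have /andP[h1 h2] := rb1 c; rewrite ger0_norm. Qed.

Let m_le c : (m0 c <= size (xs c))%N.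
Proof.
have [h _] := ipP (size (xs c)) b0; rewrite -(ler_nat R) (le_trans h)//.
by rewrite ler_piMl// ltW.
Qed.
Let km c : regular c -> ((k0 c).+1 < m0 c)%N.
Proof.
move=> [[_ _ h _] _]; have [h1 _] := ipP (size (xs c)) a0.
have [_ h2] := ipP (size (xs c)) b0; move: h h1 h2; rewrite /N /k0 /m0 => h h1 h2.
by rewrite -(ltr_nat R) -natr1; lra.
Qed.

Let t9_ge1 c : regular c -> 1 <= t c ^ 9%Z.
Proof. by move=> rc; rewrite -(expr0z (t c)) ler_weXz2l// t1. Qed.

(** Stated once for both levels. All ranks between [kx] and the count are within [3 t ^ 9] of the
    count, where the order statistics are linear up to [t ^ -10]; order [t ^ 9] of such errors add
    up to [t ^ -1]. Replacing the integer [kx] by [u N] costs the same order. *)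
Let Oexc (u xi fx : R) (Nx Ax rx : cfg -> R) (kx : cfg -> nat) :
  0 < fx -> (forall c, Nx c = (count (<= xi) (xs c))%:R) ->
  (forall c, Ax c = Nx c - u * N c) -> (forall c, rx c = u * N c - (kx c)%:R) ->
  O 9%Z Ax -> (forall c, regular c -> `|Ax c| <= t c ^ 9%Z) -> (forall c, 0 <= rx c <= 1) ->
  (forall c, kx c <= size (xs c))%N ->
  (forall c i, regular c -> (0 < i <= size (xs c))%N -> `|i%:R - Nx c| <= 3 * t c ^ 9%Z ->
    `|Y c i - xi - (i%:R - Nx c) / (N c * fx)| <= t c ^ (-10)%Z) ->
  O (-1)%Z (fun c => excess (xs c) (kx c) xi - Ax c ^+ 2 / (2 * N c * fx)).
Proof.
move=> fx0 NxE AxE rxE OAx Axb rx01 kxN HY.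
have Orx : O 0 rx.
  by apply: (@OO_bnd _ _ _ _ _ 1) => c _; have /andP[h1 h2] := rx01 c; rewrite ger0_norm.
have OD : O 9%Z (fun c => Nx c - (kx c)%:R).
  apply: (OO_eq (g := fun c => Ax c + rx c)); first by move=> c _; rewrite AxE rxE; ring.
  exact: (OO_D t1 _ _ OAx Orx).
have O1 : O (-1)%Z (fun c => (Nx c - (kx c)%:R) * (t c ^ (-10)%Z + fx^-1 * (N c)^-1)).
  apply: (OO_M t1 (k1 := 9%Z) (k2 := (-10)%Z)) OD _ => //.
  by apply: (OO_D t1 _ _ (OO_t t1 (-10)%Z) (OO_Z t1 fx^-1 ONV)).
have O2 : O (-1)%Z (fun c => (2 * fx)^-1 * (rx c * (2 * Ax c + rx c) * (N c)^-1)).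
  apply: (OO_Z t1); apply: (OO_M t1 (k1 := 9%Z)) ONV => //.
  have O3 : O 9%Z (fun c => 2 * Ax c + rx c) by apply: (OO_D t1 _ _ (OO_Z t1 2 OAx) Orx).
  by apply: (OO_M t1 (k1 := 0) (k2 := 9%Z)) O3.
apply: (OO_eq (g := fun c => (excess (xs c) (kx c) xi - (Nx c - (kx c)%:R) ^+ 2 / (2 * (N c * fx)))
  + (2 * fx)^-1 * (rx c * (2 * Ax c + rx c) * (N c)^-1))).
  move=> c rc; have -> : Nx c - (kx c)%:R = Ax c + rx c by rewrite AxE rxE; ring.
  by field; rewrite !lt0r_neq0// N0.
apply: (OO_D t1 _ _ _ O2) => //.
apply: OO_dom O1 => c rc.
have M0 : 0 < N c * fx by rewrite mulr_gt0// N0.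
have := @excess_quad R (xs c) (kx c) xi (N c * fx) (t c ^ (-10)%Z) (kxN c) M0.
rewrite -NxE => h; rewrite normrM.
have -> : `|t c ^ (-10)%Z + fx^-1 * (N c)^-1| = t c ^ (-10)%Z + 1 / (N c * fx).
  rewrite ger0_norm; first by rewrite mul1r invfM; ring.
  have n0 := ltW (N0 rc); have tt := ltW (t0 rc); have ff := ltW fx0.
  by apply: addr_ge0; [exact: exprz_ge0 | apply: mulr_ge0; rewrite invr_ge0].
apply: h => i hi hm; apply: (HY _ _ rc) => //.
have t9 := t9_ge1 rc; have Ab := Axb _ rc; have := rx01 c => /andP[r0 r1].
have : `|i%:R - Nx c| <= `|Nx c - (kx c)%:R|.
  move: hm => /andP[]; rewrite NxE; set q := count _ _; case: (leqP (kx c) q) => hq g1 g2.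
    rewrite ler0_norm ?subr_le0 ?ler_nat// ger0_norm ?subr_ge0 ?ler_nat//.
    by rewrite opprB lerD2l lerN2 ler_nat.
  rewrite ger0_norm ?subr_ge0 ?ler_nat// ler0_norm ?subr_le0 ?ler_nat//; last exact: ltnW.
  by rewrite opprB lerD2r ler_nat.
move=> /le_trans; apply.
have -> : Nx c - (kx c)%:R = Ax c + rx c by rewrite AxE rxE; ring.
rewrite (le_trans (ler_normD _ _))// [`|rx c|]ger0_norm//; lra.
Qed.

Let Oexa : O (-1)%Z (fun c => excess (xs c) (k0 c) a - A c ^+ 2 / (2 * N c * fa)).
Proof.
apply: (Oexc (u := alpha) (Nx := Na) (rx := ra)) => //.
- by move=> c [_ [[]]].
- by move=> c; rewrite (leq_trans _ (m_le c))//; apply: le_truncn; rewrite ler_wpM2r// ltW.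
- by move=> c i [_ [_ [h _]]]; exact: h.
Qed.

Let Oexb : O (-1)%Z (fun c => excess (xs c) (m0 c) b - B c ^+ 2 / (2 * N c * fb)).
Proof.
apply: (Oexc (u := beta) (Nx := Nb) (rx := rb)) => //.
- by move=> c [_ [[]]].
- by move=> c i [_ [_ [_ h]]]; exact: h.
Qed.

Let TT c := t c ^ (-8)%Z * \sum_((k0 c).+1 <= i < (m0 c).+1) (Y c i - mab).
Let Q c := t c ^ (-8)%Z * (ra c * (a - mab) - rb c * (b - mab)
  - A c ^+ 2 / (2 * N c * fa) + B c ^+ 2 / (2 * N c * fb)).

(** Up to the two excess errors of order [t ^ -1] this is an identity; the normalization by the root
    of the sample size brings [t ^ -8]. *)
Lemma trimmed_expansion : O (-9)%Z (fun c => TT c - (t c ^ (-8)%Z * SW c + Q c)).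
Proof.
apply: (OO_eq (g := fun c => t c ^ (-8)%Z *
  ((excess (xs c) (m0 c) b - B c ^+ 2 / (2 * N c * fb)) -
   (excess (xs c) (k0 c) a - A c ^+ 2 / (2 * N c * fa))))).
  move=> c rc; rewrite /TT /Q -mulrDr -mulrBr; congr (_ * _).
  have kmc := ltnW (ltnW (km rc)).
  have -> : \sum_((k0 c).+1 <= i < (m0 c).+1) (Y c i - mab) =
     \sum_((k0 c).+1 <= i < (m0 c).+1) Y c i - ((m0 c)%:R - (k0 c)%:R) * mab.
    by rewrite sumrB; congr (_ - _); rewrite sumr_const_nat subSS -natrB// mulr_natl.
  rewrite (trimmed_sum kmc (m_le c) (ltW xab)) natrB ?m_le//.
  have -> : \sum_(y <- xs c) W y = SW c + N c * mu.
    rewrite /SW sumrB big_const_seq count_predT iter_addr_0 /N mulr_natl; ring.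
  rewrite /ra /rb /mu /N; ring.
apply: (OO_M t1 (k1 := (-8)%Z) (k2 := (-1)%Z)) (OO_t t1 _) _ => //.
by apply: (OO_B t1 _ _ Oexb Oexa).
Qed.

Let k c := (k0 c).+1.
Let da c := Y c (k c) - a.
Let db c := Y c (m0 c) - b.
Let kN c : regular c -> (0 < k c <= size (xs c))%N.
Proof. by move=> rc; rewrite /= (leq_trans (ltnW (km rc)) (m_le c)). Qed.
Let mN c : regular c -> (0 < m0 c <= size (xs c))%N.
Proof. by move=> rc; rewrite m_le (leq_trans _ (km rc)). Qed.

Let Oka : O 9%Z (fun c => (k c)%:R - Na c).
Proof.
apply: (OO_eq (g := fun c => 1 - ra c - A c)).
  by move=> c _; rewrite /k /ra /A -natr1; ring.
by apply: (OO_B t1 (k1 := 0)) OA => //; apply: (OO_B t1 (k1 := 0)) Ora => //; exact: OO_cst.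
Qed.
Let Omb : O 9%Z (fun c => (m0 c)%:R - Nb c).
Proof.
apply: (OO_eq (g := fun c => - rb c - B c)); first by move=> c _; rewrite /rb /B; ring.
by apply: (OO_B t1 (k1 := 0)) OB => //; exact: OO_N.
Qed.

Let ka_bnd c : regular c -> `|(k c)%:R - Na c| <= 3 * t c ^ 9%Z.
Proof.
move=> rc; have t9 := t9_ge1 rc; have [_ [[h _ _ _] _]] := rc; have /andP[h1 h2] := ra1 c.
have -> : (k c)%:R - Na c = (1 - ra c) - A c by rewrite /k /ra /A -natr1; ring.
rewrite (le_trans (ler_normB _ _))// [`|1 - _|]ger0_norm ?subr_ge0//; lra.
Qed.
Let mb_bnd c : regular c -> `|(m0 c)%:R - Nb c| <= 3 * t c ^ 9%Z.
Proof.
move=> rc; have t9 := t9_ge1 rc; have [_ [[_ h _ _] _]] := rc; have /andP[h1 h2] := rb1 c.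
have -> : (m0 c)%:R - Nb c = - rb c - B c by rewrite /rb /B; ring.
rewrite (le_trans (ler_normB _ _))// normrN [`|rb c|]ger0_norm//; lra.
Qed.

Let Oda1 : O (-10)%Z (fun c => da c - ((k c)%:R - Na c) / (N c * fa)).
Proof. by exists 1 => c rc; rewrite mul1r; have [_ [_ [h _]]] := rc; exact: h (kN rc) (ka_bnd rc). Qed.
Let Odb1 : O (-10)%Z (fun c => db c - ((m0 c)%:R - Nb c) / (N c * fb)).
Proof. by exists 1 => c rc; rewrite mul1r; have [_ [_ [_ h]]] := rc; exact: h (mN rc) (mb_bnd rc). Qed.
Let Oda : O (-7)%Z da.
Proof.
apply: (OO_eq (g := fun c => (da c - ((k c)%:R - Na c) / (N c * fa)) +
   fa^-1 * (((k c)%:R - Na c) * (N c)^-1))).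
  by move=> c rc; field; rewrite !lt0r_neq0// N0.
apply: (OO_D t1 _ _ Oda1) => //; last by apply: (OO_Z t1); apply: (OO_M t1 _ Oka ONV).
Qed.
Let Odb : O (-7)%Z db.
Proof.
apply: (OO_eq (g := fun c => (db c - ((m0 c)%:R - Nb c) / (N c * fb)) +
   fb^-1 * (((m0 c)%:R - Nb c) * (N c)^-1))).
  by move=> c rc; field; rewrite !lt0r_neq0// N0.
apply: (OO_D t1 _ _ Odb1) => //; last by apply: (OO_Z t1); apply: (OO_M t1 _ Omb ONV).
Qed.

Let S2 c := S2N alpha beta (xs c).
Let U1 c := \sum_(1 <= i < (size (xs c)).+1) (wins (xs c) (k c) (m0 c) i - mu).
Let U2 c := \sum_(1 <= i < (size (xs c)).+1) (wins (xs c) (k c) (m0 c) i - mu) ^+ 2.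
Let SW2 c := \sum_(y <- xs c) (W y - mu) ^+ 2.

Let eps c := `|da c| + `|db c|.
Let Oeps : O (-7)%Z eps.
Proof. by apply: (OO_D t1 _ _ (OO_norm Oda) (OO_norm Odb)). Qed.
Let D9 c := 3 * t c ^ 9%Z.
Let OD9 : O 9%Z D9. Proof. exact: (OO_Z t1 3 (OO_t t1 9%Z)). Qed.

Let OU1 : O 9%Z U1.
Proof.
apply: (OO_dom (g := fun c => `|SW c| + N c * eps c)) => [c rc|].
  have e1 : `|da c| <= eps c by rewrite lerDl.
  have e2 : `|db c| <= eps c by rewrite lerDr.
  have := wins_sum1 (isT : (0 < k c)%N) (km rc) (m_le c) mu (ltW xab) e1 e2.
  move=> /le_trans; apply; rewrite ler_norm//.
by apply: (OO_D t1 _ _ (OO_norm OSW) (OO_M t1 (k := 9%Z) _ ON Oeps)).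
Qed.

Let OU2 : O 2%Z (fun c => U2 c - (SW2 c + 2 * (a - mu) * da c * Na c
   + 2 * (b - mu) * db c * (N c - Nb c))).
Proof.
apply: (OO_dom (g := fun c => 4 * (b - a) * (eps c * (2 * D9 c + 1)) + N c * eps c ^+ 2)) => [c rc|].
  have e1 : `|da c| <= eps c by rewrite lerDl.
  have e2 : `|db c| <= eps c by rewrite lerDr.
  have d1 : `|(count (<= a) (xs c))%:R - (k c)%:R| <= D9 c by rewrite distrC; exact: ka_bnd.
  have d2 : `|(count (<= b) (xs c))%:R - (m0 c)%:R| <= D9 c by rewrite distrC; exact: mb_bnd.
  have := wins_sum2 (isT : (0 < k c)%N) (km rc) (m_le c) (ltW xab) amu mub e1 e2 d1 d2.
  by move=> /le_trans; apply; rewrite -(mulrA (4 * (b - a))) ler_norm.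
apply: (OO_D t1 (k1 := 2%Z) (k2 := 2%Z)) => //.
  apply: (OO_Z t1); apply: (OO_M t1 (k1 := (-7)%Z) (k2 := 9%Z)) Oeps _ => //.
  by apply: (OO_D t1 _ _ (OO_Z t1 2 OD9) (OO_cst _ _ 1)).
apply: (OO_M t1 (k1 := 16%Z) (k2 := (-14)%Z)) ON _ => //.
exact: (OO_X2 t1 _ Oeps).
Qed.

Let SVE c : SV c = SW2 c - N c * sigma ^+ 2 - 2 * alpha * (a - mu) / fa * A c
  - 2 * (1 - beta) * (b - mu) / fb * B c.
Proof.
rewrite /SV /vfun !sumrB -!mulr_sumr !sumrB.
have cs (u : R) : \sum_(y <- xs c) u = N c * u.
  by rewrite big_const_seq count_predT iter_addr_0 /N mulr_natl.
have ci u : \sum_(y <- xs c) ((y <= u)%R : nat)%:R = (count (<= u) (xs c))%:R :> R.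
  by rewrite count_sum natr_sum.
by rewrite !cs !ci /A /B /Na /Nb /SW2; ring.
Qed.

(** The displacements [da] and [db] of the two extreme order statistics enter linearly, with weights
    close to [alpha N] and [(1 - beta) N]. Inserting their linear expressions [- A / (N fa)] and
    [- B / (N fb)] produces the indicator terms of [vfun]. *)
Lemma variance_expansion : O (-10)%Z (fun c => S2 c - sigma ^+ 2 - SV c / N c).
Proof.
apply: (OO_eq (g := fun c => (N c)^-1 * ((U2 c - (SW2 c + 2 * (a - mu) * da c * Na c
   + 2 * (b - mu) * db c * (N c - Nb c)))
   + (2 * (a - mu)) * (da c * A c) - (2 * (b - mu)) * (db c * B c)
   + (2 * (a - mu) * alpha) * (N c * (da c - ((k c)%:R - Na c) / (N c * fa)))
   + (2 * (b - mu) * (1 - beta)) * (N c * (db c - ((m0 c)%:R - Nb c) / (N c * fb)))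
   + (2 * (a - mu) * alpha / fa) * (1 - ra c)
   - (2 * (b - mu) * (1 - beta) / fb) * rb c) - (U1 c * (N c)^-1) ^+ 2)).
  move=> c rc; rewrite /S2 (S2N_wins mu (km rc) (m_le c)) -/(U1 c) -/(U2 c) SVE.
  have -> : ra c = alpha * N c - ((k c)%:R - 1) by rewrite /ra /k -natr1; ring.
  rewrite /rb /A /B; field; rewrite ?lt0r_neq0// N0//.
apply: (OO_B t1 (k1 := (-10)%Z) (k2 := (-14)%Z)) => //; last first.
  by apply: (OO_X2 t1 (k := (-7)%Z)) => //; apply: (OO_M t1 _ OU1 ONV).
apply: (OO_M t1 (k1 := (-16)%Z) (k2 := 6%Z)) ONV _ => //.
have OdA : O 2%Z (fun c => da c * A c) by apply: (OO_M t1 _ Oda OA).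
have OdB : O 2%Z (fun c => db c * B c) by apply: (OO_M t1 _ Odb OB).
have Oa6 : O 6%Z (fun c => N c * (da c - ((k c)%:R - Na c) / (N c * fa))).
  by apply: (OO_M t1 _ ON Oda1).
have Ob6 : O 6%Z (fun c => N c * (db c - ((m0 c)%:R - Nb c) / (N c * fb))).
  by apply: (OO_M t1 _ ON Odb1).
apply: (OO_B t1 (k1 := 6%Z) (k2 := 0)) => //; last exact: (OO_Z t1 _ Orb).
apply: (OO_D t1 (k1 := 6%Z) (k2 := 0)) => //; last first.
  by apply: (OO_Z t1); apply: (OO_B t1 _ _ (OO_cst _ _ 1) Ora).
apply: (OO_D t1 (k1 := 6%Z) (k2 := 6%Z)) => //; last exact: (OO_Z t1 _ Ob6).
apply: (OO_D t1 (k1 := 6%Z) (k2 := 6%Z)) => //; last exact: (OO_Z t1 _ Oa6).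
apply: (OO_B t1 (k1 := 2%Z) (k2 := 2%Z)) => //; last exact: (OO_Z t1 _ OdB).
apply: (OO_D t1 (k1 := 2%Z) (k2 := 2%Z)) => //; exact: (OO_Z t1 _ OdA).
Qed.

Let S c := SN alpha beta (xs c).
Let positive c := regular c /\ sigma ^+ 2 / 2 <= S2 c.
Local Notation Op := (OO positive t).
Let pr c : positive c -> regular c. Proof. by case. Qed.
Let pt1 c : positive c -> 1 <= t c. Proof. by move=> /pr; exact: t1. Qed.

Let S_ge0 c : 0 <= S c. Proof. exact: sqrtr_ge0. Qed.
Let S_sq c : positive c -> S c ^+ 2 = S2 c.
Proof.
by move=> [_ h]; rewrite sqr_sqrtr// (le_trans _ h)// divr_ge0// sqr_ge0.
Qed.

Let OS2 : Op (-7)%Z (fun c => S2 c - sigma ^+ 2).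
Proof.
apply: (OO_sub pr); apply: (OO_eq (g := fun c => (S2 c - sigma ^+ 2 - SV c / N c) + SV c * (N c)^-1)).
  by move=> c _; ring.
by apply: (OO_D t1 _ _ variance_expansion (OO_M t1 (k := (-7)%Z) _ OSV ONV)).
Qed.

Let OS1 : Op (-7)%Z (fun c => S c - sigma).
Proof.
apply: (OO_dom (g := fun c => sigma^-1 * (S2 c - sigma ^+ 2))); last exact: (OO_Z pt1).
move=> c pc; rewrite -S_sq// subr_sqr !normrM mulrCA; apply: ler_peMr => //.
have s0' := ltW sig0; have S0 := S_ge0 c.
rewrite [`|sigma^-1|]ger0_norm ?invr_ge0// [`|S c + _|]ger0_norm ?addr_ge0//.
by rewrite mulrDr mulVf ?lt0r_neq0// lerDr mulr_ge0// invr_ge0.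
Qed.

(** The identity [2 sigma (S - sigma) = (S ^ 2 - sigma ^ 2) - (S - sigma) ^ 2] linearizes the
    root. *)
Let OS : Op (-10)%Z (fun c => S c - sigma - SV c / (2 * sigma * N c)).
Proof.
apply: (OO_eq (g := fun c => (2 * sigma)^-1 * ((S2 c - sigma ^+ 2 - SV c / N c) - (S c - sigma) ^+ 2))).
  move=> c pc; rewrite -S_sq//; field; rewrite !lt0r_neq0//; exact: N0 (pr pc).
apply: (OO_Z pt1); apply: (OO_B pt1 (k1 := (-10)%Z) (k2 := (-14)%Z)) => //.
  exact: (OO_sub pr variance_expansion).
exact: (OO_X2 pt1 _ OS1).
Qed.

(** The trimmed mean divides by the integer number of retained observations, the standardization by
    [beta - alpha]; the quotient is [1 + O(1 / N)]. *)
Let ratio c := ((m0 c)%:R - (k0 c)%:R) / ((beta - alpha) * N c).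
Let Oratio : Op (-16)%Z (fun c => ratio c - 1).
Proof.
apply: (OO_sub pr); apply: (OO_eq (g := fun c => (beta - alpha)^-1 * ((ra c - rb c) * (N c)^-1))).
  move=> c rc; rewrite /ratio /ra /rb; field; rewrite lt0r_neq0 ?N0//= lt0r_neq0// subr_gt0//.
by apply: (OO_Z t1); apply: (OO_M t1 (k1 := 0)) ONV => //; apply: (OO_B t1 _ _ Ora Orb).
Qed.

Lemma threshold_expansion :
  Op (-9)%Z (fun c => x c * S c * ratio c - (x c * sigma + x c * SV c / (2 * sigma * N c))).
Proof.
have pOx := OO_sub pr Ox.
apply: (OO_eq (g := fun c => x c * (S c - sigma - SV c / (2 * sigma * N c))
  + x c * (((S c - sigma) + sigma) * (ratio c - 1)))).
  by move=> c _; rewrite subrK; ring.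
apply: (OO_D pt1 (k1 := (-9)%Z) (k2 := (-15)%Z)) => //.
  exact: (OO_M pt1 _ pOx OS).
apply: (OO_M pt1 (k1 := 1%Z) (k2 := (-16)%Z)) pOx _ => //.
apply: (OO_M pt1 (k1 := 0%Z) (k2 := (-16)%Z)) _ Oratio => //.
by apply: (OO_D pt1 _ _ OS1 (OO_cst _ _ sigma)).
Qed.

Definition studentized (xs : seq R) : R :=
  Num.sqrt (size xs)%:R * (trimmed_mean alpha beta xs - mab)
    / ((beta - alpha)^-1 * SN alpha beta xs).

Lemma studentized_le c : positive c ->
  (studentized (xs c) <= x c) = (TT c <= x c * S c * ratio c).
Proof.
move=> pc; have rc := pr pc; have Nc := N0 rc; have kmc := km rc.
have S0 : 0 < S c.
  by rewrite sqrtr_gt0; have [_ h] := pc; apply: lt_le_trans h; rewrite divr_gt0// exprn_gt0.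
have d0 : 0 < (m0 c)%:R - (k0 c)%:R :> R by rewrite subr_gt0 ltr_nat; exact: ltn_trans kmc.
have ba : 0 < beta - alpha by rewrite subr_gt0.
have t80 : 0 < t c ^ 8%Z by rewrite exprz_gt0// t0.
have NE : N c = t c ^ 8%Z * t c ^ 8%Z.
  by have [[_ -> _ _] _] := rc; rewrite -expfzDr// lt0r_neq0// t0.
have sq : Num.sqrt (size (xs c))%:R = t c ^ 8%Z.
  by rewrite -/(N c) NE -expr2 sqrtr_sqr ger0_norm// ltW.
rewrite /studentized sq.
have -> : trimmed_mean alpha beta (xs c) - mab =
   (\sum_((k0 c).+1 <= i < (m0 c).+1) (Y c i - mab)) / ((m0 c)%:R - (k0 c)%:R).
  have le : (k0 c <= m0 c)%N by exact: ltnW (ltnW kmc).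
  have -> : \sum_((k0 c).+1 <= i < (m0 c).+1) (Y c i - mab) =
     \sum_((k0 c).+1 <= i < (m0 c).+1) Y c i - ((m0 c)%:R - (k0 c)%:R) * mab.
    by rewrite sumrB; congr (_ - _); rewrite sumr_const_nat subSS -natrB// mulr_natl.
  rewrite /trimmed_mean -/(k0 c) -/(m0 c) natrB//; field.
  by rewrite lt0r_neq0.
set Sm := \sum_(_ <= i < _) _.
have -> : TT c = t c ^ (-8)%Z * Sm by [].
have -> : t c ^ (-8)%Z = (t c ^ 8%Z)^-1 by rewrite invr_expz.
rewrite -/(S c) /ratio NE; set T8 := t c ^ 8%Z in t80 *; set d := _ - _ in d0 *.
rewrite ler_pdivrMr; last by rewrite mulr_gt0// invr_gt0.
have -> : T8 * (Sm / d) = (T8^-1 * Sm) * (T8 * T8 / d) by field; rewrite !lt0r_neq0.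
rewrite -ler_pdivlMr; last by rewrite divr_gt0// mulr_gt0.
congr (_ <= _); field; rewrite !lt0r_neq0//.
Qed.

Lemma bahadur : exists C T0 : R, [/\ 0 <= C, 1 <= T0 & forall c, regular c -> T0 <= t c ->
  let G := t c ^ (-8)%Z * SW c + Q c - x c * SV c / (2 * sigma * N c) in
  (studentized (xs c) <= x c -> G <= x c * sigma + C * t c ^ (-9)%Z) /\
  (G <= x c * sigma - C * t c ^ (-9)%Z -> studentized (xs c) <= x c)].
Proof.
have OS2r : O (-7)%Z (fun c => S2 c - sigma ^+ 2).
  apply: (OO_eq (g := fun c => (S2 c - sigma ^+ 2 - SV c / N c) + SV c * (N c)^-1)).
    by move=> c _; ring.
  by apply: (OO_D t1 _ _ variance_expansion (OO_M t1 (k := (-7)%Z) _ OSV ONV)).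
have [M [M0 hM]] := OO_pos t1 OS2r.
have [C1 [C10 h1]] := OO_pos t1 trimmed_expansion.
have [C2 [C20 h2]] := OO_pos pt1 threshold_expansion.
exists (C1 + C2), (1 + 2 * M / sigma ^+ 2); split; first exact: addr_ge0.
  by rewrite lerDl; apply: divr_ge0; [exact: mulr_ge0 | exact: sqr_ge0].
move=> c rc Tc G; have tc := t0 rc.
have s2 : 0 < sigma ^+ 2 by rewrite exprn_gt0.
have pc : positive c.
  split=> //; have hh := hM c rc.
  have : M * t c ^ (-7)%Z <= sigma ^+ 2 / 2.
    apply: (@le_trans _ _ (M * t c ^ (-1)%Z)).
      by rewrite ler_wpM2l// ler_weXz2l// t1.
    have -> : t c ^ (-1)%Z = (t c)^-1 by [].
    rewrite ler_pdivrMr//.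
    have : 2 * M / sigma ^+ 2 <= t c by apply: le_trans Tc; rewrite lerDr.
    rewrite ler_pdivrMr// => h; rewrite mulrAC ler_pdivlMr//.
    by rewrite mulrC [_ ^+ 2 * _]mulrC.
  by move: hh; rewrite ler_norml => /andP[g _] g2; exact: half_le_of_close g g2.
have {}h1 := h1 c rc; have {}h2 := h2 c pc.
rewrite studentized_le//.
have -> : (C1 + C2) * t c ^ (-9)%Z = C1 * t c ^ (-9)%Z + C2 * t c ^ (-9)%Z by rewrite mulrDl.
by have [g1 g2] := sandwich_of_close h1 h2; split.
Qed.

End BahadurExpansion.

(** * The exceptional event *)

(** The inequality [expR u >= u] at [u = rho t / n], raised to the power [n]. *)
Lemma expR_decay (R : realType) (n : nat) (rho t : R) : (0 < n)%N -> 0 < rho -> 0 < t ->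
  expR (- rho * t) <= (n%:R / rho) ^+ n / t ^+ n.
Proof.
move=> n0 r0 t0; have nR : 0 < n%:R :> R by rewrite ltr0n.
have q0 : 0 < rho * t / n%:R by rewrite divr_gt0// mulr_gt0.
have -> : (n%:R / rho) ^+ n / t ^+ n = ((rho * t / n%:R) ^+ n)^-1.
  by rewrite -expr_div_n -exprVn; congr (_ ^+ _); field; rewrite !lt0r_neq0.
rewrite mulNr expRN lef_pV2 ?posrE ?expR_gt0 ?exprn_gt0//.
have -> : rho * t = n%:R * (rho * t / n%:R) by field; rewrite lt0r_neq0.
rewrite expRM_natl lerXn2r ?nnegrE ?expR_ge0//.
- have -> : n%:R * (rho * t / n%:R) / n%:R = rho * t / n%:R by field; rewrite lt0r_neq0.
  exact: ltW.
- have -> : n%:R * (rho * t / n%:R) / n%:R = rho * t / n%:R by field; rewrite lt0r_neq0.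
  by rewrite (le_trans _ (expR_ge1Dx _))// lerDr.
Qed.

Section GoodEvent.
Context d (T : measurableType d) (R : realType) (P : probability T R).
Variable X : nat -> {RV P >-> R}.
Hypothesis hind : mutually_independent P (fun i => (X i : T -> R)).
Hypothesis hid : forall i x,
  fine (P [set w | X i w <= x]) = fine (P [set w | X 0%N w <= x]).
Variable F : R -> R.
Hypothesis hF : forall x, fine (P [set w | X 0%N w <= x]) = F x.
Local Notation nu := (law X).
Let mTR := @measurableT _ R.
Let fTR := probT_lty nu.
Local Notation Xf := (fun i => (X i : T -> R)).
Local Notation smp := (sample Xf).

Lemma sum_sample N w (g : R -> R) :
  \sum_(x <- smp N w) g x = \sum_(j <- iota 0 N) g (X j w).
Proof. by rewrite /sample big_map. Qed.

Definition dev (eta : R -> R) (N : nat) (r : R) : set T :=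
  [set w | r <= `|\sum_(j <- iota 0 N) eta (X j w)|].

Lemma meas_dev eta N r : measurable_fun setT eta -> measurable (dev eta N r).
Proof.
move=> me; apply: (meas_ge r); apply: measurableT_comp => //; exact: meas_sumX.
Qed.

(** With [lam = t ^ -8] the linear term of the exponent is [- t] and the variance term is the
    constant [2 K ^ 2]. *)
Lemma dev_prob (eta : R -> R) (K : R) (N : nat) (t : R) : measurable_fun setT eta -> (forall x, `|eta x| <= K) ->
  \int[nu]_x eta x = 0 -> 1 <= t -> 2 * K <= t -> N%:R = t ^+ 16 ->
  fine (P (dev eta N (t ^+ 9))) <= 2 * expR (2 * K ^+ 2) * expR (- 1 * t).
Proof.
move=> me eK e0 t1 tK NE; have t0 : 0 < t by exact: lt_le_trans t1.
have K0 : 0 <= K by exact: le_trans (eK 0).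
have beta : bmeas setT eta by split=> //; exists K.
have lam0 : 0 < (t ^+ 8)^-1 by rewrite invr_gt0 exprn_gt0.
have v : \int[nu]_x eta x ^+ 2 <= K ^+ 2.
  rewrite -[leRHS](Rint_prob_cst nu).
  apply: (Rint_le mTR fTR (bmeasX 2 beta) (bmeas_cst _ _)) => x _.
  by rewrite -[eta x ^+ 2]real_normK ?num_real// lerXn2r// nnegrE.
have lb x : `|(t ^+ 8)^-1 * eta x| <= 1 / 2.
  rewrite normrM gtr0_norm// ler_pdivrMl ?exprn_gt0//.
  apply: (le_trans (eK x)); have : t <= t ^+ 8 by rewrite -[leLHS]expr1 ler_weXn2l.
  by move=> h; lra.
apply: (le_trans (bernstein hind hid N (t ^+ 9) me lam0 lb e0 v)).
rewrite -[leRHS]mulrA -expRD ler_wpM2l// ler_expR NE le_eqVlt; apply/orP; left; apply/eqP.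
by field; rewrite lt0r_neq0.
Qed.

(** * Fluctuation of the empirical distribution function over short intervals *)

Section Modulus.
Variables (c0 c : R).
Let g x := ind c x - ind c0 x.
Let eta x := g x - (F c - F c0).

Let bg : bmeas setT g. Proof. by apply: bmeasB; exact: bmeas_ind. Qed.
Let beta : bmeas setT eta. Proof. by apply: bmeasB => //; exact: bmeas_cst. Qed.
Let intg : \int[nu]_x g x = F c - F c0.
Proof. by rewrite (RintB mTR fTR (bmeas_ind c) (bmeas_ind c0)) !(Rint_ind hF). Qed.
Let int_eta : \int[nu]_x eta x = 0.
Proof. by rewrite (RintB mTR fTR bg (bmeas_cst _ _)) intg Rint_prob_cst subrr. Qed.

Let intg2 : \int[nu]_x g x ^+ 2 = `|F c - F c0|.
Proof.
case: (leP c0 c) => cc.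
  rewrite ger0_norm ?subr_ge0 ?(F_mono hF)// -intg; apply: eq_Rintegral => x _.
  rewrite /g /ind; case: (leP x c0) => h; first by rewrite (le_trans h cc)/= subrr expr0n.
  by case: (x <= c); rewrite /= subr0 ?expr1n ?expr0n.
rewrite ler0_norm ?subr_le0 ?(F_mono hF) ?(ltW cc)// opprB.
have -> : F c0 - F c = \int[nu]_x (- 1 * g x) by rewrite (RintZ mTR fTR _ bg) intg; ring.
apply: eq_Rintegral => x _.
rewrite /g /ind; case: (leP x c) => h; first by rewrite (le_trans h (ltW cc))/= subrr expr0n mulr0.
by case: (x <= c0); rewrite /= sub0r ?sqrrN ?mulrNN ?mulr1 ?expr1n ?oppr0 ?expr0n ?mulr0.
Qed.

Definition osc N r : set T := dev eta N r.

Lemma meas_osc N r : measurable (osc N r).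
Proof. by apply: meas_dev; exact: beta.1. Qed.

(** An indicator increment of mass at most [p t ^ -7] has variance of that order, so [lam = t ^ -5]
    is admissible: the variance term becomes [2 p / t]. A deviation of order [t ^ 6] in the count
    corresponds to [t ^ -10] in the position of an order statistic. *)
Lemma osc_prob N (t rho p : R) : 1 <= t -> 4 <= t ->
  `|F c - F c0| <= p / t ^+ 7 -> N%:R = t ^+ 16 -> 0 < rho -> 0 <= p ->
  fine (P (osc N (rho * t ^+ 6))) <= 2 * expR (2 * p) * expR (- rho * t).
Proof.
move=> t1 t4 hp NE rho0 p0; have t0 : 0 < t by exact: lt_le_trans t1.
have lam0 : 0 < (t ^+ 5)^-1 by rewrite invr_gt0 exprn_gt0.
have g1 x : `|g x| <= 1.
  rewrite /g /ind; case: (x <= c); case: (x <= c0);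
  by rewrite /= ?subrr ?subr0 ?sub0r ?normrN ?normr0 ?normr1.
have Fc1 : `|F c - F c0| <= 1.
  have := F_ge0 hF c; have := F_ge0 hF c0; have := F_le1 hF c; have := F_le1 hF c0.
  by move=> ????; rewrite ler_norml; apply/andP; split; lra.
have eb x : `|eta x| <= 2.
  by apply: (le_trans (ler_normB _ _)); have := g1 x; lra.
have lb x : `|(t ^+ 5)^-1 * eta x| <= 1 / 2.
  rewrite normrM gtr0_norm// ler_pdivrMl ?exprn_gt0//.
  apply: (le_trans (eb x)); have : t <= t ^+ 5 by rewrite -[leLHS]expr1 ler_weXn2l.
  by move=> h; lra.
have v : \int[nu]_x eta x ^+ 2 <= p / t ^+ 7.
  have e x : eta x ^+ 2 = g x ^+ 2 - 2 * (F c - F c0) * g x + (F c - F c0) ^+ 2.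
    by rewrite /eta; ring.
  under eq_Rintegral do rewrite e.
  rewrite (RintD mTR fTR (bmeasB (bmeasX 2 bg) (bmeasZ _ bg)) (bmeas_cst _ _)).
  rewrite (RintB mTR fTR (bmeasX 2 bg) (bmeasZ _ bg)) (RintZ mTR fTR _ bg) Rint_prob_cst.
  rewrite intg intg2; apply: (le_trans _ hp).
  have -> : `|F c - F c0| - 2 * (F c - F c0) * (F c - F c0) + (F c - F c0) ^+ 2 =
    `|F c - F c0| - (F c - F c0) ^+ 2 by ring.
  by rewrite gerBl sqr_ge0.
apply: (le_trans (bernstein hind hid N (rho * t ^+ 6) beta.1 lam0 lb int_eta v)).
rewrite -[leRHS]mulrA -expRD ler_wpM2l// ler_expR NE.
have -> : - (t ^+ 5)^-1 * (rho * t ^+ 6) + 2 * t ^+ 16 * (t ^+ 5)^-1 ^+ 2 * (p / t ^+ 7) =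
   - rho * t + 2 * p / t by field; rewrite lt0r_neq0.
rewrite addrC lerD2r ler_pdivrMr// ler_peMr// mulr_ge0//.
Qed.

Lemma oscC N r w : ~ osc N r w ->
  `|((count (<= c) (smp N w))%:R - (count (<= c0) (smp N w))%:R) - N%:R * (F c - F c0)| < r.
Proof.
have e : \sum_(j <- iota 0 N) eta (X j w) =
    ((count (<= c) (smp N w))%:R - (count (<= c0) (smp N w))%:R) - N%:R * (F c - F c0).
  have cs (u : R) : \sum_(j <- iota 0 N) u = N%:R * u.
    by rewrite big_const_seq count_predT iter_addr_0 size_iota mulr_natl.
  by rewrite !count_sample !natr_sum /eta /g !sumrB !cs mulrBr.
by move=> h; rewrite ltNge -e; apply/negP => h'; exact: h.
Qed.

End Modulus.

(* The empirical distribution function is compared with [F] only at the [2 J + 1]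
   equally spaced points around [xi] where the order statistics are expected, shifted
   by the admissible error in both directions. *)
Section OrderStatisticsLinear.
Variables (xi fx L delta : R).
Hypotheses (fx0 : 0 < fx) (delta0 : 0 < delta).
Hypothesis FL : forall h, `|h| < delta -> `|F (xi + h) - F xi - h * fx| <= L * h ^+ 2.
Let L0 : 0 <= L.
Proof.
have h := FL (h := delta / 2); have d2 : 0 < (delta / 2) ^+ 2 by rewrite exprn_gt0// divr_gt0.
rewrite -(pmulr_lge0 _ d2); apply: le_trans (h _) => //.
by rewrite gtr0_norm ?divr_gt0//; have := delta0; lra.
Qed.

(** Radius of the relevant neighbourhood in units of [t ^ -7]: ranks up to [J <= 4 t ^ 9] away from
    the count move the point by at most [(4 / fx) t ^ -7], and 1 covers the shift [t ^ -10]. *)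
Let H : R := 4 / fx + 1.
Let H0 : 0 < H. Proof. by rewrite addr_gt0// divr_gt0. Qed.
Let p : R := fx * H + L * H ^+ 2.
Let p0 : 0 <= p.
Proof. by apply: addr_ge0; apply: mulr_ge0; rewrite ?exprn_ge0// ltW. Qed.

Definition cpt (J : nat) (t : R) (s : R) (n : nat) : R :=
  xi + (n%:R - J%:R) / (t ^+ 16 * fx) + s * (t ^+ 10)^-1.

Definition osbad (N J : nat) (t s : R) : set T :=
  \bigcup_(n in [set n | (n < (2 * J).+1)%N]) osc xi (cpt J t s n) N (fx / 2 * t ^+ 6).

Lemma meas_osbad N J t s : measurable (osbad N J t s).
Proof. by apply: bigcup_measurable => n _; exact: meas_osc. Qed.

Section Fixed.
Variables (N J : nat) (t : R).
Hypotheses (t1 : 4 <= t) (NE : N%:R = t ^+ 16) (J1 : 3 * t ^+ 9 <= J%:R)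
  (J2 : J%:R <= 3 * t ^+ 9 + 1) (td : H < delta * t ^+ 7) (tL : L * H ^+ 2 < fx / 2 * t ^+ 4).
Let t0 : 0 < t. Proof. by apply: lt_le_trans t1. Qed.
Let t1' : 1 <= t. Proof. by have t1' := t1; lra. Qed.

Let cpt_near s n : `|s| <= 1 -> (n < (2 * J).+1)%N -> `|cpt J t s n - xi| <= H / t ^+ 7.
Proof.
move=> s1 nJ; rewrite /cpt; set y := _ / _.
have -> : xi + y + s * (t ^+ 10)^-1 - xi = y + s * (t ^+ 10)^-1 by ring.
apply: (le_trans (ler_normD _ _)); rewrite /H mulrDl; apply: lerD; last first.
  rewrite normrM ler_pM// normfV gtr0_norm ?exprn_gt0// lef_pV2 ?posrE ?exprn_gt0//.
  by rewrite ler_weXn2l.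
have nJ' : `|n%:R - J%:R : R| <= J%:R.
  rewrite ler_norml; apply/andP; split; first by rewrite lerBrDl subrr.
  by rewrite lerBlDr -natrD ler_nat; move: nJ; rewrite ltnS mul2n addnn.
rewrite /y normrM normfV [`|t ^+ 16 * fx|]gtr0_norm ?mulr_gt0 ?exprn_gt0//.
rewrite ler_pdivrMr ?mulr_gt0 ?exprn_gt0//.
have -> : 4 / fx / t ^+ 7 * (t ^+ 16 * fx) = 4 * t ^+ 9 by field; rewrite !lt0r_neq0.
apply: (le_trans nJ'); apply: (le_trans J2).
have : 1 <= t ^+ 9 by rewrite exprn_ege1.
by move=> ?; lra.
Qed.

Let cpt_F s n : `|s| <= 1 -> (n < (2 * J).+1)%N ->
  `|F (cpt J t s n) - F xi - (cpt J t s n - xi) * fx| <= L * H ^+ 2 / t ^+ 14.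
Proof.
move=> s1 nJ; have h := cpt_near s1 nJ; set h' := cpt J t s n - xi in h *.
have -> : cpt J t s n = xi + h' by rewrite /h'; ring.
apply: (le_trans (FL _)).
  by apply: (le_lt_trans h); rewrite ltr_pdivrMr ?exprn_gt0.
rewrite -mulrA ler_wpM2l//.
have -> : H ^+ 2 / t ^+ 14 = (H / t ^+ 7) ^+ 2 by field; rewrite lt0r_neq0.
by rewrite -[h' ^+ 2]real_normK ?num_real// lerXn2r// nnegrE divr_ge0 ?exprn_ge0// ltW.
Qed.

(** A union bound over the [2 J + 1 <= 9 t ^ 9] points. *)
Lemma osbad_prob s : `|s| <= 1 ->
  fine (P (osbad N J t s)) <= (9 * t ^+ 9) * (2 * expR (2 * p) * expR (- (fx / 2) * t)).
Proof.
move=> s1; apply: (@le_trans _ _ ((2 * J).+1%:R * (2 * expR (2 * p) * expR (- (fx / 2) * t)))).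
  apply: prob_bigcup_le => [n|n nJ]; first exact: meas_osc.
  apply: (osc_prob t1' t1 _ NE _ p0); last by rewrite divr_gt0.
  have h1 := cpt_F s1 nJ; have h2 := cpt_near s1 nJ; set c := cpt J t s n in h1 h2 *.
  have -> : F c - F xi = (F c - F xi - (c - xi) * fx) + (c - xi) * fx by ring.
  apply: (le_trans (ler_normD _ _)); have -> : p / t ^+ 7 = L * H ^+ 2 / t ^+ 7 + H / t ^+ 7 * fx by rewrite /p; ring.
  apply: lerD.
    apply: (le_trans h1); apply: ler_wpM2l.
      by rewrite mulr_ge0// exprn_ge0// ltW.
    by rewrite lef_pV2 ?posrE ?exprn_gt0// ler_weXn2l.
  by rewrite normrM [`|fx|]gtr0_norm// ler_wpM2r// ltW.
rewrite ler_wpM2r ?mulr_ge0 ?expR_ge0// -natr1 natrM.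
have : 1 <= t ^+ 9 by rewrite exprn_ege1.
by have := J2; move=> ??; lra.
Qed.

(** Shifting the predicted position by [t ^ -10] changes the expected count by [fx t ^ 6].
    Fluctuation and curvature of [F] each stay below half of this, so the count at the upper point
    reaches [i], the one at the lower point does not, and [ostat_le] encloses the order
    statistic. *)
Lemma ostat_linear w i : ~ osbad N J t 1 w -> ~ osbad N J t (- 1) w ->
  (0 < i <= N)%N -> `|i%:R - (count (<= xi) (smp N w))%:R| <= 3 * t ^+ 9 ->
  `|ostat (smp N w) i - xi - (i%:R - (count (<= xi) (smp N w))%:R) / (N%:R * fx)| <= (t ^+ 10)^-1.
Proof.
move=> g1 g2 hi hJ; set q := count _ _ in hJ *.
have hi' : (0 < i <= size (smp N w))%N by rewrite size_sample.
have qJ : (q <= i + J)%N.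
  rewrite -(ler_nat R) natrD; move: hJ; rewrite ler_norml => /andP[h _]; have := J1; lra.
have nJ : ((i + J) - q < (2 * J).+1)%N.
  rewrite ltnS leq_subLR mul2n -addnn -(ler_nat R) !natrD.
  move: hJ; rewrite ler_norml => /andP[_ h]; have := J1; lra.
pose n := ((i + J) - q)%N.
have nE : n%:R - J%:R = i%:R - q%:R :> R by rewrite /n natrB// natrD; ring.
have o (s : R) : ~ osbad N J t s w -> ~ osc xi (cpt J t s n) N (fx / 2 * t ^+ 6) w.
  by move=> h h'; apply: h; exists n.
have small : t ^+ 16 * (L * H ^+ 2 / t ^+ 14) < fx / 2 * t ^+ 6.
  have -> : t ^+ 16 * (L * H ^+ 2 / t ^+ 14) = L * H ^+ 2 * t ^+ 2 by field; rewrite lt0r_neq0.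
  have -> : fx / 2 * t ^+ 6 = fx / 2 * t ^+ 4 * t ^+ 2 by ring.
  by rewrite ltr_pM2r// exprn_gt0.
have key (s : R) : `|s| <= 1 -> ~ osbad N J t s w ->
    `|(count (<= cpt J t s n) (smp N w))%:R - q%:R - ((i%:R - q%:R) + s * fx * t ^+ 6)| < fx * t ^+ 6.
  move=> s1 hb; have h1 := oscC (o s hb); have h2 := cpt_F s1 nJ.
  have e : t ^+ 16 * ((cpt J t s n - xi) * fx) = (i%:R - q%:R) + s * fx * t ^+ 6.
    by rewrite /cpt nE; field; rewrite !lt0r_neq0.
  rewrite NE in h1; have h3 : `|t ^+ 16 * (F (cpt J t s n) - F xi - (cpt J t s n - xi) * fx)| < fx / 2 * t ^+ 6.
    apply: le_lt_trans small; rewrite normrM gtr0_norm ?exprn_gt0// ler_wpM2l// exprn_ge0//.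
    exact: ltW.
  rewrite mulrBr e in h3.
  set u := (count _ _)%:R - q%:R in h1 *; set v := t ^+ 16 * _ in h1 h3.
  have -> : u - (i%:R - q%:R + s * fx * t ^+ 6) = (u - v) + (v - (i%:R - q%:R + s * fx * t ^+ 6)) by ring.
  apply: (le_lt_trans (ler_normD _ _)).
  have -> : fx * t ^+ 6 = fx / 2 * t ^+ 6 + fx / 2 * t ^+ 6 by field.
  exact: ltrD.
have cE (s : R) : cpt J t s n = xi + (i%:R - q%:R) / (N%:R * fx) + s * (t ^+ 10)^-1.
  by rewrite /cpt nE NE.
have n1 : `|1 : R| <= 1 by rewrite normr1.
have n2 : `|- 1 : R| <= 1 by rewrite normrN normr1.
have k1 : ostat (smp N w) i <= cpt J t 1 n.
  rewrite ostat_le// -(ler_nat R); have := key 1 n1 g1.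
  by rewrite mul1r ltr_norml => /andP[h _]; lra.
have k2 : cpt J t (- 1) n <= ostat (smp N w) i.
  rewrite ltW// ltNge ostat_le// -ltnNge -(ltr_nat R); have := key (- 1) n2 g2.
  by rewrite mulN1r mulNr ltr_norml => /andP[_ h]; lra.
rewrite !cE in k1 k2; rewrite ler_norml; apply/andP; split; lra.
Qed.

End Fixed.

Lemma order_statistics_linear : exists K T0 : R, [/\ 0 <= K, 4 <= T0 &
  forall (N : nat) (t : R), T0 <= t -> N%:R = t ^+ 16 ->
  exists B : set T, [/\ measurable B, fine (P B) <= K / t ^+ 9 &
    forall w, ~ B w -> forall i, (0 < i <= N)%N ->
      `|i%:R - (count (<= xi) (smp N w))%:R| <= 3 * t ^+ 9 ->
      `|ostat (smp N w) i - xi - (i%:R - (count (<= xi) (smp N w))%:R) / (N%:R * fx)|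
        <= (t ^+ 10)^-1]].
Proof.
(* The exponent 18 leaves [t ^ -9] after the factor [t ^ 9] of the union bound. *)
pose K := 36 * expR (2 * p) * (18%:R / (fx / 2)) ^+ 18.
have fx2 : 0 < fx / 2 by rewrite divr_gt0.
have K0 : 0 <= K.
  apply: mulr_ge0; first by apply: mulr_ge0 => //; exact: expR_ge0.
  by apply: exprn_ge0; apply: divr_ge0 => //; exact: ltW.
pose T0 := 4 + H / delta + L * H ^+ 2 / (fx / 2).
have Hd : 0 <= H / delta by rewrite divr_ge0 ?ltW.
have LH : 0 <= L * H ^+ 2 / (fx / 2).
  by apply: divr_ge0; [apply: mulr_ge0 => //; rewrite exprn_ge0// ltW | exact: ltW].
exists K, T0; split=> //; first by rewrite /T0 -addrA lerDl addr_ge0.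
move=> N t Tt NE.
have t4 : 4 <= t by apply: le_trans Tt; rewrite /T0 -addrA lerDl addr_ge0.
have t0 : 0 < t by exact: lt_le_trans t4.
have t1 : 1 <= t by apply: le_trans t4; rewrite ler1n.
have tp n : (0 < n)%N -> t <= t ^+ n by move=> n0; rewrite -[leLHS]expr1 ler_weXn2l.
have td : H < delta * t ^+ 7.
  rewrite -ltr_pdivrMl// mulrC; apply: (lt_le_trans _ (tp 7 isT)); apply: lt_le_trans Tt.
  by rewrite /T0 -addrA addrCA ltrDl ltr_pwDl.
have tL : L * H ^+ 2 < fx / 2 * t ^+ 4.
  rewrite -ltr_pdivrMl// mulrC; apply: (lt_le_trans _ (tp 4 isT)); apply: lt_le_trans Tt.
  by rewrite /T0 ltrDr ltr_pwDl.
pose J := (Num.truncn (3 * t ^+ 9)).+1.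
have /truncn_itv/andP[j1 j2] : 0 <= 3 * t ^+ 9 by rewrite mulr_ge0// exprn_ge0// ltW.
have J1 : 3 * t ^+ 9 <= J%:R by exact: ltW.
have J2 : J%:R <= 3 * t ^+ 9 + 1 by rewrite /J -natr1 lerD2r.
have b1 : `|1 : R| <= 1 by rewrite normr1.
have b2 : `|- 1 : R| <= 1 by rewrite normrN normr1.
exists (osbad N J t 1 `|` osbad N J t (- 1)); split.
- by apply: measurableU; exact: meas_osbad.
- apply: (le_trans (prob_setU_le _ (meas_osbad _ _ _ _) (meas_osbad _ _ _ _))).
  have h1 := osbad_prob t4 NE J2 td b1; have h2 := osbad_prob t4 NE J2 td b2.
  apply: (le_trans (lerD h1 h2)).
  have dec := expR_decay (n := 18) isT fx2 t0.
  have -> : K / t ^+ 9 = 36 * t ^+ 9 * expR (2 * p) * ((18%:R / (fx / 2)) ^+ 18 / t ^+ 18).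
    by rewrite /K; field; rewrite ?lt0r_neq0.
  have -> : 9 * t ^+ 9 * (2 * expR (2 * p) * expR (- (fx / 2) * t)) +
    9 * t ^+ 9 * (2 * expR (2 * p) * expR (- (fx / 2) * t)) =
    36 * t ^+ 9 * expR (2 * p) * expR (- (fx / 2) * t) by ring.
  by apply: ler_wpM2l dec; rewrite !mulr_ge0 ?expR_ge0 ?exprn_ge0// ltW.
- move=> w /not_orP[g1 g2] i hi hJ.
  by apply: (@ostat_linear N J t).
Qed.

End OrderStatisticsLinear.

End GoodEvent.

(** * Consequences of a locally Lipschitz density *)

Section LipschitzDensity.
Context (R : realType) (F f : R -> R) (xi L delta : R).
Hypotheses (delta0 : 0 < delta)
  (dF : forall x, `|x - xi| < delta -> is_derive x 1 F (f x))
  (fL : forall x y, `|x - xi| < delta -> `|y - xi| < delta -> `|f x - f y| <= L * `|x - y|).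

Let xi_near : `|xi - xi| < delta. Proof. by rewrite subrr normr0. Qed.

Lemma lipschitz_ge0 : 0 <= L.
Proof.
have d2 : 0 < delta / 2 by rewrite divr_gt0.
have h : `|xi + delta / 2 - xi| < delta.
  by rewrite addrAC subrr add0r gtr0_norm//; have := delta0; lra.
have := fL h xi_near; rewrite addrAC subrr add0r [`|delta / 2|]gtr0_norm// => g.
by rewrite -(pmulr_lge0 _ d2); exact: le_trans g.
Qed.

Lemma cdf_quad h : `|h| < delta -> `|F (xi + h) - F xi - h * f xi| <= L * h ^+ 2.
Proof.
move=> hd; have L0 := lipschitz_ge0.
have near t : 0 <= t <= 1 -> `|xi + t * h - xi| < delta.
  move=> /andP[t0 t1]; rewrite addrAC subrr add0r normrM (ger0_norm t0).
  by apply: le_lt_trans hd; rewrite ler_piMl.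
have := @mvt_bound R (fun s => F s - s * f xi) (fun s => f s - f xi) xi h (L * `|h|).
have -> : L * `|h| * `|h| = L * h ^+ 2 by rewrite -mulrA -expr2 real_normK ?num_real.
have -> : F (xi + h) - (xi + h) * f xi - (F xi - xi * f xi) = F (xi + h) - F xi - h * f xi by ring.
apply => t ht.
  have D := dF (near t ht).
  have D2 : is_derive (xi + t * h) (1 : R) (fun s => s * f xi) (f xi).
    apply: is_derive_eq.
    by rewrite !scaler0 add0r; rewrite /GRing.scale/= mulr1.
  exact: is_deriveB.
apply: (le_trans (fL (near t ht) xi_near)); rewrite ler_wpM2l//.
rewrite addrAC subrr add0r normrM; move: ht => /andP[t0 t1].
by rewrite (ger0_norm t0) ler_piMl.
Qed.

Lemma cdf_increment_ge a b : 0 < f xi -> `|a - xi| < delta -> `|b - xi| < delta ->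
  L * `|a - xi| <= f xi / 2 -> L * `|b - xi| <= f xi / 2 -> a <= b ->
  f xi / 2 * (b - a) <= F b - F a.
Proof.
move=> f0 ha hb La Lb ab; have L0 := lipschitz_ge0.
have near t : 0 <= t <= 1 -> `|a + t * (b - a) - xi| < delta /\ L * `|a + t * (b - a) - xi| <= f xi / 2.
  move=> /andP[t0 t1].
  have -> : a + t * (b - a) - xi = (1 - t) * (a - xi) + t * (b - xi) by ring.
  have n : `|(1 - t) * (a - xi) + t * (b - xi)| <= (1 - t) * `|a - xi| + t * `|b - xi|.
    apply: (le_trans (ler_normD _ _)).
    by rewrite !normrM (ger0_norm t0) [`|1 - t|]ger0_norm ?subr_ge0.
  split.
    apply: (le_lt_trans n); have [m hm mb] : exists2 m, m < delta & `|a - xi| <= m /\ `|b - xi| <= m.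
      exists (Num.max `|a - xi| `|b - xi|); first by rewrite gt_max ha hb.
      by rewrite !le_max !lexx orbT.
    apply: le_lt_trans hm; case: mb => m1 m2.
    apply: (@le_trans _ _ ((1 - t) * m + t * m)); last by rewrite -mulrDl subrK mul1r.
    by rewrite lerD// ler_wpM2l// subr_ge0.
  apply: (le_trans (ler_wpM2l L0 n)); rewrite mulrDr !(mulrCA L).
  apply: (@le_trans _ _ ((1 - t) * (f xi / 2) + t * (f xi / 2))); last by rewrite -mulrDl subrK mul1r.
  by rewrite lerD// ler_wpM2l// subr_ge0.
have := @mvt_bound R (fun s => F s - s * f xi) (fun s => f s - f xi) a (b - a) (f xi / 2).
have -> : a + (b - a) = b by ring.
have h : `|b - a| = b - a by rewrite ger0_norm// subr_ge0.
rewrite h => /(_ _ _) H.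
have {}H : `|F b - b * f xi - (F a - a * f xi)| <= f xi / 2 * (b - a).
  apply: H => t ht.
    have D := dF (near t ht).1.
    have D2 : is_derive (a + t * (b - a)) (1 : R) (fun s => s * f xi) (f xi).
      apply: is_derive_eq.
      by rewrite !scaler0 add0r; rewrite /GRing.scale/= mulr1.
    exact: is_deriveB.
  exact: le_trans (fL (near t ht).1 xi_near) (near t ht).2.
move: H; rewrite ler_norml => /andP[H _].
have e : F b - F a = (F b - b * f xi - (F a - a * f xi)) + f xi * (b - a) by ring.
rewrite e; set u := _ - _ - _ in H *; set v := b - a in H *.
have -> : f xi * v = f xi / 2 * v + f xi / 2 * v by field.
by rewrite addrA lerDr; move: H; rewrite -subr_ge0 opprK.
Qed.

End LipschitzDensity.

(** For every [h > 0] one has [F (xi - h) < u], and the quadratic bound makes [F] continuous at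
    [xi]; letting [h] tend to 0 gives [F xi <= u]. *)
Lemma cdf_quantile d (T : measurableType d) (R : realType) (P : probability T R)
  (X : nat -> {RV P >-> R}) (F : R -> R) (u D : R) (c delta : R) :
  (forall x, fine (P [set w | X 0%N w <= x]) = F x) -> 0 < u -> u < 1 -> 0 < delta ->
  (forall h, `|h| < delta -> `|F (quantile F u + h) - F (quantile F u) - h * c| <= D * h ^+ 2) ->
  F (quantile F u) = u.
Proof.
move=> hF u0 u1 delta0 H; apply/eqP; rewrite eq_le; apply/andP; split; last first.
  by rewrite -(quantile_le hF)//.
set xi := quantile F u in H *.
apply/ler_addgt0Pr => e e0.
pose M := `|c| + `|D| * delta + 1.
have M0 : 0 < M by rewrite ltr_wpDl// addr_ge0// mulr_ge0// ltW.
pose h := Num.min (delta / 2) (e / M).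
have h0 : 0 < h by rewrite lt_min !divr_gt0.
have hd : h < delta by rewrite gt_min; apply/orP; left; have := delta0; lra.
have hM : h * M <= e by rewrite -ler_pdivlMr// ge_min lexx orbT.
have Fl : F (xi - h) < u.
  by rewrite ltNge -(quantile_le hF)// -/xi -ltNge ltrBlDr ltrDl.
have := H (- h); rewrite normrN gtr0_norm// sqrrN => /(_ hd).
rewrite ler_norml => /andP[g _].
have b1 : h * c <= h * `|c| by rewrite ler_wpM2l ?ler_norm// ltW.
have b2 : D * h ^+ 2 <= h * (`|D| * delta).
  apply: (@le_trans _ _ (h * (`|D| * h))); last by rewrite !ler_wpM2l// ltW.
  have -> : h * (`|D| * h) = `|D| * h ^+ 2 by ring.
  by rewrite ler_wpM2r ?sqr_ge0 ?ler_norm.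
have e3 : h * M = h * `|c| + h * (`|D| * delta) + h by rewrite /M; ring.
rewrite e3 in hM; have h0' := ltW h0; rewrite mulNr in g; lra.
Qed.

(** * Samples are regular off a small event *)

Section RegularSample.
Context d (T : measurableType d) (R : realType) (P : probability T R).
Variable X : nat -> {RV P >-> R}.
Hypothesis hind : mutually_independent P (fun i => (X i : T -> R)).
Hypothesis hid : forall i x,
  fine (P [set w | X i w <= x]) = fine (P [set w | X 0%N w <= x]).
Variable F : R -> R.
Hypothesis hF : forall x, fine (P [set w | X 0%N w <= x]) = F x.
Local Notation nu := (law X).
Local Notation smp := (sample (fun i => (X i : T -> R))).
Variables (alpha beta a b mab fa fb sigma L delta : R).
Hypotheses (a0 : 0 < alpha) (ab : alpha < beta) (b1 : beta < 1)
  (fa0 : 0 < fa) (fb0 : 0 < fb) (delta0 : 0 < delta).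
Hypotheses (Fa : F a = alpha) (Fb : F b = beta).
Hypothesis FLa : forall h, `|h| < delta -> `|F (a + h) - F a - h * fa| <= L * h ^+ 2.
Hypothesis FLb : forall h, `|h| < delta -> `|F (b + h) - F b - h * fb| <= L * h ^+ 2.
Let mu := alpha * a + (beta - alpha) * mab + (1 - beta) * b.
Let W x := clipf a b x - mu.
Let v := vfun alpha beta a b mab fa fb sigma.
Hypotheses (bW : bmeas setT W) (bv : bmeas setT v).
Hypotheses (W0 : \int[nu]_x W x = 0) (v0 : \int[nu]_x v x = 0).

Let ia x := ind a x - alpha.
Let ib x := ind b x - beta.
Let bia : bmeas setT ia. Proof. by apply: bmeasB; [exact: bmeas_ind | exact: bmeas_cst]. Qed.
Let bib : bmeas setT ib. Proof. by apply: bmeasB; [exact: bmeas_ind | exact: bmeas_cst]. Qed.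

(** The high power 50 is for the truncation of squared counts, where such an event is multiplied by
    [N ^ 2 = t ^ 32] and by a kernel derivative of size [t ^ 12]. *)
Lemma dev_decay (eta : R -> R) : bmeas setT eta -> \int[nu]_x eta x = 0 ->
  exists K T0 : R, [/\ 0 <= K, 1 <= T0 & forall (N : nat) (t : R), T0 <= t -> N%:R = t ^+ 16 ->
    fine (P (dev X eta N (t ^+ 9))) <= K / t ^+ 50].
Proof.
move=> [me [M hM]] e0; have M0 : 0 <= M by exact: le_trans (hM 0 I).
exists (2 * expR (2 * M ^+ 2) * (50%:R / 1) ^+ 50), (1 + 2 * M); split.
- by apply: mulr_ge0; [apply: mulr_ge0 => //; exact: expR_ge0 | rewrite exprn_ge0// divr_ge0].
- by rewrite lerDl mulr_ge0.
- move=> N t Tt NE.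
  have t1 : 1 <= t by apply: le_trans Tt; rewrite lerDl mulr_ge0.
  have tM : 2 * M <= t by apply: le_trans Tt; rewrite lerDr.
  apply: (le_trans (dev_prob hind hid me (fun x => hM x I) e0 t1 tM NE)).
  rewrite -[leRHS]mulrA; apply: ler_wpM2l; first by apply: mulr_ge0 => //; exact: expR_ge0.
  by apply: expR_decay => //; exact: lt_le_trans t1.
Qed.

Lemma regular_sample : exists K T0 : R, [/\ 0 <= K, 4 <= T0 &
  forall (N : nat) (t : R), T0 <= t -> N%:R = t ^+ 16 ->
  exists B : set T, [/\ measurable B, fine (P B) <= K / t ^+ 9 &
    forall w x, ~ B w -> `|x| <= t ->
      regular alpha beta a b mab fa fb sigma (smp N w, t, x)]].
Proof.
have [K1 [T1 [K10 T11 h1]]] := dev_decay bia (ind_centered hF Fa).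
have [K2 [T2 [K20 T21 h2]]] := dev_decay bib (ind_centered hF Fb).
have [K3 [T3 [K30 T31 h3]]] := dev_decay bW W0.
have [K4 [T4 [K40 T41 h4]]] := dev_decay bv v0.
have [K5 [T5 [K50 T51 h5]]] := order_statistics_linear hind hid hF fa0 delta0 FLa.
have [K6 [T6 [K60 T61 h6]]] := order_statistics_linear hind hid hF fb0 delta0 FLb.
pose T7 := 4 / (beta - alpha).
have T70 : 0 <= T7 by rewrite divr_ge0// subr_ge0 ltW.
exists (K1 + K2 + K3 + K4 + K5 + K6), (T1 + T2 + T3 + T4 + T5 + T6 + T7); split.
- by rewrite !addr_ge0.
- by lra.
move=> N t Tt NE.
have t1 : 1 <= t by lra.
have t0 : 0 < t by exact: lt_le_trans t1.
have [B5 [m5 p5 g5]] := h5 N t ltac:(lra) NE.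
have [B6 [m6 p6 g6]] := h6 N t ltac:(lra) NE.
have {}h1 := h1 N t ltac:(lra) NE; have {}h2 := h2 N t ltac:(lra) NE.
have {}h3 := h3 N t ltac:(lra) NE; have {}h4 := h4 N t ltac:(lra) NE.
have m1 := meas_dev X N (t ^+ 9) bia.1.
have m2 := meas_dev X N (t ^+ 9) bib.1.
have m3 := meas_dev X N (t ^+ 9) bW.1.
have m4 := meas_dev X N (t ^+ 9) bv.1.
set D1 := dev X ia N _ in h1 m1; set D2 := dev X ib N _ in h2 m2.
set D3 := dev X W N _ in h3 m3; set D4 := dev X v N _ in h4 m4.
exists (D1 `|` D2 `|` D3 `|` D4 `|` B5 `|` B6).
have mm2 : measurable (D1 `|` D2) by exact: measurableU.
have mm3 : measurable (D1 `|` D2 `|` D3) by exact: measurableU.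
have mm4 : measurable (D1 `|` D2 `|` D3 `|` D4) by exact: measurableU.
have mm5 : measurable (D1 `|` D2 `|` D3 `|` D4 `|` B5) by exact: measurableU.
have dec K' : 0 <= K' -> K' / t ^+ 50 <= K' / t ^+ 9.
  by move=> ?; rewrite ler_wpM2l// lef_pV2 ?posrE ?exprn_gt0// ler_weXn2l.
split; first exact: measurableU.
  have u5 := prob_setU_le P mm5 m6; have u4 := prob_setU_le P mm4 m5.
  have u3 := prob_setU_le P mm3 m4; have u2 := prob_setU_le P mm2 m3.
  have u1 := prob_setU_le P m1 m2.
  apply: (le_trans u5); rewrite !mulrDl; apply: lerD => //.
  apply: (le_trans u4); apply: lerD => //.
  apply: (le_trans u3); apply: lerD; last exact: le_trans h4 (dec _ K40).
  apply: (le_trans u2); apply: lerD; last exact: le_trans h3 (dec _ K30).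
  apply: (le_trans u1); apply: lerD; last exact: le_trans h2 (dec _ K20).
  exact: le_trans h1 (dec _ K10).
move=> w x /not_orP[/not_orP[/not_orP[/not_orP[/not_orP[n1 n2] n3] n4] n5] n6] xt.
have dv (eta : R -> R) : ~ dev X eta N (t ^+ 9) w -> `|\sum_(y <- smp N w) eta y| <= t ^+ 9.
  by rewrite /dev/= sum_sample => h; rewrite leNgt; apply/negP => g; apply: h; exact: ltW.
have cs (u : R) : \sum_(y <- smp N w) u = N%:R * u.
  by rewrite big_const_seq count_predT iter_addr_0 size_sample mulr_natl.
have ci c u : \sum_(y <- smp N w) (ind c y - u) = (count (<= c) (smp N w))%:R - u * N%:R.
  by rewrite sumrB cs /ind -natr_sum -count_sum mulrC.
split; [split; rewrite /= ?size_sample// | split; [split|split]]; rewrite /= ?size_sample.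
- have h : T7 <= t ^+ 16.
    apply: (@le_trans _ _ t); first by rewrite (le_trans _ Tt)// lerDr; lra.
    by rewrite -[leLHS]expr1 ler_weXn2l.
  by rewrite NE -ler_pdivrMl ?subr_gt0// mulrC.
- by have := dv _ n1; rewrite ci.
- by have := dv _ n2; rewrite ci.
- exact: dv n3.
- exact: dv n4.
- exact: g5.
- exact: g6.
Qed.

End RegularSample.

(** * Expansion of the smoothed distribution function *)

Lemma half_shift (R : realType) (u v s sb h a : R) :
  h <= v / 2 -> u <= h -> 0 < s -> 2 * sb <= v -> a = s + v - u -> sb <= a.
Proof. by move=> ???? ->; lra. Qed.

(** * Expansion of the smoothed sum and of its perturbation by the counts *)

Section SampleExpansion.
Context d (T : measurableType d) (R : realType) (P : probability T R).
Variable X : nat -> {RV P >-> R}.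
Hypothesis hind : mutually_independent P (fun i => (X i : T -> R)).
Hypothesis hid : forall i x,
  fine (P [set w | X i w <= x]) = fine (P [set w | X 0%N w <= x]).
Local Notation nu := (law X).
Variables (c1 c2 : R) (w : R -> R) (b : R) (N : nat).
Hypotheses (mw : measurable_fun setT w) (wb : forall x, `|w x| <= b) (w0 : \int[nu]_x w x = 0).
Variables (J : set R) (uJ : nat * nat -> nat * nat) (y0 delta kappa : R).
Hypotheses (mJ : measurable J) (delta0 : 0 < delta) (kappa0 : 0 < kappa)
  (p1 : 2 * delta * kappa < 1).
Hypothesis updJ : forall x s, J x -> upd c1 c2 x s = uJ s.
Hypothesis dens : forall a b, y0 <= a -> a <= b -> b <= y0 + 2 * delta ->
  kappa * (b - a) <= fine (nu (J `&` w @^-1` `]a, b])).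
Variables (m1 : nat) (A y s0 C sbar : R).
Hypotheses (A1 : 1 <= A)
  (hA : 3 / (delta / Num.sqrt (N%:R : R)) / Num.sqrt (1 + m1%:R * (2 * delta * kappa) / 4) <= A)
  (s00 : 0 < s0) (s01 : s0 <= 1).
Hypothesis hC : 1 <= C /\ forall k y s0 s z, (k <= 12)%N ->
  0 < s0 -> s0 <= s -> `|heat_der k y s z| <= C * (Num.sqrt s0)^-1 ^+ k.
Hypothesis tiny : (1 - 2 * delta * kappa) ^+ m1 * (C * (Num.sqrt s0)^-1 ^+ 8) <= 1.
Hypotheses (sbar0 : 0 < sbar) (hsb : 2 * sbar <= \int[nu]_x w x ^+ 2)
  (N30 : (30 <= N)%N) (m1N : (m1 * 20 <= N)%N) (m10 : (0 < m1)%N).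

Let q := Num.sqrt (N%:R : R).
Let N0 : (0 < N)%N. Proof. exact: leq_trans N30. Qed.
Let NR : 0 < N%:R :> R. Proof. by rewrite ltr0n. Qed.
Let q0 : 0 < q. Proof. by rewrite sqrtr_gt0. Qed.
Let q2 : q ^+ 2 = N%:R. Proof. by rewrite sqr_sqrtr// ltW. Qed.
Let b0 : 0 <= b. Proof. exact: le_trans (wb 0). Qed.
Let Cd := edge_cst A C sbar.
Let sig2 := \int[nu]_x w x ^+ 2.
Let gam := \int[nu]_x w x ^+ 3.
Let rate := `|gam / q ^+ 3| + b ^+ 4 / N%:R ^+ 2 + (sig2 / N%:R) ^+ 2.
Let wq x := w x / q.
Let mwq : measurable_fun setT wq. Proof. exact: measurable_funM. Qed.
Let Z t := stZ X wq (iota 0 N) t.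
Let St t := stS X c1 c2 (iota 0 N) t.

Let Csm_Cd : smooth_cst A C <= Cd. Proof. by rewrite le_max lexx. Qed.
Let Cd0 : 0 <= Cd.
Proof.
by rewrite le_max; apply/orP; right; rewrite mulr_ge0 ?exprn_ge0 ?le_max ?ler01//;
  case: hC => h _; exact: le_trans h.
Qed.

Let chainK (g : nat * nat -> R -> R) : blip g ->
  \int[P]_t g (St t) (Z t) = iter N (K2 nu w N c1 c2) g (0%N, 0%N) 0.
Proof.
by move=> bg; have := chain hind hid c1 c2 mwq (iota_uniq 0 N) bg; rewrite size_iota.
Qed.

Let chain1 k : \int[P]_t heat_der k y s0 (Z t) = heat_iter (K1 nu w N) y N k s0 0.
Proof.
rewrite (chainK (g := fun _ => heat_der k y s0)); last exact: heat_der_blip.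
exact: iter_K2_K1.
Qed.

Lemma expand_perturb (Q : nat * nat -> R) (qm : R) : (forall s, `|Q s| <= qm) -> 0 < qm ->
  `|\int[P]_t heat_der 0 y s0 (Z t + Q (St t)) - \int[P]_t heat_der 0 y s0 (Z t)
    - \int[P]_t (Q (St t) * heat_der 1 y s0 (Z t))| <= qm ^+ 2 * Cd.
Proof.
move=> Qb qm0.
have one (s : nat * nat) : `|(fun=> 1 : R) s| <= 1 by rewrite normr1.
have B1 := blip_weight y s00 Q 0 1 Qb.
have B0 := blip_weight y s00 Q 1 0 one.
have e0 : (fun s z => 1 * heat_der 0 y s0 (z + 1 * Q s)) = (fun s z => heat_der 0 y s0 (z + Q s)).
  by apply/funext => s; apply/funext => z; rewrite !mul1r.
have e1 : (fun s z => Q s * heat_der 1 y s0 (z + 0 * Q s)) = (fun s z => Q s * heat_der 1 y s0 z).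
  by apply/funext => s; apply/funext => z; rewrite mul0r addr0.
rewrite e0 in B0; rewrite e1 in B1.
rewrite (chainK B0) (chainK B1) (chainK (g := fun _ => heat_der 0 y s0)); last exact: heat_der_blip.
have m2 : (2 * m1 <= N)%N by rewrite (leq_trans _ m1N)// mulnC leq_mul2l orbT.
apply: le_trans (perturb mw N0 mJ delta0 kappa0 p1 updJ dens A1 hA y s00 s01 hC tiny Qb m2 qm0) _.
by rewrite ler_wpM2l// sqr_ge0.
Qed.

Lemma expand_main : `|\int[P]_t heat_der 0 y s0 (Z t) - heat_der 0 y (s0 + sig2) 0
    - gam / (6 * q) * heat_der 3 y (s0 + sig2) 0| <=
  edge_err N (sig2 / N%:R) (gam / q ^+ 3) (b ^+ 4 / N%:R ^+ 2) Cd.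
Proof.
rewrite chain1.
exact: (array_edgeworth0 mw wb N0 w0 mJ delta0 kappa0 p1 dens A1 hA y s00 s01 hC tiny
  sbar0 hsb N30 m1N m10 0).
Qed.

Let smoothV k m : (k <= 4)%N -> (N <= m + 2)%N -> (m <= N)%N ->
  `|heat_iter (K1 nu w N) y m k s0 0 - heat_der k y (s0 + m%:R * (sig2 / N%:R)) 0| <= N%:R * (rate * Cd).
Proof.
move=> k4 h1 h2.
exact: (array_edgeworth mw wb N0 w0 mJ delta0 kappa0 p1 dens A1 hA y s00 s01 hC tiny
  sbar0 hsb N30 m1N m10 0 k4 h1 h2).
Qed.

Lemma expand_first : `|\int[P]_t heat_der 1 y s0 (Z t) - heat_der 1 y (s0 + sig2) 0| <= N%:R * (rate * Cd).
Proof.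
rewrite chain1; have := @smoothV 1 N isT (leq_addr _ _) (leqnn _).
by have -> : N%:R * (sig2 / N%:R) = sig2 by field; rewrite lt0r_neq0.
Qed.

Let sig2_ge0 : 0 <= sig2. Proof. by apply: Rintegral_ge0 => x _; exact: sqr_ge0. Qed.

Let heat_der_sbar k s : (k <= 8)%N -> sbar <= s -> `|heat_der k y s 0| <= Cd.
Proof.
move=> k8 hs; have [C1 H] := hC; have C0 : 0 <= C by exact: le_trans C1.
have h := H k y sbar s 0 (leq_trans k8 (isT : (8 <= 12)%N)) sbar0 hs.
rewrite /Cd le_max; apply/orP; right; apply: (le_trans h).
rewrite ler_wpM2l//; apply: (@le_trans _ _ ((Num.max 1 (Num.sqrt sbar)^-1) ^+ k)).
  by rewrite lerXn2r ?nnegrE ?invr_ge0 ?sqrtr_ge0 ?le_max ?ler01// lexx orbT.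
by rewrite ler_weXn2l// le_max lexx.
Qed.

(** One or two missing summands lower the Gaussian variance by at most [2 sig2 / N], and along that
    segment it stays above [sbar]. *)
Let heat_der_shift k j : (k <= 6)%N -> (j <= 2)%N ->
  `|heat_der k y (s0 + (N - j)%:R * (sig2 / N%:R)) 0 - heat_der k y (s0 + sig2) 0| <= Cd * (2 * (sig2 / N%:R)).
Proof.
move=> k6 j2; have jN : (j <= N)%N by rewrite (leq_trans j2)// (leq_trans _ N30).
have h0 : 0 <= sig2 / N%:R by rewrite divr_ge0// ltW.
pose h := j%:R * (sig2 / N%:R).
have hh : h <= 2 * (sig2 / N%:R) by rewrite ler_wpM2r// ler_nat.
have h0' : 0 <= h by rewrite mulr_ge0.
have hN : 2 * (sig2 / N%:R) <= sig2 / 2.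
  rewrite mulrCA ler_wpM2l//.
  rewrite ler_pdivrMr// mulrC ler_pdivlMr// -natrM ler_nat.
  by rewrite (leq_trans _ N30).
have e : s0 + (N - j)%:R * (sig2 / N%:R) + h = s0 + sig2.
  by rewrite /h natrB//; field; rewrite lt0r_neq0.
set a := s0 + (N - j)%:R * _ in e *.
have sb : sbar <= a.
  have : a = s0 + sig2 - h by rewrite -e; ring.
  exact: half_shift hN hh s00 hsb.
rewrite distrC -e.
have := @mvt_bound R (fun s => heat_der k y s 0) (fun s => 2^-1 * heat_der k.+2 y s 0) a h Cd.
rewrite (ger0_norm h0') => H; apply: (le_trans (H _ _)); last by rewrite ler_wpM2l.
- move=> t /andP[t0 t1]; apply: heat_der_ds; apply: (lt_le_trans sbar0).
  by rewrite (le_trans sb)// lerDl mulr_ge0.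
- move=> t /andP[t0 t1]; rewrite normrM ger0_norm//; apply: (@le_trans _ _ (1 * Cd)); last by rewrite mul1r.
  apply: ler_pM => //; first by rewrite invf_le1// ler1n.
  by apply: heat_der_sbar; [rewrite (leq_trans (_ : _ <= 8)%N) | rewrite (le_trans sb)// lerDl mulr_ge0].
Qed.

(** Diagonal terms leave [N - 1] free summands and off-diagonal ones [N - 2]. Each smoothed
    derivative is replaced by the Gaussian of full variance and the proportion [(N - 1) / N] by
    1. *)
Lemma expand_quad (a : R -> R) : measurable_fun setT a -> (forall x, `|a x| <= 1) ->
  \int[nu]_x a x = 0 ->
  forall va rho, \int[nu]_x a x ^+ 2 = va -> \int[nu]_x (a x * w x) = rho ->
  `|N%:R^-1 * \int[P]_t ((\sum_(j <- iota 0 N) a (X j t)) ^+ 2 * heat_der 1 y s0 (Z t))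
    - (va * heat_der 1 y (s0 + sig2) 0 + rho ^+ 2 * heat_der 3 y (s0 + sig2) 0)| <=
  Cd * (b / q + N%:R * (2 * (b / q)) ^+ 3 + (va + rho ^+ 2) * (N%:R * rate + 2 * (sig2 / N%:R))
    + rho ^+ 2 / N%:R).
Proof.
move=> ma ab am va rho vaE rhoE.
pose F m k z := heat_iter (K1 nu w N) y m k s0 z.
have sm m : (N <= m + 2)%N -> (8 * m1 <= m)%N.
  move=> h; move: m1N N30 h; clear; lia.
have wqb x : `|wq x| <= b / q.
  by rewrite /wq normrM normfV (gtr0_norm q0) ler_wpM2r// invr_ge0 ltW.
have va0 : 0 <= va by rewrite -vaE; apply: Rintegral_ge0 => x _; exact: sqr_ge0.
have FM m k z : (N <= m + 2)%N -> (k <= 8)%N -> `|F m k z| <= Cd.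
  move=> h1 h2; apply: le_trans Csm_Cd.
  exact: (smooth_heat_der mw N0 mJ delta0 kappa0 p1 dens A1 hA y s00 s01 hC tiny z h2 (lexx _) (sm _ h1)).
have N2 : (1 < N)%N by exact: leq_trans N30.
have n1 : (N <= N.-1 + 2)%N by move: N2; clear; lia.
have n2 : (N <= N.-2 + 2)%N by move: N2; clear; lia.
have := quad_form hind hid mwq wqb (y := y) ma ab am s00 (F := F) (fun _ _ _ => erefl) N2
  (fun z => FM N.-1 2%N z n1 isT) (fun z => FM N.-2 4%N z n2 isT).
rewrite vaE; set I := \int[P]_t _.
have -> : \int[law X]_x (a x * wq x) = rho / q.
  have bw : bmeas setT w by split=> //; exists b.
  have ba : bmeas setT a by split=> //; exists 1.
  rewrite -rhoE mulrC -(RintZ (@measurableT _ R) (probT_lty nu) _ (bmeasM ba bw)).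
  by apply: eq_Rintegral => x _; rewrite /wq; ring.
move=> h.
have v1 := @smoothV 1 N.-1 isT n1 (leq_pred _).
have N22 : (N.-2 <= N)%N by move: N2; clear; lia.
have v3 := @smoothV 3 N.-2 isT n2 N22.
have u1 := @heat_der_shift 1 1 isT isT; have u3 := @heat_der_shift 3 2 isT isT.
rewrite subn1 in u1; rewrite subn2 in u3.
have k3 : `|heat_der 3 y (s0 + sig2) 0| <= Cd.
  apply: heat_der_sbar => //; apply: (half_shift (u := 0) (h := 0) _ _ s00 hsb); rewrite ?subr0//.
  by rewrite divr_ge0.
rewrite -/(F N.-1 1%N 0) in v1; rewrite -/(F N.-2 3%N 0) in v3.
set F1 := F N.-1 1%N 0 in h v1; set F3 := F N.-2 3%N 0 in h v3.
set U1 := heat_der 1 y (s0 + sig2) 0 in u1 *; set U3 := heat_der 3 y (s0 + sig2) 0 in u3 k3 *.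
set U1' := heat_der 1 y _ 0 in u1 v1; set U3' := heat_der 3 y _ 0 in u3 v3.
have NN : N.-1%:R = N%:R - 1 :> R by rewrite -[in N%:R](prednK N0) -natr1; ring.
have h' : `|N%:R^-1 * I - va * F1 - (N%:R - 1) / N%:R * (rho ^+ 2 * F3)| <=
   Cd * (b / q + N%:R * (2 * (b / q)) ^+ 3).
  have -> : N%:R^-1 * I - va * F1 - (N%:R - 1) / N%:R * (rho ^+ 2 * F3) =
    N%:R^-1 * (I - N%:R * (va * F1) - N%:R * (N.-1%:R * ((rho / q) ^+ 2 * F3))).
    by rewrite NN -q2; field; rewrite lt0r_neq0.
  rewrite normrM normfV (gtr0_norm NR) (ler_pdivrMl _ _ NR); apply: (le_trans h).
  rewrite ler_wpM2l ?ler0n// NN mulrDr lerD// mulrCA ler_wpM2l// ler_wpM2r//.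
    by rewrite exprn_ge0// mulr_ge0// divr_ge0// ltW.
  by rewrite gerBl.
have -> : N%:R^-1 * I - (va * U1 + rho ^+ 2 * U3) =
  (N%:R^-1 * I - va * F1 - (N%:R - 1) / N%:R * (rho ^+ 2 * F3))
  + va * ((F1 - U1') + (U1' - U1))
  + (N%:R - 1) / N%:R * (rho ^+ 2 * ((F3 - U3') + (U3' - U3))) - rho ^+ 2 * U3 / N%:R.
  by field; rewrite lt0r_neq0.
set E := N%:R * rate + 2 * (sig2 / N%:R).
have e1 : `|F1 - U1' + (U1' - U1)| <= Cd * E.
  rewrite (le_trans (ler_normD _ _))// /E mulrDr lerD// (le_trans v1)//.
  by rewrite le_eqVlt; apply/orP; left; apply/eqP; ring.
have e3 : `|F3 - U3' + (U3' - U3)| <= Cd * E.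
  rewrite (le_trans (ler_normD _ _))// /E mulrDr lerD// (le_trans v3)//.
  by rewrite le_eqVlt; apply/orP; left; apply/eqP; ring.
have fr : `|(N%:R - 1) / N%:R| <= 1 :> R.
  rewrite ger0_norm; first by rewrite ler_pdivrMr// mul1r gerBl.
  by rewrite divr_ge0// subr_ge0 ler1n.
have -> : Cd * (b / q + N%:R * (2 * (b / q)) ^+ 3 + (va + rho ^+ 2) * E + rho ^+ 2 / N%:R) =
  Cd * (b / q + N%:R * (2 * (b / q)) ^+ 3) + va * (Cd * E) + 1 * (rho ^+ 2 * (Cd * E))
   + rho ^+ 2 * Cd / N%:R by ring.
apply: (le_trans (ler_normB _ _)); apply: lerD.
  apply: (le_trans (ler_normD _ _)); apply: lerD.
    apply: (le_trans (ler_normD _ _)); apply: lerD => //.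
    by rewrite normrM (ger0_norm va0) ler_wpM2l.
  rewrite normrM; apply: ler_pM => //.
  by rewrite normrM ger0_norm ?sqr_ge0// ler_wpM2l// sqr_ge0.
rewrite normrM normfV (gtr0_norm NR); apply: ler_wpM2r; first by rewrite invr_ge0 ltW.
by rewrite normrM ger0_norm ?sqr_ge0// ler_wpM2l// sqr_ge0.
Qed.

End SampleExpansion.

Lemma law_itv d (T : measurableType d) (R : realType) (P : probability T R)
  (X : nat -> {RV P >-> R}) (F : R -> R) u v :
  (forall x, fine (P [set w | X 0%N w <= x]) = F x) -> u <= v ->
  fine (law X `]u, v]%classic) = F v - F u.
Proof.
move=> hF uv; have h := lawF hF.
have hu : measurable (`]-oo, u]%classic : set R) by exact: measurable_itv.
have huv : measurable (`]u, v]%classic : set R) by exact: measurable_itv.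
have e : `]-oo, v]%classic = `]-oo, u]%classic `|` `]u, v]%classic.
  apply/seteqP; split=> z /=; rewrite !in_itv/=.
    by move=> zv; case: (leP z u) => zu; [left | right; rewrite zv].
  by move=> [zu|/andP[_ //]]; exact: le_trans uv.
have di : [disjoint `]-oo, u]%classic & `]u, v]%classic].
  apply/disj_setPS => z [/=]; rewrite !in_itv/= => zu /andP[uz _].
  by have := lt_le_trans uz zu; rewrite ltxx.
have eq : (law X `]-oo, v]%classic = law X `]-oo, u]%classic + law X `]u, v]%classic)%E.
  by rewrite e; exact: (measureU (law X) hu huv (disj_set2P di)).
move: eq => /(congr1 fine); rewrite fineD; last 2 first.
- exact: fin_num_measure.
- exact: fin_num_measure.
by rewrite !h /= => ->; rewrite addrAC subrr add0r.
Qed.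

(** The polynomial [om] is the perturbed weight on the smoothing interval, where clipping is the
    identity and the indicators are constant. *)
Lemma quadratic_ivt (R : realType) (p c xi a d1 v : R) : 0 <= d1 ->
  let om z := (z - p) - xi * ((z - p) ^+ 2 + c) in
  om a <= v -> v <= om (a + d1) -> exists z, [/\ a <= z, z <= a + d1 & om z = v].
Proof.
move=> d0 om h1 h2; have le : a <= a + d1 by rewrite lerDl.
have c1 : continuous om.
  move=> z; apply: cvgB; first by apply: cvgB; [exact: cvg_id | exact: cvg_cst].
  apply: cvgM; first exact: cvg_cst.
  apply: cvgD; last exact: cvg_cst.
  by rewrite /GRing.exp/=; apply: cvgM; apply: cvgB; (exact: cvg_id || exact: cvg_cst).
have c2 : {within `[a, a + d1], continuous om} by exact: continuous_subspaceT.
have [|z + e] := IVT le c2 (v := v); last by rewrite in_itv/= => /andP[? ?]; exists z.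
by rewrite ge_min le_max h1 h2 orbT.
Qed.

(** * Smooth component of the perturbed weight *)

Section PerturbedWeight.
Context d (T : measurableType d) (R : realType) (P : probability T R).
Variable X : nat -> {RV P >-> R}.
Variable F : R -> R.
Hypothesis hF : forall x, fine (P [set w | X 0%N w <= x]) = F x.
Local Notation nu := (law X).
Variables (alpha beta a b mab fa fb sigma d1 : R).
Hypotheses (xab : a < b) (fa0 : 0 < fa) (d10 : 0 < d1) (ad1 : a + d1 <= b).
Hypothesis FJ : forall u v, a <= u -> u <= v -> v <= a + d1 -> fa / 2 * (v - u) <= F v - F u.
Let mu := alpha * a + (beta - alpha) * mab + (1 - beta) * b.
Hypotheses (amu : a <= mu) (mub : mu <= b).
Let W x := clipf a b x - mu.
Let v := vfun alpha beta a b mab fa fb sigma.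
Definition wxi (xi x : R) : R := W x - xi * v x.

Let J : set R := `]a, a + d1].

Let cv := - sigma ^+ 2 - 2 * alpha * (a - mu) / fa * (- alpha)
  - 2 * (1 - beta) * (b - mu) / fb * (1 - beta).
Let om xi z := (z - mu) - xi * ((z - mu) ^+ 2 + cv).

Let wJ xi z : J z -> wxi xi z = om xi z.
Proof.
rewrite /J/= in_itv/= => /andP[az zd].
have zb : z <= b by exact: le_trans zd ad1.
rewrite /wxi /om /W /v /vfun -/mu /clipf leNgt az/= zb/= /cv.
congr (_ - _ * _); ring.
Qed.

Let om_diff xi u u' : `|xi| * (4 * (b - a)) <= 1 -> a <= u -> u <= u' -> u' <= a + d1 ->
  (u' - u) / 2 <= om xi u' - om xi u /\ om xi u' - om xi u <= 2 * (u' - u).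
Proof.
move=> hxi au uu ud.
have -> : om xi u' - om xi u = (u' - u) * (1 - xi * (u + u' - 2 * mu)) by rewrite /om; ring.
have h : `|xi * (u + u' - 2 * mu)| <= 1 / 2.
  have hh : `|u + u' - 2 * mu| <= 2 * (b - a).
    have amu' := amu; have mub' := mub; have ad1' := ad1.
    by rewrite ler_norml; apply/andP; split; lra.
  rewrite normrM; apply: (@le_trans _ _ (`|xi| * (2 * (b - a)))); first by rewrite ler_wpM2l.
  have -> : `|xi| * (2 * (b - a)) = `|xi| * (4 * (b - a)) / 2 by field.
  by rewrite ler_wpM2r.
move: h; rewrite ler_norml => /andP[h1 h2]; have w0 : 0 <= u' - u by rewrite subr_ge0.
split; first by rewrite ler_wpM2l//; lra.
by rewrite mulrC ler_wpM2r//; lra.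
Qed.

(** For small [xi] the weight stretches distances in [J] by a factor between [1 / 2] and 2. Hence
    its image covers a length [d1 / 2] starting at [om xi a], and the density bound [fa / 2] of the
    observations becomes [fa / 4]. Endpoints are pulled back by the intermediate value theorem. *)
Lemma weight_density xi : `|xi| * (4 * (b - a)) <= 1 -> measurable_fun setT (wxi xi) ->
  exists y0, forall a' b', y0 <= a' -> a' <= b' -> b' <= y0 + 2 * (d1 / 4) ->
    fa / 4 * (b' - a') <= fine (nu (J `&` wxi xi @^-1` `]a', b'])).
Proof.
move=> hxi mw; exists (om xi a) => a' b' h1 h2 h3.
have d10' := ltW d10; have ad : a <= a + d1 by rewrite lerDl.
have [g1 _] := om_diff hxi (lexx a) ad (lexx _).
have h4 : b' <= om xi (a + d1).
  by apply: (le_trans h3); move: g1; rewrite addrAC subrr add0r; lra.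
have [u [u1 u2 u3]] := quadratic_ivt d10' h1 (le_trans h2 h4).
have [u' [u1' u2' u3']] := quadratic_ivt d10' (le_trans h1 h2) h4.
rewrite -/(om xi u) in u3; rewrite -/(om xi u') in u3'.
have mJ : measurable (J `&` wxi xi @^-1` `]a', b']).
  by apply: measurableI; [exact: measurable_itv | rewrite -[X in measurable X]setTI; exact: mw].
case: (leP u u') => uu; last first.
  have [g2 _] := om_diff hxi u1' (ltW uu) u2.
  have -> : b' - a' = 0.
    apply/eqP; rewrite subr_eq0 eq_le h2 andbT -u3 -u3' -subr_ge0.
    by apply: le_trans g2; rewrite divr_ge0// subr_ge0 ltW.
  by rewrite mulr0 fine_ge0.
have [g2 g3] := om_diff hxi u1 uu u2'.
apply: (@le_trans _ _ (fine (nu `]u, u']%classic))).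
  rewrite (law_itv hF uu); apply: le_trans (FJ u1 uu u2').
  have -> : fa / 2 * (u' - u) = fa / 4 * (2 * (u' - u)) by field.
  rewrite ler_wpM2l//; first by rewrite divr_ge0// ltW.
  by rewrite -u3 -u3'.
have mI : measurable (`]u, u']%classic : set R) by exact: measurable_itv.
apply: (prob_le nu mI mJ) => z /=; rewrite in_itv/= => /andP[uz zu].
have Jz : J z by rewrite /J/= in_itv/= (le_lt_trans u1 uz) (le_trans zu u2').
split=> //; rewrite /= wJ// in_itv/=; apply/andP; split.
  have [g4 _] := om_diff hxi u1 (ltW uz) (le_trans zu u2').
  by rewrite -u3 -subr_gt0; apply: lt_le_trans g4; rewrite divr_gt0// subr_gt0.
have [g4 _] := om_diff hxi (le_trans u1 (ltW uz)) zu u2'.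
by rewrite -u3' -subr_ge0; apply: le_trans g4; rewrite divr_ge0// subr_ge0.
Qed.

Lemma upd_const x s : J x -> upd a b x s = (s.1, s.2.+1).
Proof.
rewrite /J/= in_itv/= => /andP[az zd]; rewrite /upd leNgt az/= (le_trans zd ad1)/=.
by rewrite add0n add1n.
Qed.

Lemma density_lt1 : 2 * (d1 / 4) * (fa / 4) < 1.
Proof.
have h := FJ (lexx a) (_ : a <= a + d1) (lexx _).
have {}h : fa / 2 * d1 <= 1.
  have := h; rewrite lerDl => /(_ (ltW d10)); rewrite addrAC subrr add0r => /le_trans; apply.
  by rewrite lerBlDr (le_trans (F_le1 hF _))// lerDl (F_ge0 hF).
have -> : 2 * (d1 / 4) * (fa / 4) = (fa / 2 * d1) / 4 by field.
by rewrite ltr_pdivrMr// mul1r (le_lt_trans h)// ltr1n.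
Qed.

End PerturbedWeight.

(** The interval has width [delta / sqrt N], and a block of [m1 >= N / 40] steps gains a factor of
    order [1 / sqrt N]; the product does not depend on [N]. *)
Lemma smoothing_constant (R : realType) (N m1 : nat) (delta p : R) : 0 < delta -> 0 < p ->
  (N <= 40 * m1)%N -> (0 < N)%N ->
  3 / (delta / Num.sqrt (N%:R : R)) / Num.sqrt (1 + m1%:R * p / 4) <=
  1 + 3 / (delta * Num.sqrt (p / 160%:R)).
Proof.
move=> d0 p0 Nm N0; have NR : 0 < N%:R :> R by rewrite ltr0n.
set q := Num.sqrt (N%:R : R); have q0 : 0 < q by rewrite sqrtr_gt0.
have r0 : 0 < Num.sqrt (p / 160%:R) by rewrite sqrtr_gt0 divr_gt0.
have h : q * Num.sqrt (p / 160%:R) <= Num.sqrt (1 + m1%:R * p / 4).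
  rewrite -sqrtrM; last exact: ltW.
  rewrite ler_wsqrtr//.
  apply: (@le_trans _ _ (m1%:R * p / 4)); last by rewrite lerDr.
  have -> : m1%:R * p / 4 = (40 * m1)%:R * (p / 160%:R) :> R by rewrite natrM; field.
  by apply: ler_wpM2r; [apply: divr_ge0 => //; exact: ltW | rewrite ler_nat].
apply: (@le_trans _ _ (3 / (delta * Num.sqrt (p / 160%:R)))); last by rewrite lerDr.
have -> : 3 / (delta * Num.sqrt (p / 160%:R)) = 3 / (delta / q) / (q * Num.sqrt (p / 160%:R)).
  by field; rewrite !lt0r_neq0.
rewrite ler_wpM2l//; first by rewrite !divr_ge0// ltW.
by rewrite lef_pV2// posrE ?mulr_gt0// (lt_le_trans _ h)// mulr_gt0.
Qed.

(** The power 96 is that of eight derivatives of a kernel of width [t ^ -12]; exponential decay in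
    [m1] is only used to the order 97, one more. *)
Lemma smoothing_tiny (R : realType) (p C : R) : 0 < p -> p < 1 -> 0 <= C ->
  exists T0 : R, 1 <= T0 /\ forall (N m1 : nat) (t : R), T0 <= t -> N%:R = t ^+ 16 ->
    (N <= 40 * m1)%N -> (1 - p) ^+ m1 * (C * t ^+ 96) <= 1.
Proof.
move=> p0 p1 C0; have p40 : 0 < p / 40%:R by rewrite divr_gt0.
pose K := (97%:R / (p / 40%:R)) ^+ 97.
have K0 : 0 <= K by rewrite exprn_ge0// divr_ge0// ltW.
exists (1 + C * K); split; first by rewrite lerDl mulr_ge0.
move=> N m1 t Tt NE Nm.
have t1 : 1 <= t by apply: le_trans Tt; rewrite lerDl mulr_ge0.
have t0 : 0 < t by exact: lt_le_trans t1.
have h1 : (1 - p) ^+ m1 <= expR (- (p / 40%:R) * t).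
  apply: (@le_trans _ _ (expR (- p) ^+ m1)).
    by apply: lerXn2r; rewrite ?nnegrE ?expR_ge0 ?expR_ge1Dx// subr_ge0 ltW.
  rewrite -expRM_natl ler_expR mulrN mulNr lerN2.
  have : t <= (40 * m1)%:R.
    apply: (@le_trans _ _ N%:R); last by rewrite ler_nat.
    by rewrite NE -[leLHS]expr1 ler_weXn2l.
  rewrite natrM => h; have -> : m1%:R * p = p / 40%:R * (40%:R * m1%:R) by field.
  by rewrite ler_wpM2l// ltW.
have h2 := expR_decay (n := 97) isT p40 t0.
have h3 := le_trans h1 h2.
apply: (@le_trans _ _ (K / t ^+ 97 * (C * t ^+ 96))).
  by rewrite ler_wpM2r// mulr_ge0// exprn_ge0// ltW.
have -> : K / t ^+ 97 * (C * t ^+ 96) = C * K / t by field; rewrite lt0r_neq0.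
by rewrite ler_pdivrMr// mul1r (le_trans _ Tt)// lerDr.
Qed.

Lemma sbar_bound (R : realType) (u1 u2 u3 u4 : R) : 0 <= u3 -> u2 <= u1 -> 4 * u1 <= u4 ->
  2 * (u4 * 4^-1) <= u4 - 2 * u2 + u3.
Proof. by move=> ???; lra. Qed.

(** * The smoothed probability and the polynomials of the expansion *)

Section SmoothedProbability.
Context d (T : measurableType d) (R : realType) (P : probability T R).
Variable X : nat -> {RV P >-> R}.
Hypothesis hind : mutually_independent P (fun i => (X i : T -> R)).
Hypothesis hid : forall i x,
  fine (P [set w | X i w <= x]) = fine (P [set w | X 0%N w <= x]).
Variable F : R -> R.
Hypothesis hF : forall x, fine (P [set w | X 0%N w <= x]) = F x.
Local Notation nu := (law X).
Let mT := @measurableT _ T.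
Let fT := probT_lty P.
Let mTR := @measurableT _ R.
Let fTR := probT_lty nu.
Variables (alpha beta a b mab fa fb sigma g3 d1 : R).
Hypotheses (a0 : 0 < alpha) (ab : alpha < beta) (b1 : beta < 1) (xab : a < b)
  (fa0 : 0 < fa) (fb0 : 0 < fb) (sig0 : 0 < sigma) (d10 : 0 < d1) (ad1 : a + d1 <= b).
Hypothesis FJ : forall u v, a <= u -> u <= v -> v <= a + d1 -> fa / 2 * (v - u) <= F v - F u.
Hypotheses (Fa : F a = alpha) (Fb : F b = beta).
Let mu := alpha * a + (beta - alpha) * mab + (1 - beta) * b.
Hypotheses (amu : a <= mu) (mub : mu <= b).
Let W x := clipf a b x - mu.
Let v := vfun alpha beta a b mab fa fb sigma.
Hypotheses (mW : measurable_fun setT W) (mv : measurable_fun setT v).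
Variable B : R.
Hypotheses (B1 : 1 <= B) (WB : forall x, `|W x| <= B) (vB : forall x, `|v x| <= B).
Hypotheses (W0 : \int[nu]_x W x = 0) (v0 : \int[nu]_x v x = 0)
  (W2 : \int[nu]_x W x ^+ 2 = sigma ^+ 2) (W3 : \int[nu]_x W x ^+ 3 = g3)
  (Wa : \int[nu]_x ((ind a x - alpha) * W x) = alpha * (a - mu))
  (Wb : \int[nu]_x ((ind b x - beta) * W x) = - (1 - beta) * (b - mu)).
Variable C : R.
Hypothesis hC : 1 <= C /\ forall k y s0 s z, (k <= 12)%N ->
  0 < s0 -> s0 <= s -> `|heat_der k y s z| <= C * (Num.sqrt s0)^-1 ^+ k.

Let bW : bmeas setT W. Proof. by split=> //; exists B. Qed.
Let bv : bmeas setT v. Proof. by split=> //; exists B. Qed.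
Let B0 : 0 <= B. Proof. exact: le_trans B1. Qed.
Let ia x := ind a x - alpha.
Let ib x := ind b x - beta.
Let bia : bmeas setT ia. Proof. by apply: bmeasB; [exact: bmeas_ind | exact: bmeas_cst]. Qed.
Let bib : bmeas setT ib. Proof. by apply: bmeasB; [exact: bmeas_ind | exact: bmeas_cst]. Qed.
Let b0 : 0 < beta. Proof. exact: lt_trans ab. Qed.
Let ia1 x : `|ia x| <= 1.
Proof.
have a0' := a0; have ab' := ab; have b1' := b1.
by rewrite /ia /ind ler_norml; case: (x <= a) => /=; apply/andP; split; lra.
Qed.
Let ib1 x : `|ib x| <= 1.
Proof.
have a0' := a0; have ab' := ab; have b1' := b1.
by rewrite /ib /ind ler_norml; case: (x <= b) => /=; apply/andP; split; lra.
Qed.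

Local Notation wx := (wxi alpha beta a b mab fa fb sigma).
Let kap := \int[nu]_x (W x * v x).
Let v2 := \int[nu]_x v x ^+ 2.

Lemma weight_var xi : \int[nu]_x wx xi x ^+ 2 = sigma ^+ 2 - 2 * xi * kap + xi ^+ 2 * v2.
Proof.
have e x : wx xi x ^+ 2 = W x ^+ 2 - 2 * xi * (W x * v x) + xi ^+ 2 * v x ^+ 2.
  by rewrite /wxi -/(W x) -/(v x); ring.
under eq_Rintegral do rewrite e.
have bWv : bmeas setT (fun x => W x * v x) by exact: bmeasM.
rewrite (RintD mTR fTR (bmeasB (bmeasX 2 bW) (bmeasZ _ bWv)) (bmeasZ _ (bmeasX 2 bv))).
rewrite (RintB mTR fTR (bmeasX 2 bW) (bmeasZ _ bWv)).
by rewrite (RintZ mTR fTR _ bWv) (RintZ mTR fTR _ (bmeasX 2 bv)) W2.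
Qed.

Lemma weight_mean xi : \int[nu]_x wx xi x = 0.
Proof. by rewrite (RintB mTR fTR bW (bmeasZ _ bv)) (RintZ mTR fTR _ bv) W0 v0 mulr0 subr0. Qed.

Lemma weight_third xi : `|xi| <= 1 -> `|\int[nu]_x wx xi x ^+ 3 - g3| <= 7 * B ^+ 3 * `|xi|.
Proof.
move=> x1.
have bw : bmeas setT (wx xi) by apply: bmeasB => //; exact: bmeasZ.
rewrite -W3 -(RintB mTR fTR (bmeasX 3 bw) (bmeasX 3 bW)).
apply: Rint_bound => [|x]; first exact: (bmeasB (bmeasX 3 bw) (bmeasX 3 bW)).1.
have e : wx xi x ^+ 3 - W x ^+ 3 =
    xi * (v x * (- 3 * W x ^+ 2 + 3 * xi * W x * v x - xi ^+ 2 * v x ^+ 2)).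
  by rewrite /wxi -/(W x) -/(v x); ring.
rewrite e normrM mulrC ler_wpM2r// normrM.
have -> : 7 * B ^+ 3 = B * (3 * B ^+ 2 + 3 * 1 * B * B + 1 ^+ 2 * B ^+ 2) by ring.
have sq (u : R) : `|u| <= B -> `|u ^+ 2| <= B ^+ 2.
  by move=> h; rewrite normrX lerXn2r ?nnegrE.
apply: ler_pM => //; apply: (le_trans (ler_normB _ _)); apply: lerD.
  apply: (le_trans (ler_normD _ _)); apply: lerD.
    by rewrite mulNr normrN normrM ger0_norm// ler_wpM2l// sq.
  have n3 : `|3 * xi| <= 3 * 1 by rewrite normrM ger0_norm// ler_wpM2l.
  rewrite normrM; apply: ler_pM => //; rewrite normrM; apply: ler_pM => //.
rewrite normrM; apply: ler_pM => //; last exact: sq.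
by rewrite normrX lerXn2r ?nnegrE.
Qed.

Lemma weight_cov (g : R -> R) rho xi : measurable_fun setT g -> (forall x, `|g x| <= 1) ->
  \int[nu]_x (g x * W x) = rho -> `|\int[nu]_x (g x * wx xi x) - rho| <= B * `|xi|.
Proof.
move=> mg g1 <-; have bg : bmeas setT g by split=> //; exists 1.
have e x : g x * wx xi x = g x * W x - xi * (g x * v x).
  by rewrite /wxi -/(W x) -/(v x); ring.
have -> : \int[nu]_x (g x * wx xi x) = \int[nu]_x (g x * W x) - xi * \int[nu]_x (g x * v x).
  under eq_Rintegral do rewrite e.
  rewrite (RintB mTR fTR (bmeasM bg bW) (bmeasZ _ (bmeasM bg bv))).
  by rewrite (RintZ mTR fTR _ (bmeasM bg bv)).
rewrite addrAC subrr sub0r normrN normrM mulrC ler_wpM2r//.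
apply: Rint_bound => [|x]; first exact: (bmeasM bg bv).1.
by rewrite normrM -[leRHS]mul1r ler_pM.
Qed.

(** The covariance between the mean and the variance estimate, through which studentization changes
    the expansion; in terms of the quantity [d2] below it is [g3 + 2 d2]. *)
Lemma kapE : kap = g3 - 2 * alpha ^+ 2 * (a - mu) ^+ 2 / fa
  + 2 * (1 - beta) ^+ 2 * (b - mu) ^+ 2 / fb.
Proof.
have e x : W x * v x = W x ^+ 3 - sigma ^+ 2 * W x
   - 2 * alpha * (a - mu) / fa * (ia x * W x) - 2 * (1 - beta) * (b - mu) / fb * (ib x * W x).
  rewrite /v /vfun -/mu -/(W x) /ia /ib /ind; ring.
rewrite /kap; under eq_Rintegral do rewrite e.
have b1' := bmeasX 3 bW; have b2' := bmeasZ (sigma ^+ 2) bW.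
have b3' := bmeasZ (2 * alpha * (a - mu) / fa) (bmeasM bia bW).
have b4' := bmeasZ (2 * (1 - beta) * (b - mu) / fb) (bmeasM bib bW).
rewrite (RintB mTR fTR (bmeasB (bmeasB b1' b2') b3') b4') (RintB mTR fTR (bmeasB b1' b2') b3').
rewrite (RintB mTR fTR b1' b2') !(RintZ mTR fTR) ?W3 ?W0; [|exact: bmeasM|exact: bmeasM|exact: bW].
by rewrite Wa Wb; ring.
Qed.

Local Notation cfg := (nat * R * R * R)%type.
Implicit Types (c : cfg).
(* A configuration [(N, t, x, y)] has [N = t ^ 16]; [y] is a threshold close to [x * sigma]. *)
Definition cN c : nat := c.1.1.1.
Definition ct c : R := c.1.1.2.
Definition cx c : R := c.1.2.
Definition cy c : R := c.2.
Definition cxi c : R := cx c / (2 * sigma * ct c ^+ 8).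
Let NR c : R := (cN c)%:R.
Let w c := wx (cxi c).
Let s0 c : R := (ct c ^+ 24)^-1.
Let m1 c : nat := (cN c %/ 20)%N.
Let p := 2 * (d1 / 4) * (fa / 4).
Let p0 : 0 < p. Proof. by rewrite !mulr_gt0// divr_gt0. Qed.
Let p1 : p < 1. Proof. exact (density_lt1 hF d10 FJ). Qed.
Let Ac := 1 + 3 / (d1 / 4 * Num.sqrt (p / 160%:R)).
(** One half is reserved for the change of variance caused by [xi], the other because the Gaussian
    part has to carry the bounds as soon as half of the summands are replaced. *)
Let sbar := sigma ^+ 2 / 4.
Let Cd := edge_cst Ac C sbar.
Let sig2 c := \int[nu]_x w c x ^+ 2.
Variable Kd : R.

(** Collects all consequences of a large [t], so that the expansion can be written as uniform [OO]
    bounds; [adm_large] provides them. *)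
Record admissible c : Prop := Admissible {
  adm_t : 1 <= ct c;
  adm_N : NR c = ct c ^+ 16;
  adm_x : `|cx c| <= ct c;
  adm_N30 : (30 <= cN c)%N;
  adm_xi1 : `|cxi c| <= 1;
  adm_xi2 : `|cxi c| * (4 * (b - a)) <= 1;
  adm_tiny : (1 - p) ^+ m1 c * (C * ct c ^+ 96) <= 1;
  adm_sbar : 2 * sbar <= sig2 c;
  adm_deva : fine (P (dev X ia (cN c) (ct c ^+ 9))) <= Kd / ct c ^+ 50;
  adm_devb : fine (P (dev X ib (cN c) (ct c ^+ 9))) <= Kd / ct c ^+ 50 }.

Hypothesis deva : exists T0 : R, forall (N : nat) (t : R), T0 <= t -> N%:R = t ^+ 16 ->
    fine (P (dev X ia N (t ^+ 9))) <= Kd / t ^+ 50.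
Hypothesis devb : exists T0 : R, forall (N : nat) (t : R), T0 <= t -> N%:R = t ^+ 16 ->
    fine (P (dev X ib N (t ^+ 9))) <= Kd / t ^+ 50.

Lemma adm_large : exists T0 : R, forall c, T0 <= ct c -> NR c = ct c ^+ 16 ->
  `|cx c| <= ct c -> admissible c.
Proof.
have [Ta ha] := deva; have [Tb hb] := devb.
have C0 : 0 <= C by case: hC => h _; exact: le_trans h.
have [Tt [Tt1 ht]] := smoothing_tiny p0 p1 C0.
(* The three summands are the factors which [cxi c], of order [t ^ -7], has to beat in [adm_xi1],
   [adm_xi2] and [adm_sbar]. *)
pose M := 1 + 4 * (b - a) + 4 * `|kap| / sigma ^+ 2.
have ba : 0 <= 4 * (b - a) by rewrite mulr_ge0// subr_ge0 ltW.
have ks : 0 <= 4 * `|kap| / sigma ^+ 2 by rewrite divr_ge0 ?sqr_ge0// mulr_ge0.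
have M1 : 1 <= M by rewrite /M -addrA lerDl addr_ge0.
exists (2 + Tt + `|Ta| + `|Tb| + M / (2 * sigma)) => c hT NE hx.
have M0 : 0 <= M / (2 * sigma) by rewrite divr_ge0 ?(le_trans _ M1)// mulr_ge0// ltW.
have na := normr_ge0 Ta; have nb := normr_ge0 Tb; have la := ler_norm Ta; have lb := ler_norm Tb.
have t2 : 2 <= ct c by lra.
have t1 : 1 <= ct c by lra.
have t0 : 0 < ct c by exact: lt_le_trans t1.
have hM : M / (2 * sigma) <= ct c by lra.
have hTa : Ta <= ct c by lra.
have hTb : Tb <= ct c by lra.
have hTt : Tt <= ct c by lra.
have N30 : (30 <= cN c)%N.
  rewrite -(ler_nat R) -/(NR c) NE; apply: (@le_trans _ _ (2 ^+ 16)).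
    by rewrite -natrX ler_nat.
  by rewrite lerXn2r// nnegrE ltW.
have xiM : `|cxi c| * M <= 1.
  have s2 : 0 < 2 * sigma by rewrite mulr_gt0.
  have t8 : 0 < ct c ^+ 8 by rewrite exprn_gt0.
  have -> : `|cxi c| = `|cx c| / (2 * sigma * ct c ^+ 8).
    by rewrite /cxi normrM normfV (gtr0_norm (mulr_gt0 s2 t8)).
  rewrite mulrAC ler_pdivrMr ?mulr_gt0// mul1r.
  apply: (@le_trans _ _ (ct c * (ct c * (2 * sigma)))).
    apply: ler_pM => //; first exact: le_trans M1.
    by rewrite -ler_pdivrMr.
  have -> : ct c * (ct c * (2 * sigma)) = 2 * sigma * ct c ^+ 2 by ring.
  by apply: ler_wpM2l; [exact: ltW | exact: ler_weXn2l].
have nx := normr_ge0 (cxi c).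
split=> //.
- by apply: le_trans xiM; rewrite ler_peMr.
- by apply: le_trans xiM; rewrite ler_wpM2l// /M addrAC lerDr addr_ge0.
- apply: ht hTt NE _; rewrite /m1; move: (cN c) N30 => n n30; clear -n30; lia.
- rewrite /sig2 /w weight_var.
  have h : `|cxi c| * (4 * `|kap| / sigma ^+ 2) <= 1.
    by apply: le_trans xiM; rewrite ler_wpM2l// /M lerDr addr_ge0.
  have s2 : 0 < sigma ^+ 2 by rewrite exprn_gt0.
  rewrite mulrA ler_pdivrMr// mul1r in h.
  have h2 : cxi c * kap <= `|cxi c| * `|kap| by rewrite -normrM ler_norm.
  have h3 : 0 <= cxi c ^+ 2 * v2.
    by rewrite mulr_ge0 ?sqr_ge0//; apply: Rintegral_ge0 => x _; exact: sqr_ge0.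
  rewrite mulrCA in h.
  have -> : 2 * sbar = 2 * (sigma ^+ 2 * 4^-1) by [].
  have -> : 2 * cxi c * kap = 2 * (cxi c * kap) by rewrite mulrA.
  exact: (sbar_bound h3 h2 h).
- exact: ha.
- exact: hb.
Qed.

Local Notation O := (OO admissible ct).
Let t1 c : admissible c -> 1 <= ct c. Proof. exact: adm_t. Qed.
Let t0 c : admissible c -> 0 < ct c. Proof. by move=> /t1; exact: lt_le_trans. Qed.
Let q c : R := Num.sqrt (NR c).
Let qE c : admissible c -> q c = ct c ^+ 8.
Proof.
move=> tc; rewrite /q (adm_N tc) -[16%N]/(8 * 2)%N exprM sqrtr_sqr ger0_norm//.
by rewrite exprn_ge0// ltW// t0.
Qed.
Let N0 c : admissible c -> 0 < NR c. Proof. by move=> tc; rewrite (adm_N tc) exprn_gt0// t0. Qed.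
Let bw c : bmeas setT (w c). Proof. by apply: bmeasB => //; exact: bmeasZ. Qed.
Let wb c : admissible c -> forall x, `|w c x| <= 2 * B.
Proof.
move=> tc x; rewrite /w /wxi (le_trans (ler_normB _ _))//.
have -> : 2 * B = B + 1 * B by ring.
apply: lerD; first exact: WB.
by rewrite normrM ler_pM// ?(adm_xi1 tc)//; exact: vB.
Qed.
Let gam c := \int[nu]_x w c x ^+ 3.

Let ON : O 16%Z NR.
Proof. by apply: (OO_eq (g := fun c => ct c ^ 16%Z)) (OO_t t1 _) => c /adm_N. Qed.
Let ONV : O (-16)%Z (fun c => (NR c)^-1).
Proof. by apply: (OO_eq (g := fun c => ct c ^ (-16)%Z)) (OO_t t1 _) => c /adm_N ->. Qed.
Let Oq : O 8%Z q.
Proof. by apply: (OO_eq (g := fun c => ct c ^ 8%Z)) (OO_t t1 _) => c /qE. Qed.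
Let OqV : O (-8)%Z (fun c => (q c)^-1).
Proof. by apply: (OO_eq (g := fun c => ct c ^ (-8)%Z)) (OO_t t1 _) => c /qE ->. Qed.
Let Os0 : O (-24)%Z s0.
Proof. by apply: (OO_eq (g := fun c => ct c ^ (-24)%Z)) (OO_t t1 _). Qed.
Let Osig2 : O 0 sig2.
Proof.
apply: (@OO_bnd _ _ _ _ _ ((2 * B) ^+ 2)) => c tc; apply: Rint_bound => [|x].
  exact: (bmeasX 2 (bw c)).1.
by rewrite normrX lerXn2r ?nnegrE ?(wb tc)// mulr_ge0.
Qed.
Let Ogam : O 0 gam.
Proof.
apply: (@OO_bnd _ _ _ _ _ ((2 * B) ^+ 3)) => c tc; apply: Rint_bound => [|x].
  exact: (bmeasX 3 (bw c)).1.
by rewrite normrX lerXn2r ?nnegrE ?(wb tc)// mulr_ge0.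
Qed.
Let Ox : O 1%Z cx. Proof. by exists 1 => c tc; rewrite mul1r expr1z (adm_x tc). Qed.
Let Oxi : O (-7)%Z cxi.
Proof.
apply: (OO_eq (g := fun c => (2 * sigma)^-1 * (cx c * ct c ^ (-8)%Z))).
  move=> c _; have -> : ct c ^ (-8)%Z = (ct c ^+ 8)^-1 by [].
  by rewrite /cxi [in LHS]invfM; ring.
by apply: (OO_Z t1); apply: (OO_M t1 (k1 := 1%Z)) (OO_t t1 (-8)%Z).
Qed.
Let Oh : O (-16)%Z (fun c => sig2 c / NR c).
Proof. by apply: (OO_M t1 (k1 := 0)) ONV. Qed.
Let Oa3 : O (-24)%Z (fun c => gam c / q c ^+ 3).
Proof.
apply: (OO_eq (g := fun c => gam c * ct c ^ (-24)%Z)).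
  by move=> c tc; rewrite (qE tc) -exprM.
by apply: (OO_M t1 (k1 := 0)) (OO_t t1 _).
Qed.
Let Ob4 : O (-32)%Z (fun c => (2 * B) ^+ 4 / NR c ^+ 2).
Proof.
apply: (OO_eq (g := fun c => (2 * B) ^+ 4 * ct c ^ (-32)%Z)).
  by move=> c tc; rewrite (adm_N tc) -exprM.
exact: (OO_Z t1 _ (OO_t t1 _)).
Qed.
Let rate c := `|gam c / q c ^+ 3| + (2 * B) ^+ 4 / NR c ^+ 2 + (sig2 c / NR c) ^+ 2.
Let Orate : O (-24)%Z rate.
Proof.
apply: (OO_D t1 (k1 := (-24)%Z) (k2 := (-32)%Z)) => //; last exact: OO_X2 Oh.
by apply: (OO_D t1 (k1 := (-24)%Z) (k2 := (-32)%Z)) => //; exact: OO_norm.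
Qed.
Let Oedge : O (-16)%Z (fun c => edge_err (cN c) (sig2 c / NR c) (gam c / q c ^+ 3)
  ((2 * B) ^+ 4 / NR c ^+ 2) Cd).
Proof.
rewrite /edge_err; apply: (OO_M t1 (k1 := 16%Z) (k2 := (-32)%Z)) ON _ => //.
have Oc := OO_cst admissible ct Cd.
apply: (OO_D t1 (k1 := (-32)%Z) (k2 := (-32)%Z)) => //.
  apply: (OO_M t1 (k1 := (-32)%Z)) Oc => //.
  by apply: (OO_D t1 (k1 := (-32)%Z) (k2 := (-32)%Z)) => //; exact: OO_X2 Oh.
apply: (OO_M t1 (k1 := (-24)%Z) (k2 := (-8)%Z)) => //; first exact: OO_norm.
apply: (OO_D t1 (k1 := (-8)%Z) (k2 := (-16)%Z)) => //.
  by apply: (OO_M t1 (k1 := 16%Z) (k2 := (-24)%Z)) ON _ => //; apply: (OO_M t1 (k1 := (-24)%Z)) Orate Oc.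
by apply: (OO_M t1 (k1 := (-16)%Z)) Oh Oc.
Qed.

Definition walk_sum c (o : T) : R := stZ X (fun x => w c x / Num.sqrt (cN c)%:R) (iota 0 (cN c)) o.
Definition below_counts c (o : T) : nat * nat := stS X a b (iota 0 (cN c)) o.
Let I k c := \int[P]_o heat_der k (cy c) (s0 c) (walk_sum c o).
Let U k c := heat_der k (cy c) (s0 c + sig2 c) 0.

Let expand c : admissible c ->
  [/\ forall (Q : nat * nat -> R) (qm : R), (forall s, `|Q s| <= qm) -> 0 < qm ->
    `|\int[P]_o heat_der 0 (cy c) (s0 c) (walk_sum c o + Q (below_counts c o)) - I 0 c
       - \int[P]_o (Q (below_counts c o) * heat_der 1 (cy c) (s0 c) (walk_sum c o))| <= qm ^+ 2 * Cd,
   `|I 0 c - U 0 c - gam c / (6 * q c) * U 3 c| <= edge_err (cN c) (sig2 c / NR c)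
       (gam c / q c ^+ 3) ((2 * B) ^+ 4 / NR c ^+ 2) Cd,
   `|I 1 c - U 1 c| <= NR c * (rate c * Cd) &
   forall g : R -> R, measurable_fun setT g -> (forall x, `|g x| <= 1) -> \int[nu]_x g x = 0 ->
    forall va rho, \int[nu]_x g x ^+ 2 = va -> \int[nu]_x (g x * w c x) = rho ->
    `|(NR c)^-1 * \int[P]_o ((\sum_(j <- iota 0 (cN c)) g (X j o)) ^+ 2 * heat_der 1 (cy c) (s0 c) (walk_sum c o))
      - (va * U 1 c + rho ^+ 2 * U 3 c)| <=
    Cd * (2 * B / q c + NR c * (2 * (2 * B / q c)) ^+ 3
      + (va + rho ^+ 2) * (NR c * rate c + 2 * (sig2 c / NR c)) + rho ^+ 2 / NR c)].
Proof.
move=> tc; have [y0 dens] := weight_density hF fa0 d10 ad1 FJ amu mub (adm_xi2 tc) (bw c).1.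
have mJ : measurable (`]a, a + d1]%classic : set R) by exact: measurable_itv.
have dd : 0 < d1 / 4 by rewrite divr_gt0.
have kk : 0 < fa / 4 by rewrite divr_gt0.
have N30 := adm_N30 tc.
have A1 : 1 <= Ac.
  by rewrite /Ac lerDl divr_ge0// mulr_ge0 ?sqrtr_ge0// ltW.
have m40 : (cN c <= 40 * m1 c)%N by rewrite /m1; move: (cN c) N30 => n h; clear -h; lia.
have Npos : (0 < cN c)%N by exact: leq_trans N30.
have hA := smoothing_constant dd p0 m40 Npos.
have s00 : 0 < s0 c by rewrite invr_gt0 exprn_gt0// t0.
have s01 : s0 c <= 1 by rewrite invf_le1 ?exprn_gt0 ?t0// exprn_ege1// t1.
have sq : (Num.sqrt (s0 c))^-1 ^+ 8 = ct c ^+ 96.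
  rewrite /s0 sqrtrV ?exprn_ge0 ?(ltW (t0 tc))// invrK -[24%N]/(12 * 2)%N exprM sqrtr_sqr.
  by rewrite ger0_norm ?exprn_ge0 ?(ltW (t0 tc))// -exprM.
have tiny := adm_tiny tc; rewrite -sq in tiny.
have sb0 : 0 < sbar by rewrite divr_gt0// exprn_gt0.
have m20 : (m1 c * 20 <= cN c)%N by rewrite /m1; move: (cN c) N30 => n h; clear -h; lia.
have m10 : (0 < m1 c)%N by rewrite /m1; move: (cN c) N30 => n h; clear -h; lia.
have uJ := upd_const ad1.
have w0 := weight_mean (cxi c).
split.
- exact: (expand_perturb hind hid (bw c).1 mJ dd kk p1 uJ dens (cy c) sbar A1 hA s00 s01 hC
    tiny N30 m20).
- exact: (expand_main hind hid a b (bw c).1 (wb tc) w0 mJ dd kk p1 dens (cy c) A1 hA s00 s01 hC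
    tiny sb0 (adm_sbar tc) N30 m20 m10).
- exact: (expand_first hind hid a b (bw c).1 (wb tc) w0 mJ dd kk p1 dens (cy c) A1 hA s00 s01 hC
    tiny sb0 (adm_sbar tc) N30 m20 m10).
- exact: (expand_quad hind hid (bw c).1 (wb tc) w0 mJ dd kk p1 dens (cy c) A1 hA s00 s01 hC
    tiny sb0 (adm_sbar tc) N30 m20 m10).
Qed.
Let cap (t x : R) : R := Num.min (x ^+ 2) (t ^+ 18).
Let sumX (g : R -> R) c o := \sum_(j <- iota 0 (cN c)) g (X j o).
Let rho (g : R -> R) c := \int[nu]_x (g x * w c x).

Let mcZ c : measurable_fun setT (walk_sum c).
Proof. by apply: meas_sumX; apply: measurable_funM => //; exact: (bw c).1. Qed.

Let s0gt0 c : admissible c -> 0 < s0 c.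
Proof. by move=> tc; rewrite invr_gt0 exprn_gt0// t0. Qed.

Let sqs0 c : admissible c -> (Num.sqrt (s0 c))^-1 = ct c ^+ 12.
Proof.
move=> tc; rewrite /s0 sqrtrV ?exprn_ge0 ?(ltW (t0 tc))// invrK -[24%N]/(12 * 2)%N exprM sqrtr_sqr.
by rewrite ger0_norm ?exprn_ge0 ?(ltW (t0 tc)).
Qed.

Let uZb k c : (k <= 12)%N -> admissible c -> forall o, `|heat_der k (cy c) (s0 c) (walk_sum c o)| <= C * ct c ^+ 12 ^+ k.
Proof.
move=> k12 tc o; rewrite -(sqs0 tc); case: hC => _ h; apply: h => //; exact: s0gt0.
Qed.

Let buZ k c : (k <= 12)%N -> admissible c -> bmeas setT (fun o => heat_der k (cy c) (s0 c) (walk_sum c o)).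
Proof.
move=> k12 tc; split; last by exists (C * ct c ^+ 12 ^+ k) => o _; exact: uZb.
apply: (measurableT_comp (f := heat_der k (cy c) (s0 c))); last exact: mcZ.
have cu := @blip_cont R unit _ tt (heat_der_blip unit k (cy c) (s0gt0 tc)).
exact: continuous_measurable_fun cu.
Qed.

Let bsumX (g : R -> R) c : measurable_fun setT g -> (forall x, `|g x| <= 1) -> bmeas setT (sumX g c).
Proof.
move=> mg g1; apply: bmeas_sum => j; split; last by exists 1 => o _; exact: g1.
by apply: measurableT_comp.
Qed.

Let sumXN (g : R -> R) c o : (forall x, `|g x| <= 1) -> `|sumX g c o| <= NR c.
Proof.
move=> g1; apply: (le_trans (ler_norm_sum _ _ _)).
apply: (@le_trans _ _ (\sum_(j <- iota 0 (cN c)) 1)); first exact: ler_sum.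
by rewrite big_const_seq count_predT size_iota iter_addr addr0.
Qed.

Let bcap (g : R -> R) c : measurable_fun setT g -> (forall x, `|g x| <= 1) -> 0 <= ct c ->
  bmeas setT (fun o => cap (ct c) (sumX g c o)).
Proof.
move=> mg g1 tc; split.
  by apply: measurable_minr; [exact: (bmeasX 2 (bsumX c mg g1)).1 | exact: measurable_cst].
exists (ct c ^+ 18) => o _; rewrite /cap ger0_norm ?ge_min ?lexx ?orbT//.
by rewrite le_min sqr_ge0/= exprn_ge0.
Qed.

(** Off the deviation event the truncation is inactive; on it the trivial bound [N ^ 2] for the
    squared sum is enough. *)
Let cap_err (g : R -> R) c o : admissible c -> (forall x, `|g x| <= 1) ->
  `|cap (ct c) (sumX g c o) - sumX g c o ^+ 2| <= NR c ^+ 2 * \1_(dev X g (cN c) (ct c ^+ 9)) o.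
Proof.
move=> tc g1; rewrite indicE /cap.
have h2 : 0 <= sumX g c o ^+ 2 by exact: sqr_ge0.
have h18 : 0 <= ct c ^+ 18 by rewrite exprn_ge0// ltW// t0.
case: (boolP (o \in _)) => ho.
  rewrite mulr1 distrC ger0_norm; last by rewrite subr_ge0 ge_min lexx.
  apply: (@le_trans _ _ (sumX g c o ^+ 2)).
    by rewrite gerBl le_min h2 h18.
  by rewrite -[leLHS]ger0_norm// normrX lerXn2r ?nnegrE ?ler0n//; exact: sumXN.
rewrite mulr0; move: ho; rewrite notin_setE /dev/= => /negP; rewrite -ltNge => ho.
have : sumX g c o ^+ 2 <= ct c ^+ 18.
  rewrite -[18%N]/(9 * 2)%N exprM -[leLHS]ger0_norm// normrX lerXn2r ?nnegrE ?exprn_ge0//.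
    by rewrite ltW// t0.
  exact: ltW.
by move=> /min_idPl ->; rewrite subrr normr0.
Qed.

(** The truncated squares are exchanged for the exact ones at a cost [O(t ^ -22)] after division by
    [N], and the exact ones are covered by the last item of [expand]. *)
Let Oquad (g : R -> R) (va : R) : measurable_fun setT g -> (forall x, `|g x| <= 1) -> \int[nu]_x g x = 0 ->
  \int[nu]_x g x ^+ 2 = va ->
  (forall c, admissible c -> fine (P (dev X g (cN c) (ct c ^+ 9))) <= Kd / ct c ^+ 50) ->
  O (-8)%Z (fun c => (NR c)^-1 * \int[P]_o (cap (ct c) (sumX g c o) * heat_der 1 (cy c) (s0 c) (walk_sum c o))
     - (va * U 1 c + rho g c ^+ 2 * U 3 c)).
Proof.
move=> mg g1 g0 gv gdev.
have bg : bmeas setT g by split=> //; exists 1.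
have Orho : O 0 (rho g).
  apply: (@OO_bnd _ _ _ _ _ (2 * B)) => c tc; apply: Rint_bound => [|x].
    exact: (bmeasM bg (bw c)).1.
  by rewrite normrM -[leRHS]mul1r ler_pM// wb.
pose J c := \int[P]_o (sumX g c o ^+ 2 * heat_der 1 (cy c) (s0 c) (walk_sum c o)).
pose J' c := \int[P]_o (cap (ct c) (sumX g c o) * heat_der 1 (cy c) (s0 c) (walk_sum c o)).
apply: (OO_eq (g := fun c => (NR c)^-1 * (J' c - J c)
   + ((NR c)^-1 * J c - (va * U 1 c + rho g c ^+ 2 * U 3 c)))).
  by move=> c _; rewrite /J /J'; ring.
apply: (OO_D t1 (k1 := (-22)%Z) (k2 := (-8)%Z)) => //.
  apply: (OO_M t1 (k1 := (-16)%Z) (k2 := (-6)%Z)) ONV _ => //.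
  exists (C * Kd) => c tc.
  have C0 : 0 <= C by case: hC => h _; exact: le_trans h.
  have t0c := t0 tc.
  have bu := buZ (isT : (1 <= 12)%N) tc.
  have b1' := bmeasX 2 (bsumX c mg g1).
  have b2' := bcap mg g1 (ltW t0c).
  have md : measurable (dev X g (cN c) (ct c ^+ 9)) by exact: meas_dev.
  have bi : bmeas setT (\1_(dev X g (cN c) (ct c ^+ 9)) : T -> R) by exact: bmeas_indic.
  rewrite /J /J' -(RintB mT fT (bmeasM b2' bu) (bmeasM b1' bu)).
  apply: (le_trans (Rint_norm mT fT (bmeasB (bmeasM b2' bu) (bmeasM b1' bu)))).
  apply: (@le_trans _ _ (\int[P]_o ((NR c ^+ 2 * (C * ct c ^+ 12)) * \1_(dev X g (cN c) (ct c ^+ 9)) o))).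
    apply: (Rint_le mT fT).
    - exact: bmeas_norm (bmeasB (bmeasM b2' bu) (bmeasM b1' bu)).
    - exact: bmeasZ.
    move=> o _; rewrite -mulrBl normrM mulrAC; apply: ler_pM => //; first exact: cap_err.
    exact: (uZb (k := 1) isT tc).
  rewrite (RintZ mT fT _ bi) Rint_indic//.
  apply: (@le_trans _ _ (NR c ^+ 2 * (C * ct c ^+ 12) * (Kd / ct c ^+ 50))).
    rewrite ler_wpM2l ?gdev//; apply: mulr_ge0; first exact: sqr_ge0.
    by rewrite mulr_ge0// exprn_ge0// ltW.
  rewrite (adm_N tc) le_eqVlt; apply/orP; left; apply/eqP.
  have -> : ct c ^ (-6)%Z = (ct c ^+ 6)^-1 by [].
  by field; rewrite lt0r_neq0.
have Oc := OO_cst admissible ct Cd; have Ov := OO_cst admissible ct va.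
have Or2 : O 0 (fun c => rho g c ^+ 2) by exact: OO_X2 Orho.
apply: (OO_dom (g := fun c => Cd * (2 * B / q c + NR c * (2 * (2 * B / q c)) ^+ 3
      + (va + rho g c ^+ 2) * (NR c * rate c + 2 * (sig2 c / NR c)) + rho g c ^+ 2 / NR c))).
  move=> c tc; apply: le_trans (ler_norm _).
  have [_ _ _ h] := expand tc; exact: (h g mg g1 g0 va (rho g c) gv erefl).
have Obq : O (-8)%Z (fun c => 2 * B / q c) by exact: OO_Z OqV.
have Obq2 : O (-8)%Z (fun c => 2 * (2 * B / q c)) by exact: OO_Z Obq.
apply: (OO_Z t1); apply: (OO_D t1 (k1 := (-8)%Z) (k2 := (-16)%Z)) => //; last first.
  by apply: (OO_M t1 (k1 := 0)) ONV.
apply: (OO_D t1 (k1 := (-8)%Z) (k2 := (-8)%Z)) => //.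
  apply: (OO_D t1 (k1 := (-8)%Z) (k2 := (-8)%Z)) => //.
  apply: (OO_M t1 (k1 := 16%Z) (k2 := (-24)%Z)) ON _ => //.
  under eq_fun do rewrite exprS; apply: (OO_M t1 (k1 := (-8)%Z) (k2 := (-16)%Z)) => //.
  exact: OO_X2 Obq2.
apply: (OO_M t1 (k1 := 0) (k2 := (-8)%Z)) => //; first exact: (OO_D t1 _ _ Ov Or2).
apply: (OO_D t1 (k1 := (-8)%Z) (k2 := (-16)%Z)) => //; last exact: OO_Z Oh.
by apply: (OO_M t1 (k1 := 16%Z)) ON Orate.
Qed.
Let ra c := alpha * NR c - (ip alpha (cN c))%:R.
Let rb c := beta * NR c - (ip beta (cN c))%:R.
Definition rounding_bias c : R := (alpha * (cN c)%:R - (ip alpha (cN c))%:R) * (a - mab)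
  - (beta * (cN c)%:R - (ip beta (cN c))%:R) * (b - mab).
(* the squared counts are truncated at t^18, which is inactive off [dev], to keep Q small *)
Definition quad_corr c (s : nat * nat) : R := (ct c ^+ 8)^-1 * (rounding_bias c
  - Num.min ((s.1%:R - alpha * (cN c)%:R) ^+ 2) (ct c ^+ 18) / (2 * (cN c)%:R * fa)
  + Num.min ((s.2%:R - beta * (cN c)%:R) ^+ 2) (ct c ^+ 18) / (2 * (cN c)%:R * fb)).

Let ip01 (u : R) n : 0 < u -> `|u * n%:R - (ip u n)%:R| <= 1.
Proof.
move=> u0; have /truncn_itv/andP[h1 h2] : 0 <= u * n%:R by rewrite mulr_ge0// ltW.
rewrite ger0_norm ?subr_ge0//; move: h2; rewrite -natr1 /ip => h2.
by rewrite lerBlDl ltW.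
Qed.

Let sum_count e u c o : \sum_(j <- iota 0 (cN c)) (ind e (X j o) - u) =
  (\sum_(j <- iota 0 (cN c)) (X j o <= e)%R)%N%:R - u * NR c.
Proof.
rewrite big_split/= sumrN natr_sum; congr (_ - _).
by rewrite big_const_seq count_predT size_iota iter_addr addr0 mulr_natr.
Qed.

Let cQE c o : quad_corr c (below_counts c o) = (ct c ^+ 8)^-1 * (rounding_bias c
  - cap (ct c) (sumX ia c o) / (2 * NR c * fa) + cap (ct c) (sumX ib c o) / (2 * NR c * fb)).
Proof. by rewrite /quad_corr /sumX /ia /ib !sum_count. Qed.

Lemma rounding_bias_bound c : `|rounding_bias c| <= `|a - mab| + `|b - mab|.
Proof.
apply: (@le_trans _ _ (1 * `|a - mab| + 1 * `|b - mab|)); last by rewrite !mul1r.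
by rewrite (le_trans (ler_normB _ _))// lerD// normrM ler_wpM2r// ip01.
Qed.

Let Occ0 : O 0 rounding_bias. Proof. by apply: OO_bnd => c _; exact: rounding_bias_bound. Qed.

Let KQ := `|a - mab| + `|b - mab| + (2 * fa)^-1 + (2 * fb)^-1.
Let KQ0 : 0 < KQ.
Proof.
have h1 := normr_ge0 (a - mab); have h2 := normr_ge0 (b - mab).
have h3 : 0 < (2 * fa)^-1 by rewrite invr_gt0 mulr_gt0.
have h4 : 0 < (2 * fb)^-1 by rewrite invr_gt0 mulr_gt0.
by rewrite /KQ; apply: addr_gt0 => //; apply: ltr_wpDl => //; exact: addr_ge0.
Qed.

Let cap_quot c (x fx : R) : admissible c -> 0 < fx ->
  `|Num.min (x ^+ 2) (ct c ^+ 18) / (2 * NR c * fx)| <= (2 * fx)^-1 * ct c ^+ 2.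
Proof.
move=> tc fx0; have tc0 := t0 tc.
have h : 0 <= Num.min (x ^+ 2) (ct c ^+ 18) by rewrite le_min sqr_ge0 exprn_ge0// ltW.
have n0 : 0 < 2 * NR c * fx by rewrite !mulr_gt0// N0.
rewrite ger0_norm; last by rewrite divr_ge0// ltW.
rewrite ler_pdivrMr// (adm_N tc).
have -> : (2 * fx)^-1 * ct c ^+ 2 * (2 * ct c ^+ 16 * fx) = ct c ^+ 18.
  by field; rewrite lt0r_neq0.
by rewrite ge_min lexx orbT.
Qed.

(** Truncation makes the correction [O(t ^ -6)] for every value of the counts, so its second-order
    effect is [O(t ^ -12)]. *)
Let cQb c : admissible c -> forall s, `|quad_corr c s| <= KQ * (ct c ^+ 6)^-1.
Proof.
move=> tc s; have tc0 := t0 tc; rewrite /quad_corr normrM.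
rewrite (ger0_norm (x := (ct c ^+ 8)^-1)); last by rewrite invr_ge0 exprn_ge0// ltW.
have -> : KQ * (ct c ^+ 6)^-1 = (ct c ^+ 8)^-1 * (KQ * ct c ^+ 2).
  by field; rewrite lt0r_neq0.
apply: ler_wpM2l; first by rewrite invr_ge0 exprn_ge0// ltW.
have e1 : 1 <= ct c ^+ 2 by rewrite exprn_ege1// t1.
have h0 : `|rounding_bias c| <= (`|a - mab| + `|b - mab|) * ct c ^+ 2.
  by apply: (le_trans (rounding_bias_bound c)); rewrite ler_peMr// addr_ge0.
have -> : KQ * ct c ^+ 2 = (`|a - mab| + `|b - mab|) * ct c ^+ 2 + (2 * fa)^-1 * ct c ^+ 2
    + (2 * fb)^-1 * ct c ^+ 2 by rewrite /KQ; ring.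
apply: (le_trans (ler_normD _ _)); apply: lerD; last exact: cap_quot.
by apply: (le_trans (ler_normB _ _)); apply: lerD; last exact: cap_quot.
Qed.

Let mia : measurable_fun setT ia. Proof. by case: bia. Qed.
Let mib : measurable_fun setT ib. Proof. by case: bib. Qed.
Let va := alpha * (1 - alpha).
Let vb := beta * (1 - beta).
Let Oqa := Oquad mia ia1 (ind_centered hF Fa) (ind_var hF Fa) adm_deva.
Let Oqb := Oquad mib ib1 (ind_centered hF Fb) (ind_var hF Fb) adm_devb.

Let SI c := \int[P]_o heat_der 0 (cy c) (s0 c) (walk_sum c o + quad_corr c (below_counts c o)).

Let OI1 : O (-8)%Z (fun c => I 1 c - U 1 c).
Proof.
apply: (OO_dom (g := fun c => NR c * (rate c * Cd))).
  by move=> c tc; apply: le_trans (ler_norm _); have [_ _ h _] := expand tc.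
apply: (OO_M t1 (k1 := 16%Z) (k2 := (-24)%Z)) ON _ => //.
by apply: (OO_M t1 (k1 := (-24)%Z)) Orate (OO_cst admissible ct Cd).
Qed.

Let raw : O (-12)%Z (fun c => SI c - (U 0 c + gam c / (6 * q c) * U 3 c
  + (q c)^-1 * (rounding_bias c * U 1 c - (2 * fa)^-1 * (va * U 1 c + rho ia c ^+ 2 * U 3 c)
     + (2 * fb)^-1 * (vb * U 1 c + rho ib c ^+ 2 * U 3 c)))).
Proof.
pose QI c := \int[P]_o (quad_corr c (below_counts c o) * heat_der 1 (cy c) (s0 c) (walk_sum c o)).
pose Ja c := \int[P]_o (cap (ct c) (sumX ia c o) * heat_der 1 (cy c) (s0 c) (walk_sum c o)).
pose Jb c := \int[P]_o (cap (ct c) (sumX ib c o) * heat_der 1 (cy c) (s0 c) (walk_sum c o)).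
have QE c : admissible c -> QI c = (q c)^-1 * (rounding_bias c * I 1 c - (2 * fa)^-1 * ((NR c)^-1 * Ja c)
    + (2 * fb)^-1 * ((NR c)^-1 * Jb c)).
  move=> tc; have tc0 := ltW (t0 tc); have n0 := N0 tc.
  have bu := buZ (isT : (1 <= 12)%N) tc.
  have ba := bmeasM (bcap mia ia1 tc0) bu; have bb := bmeasM (bcap mib ib1 tc0) bu.
  have e o : quad_corr c (below_counts c o) * heat_der 1 (cy c) (s0 c) (walk_sum c o) = (ct c ^+ 8)^-1 * (rounding_bias c * heat_der 1 (cy c) (s0 c) (walk_sum c o)
      - (2 * NR c * fa)^-1 * (cap (ct c) (sumX ia c o) * heat_der 1 (cy c) (s0 c) (walk_sum c o))
      + (2 * NR c * fb)^-1 * (cap (ct c) (sumX ib c o) * heat_der 1 (cy c) (s0 c) (walk_sum c o))).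
    by rewrite cQE; ring.
  rewrite /QI; under eq_Rintegral do rewrite e.
  have bB := bmeasB (bmeasZ (rounding_bias c) bu) (bmeasZ (2 * NR c * fa)^-1 ba).
  rewrite (RintZ mT fT _ (bmeasD bB (bmeasZ (2 * NR c * fb)^-1 bb))).
  rewrite (RintD mT fT bB (bmeasZ _ bb)) (RintB mT fT (bmeasZ _ bu) (bmeasZ _ ba)).
  rewrite (RintZ mT fT _ ba) (RintZ mT fT _ bb) (RintZ mT fT _ bu) -/(Ja c) -/(Jb c) -/(I 1 c) (qE tc).
  by rewrite !invfM; ring.
apply: (OO_eq (g := fun c => (SI c - I 0 c - QI c) + (I 0 c - U 0 c - gam c / (6 * q c) * U 3 c)
  + (q c)^-1 * (rounding_bias c * (I 1 c - U 1 c)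
     - (2 * fa)^-1 * ((NR c)^-1 * Ja c - (va * U 1 c + rho ia c ^+ 2 * U 3 c))
     + (2 * fb)^-1 * ((NR c)^-1 * Jb c - (vb * U 1 c + rho ib c ^+ 2 * U 3 c))))).
  by move=> c tc; rewrite (QE c tc); ring.
apply: (OO_D t1 (k1 := (-12)%Z) (k2 := (-16)%Z)) => //.
  apply: (OO_D t1 (k1 := (-12)%Z) (k2 := (-16)%Z)) => //.
    exists (KQ ^+ 2 * Cd) => c tc; have [h _ _ _] := expand tc.
    have q0 : 0 < KQ * (ct c ^+ 6)^-1 by rewrite mulr_gt0// invr_gt0 exprn_gt0// t0.
    apply: (le_trans (h _ _ (cQb tc) q0)).
    have -> : ct c ^ (-12)%Z = (ct c ^+ 12)^-1 by [].
    rewrite le_eqVlt; apply/orP; left; apply/eqP.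
    by field; rewrite lt0r_neq0// t0.
  apply: OO_dom Oedge => c tc; apply: le_trans (ler_norm _).
  by have [_ h _ _] := expand tc.
apply: (OO_M t1 (k1 := (-8)%Z) (k2 := (-8)%Z)) OqV _ => //.
apply: (OO_D t1 (k1 := (-8)%Z) (k2 := (-8)%Z)) => //; last by exact: OO_Z Oqb.
apply: (OO_B t1 (k1 := (-8)%Z) (k2 := (-8)%Z)) => //; last by exact: OO_Z Oqa.
by apply: (OO_M t1 (k1 := 0)) Occ0 OI1.
Qed.
Let V k c := heat_der k (cy c) (sigma ^+ 2) 0.
Let dlt c := s0 c + sig2 c - sigma ^+ 2.
Let D k := C * (Num.sqrt sbar)^-1 ^+ k.
Let D0 k : 0 <= D k.
Proof.
have C0 : 0 <= C by case: hC => h _; exact: le_trans h.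
by rewrite mulr_ge0// exprn_ge0// invr_ge0 sqrtr_ge0.
Qed.
Let sbar0 : 0 < sbar. Proof. by rewrite divr_gt0// exprn_gt0. Qed.

Let path c r : admissible c -> 0 <= r <= 1 -> sbar <= sigma ^+ 2 + r * dlt c.
Proof.
move=> tc /andP[r0 r1]; have h := adm_sbar tc; have s0c := ltW (s0gt0 tc).
have sb := ltW sbar0; have e : 4 * sbar = sigma ^+ 2 by rewrite /sbar; field.
have -> : sigma ^+ 2 + r * dlt c = (1 - r) * (sigma ^+ 2) + r * (s0 c + sig2 c).
  by rewrite /dlt; ring.
have -> : sbar = (1 - r) * sbar + r * sbar by ring.
apply: lerD; rewrite ler_wpM2l ?subr_ge0//.
  by rewrite -e ler_peMl// ler1n.
by apply: (le_trans _ (lerD s0c h)); rewrite add0r ler_peMl// ler1n.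
Qed.

Let ukD k c s : (k <= 12)%N -> sbar <= s -> `|heat_der k (cy c) s 0| <= D k.
Proof. by move=> k12 hs; case: hC => _ h; exact: h. Qed.

Let OU k : (k <= 12)%N -> O 0 (U k).
Proof.
move=> k12; apply: (@OO_bnd _ _ _ _ _ (D k)) => c tc; apply: ukD => //.
by have := path (r := 1) tc; rewrite ler01 lexx => /(_ isT); rewrite mul1r /dlt addrC subrK.
Qed.
Let OV k : (k <= 12)%N -> O 0 (V k).
Proof.
move=> k12; apply: (@OO_bnd _ _ _ _ _ (D k)) => c tc; apply: ukD => //.
by have := path (r := 0) tc; rewrite ler01 lexx => /(_ isT); rewrite mul0r addr0.
Qed.

Let Odlt : O (-14)%Z (fun c => dlt c + 2 * cxi c * kap).
Proof.
apply: (OO_eq (g := fun c => cxi c ^+ 2 * v2 + s0 c)).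
  by move=> c _; rewrite /dlt /sig2 /w weight_var; ring.
apply: (OO_D t1 (k1 := (-14)%Z) (k2 := (-24)%Z)) => //.
by apply: (OO_M t1 (k1 := (-14)%Z) (k2 := 0)); [|exact: OO_X2 Oxi | exact: OO_cst].
Qed.
Let Oxik : O (-7)%Z (fun c => 2 * cxi c * kap).
Proof.
apply: (OO_eq (g := fun c => 2 * kap * cxi c)); first by move=> c _; ring.
exact: OO_Z Oxi.
Qed.
Let Odlt7 : O (-7)%Z dlt.
Proof.
apply: (OO_eq (g := fun c => (dlt c + 2 * cxi c * kap) - 2 * cxi c * kap)).
  by move=> c _; ring.
by apply: (OO_B t1 (k1 := (-14)%Z) (k2 := (-7)%Z)).
Qed.

Let UE k c : U k c = heat_der k (cy c) (sigma ^+ 2 + dlt c) 0.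
Proof. by rewrite /U /dlt; congr heat_der; ring. Qed.

Let OUV k : (k <= 8)%N -> O (-7)%Z (fun c => U k c - V k c).
Proof.
move=> k8; apply: (OO_dom (g := fun c => D k.+2 * dlt c)) (OO_Z t1 _ Odlt7) => c tc.
rewrite UE normrM (ger0_norm (D0 _)).
apply: (@mvt_bound R (fun s => heat_der k (cy c) s 0) (fun s => 2^-1 * heat_der k.+2 (cy c) s 0)) => r r01.
  by apply: heat_der_ds; apply: (lt_le_trans sbar0); exact: path.
rewrite normrM ger0_norm// -[leRHS]mul1r ler_pM//; first by rewrite invf_le1// ler1n.
by apply: ukD; [exact: leq_trans k8 _ | exact: path].
Qed.

(** The perturbed weight changes the variance by about [- 2 xi kap]. By the heat equation this
    shifts the distribution function by half that amount times the second derivative, a contribution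
    of the same order as the skewness for bounded [x]. *)
Let OUV2 : O (-14)%Z (fun c => U 0 c - V 0 c + cxi c * kap * V 2 c).
Proof.
apply: (OO_eq (g := fun c => (U 0 c - V 0 c - dlt c * (2^-1 * V 2 c))
   + 2^-1 * ((dlt c + 2 * cxi c * kap) * V 2 c))).
  by move=> c _; field.
apply: (OO_D t1 (k1 := (-14)%Z) (k2 := (-14)%Z)) => //; last first.
  by apply: (OO_Z t1); apply: (OO_M t1 (k1 := (-14)%Z)) Odlt (OV _).
apply: (OO_dom (g := fun c => D 4 * dlt c ^+ 2)); last by apply: (OO_Z t1); exact: OO_X2 Odlt7.
move=> c tc; rewrite UE [leRHS]ger0_norm; last by apply: mulr_ge0; [exact: D0 | exact: sqr_ge0].
apply: (@taylor2 R (fun s => heat_der 0 (cy c) s 0) (fun s => 2^-1 * heat_der 2 (cy c) s 0)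
  (fun s => 2^-1 * (2^-1 * heat_der 4 (cy c) s 0))) => r r01.
- by apply: heat_der_ds; apply: (lt_le_trans sbar0); exact: path.
- by apply: dvtZ; apply: heat_der_ds; apply: (lt_le_trans sbar0); exact: path.
rewrite mulrA normrM -[leRHS]mul1r ler_pM//.
  by rewrite ger0_norm// -invfM invf_le1 ?mulr_gt0// -natrM ler1n.
by apply: ukD => //; exact: path.
Qed.

Let Orho (g : R -> R) r : measurable_fun setT g -> (forall x, `|g x| <= 1) ->
  \int[nu]_x (g x * W x) = r -> O (-7)%Z (fun c => rho g c ^+ 2 * U 3 c - r ^+ 2 * V 3 c).
Proof.
move=> mg g1 gr; have O1 : O (-7)%Z (fun c => rho g c - r).
  apply: (OO_dom (g := fun c => B * cxi c)) (OO_Z t1 B Oxi) => c _.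
  by rewrite normrM (ger0_norm B0); exact: weight_cov.
have O2 : O 0 (fun c => rho g c + r).
  apply: (OO_eq (g := fun c => (rho g c - r) + 2 * r)); first by move=> c _; ring.
  by apply: (OO_D t1 _ _ O1 (OO_cst _ _ _)).
apply: (OO_eq (g := fun c => (rho g c - r) * (rho g c + r) * U 3 c + r ^+ 2 * (U 3 c - V 3 c))).
  by move=> c _; ring.
apply: (OO_D t1 (k1 := (-7)%Z) (k2 := (-7)%Z)) => //; last by apply: (OO_Z t1); exact: OUV.
by apply: (OO_M t1 (k1 := (-7)%Z) (k2 := 0)) (OU _) => //; apply: (OO_M t1 (k1 := (-7)%Z)) O1 O2.
Qed.

Let cc1 c := rounding_bias c - va / (2 * fa) + vb / (2 * fb).
Let cc3 := - (alpha * (a - mu)) ^+ 2 / (2 * fa) + ((1 - beta) * (b - mu)) ^+ 2 / (2 * fb).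

Let expanded : O (-12)%Z (fun c => SI c - (V 0 c - cxi c * kap * V 2 c
  + (q c)^-1 * (g3 / 6 * V 3 c + cc1 c * V 1 c + cc3 * V 3 c))).
Proof.
have ea := Orho mia ia1 Wa; have eb := Orho mib ib1 Wb.
have eg : O (-7)%Z (fun c => gam c * U 3 c - g3 * V 3 c).
  apply: (OO_eq (g := fun c => (gam c - g3) * U 3 c + g3 * (U 3 c - V 3 c))).
    by move=> c _; ring.
  apply: (OO_D t1 (k1 := (-7)%Z) (k2 := (-7)%Z)) => //; last by apply: (OO_Z t1); exact: OUV.
  apply: (OO_M t1 (k1 := (-7)%Z)) _ (OU _) => //.
  apply: (OO_dom (g := fun c => 7 * B ^+ 3 * cxi c)) (OO_Z t1 _ Oxi) => c tc.
  rewrite normrM (ger0_norm (x := 7 * B ^+ 3)); last by rewrite mulr_ge0// exprn_ge0.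
  by apply: weight_third; exact: adm_xi1.
apply: (OO_eq (g := fun c => (SI c - (U 0 c + gam c / (6 * q c) * U 3 c
  + (q c)^-1 * (rounding_bias c * U 1 c - (2 * fa)^-1 * (va * U 1 c + rho ia c ^+ 2 * U 3 c)
     + (2 * fb)^-1 * (vb * U 1 c + rho ib c ^+ 2 * U 3 c))))
  + (U 0 c - V 0 c + cxi c * kap * V 2 c)
  + (q c)^-1 * (6^-1 * (gam c * U 3 c - g3 * V 3 c) + cc1 c * (U 1 c - V 1 c)
     - (2 * fa)^-1 * (rho ia c ^+ 2 * U 3 c - (alpha * (a - mu)) ^+ 2 * V 3 c)
     + (2 * fb)^-1 * (rho ib c ^+ 2 * U 3 c - (- (1 - beta) * (b - mu)) ^+ 2 * V 3 c)))).
  by move=> c _; rewrite [in _ / (6 * q c)]invfM /cc1 /cc3; ring.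
apply: (OO_D t1 (k1 := (-12)%Z) (k2 := (-15)%Z)) => //.
  exact: (OO_D t1 _ _ raw OUV2).
apply: (OO_M t1 (k1 := (-8)%Z) (k2 := (-7)%Z)) OqV _ => //.
apply: (OO_D t1 (k1 := (-7)%Z) (k2 := (-7)%Z)) => //; last by exact: OO_Z eb.
apply: (OO_B t1 (k1 := (-7)%Z) (k2 := (-7)%Z)) => //; last by exact: OO_Z ea.
apply: (OO_D t1 (k1 := (-7)%Z) (k2 := (-7)%Z)) => //; first by exact: OO_Z eg.
apply: (OO_M t1 (k1 := 0) (k2 := (-7)%Z)) => //; last exact: OUV.
apply: (OO_D t1 (k1 := 0) (k2 := 0)) => //; last exact: OO_cst.
by apply: (OO_B t1 (k1 := 0) (k2 := 0)) Occ0 (OO_cst _ _ _).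
Qed.

Variable theta : R.
Let near c := admissible c /\ `|cy c - cx c * sigma| <= theta * (ct c ^+ 9)^-1.
Let near_adm c : near c -> admissible c. Proof. by case. Qed.
Let n1 c : near c -> 1 <= ct c. Proof. by case=> /t1. Qed.
Local Notation O' := (OO near ct).
Let OVG k : (k <= 3)%N -> O' (-9)%Z (fun c => V k c - (-1) ^+ k * sigma^-1 ^+ k * Phi_der k (cx c)).
Proof.
move=> k3; have [G [G1 hG]] := Phi_der_bnd R 4.
apply: (OO_dom (g := fun c => ((sigma^-1) ^+ k * G * sigma^-1) * (cy c - cx c * sigma))); last first.
  by apply: (OO_Z n1); exists theta => c [_ h].
move=> c nc.
have si : 0 <= sigma^-1 by rewrite invr_ge0 ltW.
have G0 : 0 <= G by exact: le_trans G1.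
have -> : V k c = (-1) ^+ k * sigma^-1 ^+ k * Phi_der k (cx c + (cy c / sigma - cx c)).
  by rewrite /V /heat_der sqrtr_sqr (gtr0_norm sig0) subr0 addrC subrK.
rewrite -mulrBr !normrM normrX normrN1 expr1n mul1r.
rewrite (ger0_norm (exprn_ge0 _ si)) (ger0_norm G0) (ger0_norm si) -!mulrA.
rewrite ler_wpM2l ?exprn_ge0//.
have -> : sigma^-1 * `|cy c - cx c * sigma| = `|cy c / sigma - cx c|.
  rewrite -{1}(ger0_norm si) -normrM; congr `|_|; field; rewrite lt0r_neq0//.
apply: (@mvt_bound R (Phi_der k) (Phi_der k.+1)) => r _; first exact: derive_Phi_der.
exact: hG.
Qed.

Let d2 := - alpha ^+ 2 / fa * (mu - a) ^+ 2 + (1 - beta) ^+ 2 / fb * (mu - b) ^+ 2.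
(** [HN] in the variables of a configuration; the threshold [cy] does not enter. *)
Definition edgeworth_approx c : R := Phi (cx c) + phi (cx c) / (6 * ct c ^+ 8) *
  ((2 * cx c ^+ 2 + 1) * (g3 / sigma ^+ 3) + 3 * (cx c ^+ 2 + 1) * (d2 / sigma ^+ 3)
   - 6 * (rounding_bias c - alpha * (1 - alpha) / (2 * fa) + beta * (1 - beta) / (2 * fb)) / sigma).

(** Here the polynomials appear. With second derivative [- x phi] and third derivative
    [(x ^ 2 - 1) phi] of [Phi], [kap = g3 + 2 d2] and [cc3 = d2 / 2], the coefficient of
    [phi / (6 q sigma ^ 3)] is [3 x ^ 2 (g3 + 2 d2) + (1 - x ^ 2) (g3 + 3 d2)], that is
    [(2 x ^ 2 + 1) g3 + 3 (x ^ 2 + 1) d2]; [cc1] yields the bias term. *)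
Let smoothed_expansion : O' (-9)%Z (fun c => SI c - edgeworth_approx c).
Proof.
pose E k c := V k c - (-1) ^+ k * sigma^-1 ^+ k * Phi_der k (cx c).
have Oq' : O' (-8)%Z (fun c => (q c)^-1) by exact: OO_sub near_adm OqV.
have Oxi' : O' (-7)%Z cxi by exact: OO_sub near_adm Oxi.
have Occ1 : O' 0 cc1.
  apply: (OO_sub near_adm); apply: (OO_D t1 (k1 := 0) (k2 := 0)) => //; last exact: OO_cst.
  by apply: (OO_B t1 (k1 := 0) (k2 := 0)) Occ0 (OO_cst _ _ _).
apply: (OO_eq (g := fun c => (SI c - (V 0 c - cxi c * kap * V 2 c
  + (q c)^-1 * (g3 / 6 * V 3 c + cc1 c * V 1 c + cc3 * V 3 c)))
  + (E 0%N c - kap * (cxi c * E 2%N c) + (q c)^-1 * ((g3 / 6 + cc3) * E 3%N c + cc1 c * E 1%N c)))).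
  move=> c [tc _]; have tc0 := t0 tc; rewrite /E /edgeworth_approx kapE (qE tc) /cc1 /cc3 /d2 /cxi !Phi_derSS.
  rewrite -[phi _]/(Phi_der 1 _) -[Phi _]/(Phi_der 0 _) /va /vb.
  move: (Phi_der 0 _) (Phi_der 1 _) (SI c) (V _ c) (V _ c) (V _ c) (V _ c) => G0 G1 r0 r1 r2 r3 r4.
  by field; rewrite !lt0r_neq0.
apply: (OO_D n1 (k1 := (-12)%Z) (k2 := (-9)%Z)) => //; first exact: OO_sub near_adm expanded.
apply: (OO_D n1 (k1 := (-9)%Z) (k2 := (-17)%Z)) => //.
  apply: (OO_B n1 (k1 := (-9)%Z) (k2 := (-16)%Z)) => //; first exact: OVG.
  apply: (OO_Z n1); apply: (OO_M n1 (k1 := (-7)%Z) (k2 := (-9)%Z)) => //; exact: OVG.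
apply: (OO_M n1 (k1 := (-8)%Z) (k2 := (-9)%Z)) Oq' _ => //.
apply: (OO_D n1 (k1 := (-9)%Z) (k2 := (-9)%Z)) => //; first by apply: (OO_Z n1); exact: OVG.
by apply: (OO_M n1 (k1 := 0) (k2 := (-9)%Z)) Occ1 (OVG _).
Qed.

Lemma smoothed_cdf : exists M T0 : R, 0 <= M /\ forall c, T0 <= ct c ->
  (cN c)%:R = ct c ^+ 16 -> `|cx c| <= ct c -> `|cy c - cx c * sigma| <= theta / ct c ^+ 9 ->
  `|\int[P]_o heat_der 0 (cy c) (ct c ^+ 24)^-1 (walk_sum c o + quad_corr c (below_counts c o)) - edgeworth_approx c| <= M / ct c ^+ 9.
Proof.
have [T0 hT] := adm_large.
have [M [M0 hM]] := OO_pos n1 smoothed_expansion.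
exists M, T0; split=> // c h1 h2 h3 h4; apply: hM; split=> //; exact: hT.
Qed.

Lemma meas_perturbed_sum c : measurable_fun setT (fun o => walk_sum c o + quad_corr c (below_counts c o)).
Proof.
apply: measurable_funD; first exact: mcZ.
under eq_fun do rewrite cQE.
have mcap (g : R -> R) : measurable_fun setT g -> (forall x, `|g x| <= 1) ->
    measurable_fun setT (fun o => cap (ct c) (sumX g c o)).
  move=> mg g1; apply: measurable_minr; last exact: measurable_cst.
  exact: (bmeasX 2 (bsumX c mg g1)).1.
apply: measurable_funM; first exact: measurable_cst.
apply: measurable_funD; last first.
  by apply: measurable_funM; [exact: mcap | exact: measurable_cst].
apply: measurable_funB; first exact: measurable_cst.
by apply: measurable_funM; [exact: mcap | exact: measurable_cst].
Qed.

End SmoothedProbability.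

(** * Removing the smoothing *)

Section HeatKernelSandwich.
Context (R : realType).

Let E (y t z : R) : 0 < t -> heat_der 0 y (t ^+ 24)^-1 z = Phi ((y - z) * t ^+ 12).
Proof.
move=> t0; rewrite /heat_der !expr0 !mul1r; congr (Phi (_ * _)).
rewrite sqrtrV ?exprn_ge0 ?(ltW t0)// invrK -[24%N]/(12 * 2)%N exprM sqrtr_sqr.
by rewrite ger0_norm ?exprn_ge0 ?(ltW t0).
Qed.

Lemma heat_kernel_ge0 (y t z : R) : 0 < t -> 0 <= heat_der 0 y (t ^+ 24)^-1 z.
Proof. by move=> t0; rewrite E// Phi_ge0. Qed.

Lemma heat_kernel_le1 (y t z : R) : 0 < t -> heat_der 0 y (t ^+ 24)^-1 z <= 1.
Proof. by move=> t0; rewrite E// Phi_le1. Qed.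

Let Phi_mono (x y : R) : x <= y -> Phi x <= Phi y.
Proof.
move=> xy; rewrite -lee_fin !PhiE; apply: le_measure; rewrite ?inE; try exact: measurable_itv.
by apply: subset_itvl; rewrite bnd_simp.
Qed.

(** A distance [t ^ -9] is [t ^ 3] standard deviations of the kernel, and [Phi_tail] at [t ^ 3]
    gives [t ^ -30]. *)
Lemma heat_kernel_sandwich : exists K : R, 0 <= K /\ forall y t z : R, 0 < t ->
  (z <= y - (t ^+ 9)^-1 -> 1 <= heat_der 0 y (t ^+ 24)^-1 z + K / t ^+ 30) /\
  (y + (t ^+ 9)^-1 <= z -> heat_der 0 y (t ^+ 24)^-1 z <= K / t ^+ 30).
Proof.
have [K [K0 hK]] := @Phi_tail R; exists K; split=> // y t z t0.
have t3 : 0 < t ^+ 3 by exact: exprn_gt0.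
have [h1 h2] := hK _ t3; rewrite -exprM in h1 h2.
have e : t ^+ 3 = (t ^+ 9)^-1 * t ^+ 12 by field; rewrite lt0r_neq0.
have t12 : 0 <= t ^+ 12 by rewrite exprn_ge0// ltW.
rewrite E//; split => h.
  rewrite -lerBlDl (le_trans _ h1)// lerD2l lerN2 Phi_mono// e ler_wpM2r//.
  by rewrite lerBrDl -lerBrDr.
apply: le_trans h2; rewrite Phi_mono// e -mulNr ler_wpM2r//.
by rewrite lerBlDr addrC lerBrDr.
Qed.

End HeatKernelSandwich.

Lemma close_of_sandwich (R : realType) (i1 i2 p h m k : R) :
  `|i1 - h| <= m -> `|i2 - h| <= m -> p <= i1 + k -> i2 <= p + k -> `|p - h| <= m + k.
Proof.
by rewrite !ler_norml => /andP[? ?] /andP[? ?] ? ?; apply/andP; split; lra.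
Qed.

(** * The expansion in the central range of arguments *)

Section CentralExpansion.
Context d (T : measurableType d) (R : realType) (P : probability T R).
Variable X : nat -> {RV P >-> R}.
Hypothesis hind : mutually_independent P (fun i => (X i : T -> R)).
Hypothesis hid : forall i x,
  fine (P [set w | X i w <= x]) = fine (P [set w | X 0%N w <= x]).
Variable F : R -> R.
Hypothesis hF : forall x, fine (P [set w | X 0%N w <= x]) = F x.
Local Notation nu := (law X).
Local Notation smp := (sample (fun i => (X i : T -> R))).
Let mT := @measurableT _ T.
Let fT := probT_lty P.
Variables (alpha beta a b mab fa fb sigma g3 d1 L delta : R).
Hypotheses (a0 : 0 < alpha) (ab : alpha < beta) (b1 : beta < 1) (xab : a < b)
  (fa0 : 0 < fa) (fb0 : 0 < fb) (sig0 : 0 < sigma) (d10 : 0 < d1) (ad1 : a + d1 <= b)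
  (delta0 : 0 < delta).
Hypothesis FJ : forall u v, a <= u -> u <= v -> v <= a + d1 -> fa / 2 * (v - u) <= F v - F u.
Hypotheses (Fa : F a = alpha) (Fb : F b = beta).
Hypothesis FLa : forall h, `|h| < delta -> `|F (a + h) - F a - h * fa| <= L * h ^+ 2.
Hypothesis FLb : forall h, `|h| < delta -> `|F (b + h) - F b - h * fb| <= L * h ^+ 2.
Let mu := alpha * a + (beta - alpha) * mab + (1 - beta) * b.
Hypotheses (amu : a <= mu) (mub : mu <= b).
Let W x := clipf a b x - mu.
Let v := vfun alpha beta a b mab fa fb sigma.
Hypotheses (mW : measurable_fun setT W) (mv : measurable_fun setT v).
Variable B : R.
Hypotheses (B1 : 1 <= B) (WB : forall x, `|W x| <= B) (vB : forall x, `|v x| <= B).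
Hypotheses (W0 : \int[nu]_x W x = 0) (v0 : \int[nu]_x v x = 0)
  (W2 : \int[nu]_x W x ^+ 2 = sigma ^+ 2) (W3 : \int[nu]_x W x ^+ 3 = g3)
  (Wa : \int[nu]_x ((ind a x - alpha) * W x) = alpha * (a - mu))
  (Wb : \int[nu]_x ((ind b x - beta) * W x) = - (1 - beta) * (b - mu)).

Let bW : bmeas setT W. Proof. by split=> //; exists B. Qed.
Let bv : bmeas setT v. Proof. by split=> //; exists B. Qed.
Local Notation st := (studentized alpha beta mab).
Local Notation H := (edgeworth_approx alpha beta a b mab fa fb sigma g3).
Local Notation cfg := (nat * R * R * R)%type.

Let G (c : cfg) (o : T) := walk_sum X alpha beta a b mab fa fb sigma c o
  + quad_corr alpha beta a b mab fa fb c (below_counts X a b c o).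

(* off the exceptional event the truncation in [quad_corr] is inactive *)
Let perturbed_sumE (c : cfg) o : let xs := smp (cN c) o in
  regular alpha beta a b mab fa fb sigma (xs, ct c, cx c) ->
  G c o = ct c ^ (-8)%Z * (\sum_(y <- xs) (clipf a b y - mu))
   + (ct c ^ (-8)%Z * ((alpha * (size xs)%:R - (ip alpha (size xs))%:R) * (a - mab)
        - (beta * (size xs)%:R - (ip beta (size xs))%:R) * (b - mab)
        - ((count (<= a) xs)%:R - alpha * (size xs)%:R) ^+ 2 / (2 * (size xs)%:R * fa)
        + ((count (<= b) xs)%:R - beta * (size xs)%:R) ^+ 2 / (2 * (size xs)%:R * fb)))
   - cx c * (\sum_(y <- xs) v y) / (2 * sigma * (size xs)%:R).
Proof.
move=> xs; rewrite /regular/= => -[[t1 NE _ _] [[hA hB _ _] _]].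
rewrite {}/xs in NE hA hB *; rewrite !size_sample in NE hA hB *.
rewrite !count_sample in hA hB *; rewrite !sum_sample.
have t0 : 0 < ct c by exact: lt_le_trans t1.
have NE' : (cN c)%:R = ct c ^+ 16 by exact: NE.
have capE (x : R) : `|x| <= ct c ^ 9%Z -> Num.min (x ^+ 2) (ct c ^+ 18) = x ^+ 2.
  move=> h; apply/min_idPl; rewrite -[18%N]/(9 * 2)%N exprM -[leLHS]ger0_norm ?sqr_ge0// normrX.
  by rewrite lerXn2r ?nnegrE ?exprn_ge0// ltW.
have sq : Num.sqrt (cN c)%:R = ct c ^+ 8.
  by rewrite NE' -[16%N]/(8 * 2)%N exprM sqrtr_sqr ger0_norm// exprn_ge0// ltW.
rewrite /G /quad_corr /below_counts /stS /walk_sum /stZ /= sq !capE//.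
set A := _ - alpha * _ in hA *; set A' := _ - beta * _ in hB *.
rewrite -mulr_suml; rewrite /wxi -/mu sumrB -mulr_sumr -/v /cxi /rounding_bias NE'.
rewrite -[ct c ^ (-8)%Z]/((ct c ^+ 8)^-1).
set S1 := \sum_(_ <- _) _; set S2 := \sum_(_ <- _) _.
by field; rewrite !lt0r_neq0.
Qed.

Let mG c : measurable_fun setT (G c).
Proof. exact: (meas_perturbed_sum X a0 ab b1 mW mv WB vB). Qed.

(** The probability is enclosed between smoothed ones at thresholds [x sigma -/+ (Cb + 1) t ^ -9]:
    [Cb] pays for the Bahadur remainder and 1 for the width of the kernel. [smoothed_cdf] gives both
    the same value up to [O(t ^ -9)]. *)
Lemma central_expansion : exists M T0 : R, [/\ 0 <= M, 1 <= T0 &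
  forall (N : nat) (t x : R), T0 <= t -> N%:R = t ^+ 16 -> `|x| <= t ->
  `|fine (P [set o | st (smp N o) <= x]) - H (N, t, x, 0)| <= M / t ^+ 9].
Proof.
have [C hC] := heat_der_bnd R 12.
have bia : bmeas setT (fun x => ind a x - alpha).
  by apply: bmeasB; [exact: bmeas_ind | exact: bmeas_cst].
have bib : bmeas setT (fun x => ind b x - beta).
  by apply: bmeasB; [exact: bmeas_ind | exact: bmeas_cst].
have [Ka [Ta [Ka0 Ta1 ha]]] := dev_decay hind hid bia (ind_centered hF Fa).
have [Kb [Tb [Kb0 Tb1 hb]]] := dev_decay hind hid bib (ind_centered hF Fb).
have [Kp [Kp0 hKp]] := heat_kernel_sandwich R.
have [Kr [Tr [Kr0 Tr4 hr]]] := regular_sample hind hid hF ab fa0 fb0 delta0 Fa Fb FLa FLb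
  bW bv W0 v0.
have [Cb [Tc [Cb0 Tc1 hbah]]] := bahadur a0 ab b1 xab fa0 fb0 sig0 amu mub.
pose Kd := Ka + Kb.
have deva : exists T0 : R, forall (N : nat) (t : R), T0 <= t -> N%:R = t ^+ 16 ->
    fine (P (dev X (fun x => ind a x - alpha) N (t ^+ 9))) <= Kd / t ^+ 50.
  exists Ta => N t tT NE; apply: (le_trans (ha N t tT NE)).
  rewrite ler_wpM2r ?lerDl// invr_ge0 exprn_ge0//; apply: le_trans tT; exact: le_trans Ta1.
have devb : exists T0 : R, forall (N : nat) (t : R), T0 <= t -> N%:R = t ^+ 16 ->
    fine (P (dev X (fun x => ind b x - beta) N (t ^+ 9))) <= Kd / t ^+ 50.
  exists Tb => N t tT NE; apply: (le_trans (hb N t tT NE)).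
  rewrite ler_wpM2r ?lerDr// invr_ge0 exprn_ge0//; apply: le_trans tT; exact: le_trans Tb1.
have [M [Ts [M0 hs]]] := smoothed_cdf hind hid hF a0 ab b1 xab fa0 fb0 sig0 d10 ad1 FJ Fa Fb amu mub
  mW mv B1 WB vB W0 v0 W2 W3 Wa Wb hC deva devb (Cb + 1).
exists (M + Kr + Kp), (Tr + Tc + `|Ts|); split.
- by rewrite !addr_ge0.
- have h1 := normr_ge0 Ts; lra.
move=> N t x tT NE xt.
have [tTr tTc tTs] : [/\ Tr <= t, Tc <= t & Ts <= t].
  have h1 := normr_ge0 Ts; have h2 := ler_norm Ts; split; lra.
have t1 : 1 <= t by exact: le_trans tTc.
have t0 : 0 < t by exact: lt_le_trans t1.
have [Bad [mBad PBad hreg]] := hr N t tTr NE.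
have mE : measurable [set o | st (smp N o) <= x].
  have ba : 0 <= beta - alpha by rewrite subr_ge0 ltW.
  have := meas_FNS_event X mab N x ba; congr (measurable _).
  by apply/funext => o; rewrite /mkset /studentized (size_sample X N o).
set Ev := [set o | _] in mE *.
pose e9 := (t ^+ 9)^-1.
have e90 : 0 <= e9 by rewrite invr_ge0 exprn_ge0// ltW.
have bu y : bmeas setT (fun o => heat_der 0 y (t ^+ 24)^-1 (G (N, t, x, y) o)).
  split; last first.
    exists 1 => o _; rewrite ger0_norm; first exact: heat_kernel_le1.
    exact: heat_kernel_ge0.
  have s0 : 0 < (t ^+ 24)^-1 by rewrite invr_gt0 exprn_gt0.
  apply: (measurableT_comp (f := heat_der 0 y (t ^+ 24)^-1)); last exact: mG.
  have cu := @blip_cont R unit _ tt (heat_der_blip unit 0 y s0).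
  exact: continuous_measurable_fun cu.
have near y : `|y - x * sigma| <= (Cb + 1) * e9 ->
    `|\int[P]_o heat_der 0 y (t ^+ 24)^-1 (G (N, t, x, y) o) - H (N, t, x, 0)| <= M * e9.
  by move=> hy; exact: (hs (N, t, x, y) tTs NE xt hy).
have e9z : t ^ (-9)%Z = e9 by [].
have GE y o : ~ Bad o -> (Ev o -> G (N, t, x, y) o <= x * sigma + Cb * e9) /\
    (G (N, t, x, y) o <= x * sigma - Cb * e9 -> Ev o).
  move=> hB; have rg := hreg o x hB xt.
  have := hbah _ rg tTc; rewrite (perturbed_sumE (c := (N, t, x, y)) rg) e9z; exact.
have bE : bmeas setT (\1_Ev : T -> R) by exact: bmeas_indic.
have bB : bmeas setT (\1_Bad : T -> R) by exact: bmeas_indic.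
have Kt : Kp / t ^+ 30 <= Kp * e9.
  by rewrite ler_wpM2l// lef_pV2 ?posrE ?exprn_gt0// ler_weXn2l.
have kk (y z : R) := hKp y t z t0.
have up : fine (P Ev) <= \int[P]_o heat_der 0 (x * sigma + (Cb + 1) * e9) (t ^+ 24)^-1
     (G (N, t, x, x * sigma + (Cb + 1) * e9) o) + (Kr + Kp) * e9.
  set y := x * sigma + _.
  rewrite -(Rint_indic P mE).
  apply: (@le_trans _ _ (\int[P]_o ((heat_der 0 y (t ^+ 24)^-1 (G (N, t, x, y) o) + \1_Bad o) + Kp * e9))).
    apply: (Rint_le mT fT) => //.
      by apply: bmeasD; [exact: bmeasD | exact: bmeas_cst].
    move=> o _; rewrite !indicE; have g0 := heat_kernel_ge0 y (G (N, t, x, y) o) t0.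
    have k0 : 0 <= Kp * e9 by exact: mulr_ge0.
    case: (boolP (o \in Bad)) => hB.
      by case: (o \in Ev) => /=; rewrite -addrA; [rewrite -[leLHS]add0r lerD// lerDl | rewrite !addr_ge0].
    rewrite addr0; case: (boolP (o \in Ev)) => hE; last by rewrite addr_ge0.
    rewrite notin_setE in hB; rewrite inE in hE.
    have [g1 _] := GE y o hB; have {}g1 := g1 hE.
    have [h _] := kk y (G (N, t, x, y) o); apply: (le_trans (h _)); last by rewrite lerD2l.
    by apply: (le_trans g1); rewrite /y mulrDl mul1r addrA addrK.
  rewrite (RintD mT fT (bmeasD (bu y) bB) (bmeas_cst _ _)) (RintD mT fT (bu y) bB).
  by rewrite Rint_indic// Rint_prob_cst mulrDl addrA lerD2r lerD2l.
have dn : \int[P]_o heat_der 0 (x * sigma - (Cb + 1) * e9) (t ^+ 24)^-1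
     (G (N, t, x, x * sigma - (Cb + 1) * e9) o) <= fine (P Ev) + (Kr + Kp) * e9.
  set y := x * sigma - _.
  rewrite -(Rint_indic P mE).
  apply: (@le_trans _ _ (\int[P]_o ((\1_Ev o + \1_Bad o) + Kp * e9))).
    apply: (Rint_le mT fT) => //.
      by apply: bmeasD; [exact: bmeasD | exact: bmeas_cst].
    move=> o _; rewrite !indicE; have g0 := heat_kernel_le1 y (G (N, t, x, y) o) t0.
    have k0 : 0 <= Kp * e9 by exact: mulr_ge0.
    case: (boolP (o \in Bad)) => hB.
      apply: (le_trans g0); rewrite [X in _ <= X + _]addrC -addrA lerDl; exact: addr_ge0.
    rewrite addr0; case: (boolP (o \in Ev)) => hE; first by apply: (le_trans g0); rewrite lerDl.
    rewrite notin_setE in hB; rewrite notin_setE in hE; rewrite add0r.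
    have [_ g1] := GE y o hB.
    have [_ h] := kk y (G (N, t, x, y) o); apply: le_trans (h _) Kt.
    have : x * sigma - Cb * e9 <= G (N, t, x, y) o.
      by rewrite leNgt; apply/negP => /ltW /g1.
    by apply: le_trans; rewrite /y mulrDl mul1r opprD addrA subrK.
  rewrite (RintD mT fT (bmeasD bE bB) (bmeas_cst _ _)) (RintD mT fT bE bB).
  by rewrite !Rint_indic// Rint_prob_cst mulrDl addrA lerD2r lerD2l.
have n1 := near (x * sigma + (Cb + 1) * e9); have n2 := near (x * sigma - (Cb + 1) * e9).
have c0 : 0 <= (Cb + 1) * e9 by apply: mulr_ge0 => //; rewrite addr_ge0.
rewrite addrAC subrr add0r (ger0_norm c0) lexx in n1.
rewrite addrAC subrr add0r normrN (ger0_norm c0) lexx in n2.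
have {}n1 := n1 isT; have {}n2 := n2 isT.
have e : (M + Kr + Kp) / t ^+ 9 = M * e9 + (Kr + Kp) * e9 by rewrite /e9; ring.
by rewrite e; exact: (close_of_sandwich n1 n2 up dn).
Qed.

End CentralExpansion.

(** To the right of [t] the value of [p] lies between [p t], within [m + k] of 1, and 1 itself;
    symmetrically to the left of [- t]. The closeness of [h] to 0 or 1 costs a second [k]. *)
Lemma uniform_of_central (R : realType) (p h : R -> R) (t k m : R) :
  0 <= t -> 0 <= k -> (forall x, 0 <= p x <= 1) -> {homo p : x y / x <= y} ->
  (forall x, `|x| <= t -> `|p x - h x| <= m) ->
  (forall x, t <= `|x| -> `|h x - ((0 < x)%R : nat)%:R| <= k) ->
  0 < t -> forall x, `|p x - h x| <= m + 2 * k.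
Proof.
move=> t0 k0 p01 pm hc ht t1 x; case: (leP `|x| t) => [xt|/ltW tx].
  by rewrite (le_trans (hc x xt))// lerDl mulr_ge0.
have hx := ht x tx; have /andP[px0 px1] := p01 x.
have nt : `|t| = t by exact: ger0_norm.
case: (ltP 0 x) hx => x0 /=.
  have tx' : t <= x by rewrite -(gtr0_norm x0).
  have hct := hc t; rewrite nt lexx in hct; have {}hct := hct isT.
  have htt := ht t; rewrite nt lexx t1 /= in htt; have {}htt := htt isT.
  have := pm _ _ tx'; move: hct htt; rewrite !ler_norml.
  move=> /andP[? ?] /andP[? ?] ? /andP[? ?]; apply/andP; split; lra.
have tx' : x <= - t by rewrite lerNr -(ler0_norm x0).
have hct := hc (- t); rewrite normrN nt lexx in hct; have {}hct := hct isT.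
have htt := ht (- t); rewrite normrN nt lexx oppr_gt0 ltNge t0 /= in htt; have {}htt := htt isT.
have := pm _ _ tx'; move: hct htt; rewrite !ler_norml.
move=> /andP[? ?] /andP[? ?] ? /andP[? ?]; apply/andP; split; lra.
Qed.

Lemma correction_bound (R : realType) (x p q r rho s : R) : 1 <= x -> `|r| <= rho ->
  `|(2 * x + 1) * p + 3 * (x + 1) * q - 6 * r / s| <= (`|p| * 3 + 6 * `|q| + 6 * rho * `|s^-1|) * x.
Proof.
move=> x1 hr; have x0 : 0 <= x by exact: le_trans x1.
have -> : (`|p| * 3 + 6 * `|q| + 6 * rho * `|s^-1|) * x =
  3 * x * `|p| + 6 * x * `|q| + 6 * rho * `|s^-1| * x by ring.
apply: (le_trans (ler_normB _ _)); apply: lerD.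
  apply: (le_trans (ler_normD _ _)); apply: lerD.
    by rewrite normrM ger0_norm; [rewrite ler_wpM2r//|]; lra.
  by rewrite normrM ger0_norm; [rewrite ler_wpM2r//|]; lra.
rewrite !normrM (ger0_norm (x := 6))//; apply: (@le_trans _ _ (6 * rho * `|s^-1|)).
  by rewrite ler_wpM2r// ler_wpM2l.
rewrite ler_peMr// mulr_ge0// mulr_ge0//; exact: le_trans hr.
Qed.

(** * The approximation outside the central range *)

Section Tail.
Context (R : realType).
Variables (alpha beta a b mab fa fb sigma g3 : R).
Hypotheses (a0 : 0 < alpha) (ab : alpha < beta).

(** The polynomial factor is [O(x ^ 2)] with a bounded bias term, and boundedness of [|x| ^ 3 phi x]
    gains a factor [1 / t] beyond the prefactor [t ^ -8]. *)
Lemma edgeworth_approx_tail : exists K : R, 0 <= K /\ forall c, 1 <= ct c -> ct c <= `|cx c| ->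
  `|edgeworth_approx alpha beta a b mab fa fb sigma g3 c - ((0 < cx c)%R : nat)%:R| <= K / ct c ^+ 9.
Proof.
have [K1 [K10 h1]] := Phi_tail R; have [K2 h2] := phi_decay R 3.
rewrite /edgeworth_approx; set d2 := _ + _; set e2 := alpha * (1 - alpha) / _; set e3 := beta * (1 - beta) / _.
pose K3 := `|g3 / sigma ^+ 3| * 3 + 6 * `|d2 / sigma ^+ 3|
   + 6 * (`|a - mab| + `|b - mab| + `|e2| + `|e3|) * `|sigma^-1|.
have K20 : 0 <= K2 by apply: le_trans (h2 0); rewrite mulr_ge0 ?phi_ge0.
have K30 : 0 <= K3.
  by rewrite !addr_ge0// ?mulr_ge0// !addr_ge0.
exists (K1 + K2 * K3); split; first by rewrite addr_ge0// mulr_ge0.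
move=> c t1 tx; move: (rounding_bias_bound a b mab a0 ab c); move: (rounding_bias _ _ _ _ _ _) => c0.
move: (ct c) (cx c) t1 tx => t x t1 tx hc0.
have t0 : 0 < t by exact: lt_le_trans t1.
have x1 : 1 <= `|x| by exact: le_trans tx.
have x0 : 0 < `|x| by exact: lt_le_trans x1.
have P1 : `|Phi x - ((0 < x)%R : nat)%:R| <= K1 / t ^+ 9.
  have [g1 g2] := h1 _ x0.
  have g3' : K1 / `|x| ^+ 10 <= K1 / t ^+ 9.
    rewrite ler_wpM2l// lef_pV2 ?posrE ?exprn_gt0//.
    apply: (@le_trans _ _ (t ^+ 10)); first by rewrite ler_weXn2l.
    by rewrite lerXn2r ?nnegrE// ltW.
  apply: le_trans g3'; case: (ltP 0 x) g1 g2 => hx.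
    by rewrite (gtr0_norm hx) => g1 _; rewrite distrC ger0_norm// subr_ge0 Phi_le1.
  by rewrite (ler0_norm hx) opprK subr0 => _ g2; rewrite ger0_norm// Phi_ge0.
have x2 : 1 <= x ^+ 2 by rewrite -[_ ^+ 2]ger0_norm ?sqr_ge0// normrX exprn_ege1.
have P2 : `|(2 * x ^+ 2 + 1) * (g3 / sigma ^+ 3) + 3 * (x ^+ 2 + 1) * (d2 / sigma ^+ 3)
     - 6 * (c0 - e2 + e3) / sigma| <= K3 * x ^+ 2.
  apply: correction_bound x2 _.
  by rewrite (le_trans (ler_normD _ _))// lerD// (le_trans (ler_normB _ _))// lerD.
set Q := (X in phi x / _ * X); have {}P2 : `|Q| <= K3 * x ^+ 2 := P2.
rewrite (addrAC (Phi x)) (mulrDl K1); apply: le_trans (ler_normD _ _) (lerD P1 _).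
rewrite normrM; have p0 := phi_ge0 x.
have -> : `|phi x / (6 * t ^+ 8)| = phi x / (6 * t ^+ 8).
  by rewrite ger0_norm// divr_ge0// mulr_ge0// exprn_ge0// ltW.
have d0 : 0 < 6 * t ^+ 8 by rewrite mulr_gt0// exprn_gt0.
apply: (@le_trans _ _ (phi x / (6 * t ^+ 8) * (K3 * x ^+ 2))).
  by rewrite ler_wpM2l// divr_ge0// ltW.
have -> : phi x / (6 * t ^+ 8) * (K3 * x ^+ 2) = K3 * (phi x * x ^+ 2) / (6 * t ^+ 8) by ring.
rewrite ler_pdivrMr//.
have hx : phi x * x ^+ 2 <= K2 / t.
  rewrite ler_pdivlMr//; apply: le_trans (h2 x).
  rewrite -[x ^+ 2]ger0_norm ?sqr_ge0// normrX.
  have -> : `|x| ^+ 3 * phi x = phi x * `|x| ^+ 2 * `|x| by ring.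
  by rewrite ler_wpM2l// mulr_ge0// exprn_ge0.
apply: (@le_trans _ _ (K3 * (K2 / t))); first by rewrite ler_wpM2l.
have -> : K2 * K3 / t ^+ 9 * (6 * t ^+ 8) = 6 * (K3 * (K2 / t)) by field; rewrite lt0r_neq0.
by rewrite ler_peMl ?ler1n// mulr_ge0// divr_ge0// ltW.
Qed.

End Tail.

Lemma sixteenth_root (R : realType) (t0 : R) : exists N0 : nat, forall N, (N0 <= N)%N ->
  exists t : R, t0 <= t /\ N%:R = t ^+ 16.
Proof.
pose s := 1 + `|t0|; have s1 : 1 <= s by rewrite lerDl.
exists (Num.truncn (s ^+ 16)).+1 => N hN.
have hs : s ^+ 16 <= N%:R.
  apply: (@le_trans _ _ (Num.truncn (s ^+ 16)).+1%:R); last by rewrite ler_nat.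
  exact: ltW (truncnS_gt _).
exists (Num.sqrt (Num.sqrt (Num.sqrt (Num.sqrt N%:R)))); split; last first.
  by rewrite -[16%N]/(2 * 2 * 2 * 2)%N !exprM !sqr_sqrtr ?sqrtr_ge0.
have root (u y : R) : 0 <= u -> u ^+ 2 <= y -> u <= Num.sqrt y.
  by move=> u0 uy; rewrite -[leLHS]ger0_norm// -sqrtr_sqr ler_wsqrtr.
have s0 : 0 <= s by exact: le_trans s1.
apply: (@le_trans _ _ s); first by rewrite (le_trans (ler_norm _))// lerDr.
have s2 := exprn_ge0 2 s0; have s4 := exprn_ge0 2 s2; have s8 := exprn_ge0 2 s4.
apply: (root _ _ s0); apply: (root _ _ s2); apply: (root _ _ s4); apply: (root _ _ s8).
by rewrite -!exprM.
Qed.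

(** * Assembly from the hypotheses on [F] and [f] *)

Section Main.
Context d (T : measurableType d) (R : realType) (P : probability T R).
Variable X : nat -> {RV P >-> R}.
Hypothesis hind : mutually_independent P (fun i => (X i : T -> R)).
Variables (F f : R -> R) (alpha beta : R).
Hypotheses (a0 : 0 < alpha) (ab : alpha < beta) (b1 : beta < 1).
Hypothesis hF : forall i x, fine (P [set w | X i w <= x]) = F x.
Local Notation a := (quantile F alpha).
Local Notation b := (quantile F beta).
Local Notation fns := (FNS P (fun i => (X i : T -> R)) F alpha beta).
Local Notation hn := (HN F f alpha beta).
Local Notation sigma := (sigmaW F alpha beta).
Local Notation mab := (mu_ab F alpha beta).
Variables (L delta : R).
Hypotheses (delta0 : 0 < delta)
  (dFa : forall x, `|x - a| < delta -> is_derive x 1 F (f x))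
  (fLa : forall x y, `|x - a| < delta -> `|y - a| < delta -> `|f x - f y| <= L * `|x - y|)
  (dFb : forall x, `|x - b| < delta -> is_derive x 1 F (f x))
  (fLb : forall x y, `|x - b| < delta -> `|y - b| < delta -> `|f x - f y| <= L * `|x - y|)
  (fa0 : 0 < f a) (fb0 : 0 < f b).

Let hF0 := hF 0%N.
Let hid i x : fine (P [set w | X i w <= x]) = fine (P [set w | X 0%N w <= x]).
Proof. by rewrite !hF. Qed.
Let b0 : 0 < beta. Proof. exact: lt_trans ab. Qed.
Let a1 : alpha < 1. Proof. exact: lt_trans b1. Qed.
Let FLa := cdf_quad delta0 dFa fLa.
Let FLb := cdf_quad delta0 dFb fLb.
Let Fa : F a = alpha. Proof. exact: cdf_quantile hF0 a0 a1 delta0 FLa. Qed.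
Let Fb : F b = beta. Proof. exact: cdf_quantile hF0 b0 b1 delta0 FLb. Qed.
Let xab : a < b. Proof. exact: (xa_lt_xb hF0 ab Fa Fb). Qed.
Let mTR := @measurableT _ R.
Let fTR := probT_lty (law X).
Let mu := alpha * a + (beta - alpha) * mab + (1 - beta) * b.
Let muE : muW F alpha beta = mu. Proof. exact: (muW_split hF0 a0 ab b1 Fa Fb). Qed.
Let bclip := bmeas_clip hF0 ab Fa Fb.
Let amu : a <= mu.
Proof.
rewrite -muE (muWE hF0 a0 ab b1 Fa Fb) -[leLHS](Rint_prob_cst (law X)).
apply: (Rint_le mTR fTR) => //; first exact: bmeas_cst.
by move=> x _; exact: (clip_ge hF0 ab Fa Fb).
Qed.
Let mub : mu <= b.
Proof.
rewrite -muE (muWE hF0 a0 ab b1 Fa Fb) -[leRHS](Rint_prob_cst (law X)).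
apply: (Rint_le mTR fTR) => //; first exact: bmeas_cst.
by move=> x _; exact: (clip_le hF0 ab Fa Fb).
Qed.
Let W x := clipf a b x - mu.
Let v := vfun alpha beta a b mab (f a) (f b) sigma.
Let bW : bmeas setT W. Proof. by apply: bmeasB; [exact: bclip | exact: bmeas_cst]. Qed.
Let bia := bmeasB (bmeas_ind a) (bmeas_cst setT alpha).
Let bib := bmeasB (bmeas_ind b) (bmeas_cst setT beta).
Let W0 : \int[law X]_x W x = 0.
Proof. by have := W_centered hF0 a0 ab b1 Fa Fb; rewrite muE. Qed.
Let s2E : sigma ^+ 2 = sigma2W F alpha beta.
Proof. by rewrite sqr_sqrtr// ltW// (sigma2W_gt0 hF0 a0 ab b1 Fa Fb). Qed.
Let sig0 : 0 < sigma. Proof. by rewrite sqrtr_gt0 (sigma2W_gt0 hF0 a0 ab b1 Fa Fb). Qed.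
Let W2 : \int[law X]_x W x ^+ 2 = sigma ^+ 2.
Proof. by rewrite s2E (sigma2WE hF0 a0 ab b1 Fa Fb) muE. Qed.
Let W3 : \int[law X]_x W x ^+ 3 = gamma3W F alpha beta.
Proof. by rewrite (gamma3WE hF0 a0 ab b1 Fa Fb) muE. Qed.
Let Wa : \int[law X]_x ((ind a x - alpha) * W x) = alpha * (a - mu).
Proof. by have := ind_W_a hF0 a0 ab b1 Fa Fb; rewrite muE. Qed.
Let Wb : \int[law X]_x ((ind b x - beta) * W x) = - (1 - beta) * (b - mu).
Proof. by have := ind_W_b hF0 a0 ab b1 Fa Fb; rewrite muE. Qed.
Let ca := 2 * alpha * (a - mu) / f a.
Let cb := 2 * (1 - beta) * (b - mu) / f b.
Let vE x : v x = W x ^+ 2 - sigma ^+ 2 - ca * (ind a x - alpha) - cb * (ind b x - beta).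
Proof. by []. Qed.
Let bs : bmeas setT (fun x => W x ^+ 2 - sigma ^+ 2).
Proof. by apply: bmeasB (bmeas_cst _ _); exact: bmeasX. Qed.
Let bv : bmeas setT v. Proof. exact: bmeasB (bmeasB bs (bmeasZ ca bia)) (bmeasZ cb bib). Qed.
Let v0 : \int[law X]_x v x = 0.
Proof.
under eq_Rintegral do rewrite vE.
rewrite (RintB mTR fTR (bmeasB bs (bmeasZ ca bia)) (bmeasZ cb bib)).
rewrite (RintB mTR fTR bs (bmeasZ ca bia)) (RintB mTR fTR (bmeasX 2 bW) (bmeas_cst _ _)).
rewrite (RintZ mTR fTR _ bia) (RintZ mTR fTR _ bib) (ind_centered hF0 Fa) (ind_centered hF0 Fb).
by rewrite Rint_prob_cst W2 subrr !mulr0 !subr0.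
Qed.

Let fnsE N x : fns N x = fine (P [set o | studentized alpha beta mab
  (sample (fun i => (X i : T -> R)) N o) <= x]).
Proof.
rewrite /FNS; congr (fine (P _)); apply/funext => o.
by rewrite /mkset /studentized (size_sample X N o).
Qed.

Let hnE N (t x y : R) : 0 < t -> N%:R = t ^+ 16 ->
  hn N x = edgeworth_approx alpha beta a b mab (f a) (f b) sigma (gamma3W F alpha beta) (N, t, x, y).
Proof.
move=> t0 NE; have sq : Num.sqrt N%:R = t ^+ 8.
  by rewrite NE -[16%N]/(8 * 2)%N exprM sqrtr_sqr ger0_norm// exprn_ge0// ltW.
rewrite /HN /edgeworth_approx /rounding_bias /lambda1 /lambda2 /delta2W /betaN sq -/mu muE /cx /ct /cN /= NE.
by congr (_ + _ * _); field; rewrite !lt0r_neq0.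
Qed.

Lemma studentized_trimmed_edgeworth : exists M T0 : R, 1 <= T0 /\
  forall (N : nat) (t : R), T0 <= t -> N%:R = t ^+ 16 ->
  forall x, `|fns N x - hn N x| <= M / t ^+ 9.
Proof.
have L0 := lipschitz_ge0 delta0 fLa.
(* The three bounds keep the smoothing interval inside the Lipschitz neighbourhood, below the upper
   level, and where the density is at least [f a / 2]; [L + 1] avoids a division by 0. *)
pose d1 := Num.min (delta / 2) (Num.min (b - a) (f a / (2 * (L + 1)))).
have L1 : 0 < 2 * (L + 1) by rewrite mulr_gt0// ltr_wpDl.
have d10 : 0 < d1 by rewrite !lt_min divr_gt0// subr_gt0 xab divr_gt0.
have d1d : d1 < delta.
  by rewrite gt_min; apply/orP; left; rewrite ltr_pdivrMr// ltr_pMr// ltr1n.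
have ad1 : a + d1 <= b by rewrite -lerBrDl /d1 !ge_min lexx !orbT.
have d1f : L * d1 <= f a / 2.
  apply: (@le_trans _ _ ((L + 1) * d1)); first by rewrite ler_wpM2r ?lerDl// ltW.
  have l1 : 0 < L + 1 by rewrite ltr_wpDl.
  have -> : f a / 2 = (L + 1) * (f a / (2 * (L + 1))) by field; rewrite lt0r_neq0.
  by apply: ler_wpM2l; [exact: ltW | rewrite /d1 !ge_min lexx !orbT].
have FJ u w : a <= u -> u <= w -> w <= a + d1 -> f a / 2 * (w - u) <= F w - F u.
  move=> au uw wd.
  have nu : `|u - a| <= d1.
    by rewrite ger0_norm ?subr_ge0// lerBlDl (le_trans uw).
  have nw : `|w - a| <= d1.
    by rewrite ger0_norm ?subr_ge0 ?lerBlDl// (le_trans au).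
  apply: (cdf_increment_ge delta0 dFa fLa fa0) => //; try exact: le_lt_trans d1d.
    by apply: le_trans d1f; rewrite ler_wpM2l.
  by apply: le_trans d1f; rewrite ler_wpM2l.
have [mW [BW hBW]] := bW; have [mv [Bv hBv]] := bv.
pose B := 1 + `|BW| + `|Bv|.
have B1 : 1 <= B by rewrite /B -addrA lerDl addr_ge0.
have WB x : `|W x| <= B.
  by rewrite (le_trans (hBW x I))// (le_trans (ler_norm _))// /B addrAC lerDr addr_ge0.
have vB x : `|v x| <= B.
  by rewrite (le_trans (hBv x I))// (le_trans (ler_norm _))// lerDr addr_ge0.
have [M [T0 [M0 T01 hM]]] := central_expansion hind hid hF0 a0 ab b1 xab fa0 fb0 sig0 d10 ad1
  delta0 FJ Fa Fb FLa FLb amu mub mW mv B1 WB vB W0 v0 W2 W3 Wa Wb.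
have [K [K0 hK]] := edgeworth_approx_tail a b mab (f a) (f b) sigma (gamma3W F alpha beta) a0 ab.
exists (M + 2 * K), T0; split=> // N t tT NE.
have t1 : 1 <= t by exact: le_trans tT.
have t0 : 0 < t by exact: lt_le_trans t1.
have -> : (M + 2 * K) / t ^+ 9 = M / t ^+ 9 + 2 * (K / t ^+ 9) by ring.
have ba : 0 <= beta - alpha by rewrite subr_ge0 ltW.
have mE x := meas_FNS_event X mab N x ba.
apply: (uniform_of_central (t := t)) => //.
- exact: ltW.
- by rewrite divr_ge0// exprn_ge0// ltW.
- move=> x; rewrite /FNS fine_ge0//=.
  have h := @probability_le1 _ _ _ P _ (mE x).
  by rewrite -[leRHS]/(fine 1%:E) fine_le ?fin_num_measure.
- by move=> x y xy; apply: (prob_le P (mE x) (mE y)) => o /= h; exact: le_trans xy.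
- by move=> x xt; rewrite fnsE (hnE x 0 t0 NE); exact: hM.
- by move=> x tx; rewrite (hnE x 0 t0 NE); exact: (hK (N, t, x, 0)).
Qed.

End Main.

Theorem theorem2p2 (R : realType) (d : measure_display) (T : measurableType d)
    (P : probability T R) (X : nat -> {RV P >-> R})
    (F f : R -> R) (alpha beta : R) :
  0 < alpha -> alpha < beta -> beta < 1 ->
  mutually_independent P (fun i => (X i : T -> R)) ->
  (forall (i : nat) (x : R), fine (P [set w | X i w <= x]) = F x) ->
  (exists delta L : R, 0 < delta /\
     (forall x, `|x - quantile F alpha| < delta -> is_derive x 1 F (f x)) /\
     (forall x y, `|x - quantile F alpha| < delta -> `|y - quantile F alpha| < delta ->
        `|f x - f y| <= L * `|x - y|) /\
     (forall x, `|x - quantile F beta| < delta -> is_derive x 1 F (f x)) /\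
     (forall x y, `|x - quantile F beta| < delta -> `|y - quantile F beta| < delta ->
        `|f x - f y| <= L * `|x - y|)) ->
  0 < f (quantile F alpha) -> 0 < f (quantile F beta) ->
  forall eps : R, 0 < eps -> exists N0 : nat, forall N : nat, (N0 <= N)%N ->
    forall x : R,
      `|FNS P (fun i => (X i : T -> R)) F alpha beta N x - HN F f alpha beta N x|
        <= eps / Num.sqrt N%:R.
Proof.
move=> a0 ab b1 hind hF [delta [L [delta0 [dFa [fLa [dFb fLb]]]]]] fa0 fb0 eps eps0.
have [M [T0 [T01 h]]] :=
  studentized_trimmed_edgeworth hind a0 ab b1 hF delta0 dFa fLa dFb fLb fa0 fb0.
(* With [t >= |M| / eps] the bound [M / t ^ 9] is at most [eps / t ^ 8], which is [eps / sqrt N]. *)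
have [N0 hN] := sixteenth_root (T0 + `|M| / eps).
exists N0 => N /hN[t [tT NE]] x.
have Me : 0 <= `|M| / eps by rewrite divr_ge0// ltW.
have tT0 : T0 <= t by apply: le_trans tT; rewrite lerDl.
have t0 : 0 < t by apply: lt_le_trans tT0; exact: lt_le_trans T01.
apply: (le_trans (h N t tT0 NE x)).
rewrite NE -[16%N]/(8 * 2)%N exprM sqrtr_sqr ger0_norm; last by rewrite exprn_ge0// ltW.
rewrite [t ^+ 9]exprSr invfM mulrCA mulrC ler_wpM2r//.
  by rewrite invr_ge0 exprn_ge0// ltW.
rewrite ler_pdivrMr// (le_trans (ler_norm _))// -ler_pdivrMl// mulrC.
by apply: le_trans tT; rewrite lerDr (le_trans _ T01).
Qed.
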